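(* Let $\varphi: \Gamma_1 \to \Gamma_2$ be a group morphism between virtually polycyclic groups, and let $\rho_i: \Gamma_i \to \mathrm{Aff}(N_i)$, $i\in\{1,2\}$, be translation-like NIL-affine crystallographic actions, where $N_1,N_2$ are connected and simply connected nilpotent Lie groups. Then there exist a Levi subgroup $L$ of $\overline{\rho_2(\varphi(\Gamma_1))} \le \mathrm{Aff}(N_2)$ and a unique continuous group morphism $\delta: N_1 \to N_2$ such that every affine map $\alpha \in \mathrm{aff}(N_1,N_2)$ satisfying $$\rho_2(\varphi(\gamma)) \circ \alpha = \alpha \circ \rho_1(\gamma) \quad \text{for all } \gamma\in\Gamma_1$$ is of the form $\alpha=(x,\delta)$ with the translation part $x\in N_2$ a fixed point for $L$.
   Context: A group $\Gamma$ is virtually polycyclic if it has a subnormal series $1=\Gamma_0 \triangleleft \Gamma_1 \triangleleft \dots \triangleleft \Gamma_k=\Gamma$ in which every quotient $\Gamma_{i+1}/\Gamma_i$ is finite or infinite cyclic. For a connected and simply connected nilpotent Lie group $N$, $\mathrm{Aff}(N) = N \rtimes \mathrm{Aut}(N)$ acts on $N$ by $(x,\delta)\cdot n = x\,\delta(n)$; $N \le \mathrm{Aff}(N)$ denotes the subgroup of left translations. A NIL-affine action of $\Gamma$ is a group morphism $\rho:\Gamma \to \mathrm{Aff}(N)$. An action of a (discrete) group is crystallographic if it is properly discontinuous and cocompact. $\mathrm{Aff}(N)$ is regarded as a real algebraic group (group of real points of a linear algebraic $\mathbb{R}$-group; $N$ with its unipotent algebraic structure, $\mathrm{Aut}(N)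 \cong \mathrm{Aut}(\mathrm{Lie}(N))$). An overline denotes the real Zariski closure in $\mathrm{Aff}(N)$. $U(G)$ denotes the unipotent radical of a real algebraic group $G$ (the set of unipotent elements of the maximal closed normal solvable subgroup of $G$; for virtually solvable $G$ it is the set of all unipotent elements of $G$). A Levi subgroup of $G$ is a (reductive) closed algebraic subgroup $L\le G$ such that $G$ is the semidirect product of $L$ and $U(G)$. A NIL-affine action $\rho: \Gamma \to \mathrm{Aff}(N)$ of a virtually polycyclic group is translation-like if $U(\overline{\rho(\Gamma)})$ acts by left translations on $N$, i.e. $U(\overline{\rho(\Gamma)}) \le N$. $\mathrm{aff}(N_1,N_2)$ is the set of pairs $\alpha=(x,\delta)$ with $x\in N_2$ and $\delta:N_1\to N_2$ a continuous group morphism, identified with the map $\alpha: N_1\to N_2$, $\alpha(n)=\delta(n)\,x$ (right translation part; $x$ is called the translation part). *)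

(* Defs.v *)
From HB Require Import structures.
From mathcomp Require Import all_boot all_order all_algebra.
From mathcomp Require Import all_classical all_reals all_analysis.
From mathcomp Require mpoly.

Set Implicit Arguments.
Unset Strict Implicit.
Unset Printing Implicit Defensive.

Import Order.TTheory GRing.Theory Num.Theory.
Import numFieldNormedType.Exports.

Local Open Scope classical_set_scope.
Local Open Scope ring_scope.

Section AbstractGroups.
Variable G : groupType.
Implicit Types A B H K : set G.

Definition subgroup H : Prop :=
  H 1%g /\ forall x y : G, H x -> H y -> H (x * y^-1)%g.

Definition normal_in H K : Prop :=
  [/\ subgroup H, subgroup K, H `<=` K &
      forall x y : G, K x -> H y -> H (y ^ x)%g].

Definition commutator A B : set G :=
  smallest subgroup [set [~ x, y]%g | x in A & y in B].

Definition lower_central (k : nat) : set G :=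
  iter k (fun A => commutator A [set: G]) [set: G].

Definition nilpotent_group : Prop := exists k, lower_central k = [set 1%g].

Definition derived_series (k : nat) A : set G :=
  iter k (fun B => commutator B B) A.

Definition solvable_subgroup A : Prop :=
  subgroup A /\ exists k, derived_series k A = [set 1%g].

Definition lcoset (x : G) H : set G := [set (x * h)%g | h in H].

Definition finite_quotient K H : Prop := finite_set [set lcoset x H | x in K].

(* K / H is isomorphic to the integers: there is a surjective morphism from   *)
(* K to int whose kernel is H (the values of f outside K are irrelevant).     *)
Definition infinite_cyclic_quotient K H : Prop :=
  exists f : G -> int,
    [/\ forall x y, K x -> K y -> f (x * y)%g = f x + f y,
        forall x, K x -> (f x = 0 <-> H x) &
        forall m : int, exists2 x, K x & f x = m].

Definition virtually_polycyclic : Prop :=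
  exists (k : nat) (S : nat -> set G),
    [/\ S 0 = [set 1%g], S k = [set: G] &
        forall i, (i < k)%N ->
          normal_in (S i) (S i.+1) /\
          (finite_quotient (S i.+1) (S i) \/
           infinite_cyclic_quotient (S i.+1) (S i))].

End AbstractGroups.

HB.mixin Record isTopologicalGroup G of Group G & Topological G := {
  mulg_continuous : continuous (fun p : G * G => (p.1 * p.2)%g);
  invg_continuous : continuous (fun x : G => (x^-1)%g)
}.

#[short(type="topGroupType")]
HB.structure Definition TopologicalGroup :=
  {G of Group G & Topological G & isTopologicalGroup G}.

(* Maps of class C^k and C^oo on an open subset A of V.  These definitions    *)
(* are only used for V of finite dimension, where they agree with the usual   *)
(* ones: all the iterated directional derivatives exist and are continuous.   *)
Fixpoint classC (R : realType) (V W : normedModType R) (k : nat) (A : set V)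
    (f : V -> W) : Prop :=
  if k is k'.+1 then
    (forall x v, A x -> derivable f x v) /\
    (forall v, classC k' A (fun x => 'D_v f x))
  else {in A, continuous f}.

Definition smooth_on (R : realType) (V W : normedModType R) (A : set V)
  (f : V -> W) : Prop := forall k, classC k A f.

(* A homeomorphism from an open subset of M onto an open subset of R^n;       *)
(* chart_fun and chart_inv are total, with irrelevant values elsewhere.       *)
Record chart (R : realType) (n : nat) (M : topologicalType) := Chart {
  chart_dom : set M;
  chart_fun :> M -> 'rV[R]_n;
  chart_inv : 'rV[R]_n -> M;
  chart_dom_open : open chart_dom;
  chart_codom_open : open (chart_fun @` chart_dom);
  chart_funK : {in chart_dom, cancel chart_fun chart_inv};
  chart_fun_continuous : {in chart_dom, continuous chart_fun};
  chart_inv_continuous : {in chart_fun @` chart_dom, continuous chart_inv}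
}.

Definition chart_codom (R : realType) (n : nat) (M : topologicalType)
  (c : chart R n M) : set 'rV[R]_n := c @` chart_dom c.

(* Real Lie groups of dimension n: the smooth structure is given by the atlas *)
(* consisting of the charts chart_at p, for p in G.                           *)
HB.mixin Record TopologicalGroup_isLie (R : realType) (n : nat) G
    of TopologicalGroup G := {
  lie_hausdorff : hausdorff_space G;
  lie_second_countable : @second_countable G;
  chart_at : G -> chart R n G;
  chart_at_dom : forall p : G, chart_dom (chart_at p) p;
  chart_at_smooth : forall p q : G,
    smooth_on [set x | chart_codom (chart_at p) x /\
                       chart_dom (chart_at q) (chart_inv (chart_at p) x)]
      (fun x => chart_at q (chart_inv (chart_at p) x));
  mulg_smooth : forall p q r : G,
    smooth_on [set xy : 'rV[R]_n * 'rV[R]_n |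
        [/\ chart_codom (chart_at p) xy.1, chart_codom (chart_at q) xy.2 &
            chart_dom (chart_at r)
              (chart_inv (chart_at p) xy.1 * chart_inv (chart_at q) xy.2)%g]]
      (fun xy : 'rV[R]_n * 'rV[R]_n => chart_at r
         (chart_inv (chart_at p) xy.1 * chart_inv (chart_at q) xy.2)%g);
  invg_smooth : forall p q : G,
    smooth_on [set x | chart_codom (chart_at p) x /\
                       chart_dom (chart_at q) (chart_inv (chart_at p) x)^-1%g]
      (fun x => chart_at q (chart_inv (chart_at p) x)^-1%g)
}.

#[short(type="lieGroupType")]
HB.structure Definition LieGroup (R : realType) (n : nat) :=
  {G of TopologicalGroup G & TopologicalGroup_isLie R n G}.

Arguments chart_at {R n s} p.

(* Every loop in T is homotopic, relative to its end points, to a constant.   *)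
Definition loops_contractible (R : realType) (T : topologicalType) : Prop :=
  forall c : R -> T, {within `[0, 1], continuous c} -> c 0 = c 1 ->
    exists h : R * R -> T,
      [/\ {within `[0, 1] `*` `[0, 1], continuous h},
          forall t, t \in `[0, 1] -> h (0, t) = c t,
          forall t, t \in `[0, 1] -> h (1, t) = c 0 &
          forall s, s \in `[0, 1] -> h (s, 0) = c 0 /\ h (s, 1) = c 0].

Definition connected_sc_nilpotent (R : realType) (n : nat) (N : lieGroupType R n) :=
  [/\ connected [set: N], loops_contractible R N & nilpotent_group N].

Definition cont_morphism (N1 N2 : topGroupType) (f : N1 -> N2) : Prop :=
  (forall x y, f (x * y)%g = (f x * f y)%g) /\ continuous f.

(* Continuous morphisms of Lie groups are smooth, so that the elements of aut *)
(* are the automorphisms of N as a Lie group.                                 *)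
Section Aut.
Variable N : topGroupType.

Record aut := MkAut {
  aut_fun :> N -> N;
  aut_inv : N -> N;
  aut_funP : cont_morphism aut_fun;
  aut_invP : continuous aut_inv;
  aut_funK : cancel aut_fun aut_inv;
  aut_invK : cancel aut_inv aut_fun
}.

HB.instance Definition _ := gen_eqMixin aut.
HB.instance Definition _ := gen_choiceMixin aut.

Lemma aut_eq (a b : aut) : aut_fun a =1 aut_fun b -> a = b.
Proof.
case: a b => [f f' p1 p2 p3 p4] [g g' q1 q2 q3 q4] /= fg.
have {}fg : f = g by apply/funext.
subst g; have f'g' : f' = g'.
  by apply/funext => x; rewrite -{1}(q4 x) p3.
by subst g'; congr MkAut; exact: Prop_irrelevance.
Qed.

Fact aut_one_subproof : cont_morphism (@id N).
Proof. by split => // x; exact: cvg_id. Qed.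

Definition aut_one : aut :=
  @MkAut id id aut_one_subproof aut_one_subproof.2
    (fun _ => erefl) (fun _ => erefl).

Fact aut_mul_subproof (a b : aut) : cont_morphism (a \o b).
Proof.
have [aM ac] := aut_funP a; have [bM bc] := aut_funP b; split.
  by move=> x y; rewrite /= bM aM.
by move=> x; apply: continuous_comp; [exact: bc|exact: ac].
Qed.

Fact aut_mul_inv_subproof (a b : aut) : continuous (aut_inv b \o aut_inv a).
Proof. by move=> x; apply: continuous_comp; exact: aut_invP. Qed.

Definition aut_mul (a b : aut) : aut :=
  @MkAut (a \o b) (aut_inv b \o aut_inv a) (aut_mul_subproof a b)
    (@aut_mul_inv_subproof a b)
    (can_comp (aut_funK a) (aut_funK b)) (can_comp (aut_invK b) (aut_invK a)).

Fact aut_inv_subproof (a : aut) : cont_morphism (aut_inv a).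
Proof.
split; last exact: aut_invP.
move=> x y; apply: (can_inj (aut_funK a)).
by rewrite (aut_funP a).1 !aut_invK.
Qed.

Definition aut_invg (a : aut) : aut :=
  @MkAut (aut_inv a) a (aut_inv_subproof a) (aut_funP a).2
    (aut_invK a) (aut_funK a).

Fact aut_mulA : associative aut_mul.
Proof. by move=> a b c; exact: aut_eq. Qed.
Fact aut_mul1 : left_id aut_one aut_mul.
Proof. by move=> a; exact: aut_eq. Qed.
Fact aut_mulr1 : right_id aut_one aut_mul.
Proof. by move=> a; exact: aut_eq. Qed.
Fact aut_mulV : left_inverse aut_one aut_invg aut_mul.
Proof. by move=> a; apply: aut_eq => x /=; exact: aut_funK. Qed.
Fact aut_mulrV : right_inverse aut_one aut_invg aut_mul.
Proof. by move=> a; apply: aut_eq => x /=; exact: aut_invK. Qed.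

HB.instance Definition _ := isGroup.Build aut
  aut_mulA aut_mul1 aut_mulr1 aut_mulV aut_mulrV.

End Aut.

Section Aff.
Variable N : topGroupType.

Record Aff := MkAff { Aff_trans : N; Aff_lin : aut N }.

HB.instance Definition _ := gen_eqMixin Aff.
HB.instance Definition _ := gen_choiceMixin Aff.

(* (x, delta) . n = x delta(n) *)
Definition Aff_act (g : Aff) (n : N) : N := (Aff_trans g * Aff_lin g n)%g.

Definition Aff_one : Aff := MkAff 1%g 1%g.
Definition Aff_mul (g h : Aff) : Aff :=
  MkAff (Aff_trans g * Aff_lin g (Aff_trans h))%g (Aff_lin g * Aff_lin h)%g.
Definition Aff_inv (g : Aff) : Aff :=
  MkAff ((Aff_lin g)^-1%g (Aff_trans g)^-1%g) (Aff_lin g)^-1%g.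

Fact autM (a : aut N) x y : a (x * y)%g = (a x * a y)%g.
Proof. exact: (aut_funP a).1. Qed.
Fact aut1 (a : aut N) : a 1%g = 1%g.
Proof. by apply: (mulgI (a 1%g)); rewrite -autM !mulg1. Qed.

Fact Aff_mulA : associative Aff_mul.
Proof. by move=> g h k; rewrite /Aff_mul /= autM !mulgA. Qed.
Fact Aff_mul1 : left_id Aff_one Aff_mul.
Proof. by case=> x a; rewrite /Aff_mul /= !mul1g. Qed.
Fact Aff_mulr1 : right_id Aff_one Aff_mul.
Proof. by case=> x a; rewrite /Aff_mul /= aut1 !mulg1. Qed.
Fact Aff_mulV : left_inverse Aff_one Aff_inv Aff_mul.
Proof.
case=> x a; rewrite /Aff_mul /Aff_inv; cbn [Aff_trans Aff_lin].
by rewrite -autM !mulVg aut1.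
Qed.
Fact Aff_mulrV : right_inverse Aff_one Aff_inv Aff_mul.
Proof.
case=> x a; rewrite /Aff_mul /Aff_inv; cbn [Aff_trans Aff_lin].
by rewrite (aut_invK a) !mulgV.
Qed.

HB.instance Definition _ := isGroup.Build Aff
  Aff_mulA Aff_mul1 Aff_mulr1 Aff_mulV Aff_mulrV.

(* The elements (x, id), which form N as a subgroup of Aff(N). *)
Definition left_translations : set Aff := [set g | Aff_lin g = 1%g].

Definition properly_discontinuous (Gam : groupType) (rho : Gam -> Aff) : Prop :=
  forall K : set N, compact K ->
    finite_set [set g : Gam | (Aff_act (rho g) @` K) `&` K !=set0].

(* As N is locally compact, this says that the orbit space is compact. *)
Definition cocompact (Gam : groupType) (rho : Gam -> Aff) : Prop :=
  exists2 K : set N, compact K & \bigcup_(g : Gam) (Aff_act (rho g) @` K) = setT.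

Definition crystallographic (Gam : groupType) (rho : Gam -> Aff) : Prop :=
  properly_discontinuous rho /\ cocompact rho.

End Aff.

(* Aff(N) as a real algebraic group.  The tangent space of N at 1, which is   *)
(* the underlying vector space of Lie(N), is identified with R^n through the  *)
(* chart at 1.  The coordinates of (x, delta) are those of log x (N carries   *)
(* the unipotent algebraic structure given by exp) and the entries of the     *)
(* matrix of the differential of delta at 1.  Another chart at 1 would change *)
(* these coordinates linearly only.                                           *)

Section AlgebraicStructure.
Variables (R : realType) (n : nat) (N : lieGroupType R n).
Implicit Types (g h : Aff N) (A G L S : set (Aff N)) (f : Aff N -> R).

Definition one_chart : chart R n N := chart_at 1%g.

(* x = exp v, i.e., x = X 1 for a one-parameter subgroup X of velocity v *)
Definition is_exp (v : 'rV[R]_n) (x : N) : Prop :=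
  exists X : R -> N,
    [/\ continuous X, forall s t, X (s + t) = (X s * X t)%g,
        is_derive (0 : R) (1 : R) (fun t => one_chart (X t)) v & X 1 = x].

(* For N connected, simply connected and nilpotent, exp is bijective, so that *)
(* the default value 0 is not used.                                           *)
Definition lie_log (x : N) : 'rV[R]_n := xget 0 [set v | is_exp v x].

Definition lie_diff (a : aut N) : 'M[R]_n :=
  jacobian (fun v => one_chart (a (chart_inv one_chart v))) (one_chart 1%g).

Definition Aff_coord g : 'rV[R]_(n + n * n) :=
  row_mx (lie_log (Aff_trans g)) (mxvec (lie_diff (Aff_lin g))).

Definition Aff_poly (p : mpoly.mpoly (n + n * n) R) : Aff N -> R :=
  fun g => mpoly.meval (fun i => Aff_coord g 0 i) p.

Definition zariski_closed A : Prop :=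
  exists P : set (mpoly.mpoly (n + n * n) R),
    A = [set g | forall p, P p -> Aff_poly p g = 0].

Definition zariski_closure A : set (Aff N) := smallest zariski_closed A.

(* As Aut(Lie(N)) is closed in GL(Lie(N)), the inverse of the determinant is  *)
(* a regular function.                                                        *)
Definition regular_fun f : Prop :=
  exists p k, forall g, f g = Aff_poly p g / \det (lie_diff (Aff_lin g)) ^+ k.

(* g is unipotent when right translation by g is a locally unipotent          *)
(* endomorphism of the algebra of regular functions.                          *)
Definition unipotent g : Prop :=
  forall f, regular_fun f ->
    exists k, iter k (fun (u : Aff N -> R) h => u (h * g)%g - u h) f = cst 0.

(* The maximal closed normal solvable subgroup of G; it is the largest one,   *)
(* hence the union of them all.                                               *)
Definition solvable_radical G : set (Aff N) :=
  \bigcup_(S in [set S | [/\ zariski_closed S, normal_in S G &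
                             solvable_subgroup S]]) S.

Definition unipotent_radical G : set (Aff N) :=
  [set g | solvable_radical G g /\ unipotent g].

(* A group is reductive when its unipotent radical is trivial. *)
Definition levi_subgroup G L : Prop :=
  [/\ zariski_closed L, subgroup L, L `<=` G,
      unipotent_radical L = [set 1%g] &
      normal_in (unipotent_radical G) G /\
      L `&` unipotent_radical G = [set 1%g] /\
      [set (u * l)%g | u in unipotent_radical G & l in L] = G].

Definition translation_like (Gam : groupType) (rho : Gam -> Aff N) : Prop :=
  unipotent_radical (zariski_closure (range rho)) `<=` @left_translations N.

End AlgebraicStructure.

Section AffineMaps.
Variables N1 N2 : topGroupType.

Record aff := MkaffMap {
  aff_trans : N2;
  aff_lin : N1 -> N2;
  aff_linP : cont_morphism aff_lin
}.

(* The translation part acts on the right, unlike in Aff_act. *)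
Definition aff_map (al : aff) (n : N1) : N2 := (aff_lin al n * aff_trans al)%g.

End AffineMaps.

(* Main.v *)
Require Import Defs.
From HB Require Import structures.
From mathcomp Require Import all_boot all_order all_algebra.
From mathcomp Require Import all_classical all_reals all_analysis.
From mathcomp Require mpoly.
From mathcomp Require Import zify ring lra.
From mathcomp Require Import complex.

(* For s in an algebraic group, n |-> f (s^n) is an exponential polynomial for
   every regular function f; replacing its eigenvalues by 1 yields the unipotent
   Jordan component of s.  Hence a representation of D, the Zariski closure of the
   image of a virtually polycyclic group, that is trivial on unipotent elements is
   semisimple along the polycyclic series, and invariant vectors and affine fixed
   points can be built step by step.  Descending the upper central series of N
   gives a base point x with D x = U x, where U = U(D) consists of translations;
   the group acts cocompactly on U x.

   This is applied to the closure D of the set of all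
   (rho1 g, rho2 (phi g)) in Aff(N1) x Aff(N2), with base point (x1, x2).  The
   projection of U to N1 is onto because rho1 is crystallographic, and its kernel
   is compact, hence trivial; so U is the graph of a morphism delta.  Let L be
   the stabilizer in the closure of rho2 (phi Gam1) of
   x2' = delta(x1)^-1 x2.  Then n |-> delta(n) x2' is equivariant, and by Zariski
   density any other equivariant affine map has the same linear part, and a
   translation part moved by every g in the closure by the same left translation
   as x2', so that it is fixed by L. *)

Set Implicit Arguments.
Unset Strict Implicit.
Unset Printing Implicit Defensive.

Import (canonicals) mpoly.
Import Order.TTheory GRing.Theory Num.Theory.
Import numFieldNormedType.Exports.

Local Open Scope classical_set_scope.
Local Open Scope ring_scope.

(** * The exponential map of a Lie group *)

(** Zariski closures and unipotent elements are defined in logarithmic coordinates, while N is given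
    by smooth charts only, so the group law must first be shown to be polynomial in these
    coordinates. Since Ad (exp z) is unipotent and polynomial in z, the curve log (exp x exp (t y))
    has an explicit polynomial velocity, and integrating it gives the Baker-Campbell-Hausdorff law.

    Afterwards Aff(N) enters only through the properties collected in [aff_struct]. These are stable
    under products, so the base point theorem applies verbatim to the closure taken in Aff(N1) x
    Aff(N2).

    The closures are virtually solvable and possibly disconnected, so semisimplicity is tested one
    generator t of the polycyclic series at a time: on the vectors fixed by the previous term, the
    image and the kernel of w(t) - 1 are complementary, because a Jordan block of size two would be
    detected by the unipotent component of t. This single splitting yields affine fixed points,
    invariant complements and, for cocompactness, an invariant direction for each infinite cyclic
    quotient that enlarges the translations. *)

Section Norms.
Variables (R : realType) (n : nat).

Lemma rV_norm_le (x : 'rV[R]_n) (C : R) :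
  0 <= C -> (forall i, `|x 0 i| <= C) -> `|x| <= C.
Proof.
move=> C0 H; rewrite /Num.norm /= mx_normrE; apply/bigmax_leP; split=> // -[i j] _ /=.
by rewrite ord1.
Qed.

Lemma rV_norm_ge (x : 'rV[R]_n) i : `|x 0 i| <= `|x|.
Proof. by rewrite [leRHS]/Num.norm /= mx_normrE; apply/bigmax_geP; right => /=; exists (0, i). Qed.

End Norms.

Lemma is_derive_line (R : realType) (V W : normedModType R) (F : V -> W) (p v : V) (s : R) :
  derivable F (p + s *: v) v ->
  is_derive s (1 : R) (fun s => F (p + s *: v)) ('D_v F (p + s *: v)).
Proof.
have E : (fun h : R => h^-1 *: (((fun s => F (p + s *: v)) \o shift s) (h *: (1:R)) - F (p + s *: v)))
  = (fun h => h^-1 *: ((F \o shift (p + s *: v)) (h *: v) - F (p + s *: v))).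
  apply/funext => h /=; do 3 f_equal.
  by rewrite [h *: 1]mulr1 scalerDl addrCA.
by move=> D; split; rewrite /derivable /derive E.
Qed.

Lemma is_derive_coord (R : realType) (V : normedModType R) n (F : V -> 'rV[R]_n) (p v : V)
    (l : 'rV[R]_n) (k : 'I_n) :
  is_derive p v F l -> is_derive p v (fun x => F x 0 k) (l 0 k).
Proof.
case=> D E.
have H : (fun h : R => h^-1 *: ((((fun x => F x 0 k) : V -> R) \o shift p) (h *: v) - F p 0 k)) @ 0^' --> l 0 k.
  have -> : (fun h : R => h^-1 *: ((((fun x => F x 0 k) : V -> R) \o shift p) (h *: v) - F p 0 k))
    = (fun M : 'rV[R]_n => M 0 k) \o (fun h => h^-1 *: ((F \o shift p) (h *: v) - F p)).
    by apply/funext => h /=; rewrite !mxE.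
  apply: (@cvg_comp _ _ _ _ _ _ (nbhs l)); last exact: coord_continuous.
  by rewrite -E.
by split; [apply/cvg_ex; exists (l 0 k) | apply/cvg_lim].
Qed.

Lemma MVT_abs (R : realType) (f df : R -> R) (a K : R) :
  (forall x, `|x| <= `|a| -> is_derive x (1 : R) f (df x)) ->
  (forall x, `|x| <= `|a| -> `|df x| <= K) ->
  `|f a - f 0| <= K * `|a|.
Proof.
move=> Hd Hb.
have gen (u v : R) : u < v -> `|u| <= `|a| -> `|v| <= `|a| -> `|f v - f u| <= K * (v - u).
  move=> uv ua va.
  have bt x : u <= x <= v -> `|x| <= `|a|.
    case/andP=> h1 h2; rewrite ler_norml.
    move: ua va; rewrite !ler_norml => /andP[? ?] /andP[? ?]; apply/andP; split; lra.
  have [||x xin ->] := @MVT _ f df u v uv.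
  - by move=> x; rewrite in_itv /= => /andP[/ltW ? /ltW ?]; apply/Hd/bt/andP.
  - apply: derivable_within_continuous => x.
    by rewrite in_itv /= => xi; case: (Hd x (bt x xi)).
  - rewrite normrM (gtr0_norm (x:=v-u)) ?subr_gt0//; apply: ler_wpM2r; first by lra.
    by apply/Hb/bt; move: xin; rewrite in_itv /= => /andP[/ltW -> /ltW ->].
have [a0|a0|->] := ltgtP a 0.
- by rewrite distrC (ltr0_norm a0) -[- a]add0r; apply: gen; rewrite ?normr0.
- by rewrite [`|a|]gtr0_norm// -[in leRHS](subr0 a); apply: gen => //; rewrite normr0.
- by rewrite subrr normr0 mulr0.
Qed.

(** The mean value theorem is used twice: for [g] in the direction u, its derivative being a
    difference of values of the u-derivative of [F], and then for this difference in the direction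
    w. *)
Lemma rect_estimate_coord (R : realType) (V : normedModType R) n (F : V -> 'rV[R]_n) (p u w : V) (a b M : R) :
  (forall s t, `|s| <= `|a| -> `|t| <= `|b| ->
     [/\ derivable F (p + s *: u + t *: w) u,
         derivable ('D_u F) (p + s *: u + t *: w) w &
         `|'D_w ('D_u F) (p + s *: u + t *: w)| <= M]) ->
  `|F (p + a *: u + b *: w) - F (p + a *: u) - F (p + b *: w) + F p| <= M * `|a| * `|b|.
Proof.
move=> H.
have M0 : 0 <= M.
  by have [//|//|_ _] := H 0 0; rewrite ?normr0//; apply: le_trans.
apply: rV_norm_le => [|k]; first by rewrite !mulr_ge0.
have E0 (q z : V) : q + 0 *: z = q by rewrite scale0r; exact: addr0.
pose g s := F (p + s *: u + b *: w) 0 k - F (p + s *: u) 0 k.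
pose dg s := 'D_u F (p + s *: u + b *: w) 0 k - 'D_u F (p + s *: u) 0 k.
have -> : (F (p + a *: u + b *: w) - F (p + a *: u) - F (p + b *: w) + F p) 0 k = g a - g 0.
  by rewrite /g [p + 0 *: u]E0 !mxE; ring.
rewrite mulrAC; apply: (@MVT_abs _ g dg) => s sa.
- apply: is_deriveB.
  + apply: is_derive_coord.
    have Ef x : p + x *: u + b *: w = (p + b *: w) + x *: u by rewrite addrAC.
    have [D _ _] := H s b sa (lexx _); rewrite Ef in D *.
    under eq_fun do rewrite Ef.
    exact: is_derive_line.
  + apply: is_derive_coord; apply: is_derive_line.
    have [|D _ _] := H s 0 sa; first by rewrite normr0.
    by rewrite [p + s *: u + 0 *: w]E0 in D; exact: D.
- rewrite /dg.
  pose h t := 'D_u F (p + s *: u + t *: w) 0 k.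
  have -> : 'D_u F (p + s *: u + b *: w) 0 k - 'D_u F (p + s *: u) 0 k = h b - h 0.
    by rewrite /h [p + s *: u + 0 *: w]E0.
  apply: (@MVT_abs _ h (fun t => 'D_w ('D_u F) (p + s *: u + t *: w) 0 k)) => t tb.
  + apply: is_derive_coord; apply: (@is_derive_line _ _ _ ('D_u F)).
    by have [_ D _] := H s t sa tb; exact: D.
  + by apply: le_trans (rV_norm_ge _ _) _; have [_ _ D] := H s t sa tb; exact: D.
Qed.

(** * Second differences of a map of class C^2 *)

Section Mix.
Variables (R : realType) (n : nat).
Implicit Types x y : 'rV[R]_n.

(** Moves from y to x one coordinate at a time, so that only derivatives along basis vectors occur
    and finitely many bounds suffice. *)
Definition mix x y (i : nat) : 'rV[R]_n := \row_k (if (k < i)%N then x 0 k else y 0 k).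

Lemma mix0 x y : mix x y 0 = y.
Proof. by apply/rowP => k; rewrite mxE. Qed.

Lemma mixn x y : mix x y n = x.
Proof. by apply/rowP => k; rewrite mxE ltn_ord. Qed.

Lemma mixS x y (i : 'I_n) :
  mix x y i.+1 = mix x y i + (x 0 i - y 0 i) *: delta_mx 0 i.
Proof.
apply/rowP => k; rewrite !mxE eqxx /= ltnS leq_eqVlt.
have [->|ki] := eqVneq k i; first by rewrite eqxx ltnn /= mulr1 addrC subrK.
rewrite -val_eqE /= in ki; rewrite (negbTE ki) /= mulr0 addr0; by case: ltnP.
Qed.

Lemma mix_ball (a x y : 'rV[R]_n) r i : 0 <= r -> `|x - a| <= r -> `|y - a| <= r -> `|mix x y i - a| <= r.
Proof.
move=> r0 hx hy; apply: rV_norm_le => // k; rewrite !mxE; case: ltnP => _.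
  by apply: le_trans hx; have := rV_norm_ge (x - a) k; rewrite !mxE.
by apply: le_trans hy; have := rV_norm_ge (y - a) k; rewrite !mxE.
Qed.

End Mix.

Lemma ler_sum2 (R : numDomainType) n (f : 'I_n -> 'I_n -> R) i j :
  (forall i j, 0 <= f i j) -> f i j <= \sum_i \sum_j f i j.
Proof.
move=> f0; rewrite (bigD1 i) //= (bigD1 j) //= -addrA lerDl addr_ge0 //.
  by apply: sumr_ge0.
by apply: sumr_ge0 => k _; apply: sumr_ge0.
Qed.

Lemma telescope2 (V : zmodType) (G : nat -> nat -> V) n m :
  \sum_(i < n) \sum_(j < m) ((G i.+1 j.+1 - G i j.+1) - (G i.+1 j - G i j)) =
  G n m - G 0 m - G n 0 + G 0 0.
Proof.
under eq_bigr => i _ do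
  rewrite -(big_mkord xpredT (fun j => (G i.+1 j.+1 - G i j.+1) - (G i.+1 j - G i j)))
    (telescope_sumr (fun j => G i.+1 j - G i j)) //.
rewrite -(big_mkord xpredT (fun i => G i.+1 m - G i m - (G i.+1 0 - G i 0))).
rewrite sumrB (telescope_sumr (fun i => G i m)) // (telescope_sumr (fun i => G i 0)) //.
by rewrite opprB addrA addrAC.
Qed.

Lemma norm_sum2_le (R : numFieldType) (V : normedZmodType R) n m (f : 'I_n -> 'I_m -> V) (K : R) :
  (forall i j, `|f i j| <= K) -> `|\sum_i \sum_j f i j| <= K * n%:R * m%:R.
Proof.
move=> H; apply: (@le_trans _ _ (\sum_(i < n) \sum_(j < m) K)).
  apply: le_trans (ler_norm_sum _ _ _) _; apply: ler_sum => i _.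
  by apply: le_trans (ler_norm_sum _ _ _) _; apply: ler_sum => j _.
rewrite !sumr_const !card_ord -(mulr_natr K m) -(mulr_natr (K * _) n) mulrAC; exact: lexx.
Qed.

(** This bilinear bound is the form in which smoothness of the product will be used. The rectangle
    is cut into n times n small ones with sides along basis vectors, where the mixed derivatives are
    bounded by continuity at (a, b). *)
Lemma rect_estimate (R : realType) n (F : 'rV[R]_n * 'rV[R]_n -> 'rV[R]_n)
    (O : set ('rV[R]_n * 'rV[R]_n)) (a b : 'rV[R]_n) :
  open O -> O (a, b) -> smooth_on O F ->
  exists r C, [/\ 0 < r, 0 <= C &
   forall x x' y y', `|x - a| <= r -> `|x' - a| <= r -> `|y - b| <= r -> `|y' - b| <= r ->
     `|F (x, y) - F (x', y) - F (x, y') + F (x', y')| <= C * `|x - x'| * `|y - y'|].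
Proof.
move=> oO Oab sm.
have [d1 c1] := sm 2%N.
pose e1 (i : 'I_n) : 'rV[R]_n * 'rV[R]_n := (delta_mx 0 i, 0).
pose e2 (i : 'I_n) : 'rV[R]_n * 'rV[R]_n := (0, delta_mx 0 i).
pose DD i j := 'D_(e2 j) ('D_(e1 i) F).
have [M [M0 HM]] : exists M, 0 <= M /\ forall i j, `|DD i j (a, b)| + 1 <= M.
  exists (\sum_i \sum_j (`|DD i j (a, b)| + 1)); split.
    by apply: sumr_ge0 => i _; apply: sumr_ge0 => j _; exact: addr_ge0.
  move=> i j; apply: (@ler_sum2 R n (fun i j => `|DD i j (a, b)| + 1)) => k l; exact: addr_ge0.
have [r r0 Hr] : exists2 r : R, 0 < r & forall x y, `|x - a| < r -> `|y - b| < r ->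
    O (x, y) /\ forall i j, `|DD i j (x, y)| <= M.
  have : \forall p \near (a, b), O p /\ forall i j, `|DD i j p| <= M.
    apply: filterI; first exact: open_nbhs_nbhs.
    suff H2 i j : \forall p \near (a, b), `|DD i j p| <= M.
      have FF : Filter (nbhs (a, b)) by apply: nbhs_filter.
      apply: (@filter_forall _ _ (fun i p => forall j, `|DD i j p| <= M) _ FF) => i.
      apply: (@filter_forall _ _ (fun j p => `|DD i j p| <= M) _ FF) => j.
      exact: H2.
    have [_ c2] := c1 (e1 i).
    have cc : {for (a, b), continuous (DD i j)} by apply: (c2 (e2 j)); rewrite inE.
    have /cvgrPdist_lt/(_ 1 ltr01) := cc.
    apply: filterS => p /= hp.
    apply: (@le_trans _ _ (`|DD i j (a, b)| + 1)).
      rewrite -lerBlDl; apply: le_trans (lerB_dist _ _) _.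
      by rewrite distrC; exact: ltW.
    exact: HM.
  case/nbhs_ballP => r /= r0 Hr; exists r => // x y xr yr; apply: Hr.
  split => /=; rewrite -ball_normE /ball_ /=; by rewrite distrC.
(* Increments are then at most r / 2, so that every intermediate point stays at distance less than r
   from (a, b). *)
exists (r / 4), (M * n%:R * n%:R).
split; [by rewrite divr_gt0 | by rewrite !mulr_ge0 |].
move=> x x' y y' hx hx' hy hy'.
have r4 : 0 <= r / 4 by rewrite divr_ge0// ltW.
pose G i j := F (mix x x' i, mix y y' j).
have -> : F (x, y) - F (x', y) - F (x, y') + F (x', y') = G n n - G 0 n - G n 0 + G 0 0.
  by rewrite /G !mix0 !mixn.
have -> : M * n%:R * n%:R * `|x - x'| * `|y - y'| = M * `|x - x'| * `|y - y'| * n%:R * n%:R.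
  by ring.
rewrite -telescope2; apply: norm_sum2_le => i j; rewrite {}/G.
set p := (mix x x' i, mix y y' j).
pose A := x 0 i - x' 0 i; pose B := y 0 j - y' 0 j.
have E10 : (mix x x' i.+1, mix y y' j) = p + A *: e1 i.
  by rewrite mixS /p /e1 /A; congr pair; rewrite /= scaler0 addr0.
have E01 : (mix x x' i, mix y y' j.+1) = p + B *: e2 j.
  by rewrite mixS /p /e2 /B; congr pair; rewrite /= scaler0 addr0.
have E11 : (mix x x' i.+1, mix y y' j.+1) = p + A *: e1 i + B *: e2 j.
  rewrite !mixS /p /e1 /e2 /A /B; congr pair; rewrite /= ?scaler0 ?addr0//.
rewrite E10 E01 E11 -/p.
have aux (q1 q2 q3 q4 : 'rV[R]_n) : q1 - q3 - (q2 - q4) = q1 - q2 - q3 + q4.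
  by apply/rowP => k; rewrite !mxE; ring.
rewrite aux.
have A_le : `|A| <= `|x - x'| by have := rV_norm_ge (x - x') i; rewrite !mxE.
have B_le : `|B| <= `|y - y'| by have := rV_norm_ge (y - y') j; rewrite !mxE.
apply: (@le_trans _ _ (M * `|A| * `|B|)); last first.
  by apply: ler_pM => //; [rewrite mulr_ge0 | apply: ler_wpM2l].
have dxx : `|x - x'| <= r / 2.
  rewrite -(subrKA a); apply: le_trans (ler_normD _ _) _.
  by move: hx' ; rewrite distrC => hx'; lra.
have dyy : `|y - y'| <= r / 2.
  rewrite -(subrKA b); apply: le_trans (ler_normD _ _) _.
  by move: hy' ; rewrite distrC => hy'; lra.
apply: rect_estimate_coord => s t hs ht.
have norm1 m (k : 'I_m) : `|delta_mx 0 k : 'rV[R]_m| <= 1.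
  apply: rV_norm_le => // l; rewrite mxE; by case: eqP; case: eqP; rewrite ?normr0 ?normr1.
have small (z w0 : 'rV[R]_n) (c : R) (k : 'I_n) : `|z - w0| <= r / 4 -> `|c| <= r / 2 ->
   `|z + c *: delta_mx 0 k - w0| < r.
  move=> h1 h2; rewrite addrAC; apply: le_lt_trans (ler_normD _ _) _.
  have : `|c *: (delta_mx 0 k : 'rV[R]_n)| <= r / 2.
    rewrite normrZ -[r / 2]mulr1; apply: ler_pM => //; exact: norm1.
  move=> h3; apply: le_lt_trans (lerD h1 h3) _; lra.
have pE : p + s *: e1 i + t *: e2 j =
    (mix x x' i + s *: delta_mx 0 i, mix y y' j + t *: delta_mx 0 j).
  by rewrite /p /e1 /e2; congr pair; rewrite /= ?scaler0 ?addr0.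
have [Op Dp] : O (p + s *: e1 i + t *: e2 j) /\ forall i' j', `|DD i' j' (p + s *: e1 i + t *: e2 j)| <= M.
  rewrite pE; apply: Hr; apply: small.
  - exact: mix_ball.
  - exact: le_trans hs (le_trans A_le dxx).
  - exact: mix_ball.
  - exact: le_trans ht (le_trans B_le dyy).
split; [exact: d1 | | exact: Dp].
by have [d2 _] := c1 (e1 i); apply: d2.
Qed.

(** A chart centred at the identity, in which smoothness of the product is retained as the
    second-difference bound [cc_rect]. The normalization [lCr] makes each quadratic error at most a
    sixteenth of its linear term. *)
Record loc_chart (R : realType) (n : nat) (N : topGroupType) := LocChart {
  cc : N -> 'rV[R]_n;
  ci : 'rV[R]_n -> N;
  lr : R;
  lC : R;
  lr_gt0 : 0 < lr;
  lC_ge0 : 0 <= lC;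
  lCr : lC * lr <= 1 / 16;
  cc1 : cc 1%g = 0;
  ciK : forall v, `|v| <= lr -> cc (ci v) = v;
  ci_cont : forall v, `|v| <= lr -> {for v, continuous ci};
  ccK_near : \forall x \near (1%g : N), ci (cc x) = x;
  cc_cont : forall x, ci (cc x) = x -> `|cc x| <= lr -> {for x, continuous cc};
  ccM : forall x y, ci (cc x) = x -> `|cc x| <= lr -> ci (cc y) = y -> `|cc y| <= lr ->
     ci (cc (x * y)%g) = (x * y)%g;
  cc_rect : forall x x' y y',
    ci (cc x) = x -> `|cc x| <= lr -> ci (cc x') = x' -> `|cc x'| <= lr ->
    ci (cc y) = y -> `|cc y| <= lr -> ci (cc y') = y' -> `|cc y'| <= lr ->
    `|cc (x * y)%g - cc (x' * y)%g - cc (x * y')%g + cc (x' * y')%g|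
      <= lC * `|cc x - cc x'| * `|cc y - cc y'|
}.

Section LieLocChart.
Variables (R : realType) (n : nat) (N : lieGroupType R n).

Let c : chart R n N := one_chart N.
Let e0 := c 1%g.

Lemma lie_loc_chart : exists lc : loc_chart R n N,
  (forall x, cc lc x = one_chart N x - one_chart N 1%g) /\
  (forall v, ci lc v = chart_inv (one_chart N) (v + one_chart N 1%g)).
Proof.
have d1 : chart_dom c 1%g by exact: chart_at_dom.
have cod0 : chart_codom c e0 by exists 1%g.
have inv0 : chart_inv c e0 = 1%g by apply: chart_funK; rewrite inE.
pose O := [set xy : 'rV[R]_n * 'rV[R]_n |
        [/\ chart_codom c xy.1, chart_codom c xy.2 &
            chart_dom c (chart_inv c xy.1 * chart_inv c xy.2)%g]].
have oO : open O.
  rewrite openE => -[x y] [/= cx cy dxy]; rewrite /interior /=.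
  have nx : \forall p \near (x, y), chart_codom c p.1.
    apply: (@cvg_fst _ _ (nbhs x) (nbhs y)).
    by apply: open_nbhs_nbhs; split => //; exact: chart_codom_open.
  have ny : \forall p \near (x, y), chart_codom c p.2.
    apply: (@cvg_snd _ _ (nbhs x) (nbhs y)).
    by apply: open_nbhs_nbhs; split => //; exact: chart_codom_open.
  have nd : \forall p \near (x, y), chart_dom c (chart_inv c p.1 * chart_inv c p.2)%g.
    have H : (fun p => (chart_inv c p.1 * chart_inv c p.2)%g) @ (x, y) -->
        (chart_inv c x * chart_inv c y)%g.
      apply: (@cvg_comp _ _ _ (fun p => (chart_inv c p.1, chart_inv c p.2))
         (fun q : N * N => (q.1 * q.2)%g) (nbhs (x, y))
         (nbhs (chart_inv c x, chart_inv c y))); last exact: (@mulg_continuous N (chart_inv c x, chart_inv c y)).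
      apply: cvg_pair => /=.
        apply: (@cvg_comp _ _ _ fst (chart_inv c) _ (nbhs x)); first exact: cvg_fst.
        by apply: chart_inv_continuous; rewrite inE.
      apply: (@cvg_comp _ _ _ snd (chart_inv c) _ (nbhs y)); first exact: cvg_snd.
      by apply: chart_inv_continuous; rewrite inE.
    by apply: H; apply: open_nbhs_nbhs; split => //; exact: chart_dom_open.
  by near=> p; split; near: p.
have O0 : O (e0, e0) by split => //=; rewrite inv0 mulg1.
have [r [C [r0 C0 HC]]] := rect_estimate oO O0 (mulg_smooth (1%g : N) (1%g : N) (1%g : N)).
have [r2 r20 Hr2] : exists2 r2 : R, 0 < r2 & forall x y, `|x - e0| < r2 -> `|y - e0| < r2 -> O (x, y).
  have /nbhs_ballP[r2 /= r20 H] : nbhs (e0, e0) O by exact: open_nbhs_nbhs.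
  exists r2 => // x y hx hy; apply: H; split => /=; rewrite -ball_normE /ball_ /= distrC//.
(* The three bounds ensure respectively the rectangle estimate, that points and their products stay
   in the domain of the chart, and [lCr]. *)
pose rho := Num.min (Num.min r (r2 / 2)) (1 / (16 * (C + 1))).
have rho0 : 0 < rho by rewrite !lt_min r0 !divr_gt0 //= mulr_gt0// ltr_wpDl.
have rho1 : rho <= r by rewrite !ge_min lexx.
have rho2 : rho < r2.
  apply: (@le_lt_trans _ _ (r2 / 2)); first by rewrite !ge_min lexx orbT.
  by rewrite ltr_pdivrMr// mulr_natr mulr2n ltrDl.
have rho3 : C * rho <= 1 / 16.
  apply: (@le_trans _ _ (C * (1 / (16 * (C + 1))))).
    by apply: ler_wpM2l => //; rewrite ge_min lexx orbT.
  rewrite !mul1r ler_pdivrMr ?mulr_gt0 ?ltr_wpDl//.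
  by rewrite mulrA mulVf// mul1r lerDl.
pose fcc (x : N) := c x - e0.
pose fci v := chart_inv c (v + e0).
have cod v : `|v| <= rho -> chart_codom c (v + e0).
  move=> hv; have [] // := Hr2 (v + e0) (v + e0); rewrite addrK; exact: le_lt_trans rho2.
have Kdom x : fci (fcc x) = x -> `|fcc x| <= rho -> chart_dom c x.
  rewrite /fci /fcc => E /cod; rewrite subrK in E *; case=> y dy yx.
  have <- : y = x by rewrite -E -yx chart_funK// inE.
  by [].
have domK x : chart_dom c x -> fci (fcc x) = x.
  by move=> dx; rewrite /fci /fcc subrK chart_funK// inE.
have sm2 x : fci (fcc x) = x -> `|fcc x| <= rho -> x = chart_inv c (c x) /\ `|c x - e0| < r2.
  by move=> E h; split; [rewrite -[LHS]E /fci /fcc subrK | exact: le_lt_trans rho2].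
unshelve eexists.
  apply: (@LocChart R n N fcc fci rho C rho0 C0 rho3).
  - by rewrite /fcc subrr.
  - move=> v /cod [y dy yv]; rewrite /fci /fcc -yv chart_funK ?inE// yv addrK//.
  - move=> v /cod hv; rewrite /fci.
    apply: (@cvg_comp _ _ _ (fun v => v + e0) (chart_inv c) (nbhs v) (nbhs (v + e0))).
      by apply: cvgD; [exact: cvg_id | exact: cvg_cst].
    by apply: chart_inv_continuous; rewrite inE.
  - have : \forall x \near (1%g : N), chart_dom c x.
      by apply: open_nbhs_nbhs; split => //; exact: chart_dom_open.
    by apply: filterS => x /domK.
  - move=> x E h; apply: cvgB; last exact: cvg_cst.
    by apply: chart_fun_continuous; rewrite inE; exact: Kdom.
  - move=> x y Ex hx Ey hy; apply: domK.
    have [ex hx'] := sm2 _ Ex hx; have [ey hy'] := sm2 _ Ey hy.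
    by have [_ _] := Hr2 _ _ hx' hy'; rewrite /= -ex -ey.
  - move=> x x' y y' Ex hx Ex' hx' Ey hy Ey' hy'.
    have [ex _] := sm2 _ Ex hx; have [ey _] := sm2 _ Ey hy.
    have [ex' _] := sm2 _ Ex' hx'; have [ey' _] := sm2 _ Ey' hy'.
    have := HC (c x) (c x') (c y) (c y').
    rewrite /= -/c -ex -ex' -ey -ey' /fcc.
    have aux (A B D E : 'rV[R]_n) : A - e0 - (B - e0) - (D - e0) + (E - e0) = A - B - D + E.
      by apply/rowP => k; rewrite !mxE; ring.
    rewrite aux => H; have aux2 (A B : 'rV[R]_n) : A - e0 - (B - e0) = A - B.
      by rewrite opprB addrA subrK.
    rewrite !aux2; apply: H; exact: le_trans rho1.
by split.
Unshelve. all: by end_near.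
Qed.

End LieLocChart.

Section NormAux.
Variables (K : numDomainType) (V : normedZmodType K).
Implicit Types u v w : V.

Lemma norm_via u v : `|u| <= `|u - v| + `|v|.
Proof. by rewrite -[X in `|X| <= _](subrK v) ler_normD. Qed.

Lemma norm_via3 u v w : `|u| <= `|u - v - w| + `|v| + `|w|.
Proof.
by apply: le_trans (norm_via u v) _; rewrite addrAC; apply: lerD => //; apply: norm_via.
Qed.

End NormAux.

Lemma cvg_norm_bound (R : realType) (V : normedModType R) (u : nat -> V) (l : V) (B : R) :
  u @ \oo --> l -> (forall k, `|u k| <= B) -> `|l| <= B.
Proof.
move=> ul H; apply: (cvgr_to_le (f := fun k => `|u k|) (cvg_norm ul)).
exact: nearW.
Qed.

Lemma half_pow_cvg (R : realType) (K : R) : (fun k => K / 2 ^+ k) @ \oo --> (0 : R).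
Proof.
have -> : (fun k : nat => K / 2 ^+ k) = geometric K 2^-1.
  by apply/funext => k; rewrite /geometric /= exprVn.
by apply: cvg_geometric; rewrite ger0_norm ?invr_ge0// invf_lt1// ltr1n.
Qed.

Lemma cvg_rV (R : realType) (n : nat) (T : Type) (F : set_system T) (FF : Filter F)
    (u : T -> 'rV[R]_n) (l : 'rV[R]_n) :
  (forall i, (fun k => u k 0 i) @ F --> l 0 i) -> u @ F --> l.
Proof.
move=> H; apply/cvgrPdist_le => eps eps0.
have H2 i : \forall k \near F, `|l 0 i - u k 0 i| <= eps.
  by have /cvgrPdist_le/(_ eps eps0) := H i.
have H3 : \forall k \near F, forall i, `|l 0 i - u k 0 i| <= eps.
  exact: (@filter_forall _ _ (fun i k => `|l 0 i - u k 0 i| <= eps) _ FF).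
apply: filterS H3 => k hk.
by apply: rV_norm_le; rewrite ?ltW// => i; have := hk i; rewrite !mxE.
Qed.

Lemma half_cauchy1 (R : realType) (u : nat -> R) (K : R) :
  (forall k, `|u k.+1 - u k| <= K / 2 ^+ k) -> exists l : R, u @ \oo --> l.
Proof.
move=> H; pose w k : R := u k.+1 - u k.
have K0 : 0 <= K by have := H 0; rewrite expr0 divr1; apply: le_trans.
have cw : cvgn (series w).
  apply: normed_cvg; apply: (@series_le_cvg _ _ (geometric K 2^-1)) => //.
  - by move=> k /=; exact: normr_ge0.
  - by move=> k; rewrite /geometric /=; apply: mulr_ge0 => //; rewrite exprn_ge0// invr_ge0.
  - by move=> k; rewrite /geometric /= exprVn; apply: H.
  - by apply: is_cvg_geometric_series; rewrite ger0_norm ?invr_ge0// invf_lt1// ltr1n.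
exists (lim (series w @ \oo) + u 0).
have E : (fun k => series w k + u 0) = u.
  apply/funext => k; rewrite /series /= /w.
  by rewrite (telescope_sumr (fun k => u k)) // subrK.
have cc0 : (fun _ : nat => u 0) @ \oo --> u 0 by exact: cvg_cst.
have H2 : (fun k => series w k + u 0) @ \oo --> lim (series w @ \oo) + u 0 by exact: cvgD cw cc0.
by rewrite E in H2.
Qed.

Lemma half_cauchy (R : realType) (n : nat) (u : nat -> 'rV[R]_n) (K : R) :
  (forall k, `|u k.+1 - u k| <= K / 2 ^+ k) -> exists l : 'rV[R]_n, u @ \oo --> l.
Proof.
move=> H; have H1 i : exists l : R, (fun k => u k 0 i) @ \oo --> l.
  apply: (@half_cauchy1 _ _ K) => k; apply: le_trans (H k).
  by have := rV_norm_ge (u k.+1 - u k) i; rewrite !mxE.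
have [l hl] := choice H1; exists (\row_i l i).
by apply: cvg_rV => i; rewrite mxE.
Qed.

(** * Products and powers in a chart at the identity *)

Section LocalGroup.
Variables (R : realType) (n : nat) (N : topGroupType) (lc : loc_chart R n N).
Hypothesis hN : hausdorff_space N.

Local Notation c := (cc lc).
Local Notation e := (ci lc).
Local Notation r := (lr lc).
Local Notation C := (lC lc).

(** [cc] is a total function; the first equation is what says that x lies in the domain of the
    chart. *)
Definition sm (a : R) (x : N) := e (c x) = x /\ `|c x| <= a.

Lemma sm_le a b x : a <= b -> sm a x -> sm b x.
Proof. by move=> ab [h1 h2]; split => //; exact: le_trans ab. Qed.

Lemma ci0 : e 0 = 1%g.
Proof. by have := nbhs_singleton (ccK_near lc); rewrite cc1. Qed.

Lemma sm1 a : 0 <= a -> sm a 1%g.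
Proof. by move=> a0; split; rewrite cc1 ?ci0 ?normr0. Qed.

Lemma sm_e a v : `|v| <= a -> a <= r -> sm a (e v).
Proof. by move=> va ar; split; rewrite ciK //; exact: le_trans ar. Qed.

Lemma sm_nbhs (U : set N) : nbhs 1%g U -> exists2 a, 0 < a <= r & forall x, sm a x -> U x.
Proof.
move=> hU; have c0 : {for (0 : 'rV[R]_n), continuous e}.
  by apply: ci_cont; rewrite normr0 ltW// lr_gt0.
have : \forall v \near (0 : 'rV[R]_n), U (e v) by apply: c0; rewrite ci0.
case/nbhs_ballP => d /= d0 Hd; exists (Num.min (d / 2) r).
  by rewrite ge_min lexx orbT lt_min lr_gt0 divr_gt0.
move=> x [Ex h]; rewrite -Ex; apply: Hd; rewrite -ball_normE /ball_ /= sub0r normrN.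
apply: le_lt_trans h _; rewrite gt_min; apply/orP; left.
by rewrite ltr_pdivrMr// mulr_natr mulr2n ltrDl.
Qed.

Lemma near_sm a : 0 < a -> \forall x \near (1%g : N), sm a x.
Proof.
move=> a0; apply: filterI; first exact: ccK_near.
have h : {for (1%g : N), continuous c} by apply: cc_cont; rewrite cc1 ?ci0 ?normr0 ?ltW ?lr_gt0.
move/cvgrPdist_lt/(_ a a0): h; rewrite cc1; apply: filterS => x /=.
by rewrite sub0r normrN => /ltW.
Qed.

Lemma cc_mul_left x y z : sm r x -> sm r y -> sm r z ->
  `|c (x * y)%g - c (x * z)%g - (c y - c z)| <= C * `|c x| * `|c y - c z|.
Proof.
move=> [x1 x2] [y1 y2] [z1 z2]; have [p1 p2] := sm1 (ltW (lr_gt0 lc)).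
have := cc_rect x1 x2 p1 p2 y1 y2 z1 z2; rewrite !mul1g cc1 subr0.
rewrite (_ : c (x * y)%g - c (x * z)%g - (c y - c z) = c (x * y)%g - c y - c (x * z)%g + c z) //.
by apply/rowP => k; rewrite !mxE; ring.
Qed.

Lemma cc_mul_right x y z : sm r x -> sm r y -> sm r z ->
  `|c (y * x)%g - c (z * x)%g - (c y - c z)| <= C * `|c x| * `|c y - c z|.
Proof.
move=> [x1 x2] [y1 y2] [z1 z2]; have [p1 p2] := sm1 (ltW (lr_gt0 lc)).
have := cc_rect y1 y2 z1 z2 x1 x2 p1 p2; rewrite !mulg1 cc1 subr0 mulrAC.
rewrite (_ : c (y * x)%g - c (z * x)%g - (c y - c z) = c (y * x)%g - c (z * x)%g - c y + c z) //.
by apply/rowP => k; rewrite !mxE; ring.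
Qed.

(** To first order the product is the sum of the coordinates; this is [cc_mul_left] with the second
    point equal to 1. *)
Lemma M1 x y : sm r x -> sm r y -> `|c (x * y)%g - c x - c y| <= C * `|c x| * `|c y|.
Proof.
move=> sx sy; have := cc_mul_left sx sy (sm1 (ltW (lr_gt0 lc))).
by rewrite mulg1 cc1 subr0.
Qed.

Lemma lC_ball_small a : a <= r -> C * a <= 1 / 16.
Proof. by move=> ar; apply: le_trans (lCr lc); apply: ler_wpM2l => //; exact: lC_ge0. Qed.

(** Each further factor x adds an error at most C (2 m a) a, and these sum up quadratically in m.
    The bound 2 m a <= r keeps all powers in the chart, and its factor 2 absorbs the total error
    because C r <= 1 / 16. *)
Lemma pow1 x a (m : nat) : sm a x -> 0 <= a -> 2 * m%:R * a <= r ->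
  sm (2 * m%:R * a) (x ^+ m)%g /\
  `|c (x ^+ m)%g - m%:R *: c x| <= 2 * C * m%:R ^+ 2 * a ^+ 2.
Proof.
move=> sx a0; elim: m => [|m IH] hm.
  rewrite expg0 cc1 scale0r subrr normr0 mulr0 !mul0r expr0n /= mulr0 mul0r; split => //.
  by apply: sm1.
have mR : m.+1%:R = m%:R + 1 :> R by rewrite -addn1 natrD.
have m0 : 0 <= m%:R :> R by [].
move: hm; rewrite mR => hm.
have ma0 : 0 <= m%:R * a by rewrite mulr_ge0.
have hm' : 2 * m%:R * a <= r by apply: le_trans hm; lra.
have ar : a <= r by apply: le_trans hm; lra.
have [[s1 s2] d] := IH hm'.
have sxr : sm r x by exact: sm_le sx.
have spr : sm r (x ^+ m)%g by split => //; exact: le_trans hm'.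
have h := M1 spr sxr.
have C0 := lC_ge0 lc.
have hb : C * `|c (x ^+ m)%g| * `|c x| <= C * (2 * m%:R * a) * a.
  apply: ler_pM => //; first by rewrite mulr_ge0.
    by apply: ler_wpM2l.
  by case: sx.
have D : `|c (x ^+ m.+1)%g - (m%:R + 1) *: c x| <= 2 * C * (m%:R + 1) ^+ 2 * a ^+ 2.
  rewrite expgSr.
  have -> : c (x ^+ m * x)%g - (m%:R + 1) *: c x =
    (c (x ^+ m * x)%g - c (x ^+ m)%g - c x) + (c (x ^+ m)%g - m%:R *: c x).
    by apply/rowP => k; rewrite !mxE; ring.
  apply: le_trans (ler_normD _ _) _; apply: le_trans (lerD h d) _.
  apply: le_trans (lerD hb (lexx _)) _.
  have Ca2 : 0 <= C * a ^+ 2 by rewrite mulr_ge0// exprn_ge0.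
  have Cma2 : 0 <= m%:R * (C * a ^+ 2) by rewrite mulr_ge0.
  rewrite -subr_ge0; have -> : 2 * C * (m%:R + 1) ^+ 2 * a ^+ 2 - (C * (2 * m%:R * a) * a + 2 * C * m%:R ^+ 2 * a ^+ 2) = 2 * (m%:R * (C * a ^+ 2)) + 2 * (C * a ^+ 2) by ring.
  lra.
split; last exact: D.
split.
  by rewrite expgSr; apply: ccM; [case: spr|case: spr|case: sxr|case: sxr].
apply: le_trans (norm_via _ ((m%:R + 1) *: c x)) _.
have hx : `|(m%:R + 1) *: c x| <= (m%:R + 1) * a.
  rewrite normrZ ger0_norm ?addr_ge0//; apply: ler_wpM2l; rewrite ?addr_ge0//.
  by case: sx.
apply: le_trans (lerD D hx) _.
have q0 : 0 <= (m%:R + 1) * a by rewrite mulr_ge0// addr_ge0.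
have qr : C * (2 * (m%:R + 1) * a) <= 1/16 by apply: lC_ball_small.
have : C * (2 * (m%:R + 1) * a) * ((m%:R + 1) * a) <= 1/16 * ((m%:R + 1) * a) by apply: ler_wpM2r.
have -> : 2 * C * (m%:R + 1) ^+ 2 * a ^+ 2 = C * (2 * (m%:R + 1) * a) * ((m%:R + 1) * a) by ring.
lra.
Qed.

(** The version of [pow1] for differences: the error is proportional to the distance of x and y,
    which is what makes the limits below Lipschitz and injective. *)
Lemma pow2 x y a (m : nat) : sm a x -> sm a y -> 0 <= a -> 2 * m%:R * a <= r ->
  `|c (x ^+ m)%g - c (y ^+ m)%g - m%:R *: (c x - c y)|
     <= 2 * C * m%:R ^+ 2 * a * `|c x - c y|.
Proof.
move=> sx sy a0; set D := `|c x - c y|; have D0 : 0 <= D by exact: normr_ge0.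
elim: m => [|m IH] hm.
  by rewrite !expg0 !subrr scale0r subrr normr0 expr0n /= mulr0 !mul0r.
have mR : m.+1%:R = m%:R + 1 :> R by rewrite -addn1 natrD.
have m0 : 0 <= m%:R :> R by [].
move: hm; rewrite mR => hm.
have ma0 : 0 <= m%:R * a by rewrite mulr_ge0.
have hm' : 2 * m%:R * a <= r by apply: le_trans hm; lra.
have ar : a <= r by apply: le_trans hm; lra.
have [sxm _] := pow1 sx a0 hm'; have [sym _] := pow1 sy a0 hm'.
have d := IH hm'.
have C0 := lC_ge0 lc.
have sxr : sm r x by exact: sm_le sx.
have syr : sm r y by exact: sm_le sy.
have sxmr : sm r (x ^+ m)%g by exact: sm_le sxm.
have symr : sm r (y ^+ m)%g by exact: sm_le sym.
have e1 : `|c (x ^+ m * x)%g - c (x ^+ m * y)%g - (c x - c y)| <= C * (2 * m%:R * a) * D.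
  apply: le_trans (cc_mul_left sxmr sxr syr) _; apply: ler_wpM2r => //.
  by apply: ler_wpM2l => //; case: sxm.
have dm : `|c (x ^+ m)%g - c (y ^+ m)%g| <= 2 * m%:R * D.
  apply: le_trans (norm_via _ (m%:R *: (c x - c y))) _.
  rewrite normrZ ger0_norm// -/D.
  have mD : 0 <= m%:R * D by rewrite mulr_ge0.
  have : C * (2 * m%:R * a) * (m%:R * D) <= 1/16 * (m%:R * D) by apply: ler_wpM2r => //; apply: lC_ball_small.
  have : 2 * C * m%:R ^+ 2 * a * D = C * (2 * m%:R * a) * (m%:R * D) by ring.
  move: d; rewrite -/D; lra.
have e2 : `|c (x ^+ m * y)%g - c (y ^+ m * y)%g - (c (x ^+ m)%g - c (y ^+ m)%g)| <= C * a * (2 * m%:R * D).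
  apply: le_trans (cc_mul_right syr sxmr symr) _; apply: ler_pM => //; first by rewrite mulr_ge0.
  by apply: ler_wpM2l => //; case: sy.
rewrite !expgSr.
have -> : c (x ^+ m * x)%g - c (y ^+ m * y)%g - (m%:R + 1) *: (c x - c y) =
   (c (x ^+ m * x)%g - c (x ^+ m * y)%g - (c x - c y)) +
   ((c (x ^+ m * y)%g - c (y ^+ m * y)%g - (c (x ^+ m)%g - c (y ^+ m)%g)) +
   (c (x ^+ m)%g - c (y ^+ m)%g - m%:R *: (c x - c y))).
  by apply/rowP => k; rewrite !mxE; ring.
apply: le_trans (ler_normD _ _) _; apply: le_trans (lerD e1 (ler_normD _ _)) _.
apply: le_trans (lerD (lexx _) (lerD e2 d)) _; rewrite -/D.
have CaD : 0 <= C * a * D by rewrite !mulr_ge0.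
rewrite -subr_ge0.
have -> : 2 * C * (m%:R + 1) ^+ 2 * a * D - (C * (2 * m%:R * a) * D + (C * a * (2 * m%:R * D) + 2 * C * m%:R ^+ 2 * a * D)) = 2 * (C * a * D) by ring.
lra.
Qed.

Lemma pow3 x y a (m : nat) : sm a x -> sm a y -> 0 <= a -> 2 * m%:R * a <= r ->
  `|c (x ^+ m)%g - c (y ^+ m)%g| <= 2 * m%:R * `|c x - c y|.
Proof.
move=> sx sy a0 hm; have h := pow2 sx sy a0 hm.
apply: le_trans (norm_via _ (m%:R *: (c x - c y))) _.
have mD : 0 <= m%:R * `|c x - c y| by rewrite mulr_ge0.
have : C * (2 * m%:R * a) * (m%:R * `|c x - c y|) <= 1/16 * (m%:R * `|c x - c y|).
  by apply: ler_wpM2r => //; apply: lC_ball_small.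
have : 2 * C * m%:R ^+ 2 * a * `|c x - c y| = C * (2 * m%:R * a) * (m%:R * `|c x - c y|) by ring.
rewrite normrZ ger0_norm//; move: h; lra.
Qed.

Lemma inv_near : exists2 a, 0 < a <= r & forall x, sm a x ->
  sm r (x^-1)%g /\ `|c (x^-1)%g + c x| <= 2 * C * `|c x| ^+ 2.
Proof.
have : \forall x \near (1%g : N), sm r (x^-1)%g.
  have h : (fun x : N => x^-1)%g @ (1%g : N) --> (1%g : N).
    by rewrite -[X in _ --> X]invg1; exact: invg_continuous.
  apply: h.
  by apply: near_sm; exact: lr_gt0.
case/sm_nbhs => a ha H; exists a => // x sx; have sxi := H _ sx; split=> //.
have sxr : sm r x by apply: sm_le sx; case/andP: ha.
have h := M1 sxr sxi; rewrite mulgV cc1 sub0r -opprD normrN addrC in h.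
have C0 := lC_ge0 lc.
have hx : C * `|c x| <= 1/16 by apply: lC_ball_small; case: sxr.
have h2 : C * `|c x| * `|c (x^-1)%g| <= 1/16 * `|c (x^-1)%g| by apply: ler_wpM2r.
have h3 : `|c (x^-1)%g| <= 2 * `|c x|.
  have : `|c (x^-1)%g| <= `|c (x^-1)%g + c x| + `|c x|.
    by have := norm_via (c (x^-1)%g) (- c x); rewrite opprK normrN.
  have := normr_ge0 (c x); lra.
apply: le_trans h _.
have : C * `|c x| * `|c (x^-1)%g| <= C * `|c x| * (2 * `|c x|).
  by apply: ler_wpM2l => //; rewrite mulr_ge0.
rewrite expr2; lra.
Qed.

End LocalGroup.

Lemma ler_eq (R : numDomainType) (x y : R) : x = y -> x <= y.
Proof. by move->. Qed.

Lemma cvg_cst_le0 (R : realType) (a : R) (B : nat -> R) :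
  B @ \oo --> (0 : R) -> (\forall k \near \oo, a <= B k) -> a <= 0.
Proof. by move=> B0 H; apply: (cvgr_to_ge (f := B) B0). Qed.

Lemma cvg_norm0 (R : realType) n (u : nat -> 'rV[R]_n) (l : 'rV[R]_n) (B : nat -> R) :
  B @ \oo --> (0 : R) -> (\forall k \near \oo, `|u k - l| <= B k) -> u @ \oo --> l.
Proof.
move=> /cvgrPdist_lt B0 H; apply/cvgrPdist_lt => eps eps0.
have := B0 _ eps0; apply: filterS2 H => k /= h1 h2.
rewrite distrC; apply: le_lt_trans h1 _; apply: le_lt_trans h2.
by rewrite sub0r normrN ler_norm.
Qed.

(** The iteration v |-> v + (y - g v) converges since its steps are halved each time. It plays the
    part of the inverse function theorem for exp near 0. *)
Lemma half_surj (R : realType) n (g : 'rV[R]_n -> 'rV[R]_n) (rho : R) :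
  (forall v w : 'rV[R]_n, `|v| <= rho -> `|w| <= rho -> `|g v - g w - (v - w)| <= 1 / 2 * `|v - w|) ->
  g 0 = 0 ->
  forall y : 'rV[R]_n, `|y| <= rho / 2 -> exists2 v : 'rV[R]_n, `|v| <= 2 * `|y| & g v = y.
Proof.
move=> H g0 y hy.
have y0 := normr_ge0 y.
pose v := fix v (k : nat) : 'rV[R]_n := if k is k'.+1 then v k' + (y - g (v k')) else 0.
have vS k : v k.+1 - v k = y - g (v k) by rewrite /= addrAC subrr add0r.
have p2 k : 0 < 2 ^+ k :> R by rewrite exprn_gt0.
have inv2 k : (2 ^+ k.+1)^-1 = 2^-1 * (2 ^+ k)^-1 :> R by rewrite exprS invfM.
have main k : `|v k.+1 - v k| <= `|y| / 2 ^+ k /\ `|v k| <= 2 * `|y| - 2 * `|y| / 2 ^+ k.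
  elim: k => [|k [IH1 IH2]].
    by rewrite vS /= g0 subr0 expr0 !divr1 subrr normr0.
  have nv : `|v k.+1| <= 2 * `|y| - 2 * `|y| / 2 ^+ k.+1.
    apply: le_trans (norm_via _ (v k)) _.
    apply: le_trans (lerD IH1 IH2) _; rewrite inv2; lra.
  split=> //.
  have b1 : `|v k.+1| <= rho.
    apply: le_trans nv _; have : 0 <= 2 * `|y| / 2 ^+ k.+1 by rewrite divr_ge0// ?mulr_ge0// ltW.
    lra.
  have b0 : `|v k| <= rho.
    apply: le_trans IH2 _; have : 0 <= 2 * `|y| / 2 ^+ k by rewrite divr_ge0// ?mulr_ge0// ltW.
    lra.
  rewrite vS.
  have -> : y - g (v k.+1) = - (g (v k.+1) - g (v k) - (v k.+1 - v k)).
    by rewrite vS; apply/rowP => i; rewrite !mxE; ring.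
  rewrite normrN; apply: le_trans (H _ _ b1 b0) _; rewrite inv2; lra.
have [l vl] : exists l : 'rV[R]_n, v @ \oo --> l.
  by apply: (@half_cauchy _ _ _ `|y|) => k; case: (main k).
have vb k : `|v k| <= 2 * `|y|.
  have [_ h] := main k; apply: le_trans h _.
  have : 0 <= 2 * `|y| / 2 ^+ k by rewrite divr_ge0// ?mulr_ge0// ltW.
  lra.
have lb : `|l| <= 2 * `|y| by apply: cvg_norm_bound vl _.
exists l => //.
have rb (x : 'rV[R]_n) : `|x| <= 2 * `|y| -> `|x| <= rho by move=> h; lra.
apply/eqP; rewrite -subr_eq0 -normr_le0.
have cB : (fun k => `|y| / 2 ^+ k + 2 * `|v k - l|) @ \oo --> (0 : R).
  have -> : (0 : R) = 0 + 2 * 0 by rewrite mulr0 addr0.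
  apply: cvgD; first exact: half_pow_cvg.
  have h1 : (fun k => v k - l) @ \oo --> (0 : 'rV[R]_n).
    by rewrite -[X in _ --> X](subrr l); apply: cvgB => //; exact: cvg_cst.
  have h2 : (fun k => `|v k - l|) @ \oo --> (0 : R).
    by rewrite -[X in _ --> X](@normr0 R 'rV[R]_n); exact: cvg_norm h1.
  have h3 : (fun _ : nat => 2 : R) @ \oo --> (2 : R) by exact: cvg_cst.
  exact: cvgM h3 h2.
apply: (cvg_cst_le0 cB); apply: nearW => k.
have -> : g l - y = - (y - g (v k)) + ((g l - g (v k) - (l - v k)) + (l - v k)).
  by apply/rowP => i; rewrite !mxE; ring.
apply: le_trans (ler_normD _ _) _; rewrite normrN -vS; apply: lerD.
  by case: (main k).
apply: le_trans (ler_normD _ _) _.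
have := H l (v k) (rb _ lb) (rb _ (vb k)); rewrite (distrC (v k)).
have := normr_ge0 (l - v k); lra.
Qed.

(** * The local exponential map as a limit of dyadic powers *)

Section Exponential.
Variables (R : realType) (n : nat) (N : topGroupType) (lc : loc_chart R n N).
Hypothesis hN : hausdorff_space N.

Implicit Types u v w : 'rV[R]_n.
Local Notation c := (cc lc).
Local Notation e := (ci lc).
Local Notation r := (lr lc).
Local Notation C := (lC lc).
Local Notation sm := (sm lc).

(** A quarter, because elements of size 2 |v| / 2^k are raised to the power 2^k in [pow_seq_diff],
    where the power estimates require 4 |v| <= r. *)
Definition exr : R := r / 4.
Local Notation q := exr.

Lemma exr_gt0 : 0 < q. Proof. by rewrite /exr divr_gt0// lr_gt0. Qed.
Lemma exr_le : q <= r. Proof. by rewrite /exr; have := lr_gt0 lc; lra. Qed.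

Lemma expg_continuous (m : nat) : continuous (fun x : N => x ^+ m)%g.
Proof.
elim: m => [|m IH] x.
  by have -> : (fun x : N => x ^+ 0)%g = (fun _ => 1%g) by []; exact: cvg_cst.
have -> : (fun x : N => x ^+ m.+1)%g = (fun x : N => x ^+ m * x)%g.
  by apply/funext => z; rewrite expgSr.
apply: (@cvg_comp _ _ _ (fun z : N => (z ^+ m, z)%g) (fun p : N * N => p.1 * p.2)%g (nbhs x)
  (nbhs ((x ^+ m)%g, x))); last exact: (@mulg_continuous N ((x ^+ m)%g, x)).
by apply: cvg_pair; [exact: IH | exact: cvg_id].
Qed.

(** The approximation (1 + v / 2^k)^(2^k) of exp v. Dyadic exponents make consecutive terms
    comparable, the next one being the 2^k-th power of a square. *)
Definition ex_seq (k : nat) (v : 'rV[R]_n) : N := (e ((2 ^+ k)^-1 *: v) ^+ (2 ^ k))%g.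

Lemma ex_seq_sm k v : `|v| <= q -> sm (2 * `|v|) (ex_seq k v).
Proof.
move=> hv; have p0 : 0 < 2 ^+ k :> R by rewrite exprn_gt0.
have p1 : 1 <= 2 ^+ k :> R by rewrite exprn_ege1// ler1n.
have r0 := lr_gt0 lc.
have hn : `|(2 ^+ k)^-1 *: v| = `|v| / 2 ^+ k by rewrite normrZ gtr0_norm ?invr_gt0// mulrC.
have hk : `|v| / 2 ^+ k <= `|v| by rewrite ler_pdivrMr// ler_peMr.
have E : 2 * (2 ^ k)%:R * (`|v| / 2 ^+ k) = 2 * `|v| by rewrite natrX; field; rewrite gt_eqF.
have [|||h _] := @pow1 _ _ _ lc (e ((2 ^+ k)^-1 *: v)) (`|v| / 2 ^+ k) (2 ^ k).
- by apply: sm_e; rewrite ?hn// (le_trans hk) // (le_trans hv) // exr_le.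
- by rewrite divr_ge0// ltW.
- by rewrite E; move: hv; rewrite /exr; lra.
by rewrite E in h.
Qed.

Lemma ex_seq_diff k v w a : `|v| <= a -> `|w| <= a -> a <= q ->
  `|c (ex_seq k v) - c (ex_seq k w) - (v - w)| <= 2 * C * a * `|v - w|.
Proof.
move=> hv hw ha; have p0 : 0 < 2 ^+ k :> R by rewrite exprn_gt0.
have p1 : 1 <= 2 ^+ k :> R by rewrite exprn_ege1// ler1n.
have r0 := lr_gt0 lc; have a0 : 0 <= a by apply: le_trans hv.
have ar : a / 2 ^+ k <= r.
  apply: (@le_trans _ _ a); first by rewrite ler_pdivrMr// ler_peMr.
  by apply: le_trans ha exr_le.
have hn u : `|u| <= a -> `|(2 ^+ k)^-1 *: u| <= a / 2 ^+ k.
  by move=> h; rewrite normrZ gtr0_norm ?invr_gt0// mulrC ler_pM2r ?invr_gt0.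
have E : 2 * (2 ^ k)%:R * (a / 2 ^+ k) = 2 * a by rewrite natrX; field; rewrite gt_eqF.
have := @pow2 _ _ _ lc (e ((2 ^+ k)^-1 *: v)) (e ((2 ^+ k)^-1 *: w)) (a / 2 ^+ k) (2 ^ k)
  (sm_e (hn _ hv) ar) (sm_e (hn _ hw) ar).
rewrite E !ciK ?(le_trans (hn _ hv) ar) ?(le_trans (hn _ hw) ar)// => H.
have := H (divr_ge0 a0 (ltW p0)) ; rewrite -/(ex_seq k v) -/(ex_seq k w) -scalerBr scalerA natrX.
rewrite mulfV ?gt_eqF// scale1r normrZ gtr0_norm ?invr_gt0// => H2.
apply: le_trans (H2 _) _; first by move: ha; rewrite /exr; lra.
by apply: ler_eq; field; rewrite gt_eqF.
Qed.

(** The m-th power of the element with coordinates w has coordinates m w up to a quadratic error,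
    which the 2^k-th power amplifies only linearly. The case m = 2 gives convergence of [ex_seq],
    general m the compatibility of its limit with m-th roots. *)
Lemma pow_seq_diff (x : N) m k v : (0 < m)%N -> `|v| <= q ->
  x = (e ((2 ^+ k)^-1 *: (m%:R^-1 *: v)) ^+ m)%g ->
  `|c (x ^+ (2 ^ k))%g - c (ex_seq k v)| <= 4 * C * `|v| ^+ 2 / 2 ^+ k.
Proof.
move=> m0 hv xE; have p0 : 0 < 2 ^+ k :> R by rewrite exprn_gt0.
have p1 : 1 <= 2 ^+ k :> R by rewrite exprn_ege1// ler1n.
have mR : 0 < m%:R :> R by rewrite ltr0n.
have m1 : 1 <= m%:R :> R by rewrite ler1n.
have r0 := lr_gt0 lc; have v0 := normr_ge0 v.
set w := (2 ^+ k)^-1 *: (m%:R^-1 *: v) in xE.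
have hw : `|w| = `|v| / (m%:R * 2 ^+ k).
  by rewrite /w !normrZ !gtr0_norm ?invr_gt0//; field; rewrite !gt_eqF.
have mp1 : 1 <= m%:R * 2 ^+ k :> R by apply: mulr_ege1.
have mp0 : 0 < m%:R * 2 ^+ k :> R by apply: lt_le_trans mp1.
have wv : `|w| <= `|v| by rewrite hw ler_pdivrMr// ler_peMr.
have wr : `|w| <= r by apply: le_trans wv (le_trans hv exr_le).
have E1 : 2 * m%:R * `|w| = 2 * `|v| / 2 ^+ k by rewrite hw; field; rewrite !gt_eqF.
have vk : `|v| / 2 ^+ k <= `|v| by rewrite ler_pdivrMr// ler_peMr.
have hb : 2 * `|v| / 2 ^+ k <= r by move: hv vk; rewrite /exr; lra.
have [||sx dx] := @pow1 _ _ _ lc (e w) `|w| m (sm_e (lexx _) wr).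
- exact: normr_ge0.
- by rewrite E1.
rewrite -xE E1 in sx dx.
have vk2 : `|(2 ^+ k)^-1 *: v| = `|v| / 2 ^+ k by rewrite normrZ gtr0_norm ?invr_gt0// mulrC.
have sy : sm (2 * `|v| / 2 ^+ k) (e ((2 ^+ k)^-1 *: v)).
  apply: sm_e => //; rewrite vk2; have : 0 <= `|v| / 2 ^+ k by rewrite divr_ge0// ltW.
  lra.
have E2 : 2 * (2 ^ k)%:R * (2 * `|v| / 2 ^+ k) = 4 * `|v| by rewrite natrX; field; rewrite gt_eqF.
have := pow3 (m := 2 ^ k) sx sy; rewrite E2 => H.
apply: le_trans (H _ _) _.
- by rewrite divr_ge0 ?mulr_ge0// ltW.
- by move: hv; rewrite /exr; lra.
have dxy : `|c x - c (e ((2 ^+ k)^-1 *: v))| <= 2 * C * `|v| ^+ 2 / (2 ^+ k) ^+ 2.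
  rewrite ciK; last by rewrite vk2; apply: le_trans vk (le_trans hv exr_le).
  have <- : 2 * C * m%:R ^+ 2 * `|w| ^+ 2 = 2 * C * `|v| ^+ 2 / (2 ^+ k) ^+ 2.
    by rewrite hw; field; rewrite !gt_eqF.
  have Ew : m%:R *: w = (2 ^+ k)^-1 *: v.
    by rewrite /w !scalerA; congr (_ *: _); field; rewrite !gt_eqF.
  by move: dx; rewrite ciK// Ew.
apply: le_trans (ler_wpM2l _ dxy) _; first by rewrite mulr_ge0.
by apply: ler_eq; rewrite natrX; field; rewrite gt_eqF.
Qed.

Lemma ex_seq_step k v : `|v| <= q ->
  `|c (ex_seq k.+1 v) - c (ex_seq k v)| <= 4 * C * `|v| ^+ 2 / 2 ^+ k.
Proof.
move=> hv; have := @pow_seq_diff _ 2 k v isT hv erefl.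
by rewrite scalerA -invfM -exprSr -expgnA -expnS.
Qed.

Definition Lv (v : 'rV[R]_n) : 'rV[R]_n := lim (c (ex_seq k v) @[k --> \oo]).

Lemma Lv_cvg v : `|v| <= q -> (fun k => c (ex_seq k v)) @ \oo --> Lv v.
Proof.
move=> hv; have [l hl] := half_cauchy (fun k => ex_seq_step k hv).
by apply/cvg_ex; exists l.
Qed.

Lemma Lv_diff v w a : `|v| <= a -> `|w| <= a -> a <= q ->
  `|Lv v - Lv w - (v - w)| <= 2 * C * a * `|v - w|.
Proof.
move=> hv hw ha.
have h : (fun k => c (ex_seq k v) - c (ex_seq k w) - (v - w)) @ \oo --> Lv v - Lv w - (v - w).
  apply: cvgB; last exact: cvg_cst.
  by apply: cvgB; apply: Lv_cvg; apply: le_trans ha.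
by apply: cvg_norm_bound h _ => k; apply: ex_seq_diff.
Qed.

Lemma Lv0 : Lv 0 = 0.
Proof.
rewrite /Lv (_ : (fun k => c (ex_seq k 0)) = (fun _ => 0)).
  by apply: lim_cst; exact: norm_hausdorff.
by apply/funext => k; rewrite /ex_seq scaler0 ci0 expg1n cc1.
Qed.

Lemma Caq a : a <= q -> 2 * C * a <= 1 / 32.
Proof.
move=> aq; have h : C * (4 * a) <= C * r.
  by apply: ler_wpM2l; [exact: lC_ge0 | move: aq; rewrite /exr; lra].
have := lCr lc; lra.
Qed.

Lemma Lv_norm v : `|v| <= q -> `|Lv v| <= 2 * `|v|.
Proof.
move=> hv; have := Lv_diff (lexx `|v|) (_ : `|0| <= `|v|) hv.
rewrite normr0 Lv0 !subr0 => /(_ (normr_ge0 _)) h.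
apply: le_trans (norm_via _ v) _.
have : 2 * C * `|v| * `|v| <= 1 / 32 * `|v| by apply: ler_wpM2r => //; exact: Caq.
have := normr_ge0 v; lra.
Qed.

Definition E_loc (v : 'rV[R]_n) : N := e (Lv v).

Lemma Lv_le v : `|v| <= q -> `|Lv v| <= r.
Proof. by move=> hv; apply: le_trans (Lv_norm hv) _; move: hv; rewrite /exr; have := lr_gt0 lc; lra. Qed.

Lemma E_loc_sm v : `|v| <= q -> sm (2 * `|v|) (E_loc v).
Proof.
move=> hv; apply: sm_e; first exact: Lv_norm.
by move: hv; rewrite /exr; have := lr_gt0 lc; lra.
Qed.

Lemma cE_loc v : `|v| <= q -> c (E_loc v) = Lv v.
Proof. by move=> hv; rewrite /E_loc ciK// Lv_le. Qed.

(** The m-th powers of the approximations of exp (v / m) are asymptotic to the approximations of exp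
    v by [pow_seq_diff], and the chart is injective where both limits live. *)
Lemma E_loc_pow v m : (0 < m)%N -> `|v| <= q -> (E_loc (m%:R^-1 *: v) ^+ m)%g = E_loc v.
Proof.
move=> m0 hv; set w := m%:R^-1 *: v.
have mR : 0 < m%:R :> R by rewrite ltr0n.
have m1 : 1 <= m%:R :> R by rewrite ler1n.
have v0 := normr_ge0 v; have r0 := lr_gt0 lc.
have hw : m%:R * `|w| = `|v|.
  by rewrite /w normrZ gtr0_norm ?invr_gt0// mulrA mulfV ?mul1r// gt_eqF.
have wq : `|w| <= q by apply: le_trans hv; rewrite -hw ler_peMl.
have zc : (fun k => ex_seq k w) @ \oo --> E_loc w.
  have -> : (fun k => ex_seq k w) = (fun k => e (c (ex_seq k w))).
    by apply/funext => k; have [-> _] := ex_seq_sm k wq.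
  apply: (@cvg_comp _ _ _ (fun k => c (ex_seq k w)) e \oo (nbhs (Lv w))); first exact: Lv_cvg.
  by apply: ci_cont; apply: Lv_le.
have zmc : (fun k => (ex_seq k w ^+ m)%g) @ \oo --> (E_loc w ^+ m)%g.
  apply: (@cvg_comp _ _ _ (fun k => ex_seq k w) (fun x : N => x ^+ m)%g \oo (nbhs (E_loc w))) => //.
  exact: expg_continuous.
have smw := E_loc_sm wq.
have [||sE _] := @pow1 _ _ _ lc _ _ m smw.
- by rewrite mulr_ge0.
- have -> : 2 * m%:R * (2 * `|w|) = 4 * `|v| by rewrite -hw; ring.
  by move: hv; rewrite /exr; lra.
have sEr : sm r (E_loc w ^+ m)%g.
  apply: sm_le sE; have -> : 2 * m%:R * (2 * `|w|) = 4 * `|v| by rewrite -hw; ring.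
  by move: hv; rewrite /exr; lra.
have czc : (fun k => c (ex_seq k w ^+ m)%g) @ \oo --> c (E_loc w ^+ m)%g.
  apply: (@cvg_comp _ _ _ (fun k => (ex_seq k w ^+ m)%g) c \oo (nbhs (E_loc w ^+ m)%g)) => //.
  by case: sEr => h1 h2; apply: cc_cont.
have czv : (fun k => c (ex_seq k w ^+ m)%g) @ \oo --> Lv v.
  have E k : (ex_seq k w ^+ m)%g = ((e ((2 ^+ k)^-1 *: w) ^+ m) ^+ (2 ^ k))%g.
    by rewrite /ex_seq expgnAC.
  have h : (fun k => c (ex_seq k w ^+ m)%g - c (ex_seq k v)) @ \oo --> (0 : 'rV[R]_n).
    apply: (cvg_norm0 (half_pow_cvg (4 * C * `|v| ^+ 2))); apply: nearW => k.
    by rewrite subr0 E; apply: pow_seq_diff m0 hv erefl.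
  have H2 : (fun k => (c (ex_seq k w ^+ m)%g - c (ex_seq k v)) + c (ex_seq k v)) @ \oo --> 0 + Lv v.
    exact: cvgD h (Lv_cvg hv).
  rewrite add0r in H2; apply: cvg_trans H2; apply: near_eq_cvg; apply: nearW => k.
  by rewrite subrK.
have cE : c (E_loc w ^+ m)%g = Lv v by exact: (cvg_unique _ czc czv).
by case: sEr => <- _; rewrite cE.
Qed.
End Exponential.

Lemma cvg_near_eq (T : Type) (F : set_system T) (FF : Filter F) (U : topologicalType)
    (f g : T -> U) (l : U) :
  (\forall x \near F, g x = f x) -> f @ F --> l -> g @ F --> l.
Proof. by move=> E; apply: cvg_trans; apply: near_eq_cvg; apply: filterS E => x ->. Qed.

Lemma rV_cvgP (R : realType) n m (f : 'rV[R]_n -> 'rV[R]_m) (z : 'rV[R]_n) (l : 'rV[R]_m) :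
  (forall eps, 0 < eps -> \forall w \near z, `|l - f w| <= eps) -> f @ z --> l.
Proof.
move=> H; have FF : Filter (nbhs z) := nbhs_filter z.
by apply/(@cvgrPdist_le _ _ _ (nbhs z) FF).
Qed.

Lemma near_norm_lt (R : realType) n (v : 'rV[R]_n) (a : R) :
  `|v| < a -> \forall w \near v, `|w| < a.
Proof.
move=> h; have H : (fun w : 'rV[R]_n => w) @ v --> v by exact: cvg_id.
exact: (@cvgr_norm_lt _ _ _ _ _ (fun w => w) v H a h).
Qed.

Lemma seq_norm_lt (R : realType) n (u : nat -> 'rV[R]_n) l (a : R) :
  u @ \oo --> l -> `|l| < a -> \forall k \near \oo, `|u k| < a.
Proof. by move=> h la; exact: (@cvgr_norm_lt _ _ _ _ _ u l h a la). Qed.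

Lemma cvg_scale0 (R : realType) (a : R) (u : nat -> R) :
  u @ \oo --> (0 : R) -> (fun k => a * u k) @ \oo --> (0 : R).
Proof.
move=> h; have H : (fun _ : nat => a) @ \oo --> a by exact: cvg_cst.
by rewrite -(mulr0 a); exact: cvgM H h.
Qed.

Lemma cvg_mul0 (R : realType) (l : R) (u w : nat -> R) :
  u @ \oo --> l -> w @ \oo --> (0 : R) -> (fun k => u k * w k) @ \oo --> (0 : R).
Proof. by move=> h h'; rewrite -(mulr0 l); exact: cvgM h h'. Qed.

Lemma nat_frac_cvg (R : realType) (x : R) : 0 <= x ->
  (fun k => (Num.truncn (x * k.+1%:R))%:R / k.+1%:R : R) @ \oo --> x.
Proof.
move=> x0; apply/cvgrPdist_le => eps eps0.
have /cvgrPdist_le/(_ _ eps0) := @cvg_harmonic R; apply: filterS => k /=.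
rewrite sub0r normrN => h.
have k0 : 0 < k.+1%:R :> R by rewrite ltr0n.
have /andP[h1 h2] : (Num.truncn (x * k.+1%:R))%:R <= x * k.+1%:R < (Num.truncn (x * k.+1%:R)).+1%:R.
  by apply: truncn_itv; rewrite mulr_ge0.
apply: le_trans h; rewrite ger0_norm; last by rewrite subr_ge0 ler_pdivrMr.
rewrite (ger0_norm (x := k.+1%:R^-1)) ?invr_ge0//.
rewrite -(ler_pM2r k0) mulVf ?gt_eqF// mulrBl divfK ?gt_eqF//.
by move: h2; rewrite -natr1; lra.
Qed.

Lemma nat_frac_dense (R : realType) (U : topologicalType) (hU : hausdorff_space U) (f g : R -> U) :
  continuous f -> continuous g ->
  (forall a k, f (a%:R / k.+1%:R) = g (a%:R / k.+1%:R)) -> forall t, 0 <= t -> f t = g t.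
Proof.
move=> cf cg fg t t0; have h := nat_frac_cvg t0.
have h1 := @cvg_comp _ _ _ _ f \oo (nbhs t) _ h (cf t).
have h2 := @cvg_comp _ _ _ _ g \oo (nbhs t) _ h (cg t).
have E : (f \o (fun k => (Num.truncn (t * k.+1%:R))%:R / k.+1%:R : R)) =
  (g \o (fun k => (Num.truncn (t * k.+1%:R))%:R / k.+1%:R)) by apply/funext => k /=.
by rewrite E in h1; apply: (cvg_unique hU h1 h2).
Qed.

(** * The global exponential map and first-order calculus of sequences *)

Section Exp.
Variables (R : realType) (n : nat) (N : topGroupType) (lc : loc_chart R n N).
Hypothesis hN : hausdorff_space N.
Implicit Types u v w : 'rV[R]_n.

Local Notation c := (cc lc).
Local Notation e := (ci lc).
Local Notation r := (lr lc).
Local Notation C := (lC lc).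
Local Notation sm := (sm lc).
Local Notation q := (exr lc).

(** Extends the local map by exp v = (exp (v / m))^m for one m that makes v / m small; [exE] shows
    that the choice of m does not matter. *)
Definition ex v : N :=
  (E_loc lc ((Num.bound (`|v| / q))%:R^-1 *: v) ^+ (Num.bound (`|v| / q)))%g.

Lemma bound_le v : `|v| <= (Num.bound (`|v| / q))%:R * q.
Proof.
rewrite -ler_pdivrMr ?exr_gt0//; apply/ltW/archi_boundP.
by rewrite divr_ge0// ltW// exr_gt0.
Qed.

Lemma exE v m : (0 < m)%N -> `|v| <= m%:R * q -> ex v = (E_loc lc (m%:R^-1 *: v) ^+ m)%g.
Proof.
have gen m1 m2 : (0 < m1)%N -> (0 < m2)%N -> `|v| <= m1%:R * q ->
   (E_loc lc (m1%:R^-1 *: v) ^+ m1)%g = (E_loc lc ((m1 * m2)%:R^-1 *: v) ^+ (m2 * m1))%g.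
  move=> h1 h2 hv; rewrite expgnA; congr (_ ^+ _)%g.
  rewrite -(@E_loc_pow _ _ _ lc (m1%:R^-1 *: v) m2) //.
    by rewrite scalerA natrM invfM mulrC.
  by rewrite normrZ gtr0_norm ?invr_gt0 ?ltr0n// mulrC ler_pdivrMr ?ltr0n// mulrC.
move=> m0 hv; rewrite /ex (gen _ m) //; last exact: bound_le.
by rewrite mulnC [RHS](gen m (Num.bound (`|v| / q))) // mulnC.
Qed.

Lemma ex_loc v : `|v| <= q -> ex v = E_loc lc v.
Proof. by move=> hv; rewrite (@exE v 1) ?mul1r// invr1 scale1r expg1. Qed.

Lemma c_ex v : `|v| <= q -> c (ex v) = Lv lc v.
Proof. by move=> hv; rewrite ex_loc// cE_loc. Qed.

Lemma ex_sm v : `|v| <= q -> sm (2 * `|v|) (ex v).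
Proof. by move=> hv; rewrite ex_loc//; apply: E_loc_sm. Qed.

Lemma ex_smr v : `|v| <= q -> sm r (ex v).
Proof.
move=> hv; apply: sm_le (ex_sm hv); move: hv; rewrite /exr; have := lr_gt0 lc; lra.
Qed.

Lemma c_ex_diff v w a : `|v| <= a -> `|w| <= a -> a <= q ->
  `|c (ex v) - c (ex w) - (v - w)| <= 2 * C * a * `|v - w|.
Proof.
move=> hv hw ha; rewrite !c_ex; [exact: Lv_diff | exact: le_trans ha | exact: le_trans ha].
Qed.

Lemma ex0 : ex 0 = 1%g.
Proof. by rewrite ex_loc ?normr0 ?ltW ?exr_gt0// /E_loc Lv0 ci0. Qed.

Lemma c_ex_approx v : `|v| <= q -> `|c (ex v) - v| <= 2 * C * `|v| ^+ 2.
Proof.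
move=> hv; have := c_ex_diff (lexx `|v|) (_ : `|0| <= `|v|) hv.
by rewrite normr0 ex0 cc1 !subr0 expr2 mulrA; apply.
Qed.

Lemma ex_inj v w : `|v| <= q -> `|w| <= q -> ex v = ex w -> v = w.
Proof.
move=> hv hw E; have := c_ex_diff hv hw (lexx _).
rewrite E subrr sub0r normrN => h.
apply/eqP; rewrite -subr_eq0 -normr_eq0.
have h2 : 2 * C * q * `|v - w| <= 1 / 32 * `|v - w|.
  by apply: ler_wpM2r => //; exact: (Caq (lexx _)).
rewrite eq_le normr_ge0 andbT; have := normr_ge0 (v - w); lra.
Qed.

Lemma ex_surj x : sm (q / 2) x -> exists2 v, `|v| <= 2 * `|c x| & ex v = x.
Proof.
case=> Ex hx; have q0 := exr_gt0 lc.
have [||v hv hLv] := @half_surj _ _ (Lv lc) q _ _ (c x) hx.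
- move=> v w hv hw; apply: le_trans (Lv_diff hv hw (lexx _)) _.
  apply: ler_wpM2r => //; have := Caq (lexx q); lra.
- exact: Lv0.
exists v => //; rewrite ex_loc; last by lra.
by rewrite /E_loc hLv.
Qed.

Lemma ex_X v m : ex (m%:R *: v) = (ex v ^+ m)%g.
Proof.
case: m => [|m]; first by rewrite scale0r ex0.
have hv := bound_le v; set M := Num.bound _ in hv.
have M0 : (0 < M)%N by rewrite /M /Num.bound.
rewrite (@exE v M)// -expgnA (@exE _ (M * m.+1)%N); last 2 first.
- by rewrite muln_gt0 M0.
- by rewrite normrZ normr_nat natrM mulrAC mulrC ler_wpM2r.
congr (E_loc lc _ ^+ _)%g; rewrite scalerA natrM; congr (_ *: _).
by rewrite invfM -mulrA mulVf ?mulr1// pnatr_eq0.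
Qed.

Lemma arch_mul (a b : R) : 0 < b -> exists2 m : nat, (0 < m)%N & a <= m%:R * b.
Proof.
move=> b0; exists (Num.bound (`|a| / b)); first by rewrite /Num.bound.
rewrite -ler_pdivrMr//; apply: le_trans (ltW (archi_boundP _)); last by rewrite divr_ge0// ltW.
by rewrite ler_pM2r ?invr_gt0// ler_norm.
Qed.

Lemma ex_cont_at v : {for v, continuous ex}.
Proof.
have q0 := exr_gt0 lc.
have [m m0 hm] := arch_mul (`|v| + 1) q0.
have mR : 0 < m%:R :> R by rewrite ltr0n.
pose f w := (E_loc lc (m%:R^-1 *: w) ^+ m)%g.
have nf : \forall w \near v, ex w = f w.
  have hd : \forall w \near v, `|w| < `|v| + 1.
    by apply: near_norm_lt; rewrite ltrDl.
  apply: filterS hd => w hw; apply: exE => //; apply: le_trans hm; exact: ltW.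
have Ef : ex v = f v by apply: exE => //; apply: le_trans hm; rewrite lerDl.
suff H : f @ v --> ex v by exact: cvg_near_eq nf H.
rewrite Ef.
have mv : `|m%:R^-1 *: v| < q.
  rewrite normrZ gtr0_norm ?invr_gt0// mulrC ltr_pdivrMr// mulrC.
  by apply: lt_le_trans hm; rewrite ltrDl.
have cE : {for m%:R^-1 *: v, continuous (E_loc lc)}.
  set z := m%:R^-1 *: v in mv *.
  have cL : Lv lc @ z --> Lv lc z.
    apply: rV_cvgP => eps eps0.
    have h1 : \forall w \near z, `|w| < q by exact: near_norm_lt.
    have h2 : \forall w \near z, `|z - w| <= eps / 2.
      have /cvgrPdist_le := @cvg_id _ (nbhs z); apply; by rewrite divr_gt0.
    near=> w; have hw1 : `|w| < q by near: w.
    have hw2 : `|z - w| <= eps / 2 by near: w.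
    apply: le_trans (norm_via _ (z - w)) _.
    have h := Lv_diff (ltW mv) (ltW hw1) (lexx _).
    have : 2 * C * q * `|z - w| <= 1 / 32 * `|z - w|.
      by apply: ler_wpM2r => //; exact: (Caq (lexx _)).
    have := normr_ge0 (z - w); lra.
  apply: (@cvg_comp _ _ _ (Lv lc) e (nbhs z) (nbhs (Lv lc z))); first exact: cL.
  by apply: ci_cont; apply: Lv_le; exact: ltW.
apply: (@cvg_comp _ _ _ (fun w => m%:R^-1 *: w) (fun w => E_loc lc w ^+ m)%g (nbhs v)
   (nbhs (m%:R^-1 *: v))); first by apply: cvgZl_tmp; exact: cvg_id.
apply: (@cvg_comp _ _ _ (E_loc lc) (fun x : N => x ^+ m)%g _ (nbhs (E_loc lc (m%:R^-1 *: v)))).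
  exact: cE.
exact: expg_continuous.
Unshelve. all: by end_near.
Qed.

Lemma ex_cont : continuous ex.
Proof. exact: ex_cont_at. Qed.

(* [jet x v]: the sequence x k approaches 1 as the curve with velocity v does
   at time 1 / (k + 1). *)
Definition jet (x : nat -> N) v :=
  (\forall k \near \oo, e (c (x k)) = x k) /\
  (fun k => k.+1%:R *: c (x k)) @ \oo --> v.

Lemma inv_cvg0 : (fun k => (k.+1%:R : R)^-1) @ \oo --> (0 : R).
Proof. exact: (@cvg_harmonic R). Qed.

Lemma jet_c0 x v : jet x v -> (fun k => c (x k)) @ \oo --> (0 : 'rV[R]_n).
Proof.
case=> _ h.
have H : (fun k => k.+1%:R^-1 *: (k.+1%:R *: c (x k))) @ \oo --> (0 : R) *: v.
  exact: cvgZ inv_cvg0 h.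
rewrite scale0r in H.
apply: cvg_near_eq H; apply: nearW => k /=.
by rewrite scalerA mulVf ?scale1r// pnatr_eq0.
Qed.

Lemma jet_sm x v a : jet x v -> 0 < a -> \forall k \near \oo, sm a (x k).
Proof.
move=> jx a0; have [h1 _] := jx; have h2 := jet_c0 jx.
have h3 : \forall k \near \oo, `|c (x k)| < a.
  by apply: (seq_norm_lt h2); rewrite normr0.
by apply: filterS2 h1 h3 => k ? ?; split => //; exact: ltW.
Qed.

Lemma jet_eq x y v : (\forall k \near \oo, x k = y k) -> jet x v -> jet y v.
Proof.
move=> E [h1 h2]; split; first by apply: filterS2 E h1 => k ->.
by apply: cvg_near_eq h2; apply: filterS E => k ->.
Qed.

Lemma cvg_norm00 (u : nat -> 'rV[R]_n) : u @ \oo --> (0 : 'rV[R]_n) ->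
  (fun k => `|u k|) @ \oo --> (0 : R).
Proof. by move=> h; rewrite -[X in _ --> X](@normr0 R 'rV[R]_n); exact: cvg_norm h. Qed.

Lemma cvg_perturb (u w : nat -> 'rV[R]_n) (l : 'rV[R]_n) :
  u @ \oo --> l -> (fun k => w k - u k) @ \oo --> (0 : 'rV[R]_n) -> w @ \oo --> l.
Proof.
move=> hu hd; have H : (fun k => (w k - u k) + u k) @ \oo --> 0 + l by exact: cvgD.
rewrite add0r in H; apply: cvg_near_eq H; apply: nearW => k.
by rewrite subrK.
Qed.

(** The bilinear error of [M1] is of order (k + 1)^-2 and disappears after rescaling by k + 1. *)
Lemma jet_mul x y v w : jet x v -> jet y w -> jet (fun k => x k * y k)%g (v + w).
Proof.
move=> jx jy; have r0 := lr_gt0 lc.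
have hx := jet_sm jx r0; have hy := jet_sm jy r0.
split.
  by apply: filterS2 hx hy => k [? ?] [? ?]; apply: ccM.
have [_ cx] := jx; have [_ cy] := jy.
apply: (@cvg_perturb (fun k => k.+1%:R *: c (x k) + k.+1%:R *: c (y k)) _ _ (cvgD cx cy)).
have B : (fun k => C * (`|k.+1%:R *: c (x k)| * `|c (y k)|)) @ \oo --> (0 : R).
  by apply: cvg_scale0; exact: cvg_mul0 (cvg_norm cx) (cvg_norm00 (jet_c0 jy)).
apply: (cvg_norm0 B); apply: filterS2 hx hy => k sx sy.
rewrite subr0 -scalerDr -scalerBr !normrZ normr_nat opprD addrA.
have := M1 sx sy => h; apply: le_trans (ler_wpM2l _ h) _ => //.
by apply: ler_eq; ring.
Qed.

Lemma jet_inv x v : jet x v -> jet (fun k => (x k)^-1)%g (- v).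
Proof.
move=> jx; have [a /andP[a0 _] ha] := inv_near lc.
have hx := jet_sm jx a0; split.
  by apply: filterS hx => k /ha [[]].
have [_ cx] := jx.
apply: (@cvg_perturb (fun k => - (k.+1%:R *: c (x k))) _ _ (cvgN cx)).
have B : (fun k => 2 * C * (`|k.+1%:R *: c (x k)| * `|c (x k)|)) @ \oo --> (0 : R).
  by apply: cvg_scale0; exact: cvg_mul0 (cvg_norm cx) (cvg_norm00 (jet_c0 jx)).
apply: (cvg_norm0 B); apply: filterS hx => k /ha [_ h].
rewrite subr0 opprK -scalerDr !normrZ normr_nat.
apply: le_trans (ler_wpM2l _ h) _ => //.
by apply: ler_eq; ring.
Qed.

Lemma jet_exu (u : nat -> 'rV[R]_n) v : u @ \oo --> (0 : 'rV[R]_n) -> (fun k => k.+1%:R *: u k) @ \oo --> v ->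
  jet (fun k => ex (u k)) v.
Proof.
move=> u0 uv; have q0 := exr_gt0 lc.
have hu : \forall k \near \oo, `|u k| < q by apply: (seq_norm_lt u0); rewrite normr0.
split; first by apply: filterS hu => k /ltW /ex_sm [].
apply: (cvg_perturb uv).
have B : (fun k => 2 * C * (`|k.+1%:R *: u k| * `|u k|)) @ \oo --> (0 : R).
  by apply: cvg_scale0; exact: cvg_mul0 (cvg_norm uv) (cvg_norm00 u0).
apply: (cvg_norm0 B); apply: filterS hu => k /ltW /c_ex_approx h.
rewrite subr0 -scalerBr !normrZ normr_nat.
apply: le_trans (ler_wpM2l _ h) _ => //.
by apply: ler_eq; ring.
Qed.

Lemma scale_cvg0 v : (fun k => k.+1%:R^-1 *: v) @ \oo --> (0 : 'rV[R]_n).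
Proof. by rewrite -(scale0r v); exact: cvgZr_tmp inv_cvg0. Qed.

Lemma jet_ex v : jet (fun k => ex (k.+1%:R^-1 *: v)) v.
Proof.
apply: jet_exu; first exact: scale_cvg0.
have -> : (fun k : nat => k.+1%:R *: (k.+1%:R^-1 *: v)) = (fun _ => v).
  by apply/funext => k; rewrite scalerA mulfV ?scale1r// pnatr_eq0.
exact: cvg_cst.
Qed.

Lemma jet_log x v : jet x v -> exists u : nat -> 'rV[R]_n, [/\ \forall k \near \oo, x k = ex (u k),
  u @ \oo --> (0 : 'rV[R]_n) & (fun k => k.+1%:R *: u k) @ \oo --> v].
Proof.
move=> jx; have q0 := exr_gt0 lc; have q2 : 0 < q / 2 by rewrite divr_gt0.
have H k : exists w, sm (q / 2) (x k) -> `|w| <= 2 * `|c (x k)| /\ ex w = x k.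
  have [/ex_surj[w h1 h2]|h] := pselect (sm (q / 2) (x k)); last by exists 0.
  by exists w.
have [u hu] := choice H; have sx := jet_sm jx q2.
have u0 : u @ \oo --> (0 : 'rV[R]_n).
  have B : (fun k => 2 * `|c (x k)|) @ \oo --> (0 : R).
    exact: cvg_scale0 (cvg_norm00 (jet_c0 jx)).
  by apply: (cvg_norm0 B); apply: filterS sx => k /hu [h _]; rewrite subr0.
exists u; split => //; first by apply: filterS sx => k /hu [].
have [_ cx] := jx; apply: (cvg_perturb cx).
have B : (fun k => 8 * C * (`|k.+1%:R *: c (x k)| * `|c (x k)|)) @ \oo --> (0 : R).
  by apply: cvg_scale0; exact: cvg_mul0 (cvg_norm cx) (cvg_norm00 (jet_c0 jx)).
apply: (cvg_norm0 B); apply: filterS sx => k sk; have [h1 h2] := hu k sk.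
rewrite subr0 -scalerBr !normrZ normr_nat.
have uq : `|u k| <= q by case: sk => _; lra.
have h := c_ex_approx uq; rewrite h2 in h; rewrite distrC.
have C0 := lC_ge0 lc.
have h3 : 2 * C * `|u k| ^+ 2 <= 2 * C * (2 * `|c (x k)|) ^+ 2.
  by apply: ler_wpM2l; [rewrite mulr_ge0 | rewrite ler_sqr ?nnegrE ?mulr_ge0].
apply: le_trans (ler_wpM2l _ (le_trans h h3)) _ => //.
by apply: ler_eq; ring.
Qed.

(* Applied to a product of two jets, this is the Lie product formula. *)
Lemma jet_lim x v : jet x v -> `|v| <= q / 4 -> (fun k => x k ^+ k.+1)%g @ \oo --> ex v.
Proof.
move=> jx hv; have q0 := exr_gt0 lc; have r0 := lr_gt0 lc.
pose y k := ex (k.+1%:R^-1 *: v); have jy : jet y v by exact: jet_ex.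
have yX k : (y k ^+ k.+1)%g = ex v by rewrite -ex_X scalerA mulfV ?scale1r// pnatr_eq0.
pose a (k : nat) : R := q / 2 / k.+1%:R.
have a0 k : 0 <= a k by rewrite divr_ge0// ltW// divr_gt0.
have ka k : k.+1%:R * a k = q / 2 by rewrite /a mulrC divfK// pnatr_eq0.
have smk z : jet z v -> \forall k \near \oo, sm (a k) (z k).
  move=> [h1 h2]; have h3 : \forall k \near \oo, `|k.+1%:R *: c (z k)| < q / 2.
    by apply: (seq_norm_lt h2); lra.
  apply: filterS2 h1 h3 => k h4 h5; split => //.
  by rewrite /a ler_pdivlMr// mulrC; move: h5; rewrite normrZ normr_nat => /ltW.
have sx := smk _ jx; have sy := smk _ jy.
have qr : q <= r by exact: exr_le.
have h2a k : 2 * k.+1%:R * a k = q by rewrite -mulrA ka mulrC divfK.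
have cxk : (fun k => c (x k ^+ k.+1)%g) @ \oo --> c (ex v).
  have B : (fun k => 2 * `|k.+1%:R *: c (x k) - k.+1%:R *: c (y k)|) @ \oo --> (0 : R).
    have [_ h1] := jx; have [_ h2] := jy; apply: cvg_scale0; apply: cvg_norm00.
    by rewrite -(subrr v); exact: cvgB h1 h2.
  apply: (cvg_norm0 B); apply: filterS2 sx sy => k s1 s2.
  rewrite -(yX k); apply: le_trans (pow3 s1 s2 (a0 k) _) _; first by rewrite h2a.
  by rewrite -scalerBr normrZ normr_nat mulrA.
have sxk : \forall k \near \oo, e (c (x k ^+ k.+1)%g) = (x k ^+ k.+1)%g.
  apply: filterS sx => k s1; have [|[h1 _] _] := pow1 (m := k.+1) s1 (a0 k).
    by rewrite h2a.
  exact: h1.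
have vq : `|v| <= q by lra.
have H : (fun k => e (c (x k ^+ k.+1)%g)) @ \oo --> ex v.
  have [Ev hr] := ex_smr vq; rewrite -Ev.
  apply: (@cvg_comp _ _ _ (fun k => c (x k ^+ k.+1)%g) e \oo (nbhs (c (ex v)))) => //.
  exact: ci_cont.
by apply: cvg_near_eq H; apply: filterS sxk => k ->.
Qed.

(** The inverses of exp (w / (k + 1)) form a jet of velocity - w whose (k + 1)-st powers are
    constant, so [jet_lim] settles small w; powers give the general case. *)
Lemma ex_N v : ex (- v) = (ex v)^-1%g.
Proof.
have small w : `|w| <= q / 4 -> ex (- w) = (ex w)^-1%g.
  move=> hw; have jN := jet_inv (jet_ex w).
  have h1 := jet_lim jN; rewrite normrN in h1; have {}h1 := h1 hw.
  have E : (fun k => ((ex (k.+1%:R^-1 *: w))^-1 ^+ k.+1)%g) = (fun _ => (ex w)^-1%g).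
    apply/funext => k; rewrite expVgn -ex_X scalerA mulfV ?scale1r// pnatr_eq0//.
  rewrite E in h1; apply: (cvg_unique hN h1); exact: cvg_cst.
have q0 := exr_gt0 lc.
have q4 : 0 < q / 4 by rewrite divr_gt0.
have [m m1 hm] := arch_mul `|v| q4.
have m0 : m%:R != 0 :> R by rewrite pnatr_eq0 -lt0n.
have Ev : v = m%:R *: (m%:R^-1 *: v) by rewrite scalerA mulfV ?scale1r.
rewrite Ev -scalerN !ex_X small ?expVgn//.
rewrite normrZ normfV normr_nat mulrC ler_pdivrMr ?lt0r ?m0 ?ler0n//.
by rewrite mulrC.
Qed.

Lemma ex_line_cont v : continuous (fun t : R => ex (t *: v)).
Proof.
move=> t; apply: (@cvg_comp _ _ _ (fun t : R => t *: v) ex (nbhs t) (nbhs (t *: v))).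
  by apply: cvgZr_tmp; exact: cvg_id.
exact: ex_cont.
Qed.

(** For rational s and t both factors are powers of one element, after passing to a common
    denominator; density is then applied to one variable at a time. *)
Lemma ex_addn v (s t : R) : 0 <= s -> 0 <= t ->
  (ex (s *: v) * ex (t *: v))%g = ex ((s + t) *: v).
Proof.
have exA (x : R) (y : R) k a b : x = a%:R / k.+1%:R -> y = b%:R / k.+1%:R ->
    (ex (x *: v) * ex (y *: v))%g = ex ((x + y) *: v).
  move=> -> ->; rewrite -mulrDl -natrD -!(scalerA _ (k.+1%:R^-1)) !ex_X.
  by rewrite -expgnDr.
have h1 k a : forall t, 0 <= t -> (ex (a%:R / k.+1%:R *: v) * ex (t *: v))%g = ex ((a%:R / k.+1%:R + t) *: v).
  move=> t2 t0; set x := _ / _; apply: (@nat_frac_dense _ _ hN (fun t => ex (x *: v) * ex (t *: v))%g (fun t => ex ((x + t) *: v)) _ _ _ t2 t0) => //.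
  - move=> y; apply: (@cvg_comp _ _ _ (fun t => (ex (x *: v), ex (t *: v))) (fun p : N * N => p.1 * p.2)%g
      (nbhs y) (nbhs (ex (x *: v), ex (y *: v)))); last exact: (@mulg_continuous N (ex (x *: v), ex (y *: v))).
    by apply: cvg_pair; [exact: cvg_cst | exact: ex_line_cont].
  - move=> y; apply: (@cvg_comp _ _ _ (fun t : R => x + t) (fun t : R => ex (t *: v)) (nbhs y) (nbhs (x + y))).
      by apply: cvgD; [exact: cvg_cst | exact: cvg_id].
    exact: ex_line_cont.
  have fr (a' m d : nat) : a'%:R / m.+1%:R = (a' * d.+1)%:R / (m.+1 * d.+1)%:R :> R.
    by rewrite !natrM invfM mulrACA mulfV ?mulr1// pnatr_eq0.
  move=> b l; have hK : (k.+1 * l.+1 = ((k.+1 * l.+1).-1).+1)%N by rewrite prednK ?muln_gt0.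
  apply: (@exA _ _ ((k.+1 * l.+1).-1) (a * l.+1)%N (b * k.+1)%N); rewrite -hK.
    by rewrite /x (fr _ _ l).
  by rewrite (fr _ _ k) [(l.+1 * _)%N]mulnC.
move=> s0 t0; apply: (@nat_frac_dense _ _ hN (fun s => ex (s *: v) * ex (t *: v))%g (fun s => ex ((s + t) *: v)) _ _ _ s s0) => //.
- move=> y; apply: (@cvg_comp _ _ _ (fun s => (ex (s *: v), ex (t *: v))) (fun p : N * N => p.1 * p.2)%g
    (nbhs y) (nbhs (ex (y *: v), ex (t *: v)))); last exact: (@mulg_continuous N (ex (y *: v), ex (t *: v))).
  by apply: cvg_pair; [exact: ex_line_cont | exact: cvg_cst].
- move=> y; apply: (@cvg_comp _ _ _ (fun s : R => s + t) (fun t : R => ex (t *: v)) (nbhs y) (nbhs (y + t))).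
    by apply: cvgD; [exact: cvg_id | exact: cvg_cst].
  exact: ex_line_cont.
- by move=> a k; exact: h1.
Qed.

Lemma ex_add v (s t : R) : (ex (s *: v) * ex (t *: v))%g = ex ((s + t) *: v).
Proof.
have neg x : ex (- x *: v) = (ex (x *: v))^-1%g by rewrite scaleNr ex_N.
have [s0|s0] := leP 0 s; have [t0|t0] := leP 0 t.
- exact: ex_addn.
- have t0' : 0 <= - t by lra.
  have [st|st] := leP 0 (s + t).
    have := ex_addn v st t0'; rewrite addrK neg => <-.
    by rewrite mulgVK.
  have st' : 0 <= - (s + t) by lra.
  have := ex_addn v st' s0; rewrite (_ : - (s + t) + s = - t); last by lra.
  rewrite !neg => E; have := congr1 (fun x : N => x^-1)%g E; rewrite invgK invgM invgK => <-.
  by rewrite mulgA mulgV mul1g.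
- have s0' : 0 <= - s by lra.
  have [st|st] := leP 0 (s + t).
    have := ex_addn v s0' st; rewrite addrA addNr add0r neg => <-.
    by rewrite mulgA mulgV mul1g.
  have st' : 0 <= - (s + t) by lra.
  have := ex_addn v t0 st'; rewrite (_ : t + - (s + t) = - s); last by lra.
  rewrite !neg => E; have := congr1 (fun x : N => x^-1)%g E; rewrite invgK invgM invgK => <-.
  by rewrite -mulgA mulVg mulg1.
- have s0' : 0 <= - s by lra.
  have t0' : 0 <= - t by lra.
  have := ex_addn v t0' s0'; rewrite (_ : - t + - s = - (s + t)); last by lra.
  rewrite !neg => E; have := congr1 (fun x : N => x^-1)%g E.
  by rewrite invgK invgM [_^-1^-1%g]invgK [_^-1^-1%g]invgK.
Qed.

End Exp.

Lemma rV_linear (R : realType) n m (f : 'rV[R]_n -> 'rV[R]_m) :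
  (forall v w, f (v + w) = f v + f w) -> (forall (s : R) v, f (s *: v) = s *: f v) ->
  exists M : 'M[R]_(n, m), forall v, f v = v *m M.
Proof.
move=> fD fZ; exists (\matrix_(i, j) f (delta_mx 0 i) 0 j) => v.
have f0 : f 0 = 0 by rewrite -(scale0r 0) fZ scale0r.
rewrite {1}(row_sum_delta v) (big_morph f fD f0).
apply/rowP => j; rewrite summxE mxE; apply: eq_bigr => i _.
by rewrite fZ !mxE.
Qed.

(** * One-parameter subgroups and differentials of morphisms *)

Section OneParam.
Variables (R : realType) (n : nat) (N : topGroupType) (lc : loc_chart R n N).
Hypothesis hN : hausdorff_space N.
Implicit Types u v w : 'rV[R]_n.
Local Notation q := (exr lc).
Local Notation ex := (ex lc).

Lemma small_scale (A B : R) : 0 < B -> exists2 s : R, 0 < s & s * A <= B.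
Proof.
move=> B0; exists (B / (`|A| + 1)); first by rewrite divr_gt0// ltr_wpDl.
rewrite mulrAC ler_pdivrMr ?ltr_wpDl//; apply: ler_wpM2l; first exact: ltW.
by apply: le_trans (ler_norm A) _; rewrite lerDl.
Qed.

Lemma ex_line_inj v w : (forall t : R, ex (t *: v) = ex (t *: w)) -> v = w.
Proof.
move=> H; have [s s0 hs] := small_scale (`|v| + `|w|) (exr_gt0 lc).
have v0 := normr_ge0 v; have w0 := normr_ge0 w.
have hv : `|s *: v| <= q.
  by rewrite normrZ gtr0_norm//; apply: le_trans hs; rewrite ler_pM2l// lerDl.
have hw : `|s *: w| <= q.
  by rewrite normrZ gtr0_norm//; apply: le_trans hs; rewrite ler_pM2l// lerDr.
have /(congr1 (fun x => s^-1 *: x)) := ex_inj hv hw (H s).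
by rewrite !scalerA mulVf ?scale1r// gt_eqF.
Qed.

Lemma one_param (X : R -> N) : continuous X -> (forall s t, X (s + t) = X s * X t)%g ->
  exists v, forall t, X t = ex (t *: v).
Proof.
move=> cX XD; have q0 := exr_gt0 lc.
have X0 : X 0 = 1%g by apply: (mulgI (X 0)); rewrite -XD addr0 mulg1.
have XX t m : X (m%:R * t) = (X t ^+ m)%g.
  elim: m => [|m IH]; first by rewrite mul0r X0.
  by rewrite -natr1 mulrDl mul1r XD IH expgSr.
have [d d0 Hd] : exists2 d : R, 0 < d & forall t, `|t| <= d -> sm lc (q / 8) (X t).
  have : \forall t \near (0 : R), sm lc (q / 8) (X t).
    by apply: (cX 0); rewrite X0; apply: near_sm; rewrite divr_gt0.
  case/nbhs_ballP => d /= d0 H; exists (d / 2); first by rewrite divr_gt0.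
  move=> t ht; apply: H; rewrite /ball /= sub0r normrN; apply: le_lt_trans ht _; lra.
have q8 : q / 8 <= q / 2 by lra.
have lg t : `|t| <= d -> exists2 w, `|w| <= q / 4 & ex w = X t.
  move=> ht; have [w h1 h2] := ex_surj (sm_le q8 (Hd t ht)).
  by exists w => //; apply: le_trans h1 _; case: (Hd t ht) => _; lra.
have [v hv Ev] : exists2 w, `|w| <= q / 4 & ex w = X d by apply: lg; rewrite gtr0_norm.
(* Uniqueness of roots: for the logarithm w of X (d / (m + 1)), induction on j identifies j w with
   the logarithm of X (j d / (m + 1)), as both lie in the ball where exp is injective. *)
have frac m : X (d / m.+1%:R) = ex (m.+1%:R^-1 *: v).
  have m0 : 0 < m.+1%:R :> R by rewrite ltr0n.
  have ht (j : nat) : (j <= m.+1)%N -> `|j%:R * (d / m.+1%:R)| <= d.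
    move=> jm; rewrite normrM normr_nat gtr0_norm ?divr_gt0//.
    by rewrite mulrA ler_pdivrMr// mulrC ler_pM2l// ler_nat.
  have [w hw Ew] := lg _ (ht 1%N isT); rewrite mul1r in Ew.
  have main j : (j <= m.+1)%N -> `|j%:R *: w| <= q / 4.
    elim: j => [|j IH] jm; first by rewrite scale0r normr0 divr_ge0// ltW.
    have [w' hw' Ew'] := lg _ (ht _ jm).
    suff -> : j.+1%:R *: w = w' by [].
    apply: (@ex_inj _ _ _ lc); [|lra|].
      rewrite -natr1 scalerDl scale1r; apply: le_trans (ler_normD _ _) _.
      have := IH (ltnW jm); lra.
    by rewrite Ew' ex_X Ew -XX.
  have E : m.+1%:R *: w = v.
    apply: (@ex_inj _ _ _ lc); [have := main _ (leqnn _); lra | lra|].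
    by rewrite ex_X Ew -XX Ev mulrC divfK// gt_eqF.
  by rewrite -E scalerA mulVf ?scale1r ?Ew// gt_eqF.
have pos t : 0 <= t -> X (d * t) = ex (t *: v).
  apply: (@nat_frac_dense _ _ hN (fun t => X (d * t)) (fun t => ex (t *: v))).
  - move=> y; apply: (@cvg_comp _ _ _ (fun t : R => d * t) X (nbhs y) (nbhs (d * y))); last exact: cX.
    by apply: cvgMl_tmp; exact: cvg_id.
  - exact: ex_line_cont.
  - move=> a k; rewrite -scalerA ex_X -frac -XX; congr X; ring.
exists (d^-1 *: v) => t; rewrite scalerA.
have [t0|t0] := leP 0 (t / d).
  by rewrite -pos// mulrC divfK// gt_eqF.
have t0' : 0 <= - (t / d) by lra.
have := pos _ t0'; rewrite scaleNr ex_N// => E.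
apply: invg_inj; rewrite -E; apply: (mulgI (X t)); rewrite mulgV -XD.
by rewrite mulrN mulrC divfK ?gt_eqF// subrr X0.
Qed.

End OneParam.

Section Hom.
Variables (R : realType) (n n' : nat) (N N' : topGroupType).
Variables (lc : loc_chart R n N) (lc' : loc_chart R n' N').
Hypotheses (hN : hausdorff_space N) (hN' : hausdorff_space N').

Lemma hom1 (f : N -> N') : (forall x y, f (x * y) = f x * f y)%g -> f 1%g = 1%g.
Proof. by move=> fM; apply: (mulgI (f 1%g)); rewrite -fM !mulg1. Qed.

Lemma homX (f : N -> N') x m : (forall x y, f (x * y) = f x * f y)%g ->
  f (x ^+ m)%g = (f x ^+ m)%g.
Proof.
move=> fM; elim: m => [|m IH]; first by rewrite !expg0 hom1.
by rewrite !expgSr fM IH.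
Qed.

(** The image of a line is a one-parameter subgroup, which defines the differential and makes it
    homogeneous. Additivity is the Lie product formula, [jet_lim] applied to a product of jets on
    both sides of f. *)
Lemma hom_linear (f : N -> N') : cont_morphism f ->
  exists M : 'M[R]_(n, n'), forall v, f (ex lc v) = ex lc' (v *m M).
Proof.
move=> [fM fc].
have H v : exists w, forall t : R, f (ex lc (t *: v)) = ex lc' (t *: w).
  apply: one_param => // [x|s t]; last by rewrite -fM ex_add.
  apply: (@cvg_comp _ _ _ (fun t : R => ex lc (t *: v)) f (nbhs x) (nbhs (ex lc (x *: v)))).
    exact: ex_line_cont.
  exact: fc.
have [df hdf] := choice H.
have dfE v : f (ex lc v) = ex lc' (df v) by have := hdf v 1; rewrite !scale1r.
have dfZ (s : R) v : df (s *: v) = s *: df v.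
  by apply: (@ex_line_inj _ _ _ lc') => t; rewrite -hdf !scalerA hdf.
have dfD v w : df (v + w) = df v + df w.
  pose A := 4 * `|v + w| + 4 * `|df v + df w| + `|df (v + w)|.
  have qq : 0 < Num.min (exr lc) (exr lc') by rewrite lt_min !exr_gt0.
  have [s s0] := small_scale A qq; rewrite le_min => /andP[h1 h2].
  have n1 := normr_ge0 (v + w); have n2 := normr_ge0 (df v + df w); have n3 := normr_ge0 (df (v + w)).
  have sn : `|s| = s by rewrite gtr0_norm.
  have m1 : 0 <= s * `|v + w| by rewrite mulr_ge0// ltW.
  have m2 : 0 <= s * `|df v + df w| by rewrite mulr_ge0// ltW.
  have m3 : 0 <= s * `|df (v + w)| by rewrite mulr_ge0// ltW.
  have EA : s * A = 4 * (s * `|v + w|) + 4 * (s * `|df v + df w|) + s * `|df (v + w)| by rewrite /A; ring.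
  pose x (k : nat) := (ex lc (k.+1%:R^-1 *: (s *: v)) * ex lc (k.+1%:R^-1 *: (s *: w)))%g.
  have jx : jet lc x (s *: v + s *: w) by apply: jet_mul; exact: jet_ex.
  have l1 : (fun k => x k ^+ k.+1)%g @ \oo --> ex lc (s *: v + s *: w).
    apply: jet_lim => //; rewrite -scalerDr normrZ sn; lra.
  have jy : jet lc' (fun k => f (x k)) (s *: df v + s *: df w).
    have -> : (fun k => f (x k)) = (fun k => ex lc' (k.+1%:R^-1 *: (s *: df v)) *
        ex lc' (k.+1%:R^-1 *: (s *: df w)))%g.
      by apply/funext => k; rewrite /x fM !dfE !dfZ.
    by apply: jet_mul; exact: jet_ex.
  have l2 : (fun k => f (x k) ^+ k.+1)%g @ \oo --> ex lc' (s *: df v + s *: df w).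
    apply: jet_lim => //; rewrite -scalerDr normrZ sn; lra.
  have l3 : (fun k => f (x k) ^+ k.+1)%g @ \oo --> f (ex lc (s *: v + s *: w)).
    have -> : (fun k => f (x k) ^+ k.+1)%g = (fun k => f (x k ^+ k.+1)%g).
      by apply/funext => k; rewrite homX.
    exact: (@cvg_comp _ _ _ (fun k => x k ^+ k.+1)%g f \oo (nbhs (ex lc (s *: v + s *: w))) _ l1 (fc _)).
  have E : f (ex lc (s *: v + s *: w)) = ex lc' (s *: df v + s *: df w).
    exact: (cvg_unique hN' l3 l2).
  rewrite -scalerDr dfE dfZ -scalerDr in E.
  have /(congr1 (fun x => s^-1 *: x)) : s *: df (v + w) = s *: (df v + df w).
    by apply: (@ex_inj _ _ _ lc' _ _ _ _ E); rewrite normrZ sn; lra.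
  by rewrite !scalerA mulVf ?scale1r// gt_eqF.
have [M hM] := rV_linear dfD dfZ.
by exists M => v; rewrite dfE hM.
Qed.

End Hom.

(** * Polynomial maps *)

Section Subalgebras.
Variables (R : realType) (X : Type).
Implicit Types (A : set (X -> R)) (f g : X -> R).

Definition is_subalg A := [/\ forall a : R, A (fun _ => a),
  forall f g, A f -> A g -> A (fun x => f x + g x) &
  forall f g, A f -> A g -> A (fun x => f x * g x)].

Variables (A : set (X -> R)) (hA : is_subalg A).

Lemma sa_cst a : A (fun _ => a). Proof. by case: hA. Qed.
Lemma sa_add f g : A f -> A g -> A (fun x => f x + g x). Proof. by case: hA => _ h _; exact: h. Qed.
Lemma sa_mul f g : A f -> A g -> A (fun x => f x * g x). Proof. by case: hA => _ _ h; exact: h. Qed.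

Lemma sa_opp f : A f -> A (fun x => - f x).
Proof.
move=> Af; have -> : (fun x => - f x) = (fun x => -1 * f x) by apply/funext => x; rewrite mulN1r.
by apply: sa_mul => //; exact: sa_cst.
Qed.

Lemma sa_sub f g : A f -> A g -> A (fun x => f x - g x).
Proof. by move=> Af Ag; apply: sa_add => //; exact: sa_opp. Qed.

Lemma sa_sum (I : Type) (s : seq I) (P : pred I) (F : I -> X -> R) :
  (forall i, P i -> A (F i)) -> A (fun x => \sum_(i <- s | P i) F i x).
Proof.
move=> H; elim: s => [|i s IH].
  by under eq_fun do rewrite big_nil; exact: sa_cst.
under eq_fun do rewrite big_cons.
have [Pi|nPi] := boolP (P i); last by [].
by apply: sa_add => //; exact: H.
Qed.

Lemma sa_prod (I : Type) (s : seq I) (P : pred I) (F : I -> X -> R) :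
  (forall i, P i -> A (F i)) -> A (fun x => \prod_(i <- s | P i) F i x).
Proof.
move=> H; elim: s => [|i s IH].
  by under eq_fun do rewrite big_nil; exact: sa_cst.
under eq_fun do rewrite big_cons.
have [Pi|nPi] := boolP (P i); last by [].
by apply: sa_mul => //; exact: H.
Qed.

Lemma sa_exp f k : A f -> A (fun x => f x ^+ k).
Proof.
move=> Af; elim: k => [|k IH]; first by under eq_fun do rewrite expr0; exact: sa_cst.
by under eq_fun do rewrite exprS; exact: sa_mul.
Qed.

Definition mxin m n (F : X -> 'M[R]_(m, n)) := forall i j, A (fun x => F x i j).

Lemma mxin_cst m n (M : 'M[R]_(m, n)) : mxin (fun _ => M).
Proof. by move=> i j; exact: sa_cst. Qed.

Lemma mxin_add m n (F G : X -> 'M[R]_(m, n)) : mxin F -> mxin G -> mxin (fun x => F x + G x).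
Proof. by move=> hF hG i j; under eq_fun do rewrite mxE; apply: sa_add; [exact: hF | exact: hG]. Qed.

Lemma mxin_opp m n (F : X -> 'M[R]_(m, n)) : mxin F -> mxin (fun x => - F x).
Proof. by move=> hF i j; under eq_fun do rewrite mxE; apply: sa_opp; exact: hF. Qed.

Lemma mxin_sub m n (F G : X -> 'M[R]_(m, n)) : mxin F -> mxin G -> mxin (fun x => F x - G x).
Proof. by move=> hF hG; apply: mxin_add => //; exact: mxin_opp. Qed.

Lemma mxin_mul m n p (F : X -> 'M[R]_(m, n)) (G : X -> 'M[R]_(n, p)) :
  mxin F -> mxin G -> mxin (fun x => F x *m G x).
Proof.
move=> hF hG i j; under eq_fun do rewrite mxE.
by apply: sa_sum => k _; apply: sa_mul; [exact: hF | exact: hG].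
Qed.

Lemma mxin_scale m n f (F : X -> 'M[R]_(m, n)) : A f -> mxin F -> mxin (fun x => f x *: F x).
Proof. by move=> hf hF i j; under eq_fun do rewrite mxE; apply: sa_mul; last exact: hF. Qed.

Lemma mxin_sum m n (I : Type) (s : seq I) (P : pred I) (F : I -> X -> 'M[R]_(m, n)) :
  (forall i, P i -> mxin (F i)) -> mxin (fun x => \sum_(i <- s | P i) F i x).
Proof.
move=> H i j; under eq_fun do rewrite summxE.
by apply: sa_sum => k Pk; exact: H.
Qed.

Lemma mxin_exp n (F : X -> 'M[R]_n) k : mxin F -> mxin (fun x => F x ^+ k).
Proof.
move=> hF; elim: k => [|k IH]; first by under eq_fun do rewrite expr0; exact: mxin_cst.
by under eq_fun do rewrite exprS; exact: mxin_mul.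
Qed.

Lemma mxin_det n (F : X -> 'M[R]_n) : mxin F -> A (fun x => \det (F x)).
Proof.
move=> hF; apply: sa_sum => s _; apply: sa_mul; first exact: sa_cst.
by apply: sa_prod => i _; exact: hF.
Qed.

End Subalgebras.
Arguments mxin {R X} A {m n} F.

(* A map is polynomial when it preserves membership of the coordinates in
   every subalgebra of functions; no polynomial needs to be exhibited. *)
Definition polymap2 (R : realType) (n1 n2 m : nat)
    (P : 'rV[R]_n1 -> 'rV[R]_n2 -> 'rV[R]_m) :=
  forall (X : Type) (A : set (X -> R)), is_subalg A ->
  forall (f : X -> 'rV[R]_n1) (g : X -> 'rV[R]_n2), mxin A f -> mxin A g ->
  mxin A (fun x => P (f x) (g x)).

Section Polyfun.
Variable R : realType.
Implicit Types (p q : {poly R}) (f : R -> R).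

Definition polyfun f := exists p, forall t, f t = p.[t].

Lemma polyfun_subalg : is_subalg polyfun.
Proof.
split.
- by move=> a; exists a%:P => t; rewrite hornerC.
- by move=> f g [p hp] [q hq]; exists (p + q) => t; rewrite hornerD hp hq.
- by move=> f g [p hp] [q hq]; exists (p * q) => t; rewrite hornerM hp hq.
Qed.

Lemma polyfun_id : polyfun (fun t => t).
Proof. by exists 'X => t; rewrite hornerX. Qed.

Lemma polyfun_horner p : polyfun (fun t => p.[t]). Proof. by exists p. Qed.

Lemma polyfun_comp f g : polyfun f -> polyfun g -> polyfun (fun t => f (g t)).
Proof. by move=> [p hp] [q hq]; exists (p \Po q) => t; rewrite horner_comp hp hq. Qed.

Lemma poly_inj0 p (z : nat -> R) : injective z -> (forall k, p.[z k] = 0) -> p = 0.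
Proof.
move=> zi hz; apply: (@roots_geq_poly_eq0 _ p [seq z i | i <- iota 0 (size p).+1]).
- by apply/allP => x /mapP[i _ ->]; apply/rootP.
- by rewrite map_inj_uniq ?iota_uniq.
- by rewrite size_map size_iota.
Qed.

Lemma natr_inj : injective (fun k : nat => k%:R : R).
Proof. by move=> i j /eqP; rewrite eqr_nat => /eqP. Qed.

Lemma poly_ext p q : (forall t, p.[t] = q.[t]) -> p = q.
Proof.
move=> H; apply/eqP; rewrite -subr_eq0; apply/eqP; apply: (poly_inj0 natr_inj) => k.
by rewrite hornerD hornerN H subrr.
Qed.

Lemma polyfun_nat0 f : polyfun f -> (forall k : nat, f k%:R = 0) -> forall t, f t = 0.
Proof.
move=> [p hp] H t; rewrite hp (@poly_inj0 p (fun k => k%:R)) ?horner0//; first exact: natr_inj.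
by move=> k; rewrite -hp.
Qed.

Lemma polyfun_small0 f (d : R) : 0 < d -> polyfun f ->
  (forall t, 0 < t -> t <= d -> f t = 0) -> forall t, f t = 0.
Proof.
move=> d0 [p hp] H t; rewrite hp (@poly_inj0 p (fun k => d / k.+1%:R)) ?horner0//.
  by move=> i j /(mulfI (lt0r_neq0 d0)) /invr_inj /eqP; rewrite eqr_nat => /eqP [].
move=> k; rewrite -hp; apply: H; first by rewrite divr_gt0.
by rewrite ler_pdivrMr ?ltr0n// ler_peMr ?ler1n// ltW.
Qed.

(** The antiderivative vanishing at 0; the coefficient at i = 0 is 0 thanks to the convention 0^-1 =
    0. *)
Definition aint p : {poly R} := \poly_(i < (size p).+1) (p`_i.-1 / i%:R).

Lemma coef_aint p i : (aint p)`_i = p`_i.-1 / i%:R.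
Proof.
rewrite coef_poly; case: ltnP => // hi; rewrite nth_default ?mul0r//.
by case: i hi.
Qed.

Lemma aint_deriv p : (aint p)^`() = p.
Proof.
by apply/polyP => i; rewrite coef_deriv coef_aint /= -(mulr_natr (_ / _)) divfK// pnatr_eq0.
Qed.

Lemma aint0 p : (aint p).[0] = 0.
Proof. by rewrite horner_coef0 coef_aint invr0 mulr0. Qed.

Lemma aint_uniq p q : q^`() = p -> q.[0] = 0 -> q = aint p.
Proof.
move=> h1 h2; apply/polyP => -[|i]; first by rewrite coef_aint invr0 mulr0 -horner_coef0.
by rewrite coef_aint /= -h1 coef_deriv -(mulr_natr q`_i.+1) mulfK// pnatr_eq0.
Qed.

Lemma aintD p q : aint (p + q) = aint p + aint q.
Proof. by apply/esym/aint_uniq; rewrite ?derivD ?aint_deriv// hornerD !aint0 addr0. Qed.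

Lemma aintZ a p : aint (a *: p) = a *: aint p.
Proof. by apply/esym/aint_uniq; rewrite ?derivZ ?aint_deriv// hornerZ aint0 mulr0. Qed.

Lemma aint_sum (I : Type) (s : seq I) (P : pred I) (F : I -> {poly R}) :
  aint (\sum_(i <- s | P i) F i) = \sum_(i <- s | P i) aint (F i).
Proof.
by apply: (big_morph aint aintD); rewrite -(scale0r 0) aintZ !scale0r.
Qed.

Lemma aint_scale a p q : (forall t, q.[t] = p.[a * t]) -> forall t, a * (aint q).[t] = (aint p).[a * t].
Proof.
move=> H t; have E : q = p \Po (a *: 'X).
  by apply: poly_ext => s; rewrite horner_comp hornerZ hornerX.
have -> : (aint p).[a * t] = (aint p \Po (a *: 'X)).[t] by rewrite horner_comp hornerZ hornerX.
rewrite -hornerZ -aintZ; congr (_.[t]); apply/esym/aint_uniq.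
  by rewrite deriv_comp aint_deriv derivZ derivX E -scalerAr mulr1.
by rewrite horner_comp hornerZ hornerX mulr0 aint0.
Qed.

Definition topoly f : {poly R} := xget 0 [set p | forall t, f t = p.[t]].

Lemma topolyE f p : (forall t, f t = p.[t]) -> topoly f = p.
Proof.
move=> H; have h := @xgetPex _ 0 [set p | forall t, f t = p.[t]] (ex_intro _ p H).
by apply: poly_ext => t; rewrite -h -H.
Qed.

Definition integ01 f : R := (aint (topoly f)).[1].

(** The binomial coefficient t choose k as a polynomial in t. *)
Definition bp k : {poly R} := (k`!%:R)^-1 *: \prod_(i < k) ('X - (i%:R)%:P).

Lemma bp0 : bp 0 = 1.
Proof. by rewrite /bp big_ord0 fact0 invr1 scale1r. Qed.

Lemma bp_nat k m : (bp k).[m%:R] = 'C(m, k)%:R.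
Proof.
rewrite /bp hornerZ horner_prod.
under eq_bigr do rewrite hornerXsubC.
have -> : \prod_(i < k) (m%:R - i%:R) = (m ^_ k)%:R :> R.
  rewrite ffact_prod natr_prod; have [km|mk] := leqP k m.
    by apply: eq_bigr => i _; rewrite natrB// ltnW// (leq_trans (ltn_ord i)).
  rewrite (bigD1 (Ordinal mk)) //= subrr mul0r.
  by rewrite (bigD1 (Ordinal mk)) //= subnn mul0r.
by rewrite -bin_ffact natrM mulrC mulfK// pnatr_eq0 -lt0n fact_gt0.
Qed.

End Polyfun.

Section PolyA.
Variables (R : realType) (X : Type) (A : set (X -> R)).
Hypothesis hA : is_subalg A.

(** Polynomials in t with coefficients in [A]. The degree bound, uniform in x, makes integration
    over t a fixed finite sum, so that the result is again in [A]. *)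
Definition polyA : set (X * R -> R) := [set F | exists m (p : X -> {poly R}),
  [/\ forall k, A (fun x => (p x)`_k), forall x, (size (p x) <= m)%N &
      forall x t, F (x, t) = (p x).[t]]].

Lemma polyA_subalg : is_subalg polyA.
Proof.
split.
- move=> a; exists 1%N, (fun _ => a%:P); split => [k|x|x t]; last by rewrite hornerC.
    by under eq_fun do rewrite coefC; exact: sa_cst.
  exact: size_polyC_leq1.
- move=> f g [m [p [h1 h2 h3]]] [m' [p' [h1' h2' h3']]].
  exists (maxn m m'), (fun x => p x + p' x); split => [k|x|x t].
  + by under eq_fun do rewrite coefD; apply: sa_add.
  + by apply: leq_trans (size_polyD _ _) _; rewrite geq_max !leq_max h2 h2' orbT.
  + by rewrite hornerD h3 h3'.
- move=> f g [m [p [h1 h2 h3]]] [m' [p' [h1' h2' h3']]].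
  exists (m + m')%N, (fun x => p x * p' x); split => [k|x|x t].
  + by under eq_fun do rewrite coefM; apply: sa_sum => // i _; apply: sa_mul.
  + apply: leq_trans (size_mul_leq _ _) _; apply: leq_trans (leq_pred _) _.
    exact: leq_add.
  + by rewrite hornerM h3 h3'.
Qed.

Lemma polyA_fst f : A f -> polyA (fun xt => f xt.1).
Proof.
move=> Af; exists 1%N, (fun x => (f x)%:P); split => [k|x|x t]; last by rewrite hornerC.
  under eq_fun do rewrite coefC; case: k => [|k] //=; exact: sa_cst.
exact: size_polyC_leq1.
Qed.

Lemma polyA_snd : polyA (fun xt => xt.2).
Proof.
exists 2%N, (fun _ => 'X); split => [k|x|x t]; last by rewrite hornerX.
  exact: sa_cst.
by rewrite size_polyX.
Qed.

Lemma polyA_integ F : polyA F -> A (fun x => integ01 (fun t => F (x, t))).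
Proof.
move=> [m [p [h1 h2 h3]]].
have -> : (fun x => integ01 (fun t => F (x, t))) =
   (fun x => \sum_(i < m.+1) (p x)`_i.-1 * i%:R^-1).
  apply/funext => x; rewrite /integ01 (topolyE (h3 x)).
  rewrite (@horner_coef_wide _ m.+1); last first.
    by apply: leq_trans (size_poly _ _) _; rewrite ltnS.
  by apply: eq_bigr => i _; rewrite coef_aint expr1n mulr1.
by apply: sa_sum => // i _; apply: sa_mul => //; exact: sa_cst.
Qed.
End PolyA.

Lemma sum_trunc (V : nmodType) (F : nat -> V) a b :
  (forall i, (a <= i)%N -> F i = 0) -> (forall i, (b <= i)%N -> F i = 0) ->
  \sum_(i < a) F i = \sum_(i < b) F i.
Proof.
wlog ab : a b / (a <= b)%N.
  by move=> H ha hb; case/orP: (leq_total a b) => h; [exact: H | apply/esym; exact: H].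
move=> ha _; rewrite -!(big_mkord xpredT F) (big_cat_nat _ ab) //=.
rewrite [X in _ + X](_ : _ = 0) ?addr0//.
by rewrite big_nat big1// => i /andP[/ha].
Qed.

(** * Real powers of unipotent matrices *)

Section Unipotent.
Variables (R : realType) (n c : nat).

(** The binomial series of (1 + (M - 1))^t, exact as soon as (M - 1)^(c + 1) = 0. *)
Definition unip_pow (M : 'M[R]_n) (t : R) : 'M[R]_n := \sum_(k < c.+1) (bp R k).[t] *: (M - 1) ^+ k.

Lemma unip_pow_nat M (m : nat) : (M - 1) ^+ c.+1 = 0 -> M ^+ m = unip_pow M m%:R.
Proof.
move=> hM; rewrite -[M in LHS](subrK 1) exprD1n /unip_pow.
under [RHS]eq_bigr do rewrite bp_nat scaler_nat.
apply: (sum_trunc (F := fun k => (M - 1) ^+ k *+ 'C(m, k))) => i hi.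
  by rewrite bin_small// mulr0n.
by rewrite -(subnK hi) exprD hM mulr0 mul0rn.
Qed.

Lemma unip_pow_fun (X : Type) (A : set (X -> R)) (F : X -> 'M[R]_n) (f : X -> R) :
  is_subalg A -> mxin A F -> (forall p : {poly R}, A (fun x => p.[f x])) ->
  mxin A (fun x => unip_pow (F x) (f x)).
Proof.
move=> hA hF hf; apply: mxin_sum => // k _; apply: mxin_scale => //.
by apply: mxin_exp => //; apply: mxin_sub => //; exact: mxin_cst.
Qed.

Lemma unip_pow_poly M : mxin (@polyfun R) (unip_pow M).
Proof.
apply: (unip_pow_fun (F := fun _ => M) (f := fun t => t)); first exact: polyfun_subalg.
  by apply: mxin_cst; exact: polyfun_subalg.
exact: polyfun_horner.
Qed.

(** On fractions with denominator d + 1, the polynomial powers of a (1 / (d + 1)) and of a 1 agree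
    at infinitely many integer points, hence everywhere. Continuity gives t >= 0 and invertibility
    gives t < 0. *)
Lemma unip_poly (a : R -> 'M[R]_n) :
  (forall s t, a (s + t) = a s *m a t) -> (forall i j, continuous (fun t => a t i j)) ->
  (forall t, (a t - 1) ^+ c.+1 = 0) -> a 0 = 1 ->
  forall t, a t = unip_pow (a 1) t.
Proof.
move=> aD ac an a0.
have aX h m : a (m%:R * h) = a h ^+ m.
  elim: m => [|m IH]; first by rewrite mul0r a0.
  by rewrite -natr1 mulrDl mul1r aD IH exprSr.
have pfM (b : R) : polyfun (fun t => t * b).
  by exists (b *: 'X) => t; rewrite hornerZ hornerX mulrC.
have frac d m : a (m%:R / d.+1%:R) = unip_pow (a 1) (m%:R / d.+1%:R).
  rewrite aX unip_pow_nat//; apply/matrixP => i j.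
  apply/eqP; rewrite -subr_eq0; apply/eqP.
  pose f t := unip_pow (a d.+1%:R^-1) t i j - unip_pow (a 1) (t / d.+1%:R) i j.
  have pf : polyfun f.
    apply: sa_sub; [exact: polyfun_subalg | exact: unip_pow_poly | ].
    by apply: (polyfun_comp (f := fun t => unip_pow (a 1) t i j)); [exact: unip_pow_poly | exact: pfM].
  suff H t : f (t * d.+1%:R) = 0 by have := H (m%:R / d.+1%:R); rewrite divfK// pnatr_eq0.
  apply: (polyfun_nat0 (f := fun t => f (t * d.+1%:R))).
    by apply: polyfun_comp => //; exact: pfM.
  move=> k; rewrite /f mulfK ?pnatr_eq0// -!natrM -!unip_pow_nat//.
  rewrite -!aX; apply/eqP; rewrite subr_eq0; apply/eqP; congr (a _ i j).
  by rewrite mulr1 natrM mulfK// pnatr_eq0.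
have pos t : 0 <= t -> a t = unip_pow (a 1) t.
  move=> t0; apply/matrixP => i j.
  have polyc p : continuous (fun t : R => p.[t]).
    elim/poly_ind: p => [|p b IH] x.
      by have -> : (fun t : R => 0.[t]) = (fun _ => 0) by [apply/funext => y; rewrite horner0]; exact: cvg_cst.
    have -> : (fun t : R => (p * 'X + b%:P).[t]) = (fun t => p.[t] * t + b).
      by apply/funext => y; rewrite hornerMXaddC.
    by apply: cvgD; [apply: cvgM; [exact: IH | exact: cvg_id] | exact: cvg_cst].
  have [p hp] := unip_pow_poly (a 1) i j; rewrite hp.
  apply: (@nat_frac_dense _ _ (@Rhausdorff R) (fun t => a t i j) (fun t => p.[t])) => //.
  by move=> m k; rewrite frac hp.
move=> t; have [t0|t0] := leP 0 t; first exact: pos.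
have t0' : 0 <= - t by rewrite oppr_ge0 ltW.
have E : unip_pow (a 1) t *m a (- t) = 1.
  apply/matrixP => i j; pose f s := (unip_pow (a 1) s *m a (- t)) i j - (unip_pow (a 1) (s - t)) i j.
  suff : f t = 0.
    rewrite /f subrr => /eqP; rewrite subr_eq0 => /eqP ->.
    by rewrite -pos// a0.
  apply: (polyfun_nat0 (f := f)).
    apply: sa_sub; first exact: polyfun_subalg.
      by apply: mxin_mul; [exact: polyfun_subalg | exact: unip_pow_poly | apply: mxin_cst; exact: polyfun_subalg].
    apply: (polyfun_comp (f := fun s => unip_pow (a 1) s i j)); first exact: unip_pow_poly.
    by exists ('X - t%:P) => s; rewrite hornerXsubC.
  move=> k; rewrite /f -!pos// ?addr_ge0// aD.
  by rewrite subrr.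
have : unip_pow (a 1) t *m a (- t) *m a t = a t by rewrite E mul1mx.
by rewrite -mulmxA -aD addNr a0 mulmx1.
Qed.

End Unipotent.

Lemma cvg_sum (R : realType) (I : Type) (s : seq I) (F : I -> nat -> R) (l : I -> R) :
  (forall i, F i @ \oo --> l i) ->
  (fun k => \sum_(i <- s) F i k) @ \oo --> \sum_(i <- s) l i.
Proof.
move=> H; elim: s => [|i s IH].
  by under eq_fun do rewrite big_nil; rewrite big_nil; exact: cvg_cst.
by under eq_fun do rewrite big_cons; rewrite big_cons; apply: cvgD.
Qed.

Lemma rVB (R : realType) n (x y : 'rV[R]_n) j : (x - y) 0 j = x 0 j - y 0 j.
Proof. by rewrite !mxE. Qed.

Lemma zmod_aux (V : zmodType) (b s : V) : b + s + b - (b + b) = s.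
Proof. by rewrite opprD addrA addrK addrC addrA addNr add0r. Qed.

Lemma scale_aux (R : realType) n (s : R) (d b y u : 'rV[R]_n) :
  s *: (d - u) - (s *: (b - u) + s *: (y - u)) = s *: (d - b) - s *: (y - u).
Proof. by apply/rowP => i; rewrite !mxE; ring. Qed.

Opaque ex.

(** * The adjoint representation and the Baker-Campbell-Hausdorff law *)

Section Adjoint.
Variables (R : realType) (n : nat) (N : topGroupType) (lc : loc_chart R n N).
Hypothesis hN : hausdorff_space N.
Implicit Types u v w z : 'rV[R]_n.
Local Notation c := (cc lc).
Local Notation r := (lr lc).
Local Notation C := (lC lc).
Local Notation q := (exr lc).
Local Notation ex := (ex lc).
Local Notation jet := (jet lc).
Local Notation sm := (sm lc).

Lemma mx_ext m (M M' : 'M[R]_(n, m)) : (forall v, v *m M = v *m M') -> M = M'.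
Proof. by move=> H; apply/row_matrixP => i; rewrite !rowE H. Qed.

Lemma ex_mx_inj m (M M' : 'M[R]_(m, n)) : (forall v : 'rV[R]_m, ex (v *m M) = ex (v *m M')) -> M = M'.
Proof.
move=> H; apply/row_matrixP => i; rewrite !rowE.
by apply: (@ex_line_inj _ _ _ lc) => t; rewrite !scalemxAl H.
Qed.

Lemma conj_morphism (g : N) : cont_morphism (fun x => g * x * g^-1)%g.
Proof.
split=> [x y|x]; first by rewrite !mulgA mulgVK.
apply: (@cvg_comp _ _ _ (fun x => (g * x, g^-1))%g (fun p : N * N => p.1 * p.2)%g (nbhs x)
  (nbhs ((g * x)%g, (g^-1)%g))); last exact: (@mulg_continuous N ((g * x)%g, (g^-1)%g)).
apply: cvg_pair; last exact: cvg_cst.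
apply: (@cvg_comp _ _ _ (fun x => (g, x)) (fun p : N * N => p.1 * p.2)%g (nbhs x)
  (nbhs (g, x))); last exact: (@mulg_continuous N (g, x)).
by apply: cvg_pair; [exact: cvg_cst | exact: cvg_id].
Qed.

(** Matrices act on row vectors from the right, so [Ad] reverses products. *)
Definition Ad (g : N) : 'M[R]_n := xget 0 [set M | forall v, (g * ex v * g^-1)%g = ex (v *m M)].

Lemma AdE g v : (g * ex v * g^-1)%g = ex (v *m Ad g).
Proof.
have [M hM] := hom_linear lc lc hN hN (conj_morphism g).
exact: (@xgetPex _ 0 [set M | forall v, (g * ex v * g^-1)%g = ex (v *m M)] (ex_intro _ M hM)).
Qed.

Lemma Ad_mul g h : Ad (g * h)%g = Ad h *m Ad g.
Proof. by apply: ex_mx_inj => v; rewrite -AdE mulmxA -!AdE invgM !mulgA. Qed.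

Lemma Ad1 : Ad 1%g = 1.
Proof. by apply: ex_mx_inj => v; rewrite -AdE invg1 mulg1 mul1g mulmx1. Qed.

Opaque Ad.

Lemma jet_conj (y : nat -> N) w g : jet y w -> jet (fun k => g * y k * g^-1)%g (w *m Ad g).
Proof.
move=> /jet_log [u [h1 h2 h3]].
have cM (s : nat -> 'rV[R]_n) (l : 'rV[R]_n) : s @ \oo --> l -> (fun k => s k *m Ad g) @ \oo --> l *m Ad g.
  move=> hs; apply: cvg_rV => i; rewrite mxE; under eq_fun do rewrite mxE.
  apply: (cvg_sum (F := fun j k => s k 0 j * Ad g j i)) => j; apply: cvgMr_tmp.
  exact: (@cvg_comp _ _ _ s (fun x : 'rV[R]_n => x 0 j) \oo (nbhs l) _ hs (@coord_continuous R 1 n 0 j l)).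
apply: (@jet_eq _ _ _ lc (fun k => ex (u k *m Ad g))).
  by apply: filterS h1 => k ->; rewrite AdE.
apply: jet_exu; first by have := cM _ _ h2; rewrite mul0mx.
by under eq_fun do rewrite scalemxAl; exact: cM.
Qed.

Lemma jet_cst1 w : jet (fun _ => 1%g) w -> w = 0.
Proof.
case=> _; rewrite cc1 => h.
have h0 : (fun k : nat => k.+1%:R *: (0 : 'rV[R]_n)) @ \oo --> (0 : 'rV[R]_n).
  by under eq_fun do rewrite scaler0; exact: cvg_cst.
by apply: (cvg_unique _ h h0); exact: norm_hausdorff.
Qed.

Lemma Ad_near g w : sm r g -> `|w *m Ad g - w| <= 3 * C * `|c g| * `|w|.
Proof.
move=> sg; set w' := w *m Ad g.
pose x (k : nat) := ex (k.+1%:R^-1 *: w); pose y k := (g * x k * g^-1)%g.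
have jx : jet x w by exact: jet_ex.
have jy : jet y w' by exact: jet_conj.
have r0 := lr_gt0 lc; have C0 := lC_ge0 lc.
have sx := jet_sm jx r0; have sy := jet_sm jy r0.
have [_ cx] := jx; have [_ cy] := jy.
(* The relation y g = g x between x and its conjugate y is expanded by [M1] on both sides: the terms
   c g cancel and only the two bilinear errors remain. The factor 3 of the statement comes from |w'|
   <= 2 |w|. *)
have key : `|w' - w| <= C * `|c g| * (`|w| + `|w'|).
  have h1 : (fun k => `|k.+1%:R *: c (y k) - k.+1%:R *: c (x k)|) @ \oo --> `|w' - w|.
    by apply: cvg_norm; exact: cvgB.
  have h2 : (fun k => C * `|c g| * (`|k.+1%:R *: c (x k)| + `|k.+1%:R *: c (y k)|)) @ \oo -->
     C * `|c g| * (`|w| + `|w'|).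
    by apply: cvgMl_tmp; apply: cvgD; apply: cvg_norm.
  apply: (ler_cvg_to h1 h2); apply: filterS2 sx sy => k s1 s2.
  rewrite -scalerBr !normrZ normr_nat -mulrDr mulrCA; apply: ler_wpM2l => //.
  have e1 := M1 s2 sg; have e2 := M1 sg s1.
  have E : (y k * g = g * x k)%g by rewrite /y mulgVK.
  rewrite E in e1.
  have -> : c (y k) - c (x k) = (c (g * x k)%g - c g - c (x k)) - (c (g * x k)%g - c (y k) - c g).
    by apply/rowP => i; rewrite !mxE; ring.
  apply: le_trans (ler_normB _ _) _; apply: le_trans (lerD e2 e1) _.
  by apply: ler_eq; ring.
have Cg : C * `|c g| <= 1 / 16 by apply: lC_ball_small; case: sg.
have Cg0 : 0 <= C * `|c g| by rewrite mulr_ge0.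
have w0 := normr_ge0 w; have w'0 := normr_ge0 w'.
have h3 : C * `|c g| * (`|w| + `|w'|) <= 1 / 16 * (`|w| + `|w'|).
  by apply: ler_wpM2r => //; rewrite addr_ge0.
have h4 := norm_via w' w.
have h5 : `|w'| <= 2 * `|w| by lra.
apply: le_trans key _.
have : C * `|c g| * (`|w| + `|w'|) <= C * `|c g| * (3 * `|w|) by apply: ler_wpM2l => //; lra.
by move/le_trans; apply; apply: ler_eq; ring.
Qed.

Hypothesis nilN : nilpotent_group N.

(* The velocity of a commutator [y_k, g] is w (Ad g^-1 - 1), hence the c-fold
   commutators of N being trivial, all products of c factors Ad g - 1 vanish. *)
Lemma Ad_nilp : exists d, forall g, (Ad g - 1) ^+ d.+1 = 0.
Proof.
have [d hd] := nilN; exists d => g.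
apply: mx_ext => w; rewrite mulmx0.
pose h := (g^-1)%g.
have H k : exists2 y : nat -> N, jet y (w *m (Ad g - 1) ^+ k) & forall m, @lower_central N k (y m).
  elim: k => [|k [y jy hy]].
    by rewrite expr0 mulmx1; exists (fun k => ex (k.+1%:R^-1 *: w)) => //; exact: jet_ex.
  exists (fun m => [~ y m, h])%g; last first.
    move=> m; rewrite /lower_central iterS => B [sB HB]; apply: HB => /=.
    by exists (y m); [exact: hy | exists h].
  have := jet_mul (jet_inv jy) (jet_conj g jy).
  rewrite exprSr [_ * (Ad g - 1)]/(_ *m _) mulmxA mulmxBr mulmx1 addrC.
  apply: jet_eq; apply: nearW => m.
  by rewrite commgEl conjgE /h invgK -!mulgA.
have [y jy hy] := H d; rewrite hd in hy.
have E : w *m (Ad g - 1) ^+ d = 0.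
  by apply: jet_cst1; apply: jet_eq jy; apply: nearW => m; exact: hy.
by rewrite exprSr mulmxA E mul0mx.
Qed.

Definition nilcls : nat := xget 0%N [set d | forall g, (Ad g - 1) ^+ d.+1 = 0].
Local Notation d := nilcls.

Lemma Ad_unip g : (Ad g - 1) ^+ d.+1 = 0.
Proof.
have [d' hd'] := Ad_nilp.
exact: (@xgetPex _ 0%N [set d | forall g, (Ad g - 1) ^+ d.+1 = 0] (ex_intro _ d' hd')).
Qed.

Definition A z : 'M[R]_n := Ad (ex z).

Lemma A_def z : A z = Ad (ex z). Proof. by []. Qed.

Lemma A_add z (s t : R) : A ((s + t) *: z) = A (s *: z) *m A (t *: z).
Proof. by rewrite /A addrC -ex_add// Ad_mul. Qed.

Lemma A0 : A 0 = 1. Proof. by rewrite /A ex0 Ad1. Qed.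

Lemma A_small z w : `|z| <= q -> `|w *m A z - w| <= 6 * C * `|z| * `|w|.
Proof.
move=> hz; apply: le_trans (Ad_near w (ex_smr hz)) _.
have [_ h] := ex_sm hz; have C0 := lC_ge0 lc.
have : C * `|c (ex z)| * `|w| <= C * (2 * `|z|) * `|w|.
  by apply: ler_wpM2r => //; apply: ler_wpM2l.
lra.
Qed.

Opaque A.

Lemma A_entry_cont z i j : continuous (fun t : R => A (t *: z) i j).
Proof.
move=> s; pose w := (delta_mx 0 i : 'rV[R]_n) *m A (s *: z).
pose K := 6 * C * `|z| * `|w| + 1.
have C0 := lC_ge0 lc; have q0 := exr_gt0 lc.
have K0 : 0 < K by rewrite ltr_wpDl// !mulr_ge0.
have z1 : 0 < `|z| + 1 by rewrite ltr_wpDl.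
apply/cvgrPdist_le => eps eps0.
pose dl := Num.min (q / (`|z| + 1)) (eps / K).
have dl0 : 0 < dl by rewrite lt_min; apply/andP; split; exact: divr_gt0.
have /cvgrPdist_le/(_ _ dl0) : (fun t : R => t) @ s --> s by exact: cvg_id.
apply: filterS => t; rewrite le_min => /andP[h1 h2].
have tz : `|(t - s) *: z| <= q.
  rewrite normrZ distrC; apply: (@le_trans _ _ (q / (`|z| + 1) * `|z|)).
    by apply: ler_wpM2r.
  by rewrite mulrAC ler_pdivrMr// ler_pM2l// lerDl.
have E : A (t *: z) i j = (w *m A ((t - s) *: z)) 0 j.
  by rewrite /w -mulmxA -A_add addrC subrK -rowE mxE.
have E2 : A (s *: z) i j = w 0 j by rewrite /w -rowE mxE.
have aux (a b a' b' : R) : a = a' -> b = b' -> `|b' - a'| <= eps -> `|a - b| <= eps.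
  by move=> -> ->; rewrite distrC.
apply: (aux _ _ _ _ E2 E).
have h3 := rV_norm_ge (w *m A ((t - s) *: z) - w) j; rewrite rVB in h3.
apply: le_trans h3 _; apply: le_trans (A_small w tz) _.
rewrite normrZ distrC.
have h4 : (6 * C * `|z| * `|w|) * `|s - t| <= (6 * C * `|z| * `|w|) * (eps / K).
  by apply: ler_wpM2l => //; rewrite !mulr_ge0.
have h5 : (6 * C * `|z| * `|w|) * (eps / K) <= eps.
  by rewrite mulrA ler_pdivrMr// mulrC ler_pM2l// /K lerDl.
have := le_trans h4 h5; apply: le_trans; apply: ler_eq; ring.
Qed.

Lemma A_line z t : A (t *: z) = unip_pow d (A z) t.
Proof.
rewrite (@unip_poly _ _ d (fun t => A (t *: z))) ?scale1r ?scale0r ?A0 //.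
- by move=> s t'; exact: A_add.
- exact: A_entry_cont.
- by move=> s; exact: Ad_unip.
Qed.

Definition Ap z (i j : 'I_n) : {poly R} := \sum_(k < d.+1) ((A z - 1) ^+ k) i j *: bp R k.

Lemma ApE z i j t : (Ap z i j).[t] = A (t *: z) i j.
Proof.
rewrite A_line /unip_pow summxE /Ap horner_sum; apply: eq_bigr => k _.
by rewrite hornerZ mxE mulrC.
Qed.

Definition Apdeg := (\max_(k < d.+1) size (bp R k))%N.

Lemma Ap_size z i j : (size (Ap z i j) <= Apdeg)%N.
Proof.
rewrite /Ap; apply: leq_trans (size_sum _ _ _) _; apply/bigmax_leqP => k _.
apply: leq_trans (size_scale_leq _ _) _.
exact: (@leq_bigmax _ (fun k : 'I_d.+1 => size (bp R k))).
Qed.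

Opaque Ap.

(** The coefficient of t^k in Ad (exp (t z)); for k = 1 it is ad z, and it stands for (ad z)^k / k!
    in general. *)
Definition Bc z k : 'M[R]_n := \matrix_(i, j) (Ap z i j)`_k.

Lemma ApZ s z i j : Ap (s *: z) i j = Ap z i j \Po (s *: 'X).
Proof.
apply: poly_ext => t; apply: (eq_trans (ApE _ _ _ _)); apply/esym.
rewrite horner_comp hornerZ hornerX; apply: (eq_trans (ApE _ _ _ _)).
by congr (A _ i j); rewrite scalerA; congr (_ *: _); exact: mulrC.
Qed.

Lemma coef_comp_scale (p : {poly R}) s k : (p \Po (s *: 'X))`_k = s ^+ k * p`_k.
Proof.
elim/poly_ind: p k => [|p a IH] k; first by rewrite comp_poly0 !coef0 mulr0.
rewrite comp_polyD comp_polyM comp_polyX comp_polyC -scalerAr !coefD coefZ coefMX coefC coefMX.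
case: k => [|k] /=; first by rewrite mulr0 expr0 mul1r.
by rewrite IH !addr0 exprS mulrA.
Qed.

Lemma BcZ s z k : Bc (s *: z) k = s ^+ k *: Bc z k.
Proof. by apply/matrixP => i j; rewrite !mxE ApZ coef_comp_scale. Qed.

Lemma Bc0 z : Bc z 0 = 1.
Proof.
apply/matrixP => i j; rewrite mxE -horner_coef0 ApE scale0r A0.
by [].
Qed.

(** Compares coefficients in Ad (exp (2 t z)) = Ad (exp (t z))^2. *)
Lemma Bc_double z k : 2 ^+ k *: Bc z k = \sum_(s < k.+1) Bc z s *m Bc z (k - s).
Proof.
apply/matrixP => i j; rewrite !mxE -coef_comp_scale.
have -> : Ap z i j \Po (2 *: 'X) = \sum_l Ap z i l * Ap z l j.
  apply: poly_ext => t; rewrite horner_comp hornerZ hornerX ApE horner_sum.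
  rewrite mulr_natl mulr2n A_add mxE; apply: eq_bigr => l _.
  by rewrite hornerM !ApE.
rewrite coef_sum summxE; under eq_bigr do rewrite coefM.
rewrite exchange_big; apply: eq_bigr => s _; rewrite mxE; apply: eq_bigr => l _.
by rewrite !mxE.
Qed.

Lemma BcE z k i j : Bc z k i j = (Ap z i j)`_k.
Proof. by rewrite mxE. Qed.

Opaque Bc.

Lemma horner_cont (p : {poly R}) : continuous (fun t : R => p.[t]).
Proof.
elim/poly_ind: p => [|p b IH] x.
  by have -> : (fun t : R => 0.[t]) = (fun _ => 0) by [apply/funext => y; rewrite horner0]; exact: cvg_cst.
have -> : (fun t : R => (p * 'X + b%:P).[t]) = (fun t => p.[t] * t + b).
  by apply/funext => y; rewrite hornerMXaddC.
by apply: cvgD; [apply: cvgM; [exact: IH | exact: cvg_id] | exact: cvg_cst].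
Qed.

Lemma poly_deriv_seq (p : {poly R}) :
  (fun k => k.+1%:R * (p.[k.+1%:R^-1] - p.[0])) @ \oo --> p`_1.
Proof.
pose s : {poly R} := \poly_(i < size p) p`_i.+1.
have sE i : s`_i = p`_i.+1.
  by rewrite coef_poly; case: ltnP => // h; rewrite nth_default// ltnW.
have pE : p = s * 'X + (p.[0])%:P.
  apply/polyP => -[|i]; rewrite coefD coefMX coefC /= ?add0r ?addr0 ?sE//.
  by rewrite horner_coef0.
have h : (fun k : nat => s.[k.+1%:R^-1]) @ \oo --> s.[0].
  have hc : (fun t : R => s.[t]) @ (0 : R) --> s.[0] by exact: horner_cont.
  exact: (@cvg_comp _ _ _ (fun k : nat => k.+1%:R^-1 : R) (fun t : R => s.[t]) \oo (nbhs (0 : R))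
    (nbhs s.[0]) (@inv_cvg0 R) hc).
rewrite horner_coef0 sE in h; apply: cvg_near_eq h; apply: nearW => k.
rewrite {1}pE hornerMXaddC addrK mulrCA mulfV ?mulr1// pnatr_eq0//.
Qed.

(** The derivative of Ad at 1 depends on the velocity alone: y is compared with exp (w / (k + 1)),
    the quotient having velocity 0, so that [Ad_near] makes its contribution vanish. Additivity of
    ad follows, since velocities of products add. *)
Lemma jet_Ad (y : nat -> N) w v : jet y w ->
  (fun k => k.+1%:R *: (v *m Ad (y k) - v)) @ \oo --> v *m Bc w 1.
Proof.
move=> jy; pose x k := ex (k.+1%:R^-1 *: w); have jx : jet x w by exact: jet_ex.
have h1 : (fun k => k.+1%:R *: (v *m Ad (x k) - v)) @ \oo --> v *m Bc w 1.
  apply: cvg_rV => j; rewrite mxE.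
  have E k : (k.+1%:R *: (v *m Ad (x k) - v)) 0 j =
     \sum_i v 0 i * (k.+1%:R * ((Ap w i j).[k.+1%:R^-1] - (Ap w i j).[0])).
    rewrite !mxE -{2}[v]mulmx1 mxE -sumrB mulr_sumr; apply: eq_bigr => i _.
    by rewrite !ApE scale0r A0 A_def; ring.
  under eq_fun do rewrite E.
  apply: (cvg_sum (F := fun i k => v 0 i * (k.+1%:R * ((Ap w i j).[k.+1%:R^-1] - (Ap w i j).[0]))))  => i.
  by apply: cvgMl_tmp; rewrite mxE; exact: poly_deriv_seq.
apply: (cvg_perturb h1).
have r0 := lr_gt0 lc; have C0 := lC_ge0 lc.
have jxy : jet (fun k => y k * (x k)^-1)%g 0.
  by rewrite -(subrr w); apply: jet_mul => //; exact: jet_inv.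
have s1 := jet_sm jxy r0; have s2 := jet_sm jx (exr_gt0 lc).
have [_ cxy] := jxy.
have B : (fun k => 3 * C * (`|v *m Ad (x k)| * `|k.+1%:R *: c (y k * (x k)^-1)%g|)) @ \oo --> (0 : R).
  apply: cvg_scale0; apply: (@cvg_mul0 _ `|v|); last exact: cvg_norm00.
  apply: cvg_norm.
  have B2 : (fun k => 3 * C * `|v| * `|c (x k)|) @ \oo --> (0 : R).
    by apply: cvg_scale0; exact: cvg_norm00 (jet_c0 jx).
  apply: (cvg_norm0 B2); apply: filterS (jet_sm jx r0) => k sk.
  by apply: le_trans (Ad_near v sk) _; apply: ler_eq; ring.
apply: (cvg_norm0 B); apply: filterS s1 => k sk.
rewrite subr0 -scalerBr opprB addrA subrK normrZ normr_nat.
have -> : v *m Ad (y k) = v *m Ad (x k) *m Ad (y k * (x k)^-1)%g.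
  by rewrite -mulmxA -Ad_mul mulgVK.
have h := Ad_near (v *m Ad (x k)) sk.
apply: le_trans (ler_wpM2l _ h) _ => //.
by rewrite normrZ normr_nat; apply: ler_eq; ring.
Qed.

Lemma BcD v w : Bc (v + w) 1 = Bc v 1 + Bc w 1.
Proof.
apply: mx_ext => u.
pose x k := ex (k.+1%:R^-1 *: v); pose y k := ex (k.+1%:R^-1 *: w).
have jx : jet x v by exact: jet_ex.
have jy : jet y w by exact: jet_ex.
have h1 := jet_Ad (v := u) (jet_mul jx jy).
have h2 : (fun k => k.+1%:R *: (u *m Ad (x k * y k)%g - u)) @ \oo --> u *m (Bc v 1 + Bc w 1).
  have hx := jet_Ad (v := u) jx; have hy := jet_Ad (v := u) jy.
  have hs : (fun k => k.+1%:R *: (u *m Ad (x k) - u) + k.+1%:R *: (u *m Ad (y k) - u)) @ \oo -->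
     u *m Bc v 1 + u *m Bc w 1 by exact: cvgD hx hy.
  rewrite mulmxDr; apply: (cvg_perturb hs).
  have C0 := lC_ge0 lc.
  have sx := jet_sm jx (lr_gt0 lc).
  pose uy k := k.+1%:R *: (u *m Ad (y k) - u).
  have B : (fun k => 3 * C * (`|uy k| * `|c (x k)|)) @ \oo --> (0 : R).
    by apply: cvg_scale0; apply: (cvg_mul0 (cvg_norm hy)); apply: cvg_norm00; exact: jet_c0 jx.
  apply: (cvg_norm0 B); apply: filterS sx => k sk; rewrite subr0.
  have -> : k.+1%:R *: (u *m Ad (x k * y k)%g - u) - (k.+1%:R *: (u *m Ad (x k) - u) +
     k.+1%:R *: (u *m Ad (y k) - u)) = uy k *m Ad (x k) - uy k.
    rewrite /uy Ad_mul mulmxA -scalemxAl mulmxBl; exact: scale_aux.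
  apply: le_trans (Ad_near (uy k) sk) _; apply: ler_eq; ring.
by apply: (cvg_unique _ h1 h2); exact: norm_hausdorff.
Qed.

(** ad is linear, and [Bc_double] determines every higher coefficient from lower ones because 2^k -
    2 is nonzero for k >= 2. Hence Ad (exp z) is polynomial in z. *)
Lemma Bc_fun (X : Type) (S : set (X -> R)) (f : X -> 'rV[R]_n) k :
  is_subalg S -> mxin S f -> mxin S (fun x => Bc (f x) k).
Proof.
move=> hS hf; elim/ltn_ind: k => -[|[|k]] IH.
- by under eq_fun do rewrite Bc0; exact: mxin_cst.
- have E z : Bc z 1 = \sum_i z 0 i *: Bc (delta_mx 0 i) 1.
    rewrite {1}(row_sum_delta z) (big_morph (fun z => Bc z 1) BcD (_ : Bc 0 1 = 0)).
      by apply: eq_bigr => i _; rewrite BcZ expr1.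
    by rewrite -(scale0r 0) BcZ expr1 scale0r.
  under eq_fun do rewrite E; apply: mxin_sum => // i _; apply: mxin_scale => //.
  exact: mxin_cst.
have E z : Bc z k.+2 = (2 ^+ k.+2 - 2)^-1 *: \sum_(s < k.+1) Bc z s.+1 *m Bc z (k.+2 - s.+1).
  have := Bc_double z k.+2; rewrite big_ord_recl big_ord_recr /=.
  rewrite subn0 subnn Bc0 mul1mx mulmx1 addrA => h0.
  have {}h0 : 2 ^+ k.+2 *: Bc z k.+2 = Bc z k.+2 +
    \sum_(s < k.+1) Bc z s.+1 *m Bc z (k.+2 - s.+1) + Bc z k.+2 by exact: h0.
  have h2 : (2 ^+ k.+2 - 2) *: Bc z k.+2 = \sum_(s < k.+1) Bc z s.+1 *m Bc z (k.+2 - s.+1).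
    rewrite scalerBl h0 scaler_nat mulr2n.
    exact: zmod_aux.
  rewrite -h2 scalerA mulVf ?scale1r//.
  rewrite subr_eq0 -[X in _ != X]expr1 -(natrX _ 2 1) -natrX eqr_nat.
  by rewrite eqn_exp2l.
under eq_fun do rewrite E; apply: mxin_scale => //; first exact: sa_cst.
apply: mxin_sum => // s _; apply: mxin_mul => //; apply: IH.
  by rewrite ltnS (ltn_ord s).
by rewrite subSS ltnS leq_subr.
Qed.

Lemma A_Bc z : A z = \sum_(k < Apdeg) Bc z k.
Proof.
apply/matrixP => i j; rewrite -[z in LHS]scale1r -ApE summxE.
rewrite (horner_coef_wide _ (Ap_size z i j)).
by apply: eq_bigr => k _; rewrite expr1n mulr1 BcE.
Qed.

Lemma A_fun (X : Type) (S : set (X -> R)) (f : X -> 'rV[R]_n) :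
  is_subalg S -> mxin S f -> mxin S (fun x => A (f x)).
Proof.
move=> hS hf; under eq_fun do rewrite A_Bc.
by apply: mxin_sum => // k _; exact: Bc_fun.
Qed.

End Adjoint.

Lemma mx_bound (R : realType) n m (M : 'M[R]_(n, m)) :
  exists2 L : R, 1 <= L & forall v : 'rV[R]_n, `|v *m M| <= L * `|v|.
Proof.
pose S := \sum_i \sum_j `|M i j|.
have S0 : 0 <= S by apply: sumr_ge0 => i _; apply: sumr_ge0 => j _; exact: normr_ge0.
exists (1 + S) => [|v]; first by rewrite lerDl.
apply: rV_norm_le => [|j]; first by rewrite mulr_ge0// addr_ge0.
rewrite mxE; apply: le_trans (ler_norm_sum _ _ _) _.
apply: (@le_trans _ _ (\sum_i `|v| * \sum_j `|M i j|)).
  apply: ler_sum => i _; rewrite normrM; apply: ler_pM => //; first exact: rV_norm_ge.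
  by rewrite (bigD1 j)//= lerDl sumr_ge0.
by rewrite -mulr_sumr mulrC; apply: ler_wpM2r => //; rewrite lerDr.
Qed.

Lemma poly_taylor (R : realType) (p : {poly R}) (t : R) :
  exists2 K : R, 0 <= K & forall h, `|h| <= 1 -> `|p.[t + h] - p.[t] - h * p^`().[t]| <= K * h ^+ 2.
Proof.
have [s hs] : exists s : {poly R}, forall h, p.[t + h] = p.[t] + h * p^`().[t] + h ^+ 2 * s.[h].
  elim/poly_ind: p => [|p b [s IH]].
    by exists 0 => h; rewrite deriv0 !horner0 !mulr0 !addr0.
  exists ((p^`().[t])%:P + t *: s + s * 'X) => h.
  rewrite derivD derivM derivX derivC !hornerE IH; ring.
exists (\sum_(i < size s) `|s`_i|) => [|h h1]; first exact: sumr_ge0.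
rewrite hs (_ : _ - _ - _ = h ^+ 2 * s.[h]); last by ring.
rewrite normrM (ger0_norm (x := h ^+ 2)) ?sqr_ge0// mulrC ler_wpM2r ?sqr_ge0//.
rewrite horner_coef; apply: le_trans (ler_norm_sum _ _ _) _; apply: ler_sum => i _.
by rewrite normrM ler_piMr// normrX exprn_ile1.
Qed.

Lemma quad_derive0 (R : realType) (f : R -> R) (t e K : R) : 0 < e ->
  (forall h, `|h| <= e -> `|f (t + h) - f t| <= K * h ^+ 2) -> is_derive t (1 : R) f 0.
Proof.
move=> e0 H.
have cv : (fun h : R => h^-1 *: ((f \o shift t) (h *: (1 : R)) - f t)) @ 0^' --> (0 : R).
  apply/cvgrPdist_le => eps eps0.
  pose dl := Num.min e (eps / (`|K| + 1)).
  have K1 : 0 < `|K| + 1 by rewrite ltr_wpDl.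
  have dl0 : 0 < dl by rewrite lt_min; apply/andP; split => //; exact: divr_gt0.
  have : \forall h \near (0 : R)^', `|h| <= dl.
    apply: nbhs_dnbhs; have /cvgrPdist_le/(_ _ dl0) : (fun t : R => t) @ (0:R) --> (0:R) by exact: cvg_id.
    by apply: filterS => h; rewrite sub0r normrN.
  apply: filterS => h; rewrite le_min => /andP[h1 h2].
  rewrite sub0r normrN /= [h *: 1]mulr1 [h + t]addrC.
  have [->|h0] := eqVneq h 0; first by rewrite invr0 scale0r normr0 ltW.
  have hp : 0 < `|h| by rewrite normr_gt0.
  rewrite normrZ normfV ler_pdivrMl//; apply: le_trans (H _ h1) _.
  rewrite -(real_normK (num_real h)) expr2 mulrA [leRHS]mulrC; apply: ler_wpM2r => //.
  apply: (@le_trans _ _ (`|K| * `|h|)); first by apply: ler_wpM2r => //; exact: ler_norm.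
  apply: (@le_trans _ _ (`|K| * (eps / (`|K| + 1)))); first exact: ler_wpM2l.
  by rewrite mulrA ler_pdivrMr// mulrC ler_pM2l// lerDl.
by split; [apply/cvg_ex; exists 0 | apply/cvg_lim].
Qed.

(** Quadratic increments force a zero derivative; this is how two curves in the group will be
    identified. *)
Lemma quad_const (R : realType) (f : R -> R) (a : R) :
  (forall t, `|t| <= `|a| -> exists e K : R, 0 < e /\
     forall h, `|h| <= e -> `|f (t + h) - f t| <= K * h ^+ 2) -> f a = f 0.
Proof.
move=> H; suff : `|f a - f 0| <= 0 * `|a| by rewrite mul0r normr_le0 subr_eq0 => /eqP.
apply: (@MVT_abs R f (fun _ => 0)) => x xa; last by rewrite normr0.
by have [e [K [e0 h]]] := H x xa; exact: quad_derive0 e0 h.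
Qed.

Lemma scale_mul_entry (R : realType) n (a : R) (X Y : 'M[R]_n) i j :
  (a *: (X *m Y + X)) i j = a * (\sum_l X i l * Y l j + X i j).
Proof. by rewrite !mxE. Qed.

Lemma dbl_aux (R : realType) (x y s t p m : R) :
  x = y + s -> s = - (2^-1 * t) -> y = 2^-1 * m -> p = - m -> - x = 2^-1 * (t + p).
Proof. by move=> -> -> -> ->; ring. Qed.

Lemma dbl_combine (R : realType) n (M : 'M[R]_n) (L e1 e2 : R) (a k f : 'rV[R]_n) :
  0 <= L -> (forall v : 'rV[R]_n, `|v *m M| <= L * `|v|) ->
  `|a - (k *m M + k)| <= e1 -> `|k - f| <= e2 ->
  `|a - (f *m M + f)| <= e1 + (L + 1) * e2.
Proof.
move=> L0 hL h1 h2.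
have -> : a - (f *m M + f) = (a - (k *m M + k)) + ((k - f) *m M + (k - f)).
  by rewrite mulmxBl; move: (k *m M) (f *m M) => x y; apply/rowP => i; rewrite !mxE; ring.
apply: le_trans (ler_normD _ _) _; apply: lerD => //.
apply: le_trans (ler_normD _ _) _; have := hL (k - f).
have : (L + 1) * `|k - f| <= (L + 1) * e2 by apply: ler_wpM2l => //; rewrite addr_ge0.
lra.
Qed.

(** * The differential of the exponential map *)

Section Phi.
Variables (R : realType) (n d : nat).
Implicit Types M : 'M[R]_n.

(** The integral of t choose k over [-1, 0]. Thus [Phi] M is the integral of M^t over [-1, 0] for
    unipotent M; for M = exp (ad z) it equals (1 - exp (- ad z)) / ad z, the left-translated
    differential of exp at z. *)
Definition kap k : R := - (aint (bp R k)).[-1].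

Lemma kap0 : kap 0 = 1.
Proof.
rewrite /kap bp0 -(@aint_uniq R 1 'X) ?derivX ?hornerX//.
by rewrite opprK.
Qed.

Definition Phi M : 'M[R]_n := \sum_(k < d.+1) kap k *: (M - 1) ^+ k.
(** The Neumann series for the inverse of [Phi] M. It is finite since 1 - [Phi] M is a multiple of M
    - 1, commuting with it, and hence nilpotent. *)
Definition Jm M : 'M[R]_n := \sum_(k < d.+1) (1 - Phi M) ^+ k.

Lemma PhiE M i j : Phi M i j = \sum_(k < d.+1) kap k * ((M - 1) ^+ k) i j.
Proof. by rewrite summxE; apply: eq_bigr => k _; rewrite mxE. Qed.

Lemma Phi_recl M : Phi M = 1 + \sum_(k < d) kap k.+1 *: (M - 1) ^+ k.+1.
Proof. by rewrite /Phi big_ord_recl kap0 expr0 scale1r. Qed.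

Lemma PhiJ M : (M - 1) ^+ d.+1 = 0 -> Phi M *m Jm M = 1.
Proof.
move=> hM; set E := 1 - Phi M.
have EE : Phi M = 1 - E by rewrite /E opprB addrC subrK.
have h : (E - 1) * Jm M = E ^+ d.+1 - 1 by rewrite subrX1.
have E0 : E ^+ d.+1 = 0.
  pose S : 'M[R]_n := - \sum_(k < d) kap k.+1 *: (M - 1) ^+ k.
  have ES : E = (M - 1) * S.
    rewrite /E Phi_recl opprD addrA subrr add0r.
    rewrite /S mulrN mulr_sumr; congr (- _); apply: eq_bigr => k _.
    by rewrite exprS; exact: scalemxAr.
  have cS : GRing.comm (M - 1) S.
    apply: commrN; apply: commr_sum => k _.
    apply: (eq_trans (esym (scalemxAr _ _ _))); apply: (eq_trans _ (scalemxAl _ _ _)).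
    by congr (_ *: _); exact: commrX.
  by rewrite ES exprMn_comm// hM mul0r.
rewrite -[_ *m _]/(Phi M * Jm M) EE -opprB mulNr h E0 sub0r opprK//.
Qed.

Lemma JPhi M : (M - 1) ^+ d.+1 = 0 -> Jm M *m Phi M = 1.
Proof. by move=> hM; apply: mulmx1C; exact: PhiJ. Qed.

Lemma Phi_fun (X : Type) (S : set (X -> R)) (F : X -> 'M[R]_n) :
  is_subalg S -> mxin S F -> mxin S (fun x => Phi (F x)).
Proof.
move=> hS hF; apply: mxin_sum => // k _; apply: mxin_scale => //; first exact: sa_cst.
by apply: mxin_exp => //; apply: mxin_sub => //; exact: mxin_cst.
Qed.

Lemma Jm_fun (X : Type) (S : set (X -> R)) (F : X -> 'M[R]_n) :
  is_subalg S -> mxin S F -> mxin S (fun x => Jm (F x)).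
Proof.
move=> hS hF; apply: mxin_sum => // k _; apply: mxin_exp => //; apply: mxin_sub => //.
  exact: mxin_cst.
exact: Phi_fun.
Qed.

End Phi.

Section Dexp.
Variables (R : realType) (n : nat) (N : topGroupType) (lc : loc_chart R n N).
Hypothesis hN : hausdorff_space N.
Hypothesis nilN : nilpotent_group N.
Implicit Types u v w x y z b : 'rV[R]_n.
Local Notation c := (cc lc).
Local Notation r := (lr lc).
Local Notation C := (lC lc).
Local Notation q := (exr lc).
Local Notation ex := (ex lc).
Local Notation sm := (sm lc).
Local Notation d := (nilcls lc).
Local Notation A := (A lc).
Local Notation Phi := (Phi d).
Local Notation Jm := (Jm d).

Transparent Ap.
Lemma Phi_Ap z i j : Phi (A z) i j = - (aint (Ap lc z i j)).[-1].
Proof.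
have -> : Ap lc z i j = \sum_(k < d.+1) ((A z - 1) ^+ k) i j *: bp R k.
  by [].
rewrite aint_sum horner_sum -sumrN PhiE; apply: eq_bigr => k _.
by rewrite aintZ hornerZ /kap mulrC mulrN.
Qed.
Opaque Ap.

Lemma aint_Ap_add z i j s t :
  (aint (Ap lc z i j)).[s + t] = (aint (Ap lc z i j)).[s] +
    \sum_l (aint (Ap lc z i l)).[t] * A (s *: z) l j.
Proof.
pose p := Ap lc z i j.
pose Q := \sum_l A (s *: z) l j *: Ap lc z i l.
have E : p \Po ('X + s%:P) = Q.
  apply: poly_ext => u; rewrite horner_comp hornerD hornerX hornerC /p ApE// A_add// mxE.
  by rewrite /Q horner_sum; apply: eq_bigr => l _; rewrite hornerZ ApE// mulrC.
have h : aint p \Po ('X + s%:P) - ((aint p).[s])%:P = aint Q.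
  apply: aint_uniq; last by rewrite hornerD hornerN horner_comp hornerD hornerX !hornerC add0r subrr.
  by rewrite derivB derivC subr0 deriv_comp aint_deriv derivD derivX derivC addr0 mulr1 E.
have : (aint p \Po ('X + s%:P)).[t] = (aint Q).[t] + (aint p).[s].
  by rewrite -h hornerD hornerN hornerC subrK.
rewrite horner_comp hornerD hornerX hornerC addrC => ->.
rewrite addrC; congr (_ + _); rewrite /Q aint_sum horner_sum; apply: eq_bigr => l _.
by rewrite aintZ hornerZ mulrC.
Qed.

(** The integral of A (2 t z) over [-1, 0] is split at - 1 / 2 and each half is rescaled. *)
Lemma Phi_double z : Phi (A (2 *: z)) = 2^-1 *: (Phi (A z) *m A (- z) + Phi (A z)).
Proof.
have hf i j : (aint (Ap lc (2 *: z) i j)).[- 2^-1] = 2^-1 * (aint (Ap lc z i j)).[-1].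
  rewrite (@aint_scale R 2^-1 (Ap lc (2 *: z) i j)) ?mulrN1// => t.
  apply: (eq_trans (ApE lc hN nilN _ _ _ _)); apply/esym; apply: (eq_trans (ApE lc hN nilN _ _ _ _)).
  by congr (A _ i j); rewrite scalerA; congr (_ *: _); field.
have Ez : - 2^-1 *: (2 *: z) = - z by rewrite scalerA mulNr mulVf// scaleN1r.
apply/matrixP => i j; apply: (eq_trans (Phi_Ap _ _ _)).
apply: (eq_trans _ (esym (scale_mul_entry _ _ _ _ _))).
have H := aint_Ap_add (2 *: z) i j (- 2^-1) (- 2^-1).
rewrite (_ : - 2^-1 - 2^-1 = -1) in H; last by field.
have HS : \sum_l (aint (Ap lc (2 *: z) i l)).[- 2^-1] * A (- 2^-1 *: (2 *: z)) l j =
    - (2^-1 * \sum_l Phi (A z) i l * A (- z) l j).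
  rewrite mulr_sumr -sumrN; apply: eq_bigr => l _; rewrite hf Ez Phi_Ap.
  by move: (aint _).[_] (A _ l j) => a b'; ring.
exact: (dbl_aux H HS (hf i j) (Phi_Ap z i j)).
Qed.

Lemma Phi_near : exists2 K, 0 <= K & forall z b, `|z| <= q -> `|b *m Phi (A z) - b| <= K * `|z| * `|b|.
Proof.
have C0 := lC_ge0 lc; have q0 := exr_gt0 lc.
exists ((\sum_(k < d) `|kap R k.+1|) * (6 * C)).
  by rewrite mulr_ge0 ?mulr_ge0// sumr_ge0.
move=> z b hz.
have p k : `|b *m (A z - 1) ^+ k.+1| <= 6 * C * `|z| * `|b|.
  elim: k => [|k IH]; first by rewrite expr1 mulmxBr mulmx1; exact: (A_small hN).
  rewrite exprSr [_ * (A z - 1)]/(_ *m _) mulmxA; set w := b *m _ in IH *.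
  rewrite mulmxBr mulmx1; apply: le_trans (A_small hN w hz) _.
  apply: le_trans _ IH; rewrite -[leRHS]mul1r; apply: ler_wpM2r => //.
  have := Caq hz; lra.
rewrite Phi_recl mulmxDr mulmx1 addrC addKr mulmx_sumr.
apply: le_trans (ler_norm_sum _ _ _) _; rewrite -!mulrA mulr_suml; apply: ler_sum => k _.
rewrite -scalemxAr normrZ; apply: ler_wpM2l => //.
by have := p k; rewrite !mulrA.
Qed.

End Dexp.

Lemma half_mulmx (R : realType) n (b b' : 'rV[R]_n) (P Q P2 : 'M[R]_n) :
  b = 2 *: b' -> P2 = 2^-1 *: (P *m Q + P) -> b *m P2 = b' *m P *m Q + b' *m P.
Proof.
move=> -> ->; rewrite -scalemxAl -scalemxAr scalerA mulfV// scale1r.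
by rewrite mulmxDr mulmxA.
Qed.

Section Dexp.
Variables (R : realType) (n : nat) (N : topGroupType) (lc : loc_chart R n N).
Hypothesis hN : hausdorff_space N.
Hypothesis nilN : nilpotent_group N.
Implicit Types u v w x y z b : 'rV[R]_n.
Local Notation c := (cc lc).
Local Notation r := (lr lc).
Local Notation C := (lC lc).
Local Notation q := (exr lc).
Local Notation ex := (ex lc).
Local Notation sm := (sm lc).
Local Notation d := (nilcls lc).
Local Notation A := (A lc).
Local Notation Phi := (Phi d).
Local Notation Jm := (Jm d).

Definition gq z b : N := (ex (- z) * ex (z + b))%g.

(** The same functional equation as [Phi_double], with a product in place of the sum. Comparing the
    two lets the differential of exp be computed by repeated halving of z. *)
Lemma gq_double z b : gq (2 *: z) (2 *: b) = ((ex (- z) * gq z b * ex z) * gq z b)%g.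
Proof.
have ex2 u : ex (2 *: u) = (ex u * ex u)%g.
  by have := ex_X lc u 2; rewrite expg2.
have E : (ex z * ex (- z) = 1)%g by rewrite ex_N// mulgV.
by rewrite /gq -scalerN -scalerDr !ex2 -!mulgA (mulgA (ex z)) E mul1g.
Qed.

Lemma double_est z b L B : 1 <= L -> (forall v, `|v *m A (- z)| <= L * `|v|) ->
  sm (q / 2) (gq z b) -> `|c (gq z b)| <= B -> 2 * L * B <= q ->
  sm r (gq (2 *: z) (2 *: b)) /\
  `|c (gq (2 *: z) (2 *: b)) - (c (gq z b) *m A (- z) + c (gq z b))| <= 20 * C * L ^+ 2 * B ^+ 2.
Proof.
move=> L1 hL sg gB LB; set g := gq z b in sg gB *; set k := c g in gB *.
have C0 := lC_ge0 lc; have q0 := exr_gt0 lc; have qr := exr_le lc.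
have B0 : 0 <= B by apply: le_trans gB.
have BLB : B <= L * B by rewrite ler_peMl.
have [eta heta Eeta] := ex_surj sg; rewrite -/k in heta.
have eB : `|eta| <= 2 * B by lra.
have eq : `|eta| <= q by lra.
have d1 : `|k - eta| <= 2 * C * `|eta| ^+ 2 by rewrite /k -Eeta; exact: c_ex_approx.
have sq2 : `|eta| ^+ 2 <= (2 * B) ^+ 2 by rewrite ler_sqr ?nnegrE ?mulr_ge0.
have d1' : `|k - eta| <= 8 * C * B ^+ 2.
  apply: le_trans d1 _; have : 2 * C * `|eta| ^+ 2 <= 2 * C * (2 * B) ^+ 2 by rewrite ler_wpM2l// mulr_ge0.
  by move/le_trans; apply; apply: ler_eq; ring.
pose w := eta *m A (- z).
have wB : `|w| <= 2 * L * B.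
  apply: le_trans (hL eta) _; have h : L * `|eta| <= L * (2 * B) by apply: ler_wpM2l; lra.
  by apply: le_trans h _; apply: ler_eq; ring.
have wq : `|w| <= q by lra.
have Ew : (ex (- z) * g * ex z)%g = ex w.
  have -> : ex z = (ex (- z))^-1%g by rewrite -ex_N// opprK.
  by rewrite -Eeta AdE// A_def.
have d2 : `|c (ex w) - w| <= 8 * C * L ^+ 2 * B ^+ 2.
  apply: le_trans (c_ex_approx wq) _.
  have : `|w| ^+ 2 <= (2 * L * B) ^+ 2 by rewrite ler_sqr ?nnegrE// ?mulr_ge0//; lra.
  move=> h; have : 2 * C * `|w| ^+ 2 <= 2 * C * (2 * L * B) ^+ 2 by rewrite ler_wpM2l// mulr_ge0.
  by move/le_trans; apply; apply: ler_eq; ring.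
have sw := ex_smr wq; have [_ cw] := ex_sm wq.
have sgr : sm r g by apply: sm_le sg; lra.
rewrite gq_double -/g Ew; split.
  have [h1 h2] := sw; have [h3 h4] := sgr.
  split; first exact: ccM.
  have := M1 sw sgr => h5; apply: le_trans (norm_via3 _ (c (ex w)) k) _.
  have h6 : C * `|c (ex w)| * `|k| <= 1 / 16 * `|k| by apply: ler_wpM2r => //; exact: lC_ball_small.
  have : q = r / 4 by []. have := normr_ge0 k; lra.
have d3 : `|c (ex w * g)%g - c (ex w) - k| <= 4 * C * L * B ^+ 2.
  apply: le_trans (M1 sw sgr) _.
  have : C * `|c (ex w)| * `|k| <= C * (4 * L * B) * B.
    by apply: ler_pM => //; [rewrite mulr_ge0 | apply: ler_wpM2l => //; lra].
  by move/le_trans; apply; apply: ler_eq; ring.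
have d4 : `|(eta - k) *m A (- z)| <= L * (8 * C * B ^+ 2).
  by apply: le_trans (hL _) _; apply: ler_wpM2l; [lra | rewrite distrC].
have -> : c (ex w * g)%g - (k *m A (- z) + k) =
  (c (ex w * g)%g - c (ex w) - k) + ((c (ex w) - w) + (eta - k) *m A (- z)).
  rewrite mulmxBl -/w; set a1 := c (ex w * g)%g; set a2 := c (ex w); set a3 := k *m _.
  by clearbody a1 a2 a3; apply/rowP => i; rewrite !mxE; ring.
apply: le_trans (ler_normD _ _) _; apply: le_trans (lerD d3 (le_trans (ler_normD _ _) (lerD d2 d4))) _.
have CB : 0 <= C * B ^+ 2 by rewrite mulr_ge0// sqr_ge0.
have LL : L <= L ^+ 2 by rewrite expr2 ler_peMl//; lra.
have h1 : C * B ^+ 2 * L <= C * B ^+ 2 * L ^+ 2 by exact: ler_wpM2l.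
have -> : 4 * C * L * B ^+ 2 + (8 * C * L ^+ 2 * B ^+ 2 + L * (8 * C * B ^+ 2)) =
   12 * (C * B ^+ 2 * L) + 8 * (C * B ^+ 2 * L ^+ 2) by ring.
have -> : 20 * C * L ^+ 2 * B ^+ 2 = 20 * (C * B ^+ 2 * L ^+ 2) by ring.
lra.
Qed.

Lemma gq_base z b : `|z| <= q / 8 -> `|b| <= q / 8 ->
  sm (q / 2) (gq z b) /\ `|c (gq z b) - b| <= 6 * C * (`|z| + `|b|) * `|b|.
Proof.
move=> hz hb; have C0 := lC_ge0 lc; have q0 := exr_gt0 lc; have qr := exr_le lc.
have z0 := normr_ge0 z; have b0 := normr_ge0 b.
have zb : `|z + b| <= `|z| + `|b| by exact: ler_normD.
have aq : `|z| + `|b| <= q by lra.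
have zq : `|- z| <= q by rewrite normrN; lra.
have zbq : `|z + b| <= q by lra.
have zq' : `|z| <= q by lra.
have sx := ex_smr zq; have sy := ex_smr zbq; have sz := ex_smr zq'.
have [_ cx] := ex_sm zq; rewrite normrN in cx.
have h1 : `|c (ex (z + b)) - c (ex z) - b| <= 2 * C * (`|z| + `|b|) * `|b|.
  have := @c_ex_diff _ _ _ lc (z + b) z _ zb _ aq; rewrite [z + b - z]addrC addKr; apply.
  by rewrite lerDl.
have Cab : 2 * C * (`|z| + `|b|) <= 1 / 32 by exact: Caq.
have h1' : 2 * C * (`|z| + `|b|) * `|b| <= 1 / 32 * `|b| by exact: ler_wpM2r.
have h2 : `|c (ex (z + b)) - c (ex z)| <= 2 * `|b| by have := norm_via (c (ex (z + b)) - c (ex z)) b; lra.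
have h3 := cc_mul_left sx sy sz; rewrite -/(gq z b) (_ : (ex (- z) * ex z)%g = 1%g) in h3; last by rewrite ex_N// mulVg.
rewrite cc1 subr0 in h3.
have h4 : C * `|c (ex (- z))| * `|c (ex (z + b)) - c (ex z)| <= C * (2 * `|z|) * (2 * `|b|).
  by apply: ler_pM => //; [rewrite mulr_ge0 | apply: ler_wpM2l].
have key : `|c (gq z b) - b| <= 6 * C * (`|z| + `|b|) * `|b|.
  have -> : c (gq z b) - b = (c (gq z b) - (c (ex (z + b)) - c (ex z))) + (c (ex (z + b)) - c (ex z) - b).
    by rewrite [RHS]addrA subrK.
  apply: le_trans (ler_normD _ _) _; apply: le_trans (lerD (le_trans h3 h4) h1) _.
  have : 0 <= C * (`|b| * `|b|) by rewrite !mulr_ge0.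
  have -> : C * (2 * `|z|) * (2 * `|b|) + 2 * C * (`|z| + `|b|) * `|b| =
    6 * C * `|z| * `|b| + 2 * (C * (`|b| * `|b|)) by ring.
  have -> : 6 * C * (`|z| + `|b|) * `|b| = 6 * C * `|z| * `|b| + 6 * (C * (`|b| * `|b|)) by ring.
  lra.
split => //; split.
  by have [? ?] := sx; have [? ?] := sy; apply: ccM.
have := norm_via (c (gq z b)) b.
have : 6 * C * (`|z| + `|b|) * `|b| <= 3 / 32 * `|b| by apply: ler_wpM2r => //; lra.
lra.
Qed.

(* The property expressing that the differential of exp at z is, after left
   translation, Phi (A z). *)
Definition dexp_at z := exists e K, [/\ 0 < e, 0 <= K & forall b, `|b| <= e ->
  sm r (gq z b) /\ `|c (gq z b) - b *m Phi (A z)| <= K * `|b| ^+ 2].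

Lemma dexp_small z : `|z| <= q / 16 -> dexp_at z.
Proof.
have C0 := lC_ge0 lc; have q0 := exr_gt0 lc; have qr := exr_le lc.
have [K0 K00 hPhi] := Phi_near lc hN.
(* In the induction below, z and b are halved and [double_est] is used with L = 2 and B = |b|. The
   remainder becomes (L + 1) / 4 = 3 / 4 of itself, and 320 solves 80 + (3 / 4) x = x, so the
   quadratic part reproduces itself. Letting k tend to infinity leaves the quadratic part only. *)
pose K2 := 6 * C + K0; pose K4 := 320 * C.
have K20 : 0 <= K2 by rewrite addr_ge0// mulr_ge0.
have K40 : 0 <= K4 by rewrite mulr_ge0.
have main k : forall z b, `|z| <= q / 16 -> `|b| <= q / 16 ->
   `|c (gq z b) - b *m Phi (A z)| <= K4 * `|b| ^+ 2 + (3 / 4) ^+ k * (K2 * (`|z| + `|b|) * `|b|).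
  elim: k => [|k IH] {}z b hz hb.
    have [_ h1] := @gq_base z b ltac:(lra) ltac:(lra).
    have h2 : `|b *m Phi (A z) - b| <= K0 * `|z| * `|b| by apply: hPhi; lra.
    have -> : c (gq z b) - b *m Phi (A z) = (c (gq z b) - b) - (b *m Phi (A z) - b).
      by rewrite opprB addrA subrK.
    apply: le_trans (ler_normB _ _) _; apply: le_trans (lerD h1 h2) _.
    have b2 : 0 <= K4 * `|b| ^+ 2 by rewrite mulr_ge0// sqr_ge0.
    have b3 : 0 <= K0 * (`|b| * `|b|) by rewrite !mulr_ge0.
    rewrite expr0 mul1r /K2; have -> : (6 * C + K0) * (`|z| + `|b|) * `|b| =
      6 * C * (`|z| + `|b|) * `|b| + K0 * `|z| * `|b| + K0 * (`|b| * `|b|) by ring.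
    lra.
  pose z' := 2^-1 *: z; pose b' := 2^-1 *: b.
  have Ez : z = 2 *: z' by rewrite scalerA mulfV ?scale1r.
  have Eb : b = 2 *: b' by rewrite scalerA mulfV ?scale1r.
  have nz : `|z'| = `|z| / 2 by rewrite normrZ ger0_norm ?invr_ge0// mulrC.
  have nb : `|b'| = `|b| / 2 by rewrite normrZ ger0_norm ?invr_ge0// mulrC.
  have z0 := normr_ge0 z; have b0 := normr_ge0 b.
  have hz' : `|z'| <= q / 16 by rewrite nz; lra.
  have hb' : `|b'| <= q / 16 by rewrite nb; lra.
  have [sg h1] := @gq_base z' b' ltac:(lra) ltac:(lra).
  have nzq : `|- z'| <= q by rewrite normrN; lra.
  have C6 : 6 * C * `|- z'| <= 1 by have := Caq nzq; lra.
  have hL v : `|v *m A (- z')| <= 2 * `|v|.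
    have h := A_small hN v nzq; have := norm_via (v *m A (- z')) v.
    have : 6 * C * `|- z'| * `|v| <= 1 * `|v| by exact: ler_wpM2r.
    lra.
  have gB : `|c (gq z' b')| <= 2 * `|b'|.
    have := norm_via (c (gq z' b')) b'.
    have aq : `|z'| + `|b'| <= q by lra.
    have : 6 * C * (`|z'| + `|b'|) * `|b'| <= 3 / 32 * `|b'|.
      by apply: ler_wpM2r => //; have := Caq aq; lra.
    have := normr_ge0 b'; lra.
  have one2 : 1 <= 2 :> R by lra.
  have two0 : 0 <= 2 :> R by lra.
  have [|_ h2] := @double_est z' b' 2 (2 * `|b'|) one2 hL sg gB; first by lra.
  rewrite -Ez -Eb in h2; have IHk := IH _ _ hz' hb'.
  set k' := c (gq z' b') in IHk h2; set f' := b' *m Phi (A z') in IHk.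
  have EP : b *m Phi (A z) = f' *m A (- z') + f'.
    by apply: (half_mulmx Eb); rewrite {1}Ez; exact: Phi_double.
  have h3 := dbl_combine two0 hL h2 IHk; rewrite EP.
  apply: le_trans h3 _; clear h1 h2 EP.
  rewrite nb nz; have ET : (3 / 4) ^+ k.+1 = 3 / 4 * (3 / 4) ^+ k :> R by rewrite exprS.
  rewrite ET /K4; set T := (3 / 4) ^+ k; set K' := K2; set b0' := `|b|; set z0' := `|z|.
  by clearbody T K' b0' z0'; apply: ler_eq; field.
move=> hz; exists (q / 16), K4; split => // [|b hb]; first by rewrite divr_gt0.
have [sg _] := @gq_base z b ltac:(lra) ltac:(lra).
split; first by apply: sm_le sg; lra.
have cv : (fun k => (3 / 4) ^+ k * (K2 * (`|z| + `|b|) * `|b|)) @ \oo --> (0 : R).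
  rewrite -(mul0r (K2 * (`|z| + `|b|) * `|b|)); apply: cvgMr_tmp; apply: cvg_expr.
  by rewrite ger0_norm; lra.
rewrite -subr_le0; apply: (cvg_cst_le0 cv); apply: nearW => k.
by rewrite lerBlDl; exact: main.
Qed.

Lemma dexp_double z : dexp_at z -> dexp_at (2 *: z).
Proof.
have C0 := lC_ge0 lc; have q0 := exr_gt0 lc; have qr := exr_le lc.
move=> [e [K [e0 K0 H]]].
have [L L1 hL] := mx_bound (A (- z)); have [L' L'1 hL'] := mx_bound (Phi (A z)).
pose B0 := L' + K * e.
have Ke : 0 <= K * e by rewrite mulr_ge0// ltW.
have B00 : 0 < B0 by rewrite /B0; lra.
pose e1 := Num.min e (q / (4 * L * B0)).
have L0 : 0 < L by lra.
have e10 : 0 < e1 by rewrite lt_min e0 /= divr_gt0// !mulr_gt0.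
have W0 : 0 <= 20 * C * L ^+ 2 * B0 ^+ 2 + (L + 1) * K.
  apply: addr_ge0; last by apply: mulr_ge0 => //; lra.
  apply: mulr_ge0; last exact: sqr_ge0.
  by apply: mulr_ge0; [apply: mulr_ge0|exact: sqr_ge0].
exists (2 * e1), (20 * C * L ^+ 2 * B0 ^+ 2 + (L + 1) * K).
split => [||b hb]; first by rewrite mulr_gt0.
  exact: W0.
pose b' := 2^-1 *: b.
have Eb : b = 2 *: b' by rewrite scalerA mulfV ?scale1r.
have nb : `|b'| = `|b| / 2 by rewrite normrZ ger0_norm ?invr_ge0// mulrC.
have hb' : `|b'| <= e1 by rewrite nb; lra.
have hbe : `|b'| <= e by apply: le_trans hb' _; rewrite ge_min lexx.
have b0 := normr_ge0 b'.
have hbq : 4 * L * B0 * `|b'| <= q.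
  have : `|b'| <= q / (4 * L * B0) by apply: le_trans hb' _; rewrite ge_min lexx orbT.
  by rewrite ler_pdivlMr ?mulr_gt0// mulrC.
have [sg h1] := H b' hbe.
have gB : `|c (gq z b')| <= B0 * `|b'|.
  apply: le_trans (norm_via _ (b' *m Phi (A z))) _.
  have h2 := hL' b'; have h3 : K * `|b'| ^+ 2 <= K * e * `|b'|.
    by rewrite expr2 mulrA; apply: ler_wpM2r => //; apply: ler_wpM2l.
  rewrite /B0; lra.
have LB : B0 * `|b'| <= L * (B0 * `|b'|) by rewrite ler_peMl// mulr_ge0// ltW.
have E4 : 4 * L * B0 * `|b'| = 4 * (L * (B0 * `|b'|)) by ring.
have sg2 : sm (q / 2) (gq z b') by case: sg => s1 s2; split => //; lra.
have [|s h2] := @double_est z b' L (B0 * `|b'|) L1 hL sg2 gB; first by lra.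
rewrite -Eb in s h2; split => //.
set k' := c (gq z b') in h1 h2; set f' := b' *m Phi (A z) in h1.
have EP : b *m Phi (A (2 *: z)) = f' *m A (- z) + f'.
  exact: (half_mulmx Eb (Phi_double lc hN nilN z)).
have h3 := dbl_combine (ltW L0) hL h2 h1; rewrite EP.
apply: le_trans h3 _; clear h1 h2 EP.
have -> : 20 * C * L ^+ 2 * (B0 * `|b'|) ^+ 2 + (L + 1) * (K * `|b'| ^+ 2) =
   (20 * C * L ^+ 2 * B0 ^+ 2 + (L + 1) * K) * `|b'| ^+ 2 by ring.
apply: (ler_wpM2l W0); rewrite ler_sqr ?nnegrE// nb; have := normr_ge0 b; lra.
Qed.

Lemma dexp z : dexp_at z.
Proof.
have q0 := exr_gt0 lc; have q16 : 0 < q / 16 by lra.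
have [m m0 hm] := arch_mul `|z| q16.
have H k : forall w, `|w| <= 2 ^+ k * (q / 16) -> dexp_at w.
  elim: k => [|k IH] w hw; first by apply: dexp_small; rewrite expr0 mul1r in hw.
  have -> : w = 2 *: (2^-1 *: w) by rewrite scalerA mulfV ?scale1r.
  apply: dexp_double; apply: IH; rewrite normrZ ger0_norm ?invr_ge0//.
  by rewrite exprS in hw; lra.
apply: (H m); apply: le_trans hm _; apply: ler_wpM2r; first exact: ltW.
by rewrite -natrX ler_nat ltnW// ltn_expl.
Qed.

End Dexp.

Definition bigO (R : realType) k (F : R -> R) :=
  exists2 K : R, 0 <= K & \forall h \near (0 : R), F h <= K * `|h| ^+ k.

Section BigO.
Variable R : realType.
Implicit Types F G : R -> R.

Lemma bigO_le k F G : (\forall h \near (0 : R), F h <= G h) -> bigO k G -> bigO k F.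
Proof. by move=> FG [K K0 H]; exists K => //; apply: filterS2 FG H => h; exact: le_trans. Qed.

Lemma bigO_add k F G : bigO k F -> bigO k G -> bigO k (fun h => F h + G h).
Proof.
move=> [K K0 H] [L L0 H']; exists (K + L); first exact: addr_ge0.
by apply: filterS2 H H' => h h1 h2; rewrite mulrDl lerD.
Qed.

Lemma bigO_mul k l F G : (forall h, 0 <= F h) -> (forall h, 0 <= G h) ->
  bigO k F -> bigO l G -> bigO (k + l) (fun h => F h * G h).
Proof.
move=> F0 G0 [K K0 H] [L L0 H']; exists (K * L); first exact: mulr_ge0.
apply: filterS2 H H' => h h1 h2; rewrite exprD.
by rewrite mulrACA; apply: ler_pM.
Qed.

Lemma bigO_cst k F a : 0 <= a -> bigO k F -> bigO k (fun h => a * F h).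
Proof.
move=> a0 [K K0 H]; exists (a * K); first exact: mulr_ge0.
by apply: filterS H => h h1; rewrite -mulrA ler_wpM2l.
Qed.

Lemma near_abs_le (a : R) : 0 < a -> \forall h \near (0 : R), `|h| <= a.
Proof.
move=> a0; have /cvgrPdist_le/(_ _ a0) : (fun t : R => t) @ (0 : R) --> (0 : R) by exact: cvg_id.
by apply: filterS => h; rewrite sub0r normrN.
Qed.

Lemma bigO_id : bigO 1 (fun h : R => `|h|).
Proof. by exists 1 => //; apply: filterS (near_abs_le ltr01) => h _; rewrite mul1r. Qed.

Lemma bigO_low k F : bigO k.+1 F -> bigO k F.
Proof.
move=> [K K0 H]; exists K => //; apply: filterS2 H (near_abs_le ltr01) => h h1 h2.
apply: le_trans h1 _; apply: ler_wpM2l => //; rewrite exprS ler_piMl// exprn_ge0//.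
Qed.

Lemma bigO_small F a : bigO 1 F -> 0 < a -> \forall h \near (0 : R), F h <= a.
Proof.
move=> [K K0 H] a0; have K1 : 0 < K + 1 by rewrite ltr_wpDl.
apply: filterS2 H (near_abs_le (divr_gt0 a0 K1)) => h h1 h2.
apply: le_trans h1 _; rewrite expr1; move: h2; rewrite ler_pdivlMr// mulrDr mulr1.
by have := normr_ge0 h; nra.
Qed.

End BigO.

Lemma near0_ex (R : realType) (P : R -> Prop) : (\forall h \near (0 : R), P h) ->
  exists2 e : R, 0 < e & forall h, `|h| <= e -> P h.
Proof.
move=> /nbhs_ballP[e /= e0 H]; exists (e / 2); first by rewrite divr_gt0.
move=> h he; apply: H; rewrite /ball /= sub0r normrN; apply: le_lt_trans he _.
by rewrite ltr_pdivrMr// ltr_pMr// ltr1n.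
Qed.

Lemma row_taylor (R : realType) n (p : 'I_n -> {poly R}) (t : R) :
  bigO 2 (fun h => `|\row_j (p j).[t + h] - \row_j (p j).[t] - h *: \row_j (p j)^`().[t]|).
Proof.
have /choice[K hK] : forall j, exists K : R, 0 <= K /\
    forall h, `|h| <= 1 -> `|(p j).[t + h] - (p j).[t] - h * (p j)^`().[t]| <= K * h ^+ 2.
  by move=> j; have [K K0 h] := poly_taylor (p j) t; exists K.
exists (\sum_j K j); first by apply: sumr_ge0 => j _; case: (hK j).
apply: filterS (near_abs_le ltr01) => h h1; apply: rV_norm_le => [|j].
  by rewrite mulr_ge0 ?exprn_ge0// sumr_ge0// => j _; case: (hK j).
rewrite !mxE; apply: le_trans ((hK j).2 h h1) _; rewrite real_normK ?num_real//.
apply: ler_wpM2r; first exact: sqr_ge0.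
by rewrite (bigD1 j)//= lerDl sumr_ge0// => i _; case: (hK i).
Qed.

Section CurveConst.
Variables (R : realType) (n : nat) (N : topGroupType) (lc : loc_chart R n N).
Local Notation c := (cc lc).
Local Notation r := (lr lc).
Local Notation C := (lC lc).
Local Notation sm := (sm lc).

(** If the left increments of a curve are quadratic, so are the increments of its coordinates seen
    from Q t0, and [quad_const] applies to each coordinate. *)
Lemma curve_const_loc (Q : R -> N) t0 :
  (forall t, (\forall h \near (0 : R), sm r ((Q t)^-1 * Q (t + h))%g) /\
     bigO 2 (fun h => `|c ((Q t)^-1 * Q (t + h))%g|)) ->
  exists2 e : R, 0 < e & forall s, `|s| <= e -> Q (t0 + s) = Q t0.
Proof.
move=> H; pose u s := ((Q t0)^-1 * Q (t0 + s))%g.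
have [e e0 he] := near0_ex (H t0).1.
have e2 : 0 < e / 2 by rewrite divr_gt0.
exists (e / 2) => // a ha.
have u0 : u 0 = 1%g by rewrite /u addr0 mulVg.
suff E : c (u a) = c (u 0).
  have ae : `|a| <= e by lra.
  have [h _] := he a ae; rewrite -/(u a) E u0 cc1 ci0 in h.
  by apply: (mulgI (Q t0)^-1%g); rewrite mulVg; exact: esym h.
apply/rowP => j; apply: (@quad_const R (fun s => c (u s) 0 j)) => t ht.
have te : `|t| <= e / 2 by exact: le_trans ha.
have [s1 [K K0 h1]] := H (t0 + t).
have [e' e'0 he'] := near0_ex (filterI s1 h1).
exists (Num.min (e / 2) e'), (2 * K); split; first by rewrite lt_min e2.
move=> h; rewrite le_min => /andP[h2 h3].
have [sw cw] := he' h h3.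
have -> : u (t + h) = (u t * ((Q (t0 + t))^-1 * Q (t0 + t + h)))%g.
  by rewrite /u addrA mulgA mulgK.
set w := (_^-1 * _)%g in sw cw *.
have su : sm r (u t) by apply: he; lra.
apply: le_trans (_ : `|c (u t * w)%g - c (u t)| <= _).
  by rewrite -rVB; exact: rV_norm_ge.
have m1 := M1 su sw; have C0 := lC_ge0 lc.
have cu : C * `|c (u t)| <= 1 / 16 by apply: lC_ball_small; case: su.
have m2 : C * `|c (u t)| * `|c w| <= 1 / 16 * `|c w| by apply: ler_wpM2r.
have := norm_via (c (u t * w)%g - c (u t)) (c w); have := normr_ge0 (c w).
rewrite real_normK ?num_real// in cw; lra.
Qed.

Lemma curve_const (Q : R -> N) :
  (forall t, (\forall h \near (0 : R), sm r ((Q t)^-1 * Q (t + h))%g) /\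
     bigO 2 (fun h => `|c ((Q t)^-1 * Q (t + h))%g|)) ->
  forall t, Q t = Q 0.
Proof.
(* The local result is globalized on the real line: the indicator function of Q t = Q 0 is locally
   constant, so [quad_const] applies with constant 0. *)
move=> H a; pose g t : R := if `[< Q t = Q 0 >] then 1 else 0.
have : g a = g 0.
  apply: quad_const => t _; have [e e0 he] := curve_const_loc t H.
  by exists e, 0; split => // h hh; rewrite /g he// subrr normr0 mul0r.
rewrite /g [X in _ = (if X then _ else _)]asboolT//.
by case: asboolP => // _ /esym/eqP; rewrite oner_eq0.
Qed.

End CurveConst.

(** * The polynomial group law, by integrating a differential equation *)

Section PolyIdeal.
Variable R : realType.

(** Polynomial functions divisible by t^k. Uniqueness for the differential equation below is proved
    by raising the order of vanishing at 0. *)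
Definition pideal k : set (R -> R) :=
  [set f | exists p : {poly R}, (forall t, f t = p.[t]) /\ forall i, (i < k)%N -> p`_i = 0].

Lemma pideal_add k f g : pideal k f -> pideal k g -> pideal k (fun t => f t + g t).
Proof.
move=> [p [h1 h2]] [q [h3 h4]]; exists (p + q); split => [t|i ik]; first by rewrite hornerD h1 h3.
by rewrite coefD h2// h4// addr0.
Qed.

Lemma pideal0 k : pideal k (fun _ => 0).
Proof. by exists 0; split => [t|i _]; rewrite ?horner0 ?coef0. Qed.

Lemma pideal_mul k f g : pideal k f -> polyfun g -> pideal k (fun t => f t * g t).
Proof.
move=> [p [h1 h2]] [q h3]; exists (p * q); split => [t|i ik]; first by rewrite hornerM h1 h3.
rewrite coefM big1// => -[j /= ji] _; rewrite h2 ?mul0r//.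
by apply: leq_ltn_trans ik; rewrite -ltnS.
Qed.

Lemma pideal_sum k (I : Type) (s : seq I) (F : I -> R -> R) :
  (forall i, pideal k (F i)) -> pideal k (fun t => \sum_(i <- s) F i t).
Proof.
move=> H; elim: s => [|i s IH]; first by under eq_fun do rewrite big_nil; exact: pideal0.
by under eq_fun do rewrite big_cons; exact: pideal_add.
Qed.

Lemma mxid_add k m n (F G : R -> 'M[R]_(m, n)) :
  mxin (pideal k) F -> mxin (pideal k) G -> mxin (pideal k) (fun t => F t + G t).
Proof. by move=> hF hG i j; under eq_fun do rewrite mxE; exact: pideal_add. Qed.

Lemma mxid_mulr k m n p (F : R -> 'M[R]_(m, n)) (G : R -> 'M[R]_(n, p)) :
  mxin (pideal k) F -> mxin (@polyfun R) G -> mxin (pideal k) (fun t => F t *m G t).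
Proof.
move=> hF hG i j; under eq_fun do rewrite mxE.
by apply: pideal_sum => l; apply: pideal_mul; [exact: hF | exact: hG].
Qed.

Lemma mxid_mull k m n p (F : R -> 'M[R]_(m, n)) (G : R -> 'M[R]_(n, p)) :
  mxin (@polyfun R) F -> mxin (pideal k) G -> mxin (pideal k) (fun t => F t *m G t).
Proof.
move=> hF hG i j; under eq_fun do rewrite mxE.
apply: pideal_sum => l; under eq_fun do rewrite mulrC.
by apply: pideal_mul; [exact: hG | exact: hF].
Qed.

Lemma mxid_exp k n (F G : R -> 'M[R]_n) l : mxin (@polyfun R) F -> mxin (@polyfun R) G ->
  mxin (pideal k) (fun t => F t - G t) -> mxin (pideal k) (fun t => F t ^+ l - G t ^+ l).
Proof.
move=> hF hG hFG; elim: l => [|l IH].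
  by move=> i j; under eq_fun do rewrite !expr0 subrr mxE; exact: pideal0.
have E t : F t ^+ l.+1 - G t ^+ l.+1 = F t *m (F t ^+ l - G t ^+ l) + (F t - G t) *m G t ^+ l.
  by rewrite mulmxBr mulmxBl !exprS addrA subrK.
under eq_fun do rewrite E; apply: mxid_add; first exact: mxid_mull.
by apply: mxid_mulr => //; apply: mxin_exp => //; exact: polyfun_subalg.
Qed.

Lemma mxid_Phi k n d (F G : R -> 'M[R]_n) : mxin (@polyfun R) F -> mxin (@polyfun R) G ->
  mxin (pideal k) (fun t => F t - G t) -> mxin (pideal k) (fun t => Phi d (F t) - Phi d (G t)).
Proof.
move=> hF hG hFG.
have hs := @polyfun_subalg R.
have h1 l : mxin (pideal k) (fun t => (F t - 1) ^+ l - (G t - 1) ^+ l).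
  apply: mxid_exp; [exact: mxin_sub (mxin_cst _ _)|exact: mxin_sub (mxin_cst _ _)|].
  by move=> i j; under eq_fun do rewrite opprB addrA subrK; exact: hFG.
move=> i j.
have E t : (Phi d (F t) - Phi d (G t)) i j =
    \sum_(l < d.+1) ((F t - 1) ^+ l - (G t - 1) ^+ l) i j * kap R l.
  rewrite mxE [X in _ + X]mxE !PhiE -sumrN -big_split; apply: eq_bigr => l _ /=.
  by rewrite [X in _ = X * _]mxE [X in _ = (_ + X) * _]mxE; ring.
under eq_fun do rewrite E; apply: pideal_sum => l; apply: pideal_mul; first exact: h1.
by exists (kap R l)%:P => t; rewrite hornerC.
Qed.

Lemma pideal_deriv k (p : {poly R}) : p.[0] = 0 -> pideal k (fun t => p^`().[t]) ->
  pideal k.+1 (fun t => p.[t]).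
Proof.
move=> p0 [q [h1 h2]]; exists p; split => // -[|i] ik; first by rewrite -horner_coef0.
have /eqP := h2 i ik; rewrite -(poly_ext h1) coef_deriv mulrn_eq0 /= => /eqP //.
Qed.

Lemma pideal_all0 (p : {poly R}) : (forall k, pideal k (fun t => p.[t])) -> p = 0.
Proof.
move=> H; apply/polyP => i; have [q [h1 h2]] := H i.+1.
by rewrite (poly_ext h1) h2// coef0.
Qed.

End PolyIdeal.

Lemma cvg_rV_entry (R : realType) n (u : nat -> 'rV[R]_n) (l : 'rV[R]_n) j :
  u @ \oo --> l -> (fun k => u k 0 j) @ \oo --> l 0 j.
Proof.
move=> h.
exact: (@cvg_comp _ _ _ u (fun x : 'rV[R]_n => x 0 j) \oo (nbhs l) _ h (@coord_continuous R 1 n 0 j l)).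
Qed.

Lemma row_ext (R : realType) n (f g : 'I_n -> R) : (forall j, f j = g j) -> \row_j f j = \row_j g j.
Proof. by move=> H; apply/rowP => j; rewrite !mxE. Qed.

Lemma mul_entry_aux (R : realType) n (U V W M L : 'M[R]_n) i j : U = V + W ->
  (U *m M) i j - (W *m L) i j = (V *m M + W *m (M - L)) i j.
Proof.
move=> ->; rewrite mulmxDl mulmxBr; move: (V *m M) (W *m M) (W *m L) => a b c.
by rewrite !mxE addrA.
Qed.

Section BCH.
Variables (R : realType) (n : nat) (N : topGroupType) (lc : loc_chart R n N).
Hypothesis hN : hausdorff_space N.
Hypothesis nilN : nilpotent_group N.
Implicit Types u v w x y z b : 'rV[R]_n.
Local Notation c := (cc lc).
Local Notation r := (lr lc).
Local Notation C := (lC lc).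
Local Notation q := (exr lc).
Local Notation ex := (ex lc).
Local Notation sm := (sm lc).
Local Notation d := (nilcls lc).
Local Notation A := (A lc).
Local Notation Ad := (Ad lc).
Local Notation jet := (jet lc).
Local Notation Phi := (Phi d).
Local Notation Jm := (Jm d).
Local Notation Bc := (Bc lc).

Lemma row_deriv_seq (F : 'I_n -> {poly R}) (t : R) :
  (fun k => k.+1%:R *: (\row_j (F j).[t + k.+1%:R^-1] - \row_j (F j).[t])) @ \oo -->
  \row_j (F j)^`().[t].
Proof.
apply: cvg_rV => j; rewrite mxE.
have := @poly_deriv_seq R (F j \Po ('X + t%:P)).
have -> : (F j \Po ('X + t%:P))`_1 = (F j)^`().[t].
  rewrite -[LHS]mulr1n -coef_deriv -horner_coef0 deriv_comp derivD derivX derivC addr0 mulr1.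
  by rewrite horner_comp hornerD hornerX hornerC add0r.
have E h : (F j \Po ('X + t%:P)).[h] = (F j).[t + h].
  by rewrite horner_comp hornerD hornerX hornerC addrC.
by apply: cvg_near_eq; apply: nearW => k; rewrite !E addr0 !mxE.
Qed.

(** Writing g (t + h) as g t times a left increment reduces the derivative at t to that of Ad at 1,
    given by [jet_Ad]. *)
Lemma Ad_curve_deriv (g : R -> N) (F : 'I_n -> 'I_n -> {poly R}) t w :
  (forall s i j, Ad (g s) i j = (F i j).[s]) ->
  jet (fun k => (g t)^-1 * g (t + k.+1%:R^-1))%g w ->
  forall i j, (F i j)^`().[t] = (Bc w 1 *m Ad (g t)) i j.
Proof.
move=> hF jw i j; set e := (delta_mx 0 i : 'rV[R]_n).
have eF s : e *m Ad (g s) = \row_l (F i l).[s].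
  by rewrite -rowE; apply/rowP => l; rewrite !mxE hF.
have h1 := @row_deriv_seq (F i) t.
have h2 : (fun k => k.+1%:R *: (e *m Ad ((g t)^-1 * g (t + k.+1%:R^-1))%g - e) *m Ad (g t)) @ \oo -->
    e *m Bc w 1 *m Ad (g t).
  have h : (fun k => k.+1%:R *: (e *m Ad ((g t)^-1 * g (t + k.+1%:R^-1))%g - e)) @ \oo --> e *m Bc w 1.
    exact: jet_Ad.
  apply: cvg_rV => l; rewrite mxE; under eq_fun do rewrite mxE.
  apply: (cvg_sum (F := fun a k => (k.+1%:R *: (e *m Ad ((g t)^-1 * g (t + k.+1%:R^-1))%g - e)) 0 a * Ad (g t) a l)) => a; apply: cvgMr_tmp.
  exact: (@cvg_rV_entry R n _ _ a h).
have h3 : \row_l (F i l)^`().[t] = e *m Bc w 1 *m Ad (g t).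
  apply: (cvg_unique _ h1 _); first exact: norm_hausdorff.
  apply: cvg_near_eq h2; apply: nearW => k.
  rewrite -scalemxAl mulmxBl -mulmxA -Ad_mul// mulgA mulgV mul1g.
  by rewrite -!eF.
by have := congr1 (fun M : 'rV[R]_n => M 0 j) h3; rewrite -mulmxA -rowE !mxE.
Qed.

Lemma mxid_Bc k (F : R -> 'rV[R]_n) : mxin (pideal (R := R) k) F ->
  mxin (pideal (R := R) k) (fun t => Bc (F t) 1).
Proof.
move=> hF i j.
have E v : Bc v 1 = \sum_l v 0 l *: Bc (delta_mx 0 l) 1.
  rewrite {1}(row_sum_delta v); elim/big_rec2: _ => [|l v' w _ <-].
    by rewrite -[0](scale0r 0) BcZ// expr1 scale0r.
  by rewrite BcD// BcZ// expr1.
under eq_fun do rewrite E summxE; apply: pideal_sum => l; under eq_fun do rewrite mxE.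
by apply: pideal_mul; [exact: hF | exists (Bc (delta_mx 0 l) 1 i j)%:P => t; rewrite hornerC].
Qed.

Variables x y : 'rV[R]_n.

(** The curve [Z] should satisfy exp (Z t) = exp x exp (t y), hence Z' = y (Phi (A (Z t)))^-1. The
    velocity [z'] uses the explicit [L] t in place of A (Z t), so that [Z] is defined by integrating
    a known polynomial; [bch_A] then justifies the replacement. *)
Let L t := Ad (ex x * ex (t *: y))%g.
Let z' t := y *m Jm (L t).

Lemma bch_LE t : L t = A (t *: y) *m A x. Proof. exact: Ad_mul. Qed.

Lemma bch_Lpoly : mxin (@polyfun R) L.
Proof.
have hs := @polyfun_subalg R.
have -> : L = (fun t => A (t *: y) *m A x) by apply/funext => t; exact: bch_LE.
apply: mxin_mul => //; last exact: mxin_cst.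
by apply: A_fun => //; apply: mxin_scale; [|exact: polyfun_id|exact: mxin_cst].
Qed.

Lemma bch_zpoly : mxin (@polyfun R) z'.
Proof.
have hs := @polyfun_subalg R.
by apply: mxin_mul => //; [exact: mxin_cst | apply: Jm_fun => //; exact: bch_Lpoly].
Qed.

Let p j : {poly R} := topoly (fun t => z' t 0 j).
Let Z t := x + \row_j (aint (p j)).[t].

Lemma bch_pE j t : z' t 0 j = (p j).[t].
Proof. by have [p' hp] := bch_zpoly 0 j; rewrite /p (topolyE hp). Qed.

Lemma bch_Z0 : Z 0 = x.
Proof. by apply/rowP => j; rewrite !mxE aint0 addr0. Qed.

Lemma bch_dZ t : bigO 2 (fun h => `|Z (t + h) - Z t - h *: z' t|).
Proof.
apply: bigO_le (row_taylor (fun j => aint (p j)) t); apply: filterS (near_abs_le ltr01) => h _.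
apply: ler_eq; congr (`|_|); have -> : z' t = \row_j (aint (p j))^`().[t].
  by apply/rowP => j; rewrite [RHS]mxE aint_deriv -bch_pE.
by rewrite /Z opprD addrACA subrr add0r.
Qed.

Lemma bch_Zpoly : mxin (@polyfun R) Z.
Proof.
have hs := @polyfun_subalg R.
apply: mxin_add => //; first exact: mxin_cst.
by move=> i j; under eq_fun do rewrite mxE; exact: polyfun_horner.
Qed.

Let M t := A (Z t).

Lemma bch_Mpoly : mxin (@polyfun R) M.
Proof. by apply: A_fun => //; [exact: polyfun_subalg | exact: bch_Zpoly]. Qed.

Lemma bch_gq t : (\forall h \near (0 : R), sm r (gq lc (Z t) (Z (t + h) - Z t))) /\
  bigO 2 (fun h => `|c (gq lc (Z t) (Z (t + h) - Z t)) - h *: (z' t *m Phi (M t))|).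
Proof.
have [e [K [e0 K0 H]]] := dexp lc hN nilN (Z t).
have dZ := bch_dZ t.
have O1 : bigO 1 (fun h => `|Z (t + h) - Z t|).
  apply: (@bigO_le _ _ _ (fun h => `|Z (t + h) - Z t - h *: z' t| + `|z' t| * `|h|)).
    apply: filterS (near_abs_le ltr01) => h _.
    by apply: le_trans (norm_via _ (h *: z' t)) _; rewrite normrZ mulrC.
  apply: bigO_add; first exact: bigO_low.
  by apply: bigO_cst => //; exact: bigO_id.
have small := bigO_small O1 e0.
split; first by apply: filterS small => h /H [].
have [L1 L11 hL] := mx_bound (Phi (M t)).
apply: (@bigO_le _ _ _ (fun h => K * (`|Z (t + h) - Z t| * `|Z (t + h) - Z t|) +
   L1 * `|Z (t + h) - Z t - h *: z' t|)).
  apply: filterS small => h /H [_ h1].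
  apply: le_trans (norm_via _ ((Z (t + h) - Z t) *m Phi (M t) - h *: (z' t *m Phi (M t)))) _.
  apply: lerD; first by rewrite opprB addrA subrK -expr2.
  by rewrite scalemxAl -mulmxBl; exact: hL.
apply: bigO_add; last by apply: bigO_cst => //; lra.
by apply: bigO_cst => //; apply: (@bigO_mul _ 1 1).
Qed.

Lemma jet_of_bigO (g : R -> N) w : (\forall h \near (0 : R), sm r (g h)) ->
  bigO 2 (fun h => `|c (g h) - h *: w|) -> jet (fun k => g k.+1%:R^-1) w.
Proof.
move=> h1 [K K0 h2]; have i0 := @inv_cvg0 R.
split.
  have h3 : \forall k \near \oo, sm r (g k.+1%:R^-1) by exact: (i0 _ h1).
  by apply: filterS h3 => k [].
have hK : (fun k : nat => K * k.+1%:R^-1 : R) @ \oo --> (0 : R).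
  by rewrite -(mulr0 K); apply: cvgM => //; exact: cvg_cst.
have cw : (fun _ : nat => w) @ \oo --> w by exact: cvg_cst.
apply: (cvg_perturb cw); apply: (cvg_norm0 hK).
have h3 : \forall k \near \oo, `|c (g k.+1%:R^-1) - k.+1%:R^-1 *: w| <= K * `|k.+1%:R^-1| ^+ 2.
  by exact: (i0 _ h2).
apply: filterS h3 => k.
have k0 : (0 : R) < k.+1%:R by rewrite ltr0n.
rewrite ger0_norm ?invr_ge0// => h.
have -> : k.+1%:R *: c (g k.+1%:R^-1) - w = k.+1%:R *: (c (g k.+1%:R^-1) - k.+1%:R^-1 *: w).
  by rewrite scalerBr scalerA mulfV ?scale1r// gt_eqF.
rewrite subr0 normrZ (ger0_norm (ltW k0)); apply: le_trans (ler_wpM2l (ltW k0) h) _.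
by apply: ler_eq; rewrite expr2 mulrCA (mulrA k.+1%:R) mulfV ?mul1r// gt_eqF.
Qed.

Lemma bch_A t : M t = L t.
Proof.
have hs := @polyfun_subalg R.
pose Mp i j := topoly (fun s => M s i j); pose Lp i j := topoly (fun s => L s i j).
have hM s i j : M s i j = (Mp i j).[s].
  by have [p' hp] := bch_Mpoly i j; rewrite /Mp (topolyE hp).
have hL s i j : L s i j = (Lp i j).[s].
  by have [p' hp] := bch_Lpoly i j; rewrite /Lp (topolyE hp).
have dM s i j : (Mp i j)^`().[s] = (Bc (z' s *m Phi (M s)) 1 *m M s) i j.
  apply: (@Ad_curve_deriv (fun s => ex (Z s))) => //.
  have [g1 g2] := bch_gq s; apply: jet_eq (jet_of_bigO g1 g2).
  by apply: nearW => k; rewrite /gq addrC subrK ex_N.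
have dL s i j : (Lp i j)^`().[s] = (Bc y 1 *m L s) i j.
  apply: (@Ad_curve_deriv (fun s => ex x * ex (s *: y))%g) => //.
  apply: jet_eq (jet_ex lc y); apply: nearW => k.
  by rewrite -(ex_add lc hN) invgM -!mulgA mulKg mulKg.
have zL s : z' s *m Phi (L s) = y.
  by rewrite -mulmxA JPhi ?mulmx1//; exact: Ad_unip.
(* Both functions solve a linear equation: M' = ad (z' Phi (M)) M and L' = ad (y) L with y = z' Phi
   (L). If M - L is divisible by t^k, so is its derivative, and M - L, vanishing at 0, is divisible
   by t^(k + 1). *)
suff H k : mxin (@pideal R k) (fun s => M s - L s).
  apply/matrixP => i j; rewrite hM hL; congr (_.[_]); apply/eqP; rewrite -subr_eq0; apply/eqP.
  apply: pideal_all0 => k; have := H k i j.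
  by under eq_fun do rewrite [_ i j]mxE [X in _ + X]mxE hM hL -hornerN -hornerD.
elim: k => [|k IH] i j.
  have [p' hp] := mxin_sub hs bch_Mpoly bch_Lpoly i j; by exists p'; split.
have E s : (M s - L s) i j = (Mp i j - Lp i j).[s].
  by rewrite [LHS]mxE [X in _ + X]mxE hM hL hornerD hornerN.
under eq_fun do rewrite E; apply: pideal_deriv.
  by rewrite -E /M bch_Z0 /L scale0r ex0 mulg1 subrr mxE.
have E' s : (Mp i j - Lp i j)^`().[s] =
   (Bc (z' s *m (Phi (M s) - Phi (L s))) 1 *m M s + Bc y 1 *m (M s - L s)) i j.
  rewrite derivB hornerD hornerN dM dL.
  have : Bc (z' s *m (Phi (M s) - Phi (L s)) + y) 1 = Bc (z' s *m (Phi (M s) - Phi (L s))) 1 + Bc y 1.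
    exact: BcD.
  have -> : z' s *m (Phi (M s) - Phi (L s)) + y = z' s *m Phi (M s) by rewrite mulmxBr zL subrK.
  exact: mul_entry_aux.
under eq_fun do rewrite E'; apply: mxid_add.
  apply: mxid_mulr; last exact: bch_Mpoly.
  apply: mxid_Bc; apply: mxid_mull; first exact: bch_zpoly.
  by apply: mxid_Phi => //; [exact: bch_Mpoly | exact: bch_Lpoly].
by apply: mxid_mull => //; exact: mxin_cst.
Qed.

Lemma ex_conj_bigO (g : N) (v : R -> N) :
  bigO 2 (fun h => `|c (v h)|) -> (\forall h \near (0 : R), sm r (v h)) ->
  (\forall h \near (0 : R), sm r (g * v h * g^-1)%g) /\ bigO 2 (fun h => `|c (g * v h * g^-1)%g|).
Proof.
move=> v2 v1; have q0 := exr_gt0 lc; have q2 : 0 < q / 2 by rewrite divr_gt0.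
have [L1 L11 hL] := mx_bound (Ad g); have L10 : 0 < L1 by lra.
have sv := bigO_small (bigO_low v2) q2.
have qL : 0 < q / (2 * L1) by rewrite divr_gt0// mulr_gt0.
have sv2 := bigO_small (bigO_low v2) qL.
have key : \forall h \near (0 : R), sm r (g * v h * g^-1)%g /\ `|c (g * v h * g^-1)%g| <= 4 * L1 * `|c (v h)|.
  apply: filterS3 v1 sv sv2 => h [e1 _] h2 h3.
  have [w w1 w2] := ex_surj (conj e1 h2 : sm (q / 2) (v h)).
  have wL := hL w.
  have w3 : `|w *m Ad g| <= 2 * L1 * `|c (v h)|.
    by apply: le_trans wL _; have := ler_wpM2l (ltW L10) w1; lra.
  have w4 : `|w *m Ad g| <= q.
    by apply: le_trans w3 _; rewrite mulrC -ler_pdivlMr// mulr_gt0.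
  have -> : (g * v h * g^-1)%g = ex (w *m Ad g) by rewrite -AdE// w2.
  split; first exact: ex_smr.
  by have [_ h4] := ex_sm w4; lra.
split; first by apply: filterS key => h [].
apply: (@bigO_le _ _ _ (fun h => 4 * L1 * `|c (v h)|)); first by apply: filterS key => h [].
by apply: bigO_cst => //; rewrite mulr_ge0// ltW.
Qed.

(** A left increment of W t = exp (Z t) exp (- t y) is the conjugate by exp (t y) of the left
    increment of exp (Z t) times exp (- h y). The first-order terms h y and - h y cancel, so
    [curve_const] applies. *)
Lemma bch_curve t : (ex (Z t) * ex (- (t *: y)) = ex x)%g.
Proof.
have C0 := lC_ge0 lc; have r0 := lr_gt0 lc; have q0 := exr_gt0 lc.
pose W t := (ex (Z t) * ex (- (t *: y)))%g.
rewrite -/(W t) (_ : ex x = W 0); last by rewrite /W bch_Z0 scale0r oppr0 ex0 mulg1.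
apply: (curve_const (lc := lc)) => {}t.
pose v h := (gq lc (Z t) (Z (t + h) - Z t) * ex (- (h *: y)))%g.
have E h : ((W t)^-1 * W (t + h) = ex (t *: y) * v h * (ex (t *: y))^-1)%g.
  rewrite /W /v /gq (addrC (Z t)) subrK invgM !ex_N// invgK scalerDl.
  have -> : ex (t *: y + h *: y) = (ex (t *: y) * ex (h *: y))%g by rewrite ex_add// scalerDl.
  by rewrite invgM !mulgA.
have [g1 g2] := bch_gq t.
have zy : z' t *m Phi (M t) = y.
  by rewrite bch_A -mulmxA JPhi ?mulmx1//; exact: Ad_unip.
rewrite zy in g2.
have yq : 0 < q / (`|y| + 1) by rewrite divr_gt0// ltr_wpDl.
have n1 : \forall h \near (0 : R), `|- (h *: y)| <= q.
  apply: filterS (near_abs_le yq) => h; rewrite normrN normrZ ler_pdivlMr ?ltr_wpDl//.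
  by apply: le_trans; apply: ler_wpM2l => //; rewrite lerDl.
have o1' : bigO 2 (fun h => `|c (ex (- (h *: y))) + h *: y|).
  exists (2 * C * `|y| ^+ 2); first by rewrite !mulr_ge0// sqr_ge0.
  apply: filterS n1 => h hq; have := c_ex_approx hq; rewrite opprK normrN normrZ => /le_trans.
  by apply; apply: ler_eq; ring.
have o2' : bigO 1 (fun h => `|c (ex (- (h *: y)))|).
  exists (2 * `|y|); first by rewrite mulr_ge0.
  apply: filterS n1 => h hq; have [_] := ex_sm hq; rewrite normrN normrZ => /le_trans.
  by apply; apply: ler_eq; ring.
have o3' : bigO 1 (fun h => `|c (gq lc (Z t) (Z (t + h) - Z t))|).
  apply: (@bigO_le _ _ _ (fun h => `|c (gq lc (Z t) (Z (t + h) - Z t)) - h *: y| + `|y| * `|h|)).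
    apply: filterS g1 => h _; apply: le_trans (norm_via _ (h *: y)) _; by rewrite normrZ mulrC.
  apply: bigO_add; first exact: bigO_low.
  by apply: bigO_cst => //; exact: bigO_id.
have v2 : bigO 2 (fun h => `|c (v h)|).
  apply: (@bigO_le _ _ _ (fun h => (`|c (gq lc (Z t) (Z (t + h) - Z t)) - h *: y| +
     `|c (ex (- (h *: y))) + h *: y|) +
     C * (`|c (gq lc (Z t) (Z (t + h) - Z t))| * `|c (ex (- (h *: y)))|))).
    apply: filterS2 g1 n1 => h h1 /ex_smr h2; have m1 := M1 h1 h2.
    move: m1; rewrite -/(v h); set a := c (gq _ _ _); set b := c (ex _) => m1.
    have : `|a + b| <= `|a - h *: y| + `|b + h *: y|.
      have -> : a + b = (a - h *: y) + (b + h *: y).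
        by rewrite addrACA [- _ + _]addrC subrr addr0.
      exact: ler_normD.
    move=> h5; apply: le_trans (norm_via _ (a + b)) _.
    move: m1 h5; rewrite -/(v h); move: (`|a - h *: y| + _) (c (v h)) => s w m1 h5.
    have -> : w - (a + b) = w - a - b by rewrite opprD addrA.
    by rewrite [leRHS]addrC mulrA; exact: lerD.
  apply: bigO_add; first exact: bigO_add.
  by apply: bigO_cst => //; apply: (@bigO_mul _ 1 1).
have v1 : \forall h \near (0 : R), sm r (v h).
  have s2 := bigO_small (bigO_low v2) r0.
  apply: filterS3 g1 n1 s2 => h [a1 a2] /ex_smr [b1 b2] h3; split => //.
  exact: (ccM a1 a2 b1 b2).
have [e1 e2] := ex_conj_bigO (ex (t *: y)) v2 v1.
split; first by apply: filterS e1 => h; rewrite E.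
by apply: bigO_le e2; apply: filterS e1 => h _; rewrite E.
Qed.

Lemma bch_final :
  (ex (x + \row_j integ01 (fun t => (y *m Jm (A (t *: y) *m A x)) 0%R j)) = ex x * ex y)%g.
Proof.
have -> : x + \row_j integ01 (fun t => (y *m Jm (A (t *: y) *m A x)) 0 j) = Z 1.
  apply: (congr1 (+%R x)); apply: row_ext => j; rewrite /integ01 /p.
  by congr ((aint (topoly _)).[1]); apply/funext => t; rewrite /z' bch_LE.
have := bch_curve 1; rewrite scale1r ex_N// => h.
by rewrite -[in RHS]h mulgVK.
Qed.

End BCH.

Section Plaw.
Variables (R : realType) (n : nat) (N : topGroupType) (lc : loc_chart R n N).
Hypothesis hN : hausdorff_space N.
Hypothesis nilN : nilpotent_group N.
Local Notation ex := (ex lc).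
Local Notation d := (nilcls lc).

(* The definition is sealed: conversion tests must not unfold it. *)
Lemma Plaw_key : {P : 'rV[R]_n -> 'rV[R]_n -> 'rV[R]_n | P = fun x y =>
  x + \row_j integ01 (fun t => (y *m Jm d (A lc (t *: y) *m A lc x)) 0 j)}.
Proof. by eexists. Qed.

Definition Plaw : 'rV[R]_n -> 'rV[R]_n -> 'rV[R]_n := sval Plaw_key.

Lemma PlawE x y : Plaw x y =
  x + \row_j integ01 (fun t => (y *m Jm d (A lc (t *: y) *m A lc x)) 0 j).
Proof. by rewrite /Plaw (svalP Plaw_key). Qed.

Lemma ex_Plaw x y : ex (Plaw x y) = (ex x * ex y)%g.
Proof.
by rewrite PlawE; exact: bch_final.
Qed.

Lemma Plaw_poly : polymap2 Plaw.
Proof.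
move=> X S hS f g hf hg; under eq_fun do rewrite PlawE; apply: mxin_add => // i j.
under eq_fun do rewrite mxE.
apply: (@polyA_integ R X S hS ( fun xt : X * R => (g xt.1 *m Jm d (A lc (xt.2 *: g xt.1) *m A lc (f xt.1))) 0 j)).
have hp := polyA_subalg hS.
have hf' : mxin (polyA S) (fun xt : X * R => f xt.1) by move=> a b; exact: (polyA_fst hS (hf a b)).
have hg' : mxin (polyA S) (fun xt : X * R => g xt.1) by move=> a b; exact: (polyA_fst hS (hg a b)).
apply: (mxin_mul hp hg'); apply: Jm_fun => //; apply: mxin_mul => //; last exact: (A_fun lc hN nilN hp hf').
by apply: (A_fun lc hN nilN) => //; apply: mxin_scale => //; exact: polyA_snd.
Qed.

End Plaw.

Lemma cvg_rVF (R : realType) n (T : Type) (F : set_system T) (FF : Filter F)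
    (f : T -> 'rV[R]_n) (l : 'rV[R]_n) :
  (forall j, (fun t => f t 0 j) @ F --> l 0 j) -> f @ F --> l.
Proof.
move=> H; apply/cvgrPdist_le => eps e0.
have H' : \forall t \near F, forall j, `|l 0 j - f t 0 j| <= eps.
  by apply: filter_forall => j; have /cvgrPdist_le := H j; apply.
apply: filterS H' => t ht; apply: rV_norm_le; first exact: ltW.
by move=> j; rewrite !mxE; exact: ht.
Qed.

Lemma cont_subalg (R : realType) (T : topologicalType) : is_subalg [set f : T -> R | continuous f].
Proof.
split => [a x|f g hf hg x|f g hf hg x]; first exact: cvg_cst.
  exact: cvgD (hf x) (hg x).
exact: cvgM (hf x) (hg x).
Qed.

Lemma mxin_continuous (R : realType) n (T : topologicalType) (f : T -> 'rV[R]_n) :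
  mxin [set f : T -> R | continuous f] f -> continuous f.
Proof. by move=> H x; apply: cvg_rVF => j; exact: H. Qed.

Lemma continuous_mxin (R : realType) n (T : topologicalType) (f : T -> 'rV[R]_n) :
  continuous f -> mxin [set f : T -> R | continuous f] f.
Proof.
move=> H i j x; rewrite (ord1 i).
exact: (@cvg_comp _ _ _ f (fun x : 'rV[R]_n => x 0 j) (nbhs x) (nbhs (f x)) _ (H x) (@coord_continuous R 1 n 0 j (f x))).
Qed.

Lemma polymap2_cont (R : realType) n1 n2 m (P : 'rV[R]_n1 -> 'rV[R]_n2 -> 'rV[R]_m)
    (T : topologicalType) (f : T -> 'rV[R]_n1) (g : T -> 'rV[R]_n2) :
  polymap2 P -> continuous f -> continuous g -> continuous (fun t => P (f t) (g t)).
Proof.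
move=> hP hf hg; apply: mxin_continuous; apply: hP; first exact: cont_subalg.
  exact: continuous_mxin.
exact: continuous_mxin.
Qed.

Lemma near_left (N : topGroupType) (x : N) (U : set N) : nbhs 1%g U ->
  \forall y \near x, U (x^-1 * y)%g.
Proof.
move=> hU.
have h : (fun y : N => x^-1 * y)%g @ x --> (1%g : N).
  rewrite -(mulVg x).
  apply: (@cvg_comp _ _ _ (fun y => (x^-1, y)%g) (fun p : N * N => p.1 * p.2)%g (nbhs x)
    (nbhs ((x^-1)%g, x))); last exact: (@mulg_continuous N ((x^-1)%g, x)).
  by apply: cvg_pair; [exact: cvg_cst | exact: cvg_id].
exact: (h U hU).
Qed.

Lemma quotient_telescope (G : groupType) (a b c d : G) :
  ((a^-1 * b) * (b^-1 * c) = (a^-1 * d) * (d^-1 * c))%g.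
Proof. by rewrite -!mulgA !mulVKg. Qed.

(** * Bijectivity of exp *)

Section ExpBij.
Variables (R : realType) (n : nat) (N : topGroupType) (lc : loc_chart R n N).
Hypothesis hN : hausdorff_space N.
Hypothesis nilN : nilpotent_group N.
Implicit Types u v w x y z : 'rV[R]_n.
Local Notation c := (cc lc).
Local Notation q := (exr lc).
Local Notation ex := (ex lc).
Local Notation sm := (sm lc).
Local Notation P := (Plaw lc).

Lemma exP x y : ex (P x y) = (ex x * ex y)%g. Proof. exact: ex_Plaw. Qed.
Lemma exP3l x y z : ex (P (P x y) z) = (ex x * ex y * ex z)%g. Proof. by rewrite exP exP. Qed.
Lemma exP3r x y z : ex (P x (P y z)) = (ex x * ex y * ex z)%g. Proof. by rewrite exP exP mulgA. Qed.
Let Pp : polymap2 P := @Plaw_poly _ _ _ lc hN nilN.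

Lemma PlawX0 x : P x 0 = x.
Proof.
rewrite PlawE (_ : \row_j _ = 0) ?addr0//; apply/rowP => j; rewrite [LHS]mxE [RHS]mxE /integ01.
rewrite (@topolyE R _ 0) => [|t]; last by rewrite mul0mx horner0 mxE.
by rewrite -(@aint_uniq R 0 0) ?horner0// deriv0.
Qed.

(** Local injectivity gives equality near 0, and polynomials propagate it. In this way identities in
    the group pass to [P] before exp is known to be injective. *)
Lemma poly_curve_eq (F G : R -> 'rV[R]_n) : mxin (@polyfun R) F -> mxin (@polyfun R) G ->
  F 0 = 0 -> G 0 = 0 -> (forall t, ex (F t) = ex (G t)) -> forall t, F t = G t.
Proof.
move=> hF hG F0 G0 H; have q0 := exr_gt0 lc.
have sml (K : R -> 'rV[R]_n) : mxin (@polyfun R) K -> K 0 = 0 -> \forall t \near (0 : R), `|K t| <= q.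
  move=> hK K0; have cK : continuous K.
    apply: mxin_continuous => i j; have [p hp] := hK i j.
    by rewrite (_ : (fun x : R => K x i j) = (fun x : R => p.[x])); [exact: horner_cont | exact/funext].
  have /cvgrPdist_le/(_ _ q0) := cK 0; rewrite K0.
  by apply: filterS => t; rewrite sub0r normrN.
have [e e0 he] := near0_ex (filterI (sml _ hF F0) (sml _ hG G0)).
move=> t; apply/rowP => j; apply/eqP; rewrite -subr_eq0; apply/eqP.
apply: (@polyfun_small0 R (fun t => F t 0 j - G t 0 j) e e0).
  by apply: (sa_sub (polyfun_subalg R)); [exact: hF | exact: hG].
move=> s s0 se; have ns : `|s| <= e by rewrite ger0_norm// ltW.
have [h1 h2] := he s ns.
by rewrite (ex_inj h1 h2 (H s)) subrr.
Qed.

Let hs := polyfun_subalg R.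

Lemma polyfun_line x : mxin (@polyfun R) (fun t => t *: x).
Proof. by apply: mxin_scale => //; [exact: polyfun_id | exact: mxin_cst]. Qed.

Lemma PlawA x y z : P (P x y) z = P x (P y z).
Proof.
suff H : forall t : R, P (P (t *: x) (t *: y)) (t *: z) = P (t *: x) (P (t *: y) (t *: z)).
  by have := H 1; rewrite !scale1r.
apply: (@poly_curve_eq (fun t => P (P (t *: x) (t *: y)) (t *: z)) (fun t => P (t *: x) (P (t *: y) (t *: z)))).
- by apply: Pp => //; [apply: Pp => //|]; exact: polyfun_line.
- by apply: Pp => //; [|apply: Pp => //]; exact: polyfun_line.
- by rewrite !scale0r PlawX0 PlawX0.
- by rewrite !scale0r PlawX0 PlawX0.
- by move=> t; apply: (eq_trans (exP3l _ _ _)); apply: (eq_trans _ (esym (exP3r _ _ _))).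
Qed.

Lemma Plaw_line x s t : P (s *: x) (t *: x) = (s + t) *: x.
Proof.
pose F : R -> 'rV[R]_n := fun u : R => P (u *: (s *: x)) (u *: (t *: x)).
pose G : R -> 'rV[R]_n := fun u : R => u *: ((s + t) *: x).
have hF : mxin (@polyfun R) F by apply: Pp => //; exact: polyfun_line.
have hG : mxin (@polyfun R) G by exact: polyfun_line.
have F0 : F 0 = 0 by rewrite /F !scale0r PlawX0.
have G0 : G 0 = 0 by rewrite /G scale0r.
have FG (u : R) : ex (F u) = ex (G u).
  by apply: (eq_trans (exP _ _)); rewrite /G !scalerA ex_add// mulrDr.
by have := poly_curve_eq hF hG F0 G0 FG 1; rewrite /F /G !scale1r.
Qed.

Lemma Plaw0X x : P 0 x = x.
Proof. by have := Plaw_line x 0 1; rewrite scale0r add0r scale1r. Qed.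

Lemma PlawXN x : P x (- x) = 0.
Proof. by have := Plaw_line x 1 (-1); rewrite scale1r scaleN1r subrr scale0r. Qed.

(** By [exP] the range of exp is stable under products and inverses, and it contains a neighbourhood
    of 1; it is therefore open and closed. *)
Lemma exp_surj : connected [set: N] -> forall g, exists v, ex v = g.
Proof.
move=> cN; have q2 : 0 < q / 2 by rewrite divr_gt0// exr_gt0.
pose I := range ex.
have near_ex (x : N) : \forall y \near x, exists w, y = (x * ex w)%g.
  apply: filterS (near_left x (near_sm lc q2)) => y sy.
  by have [w _ hw] := ex_surj sy; exists w; rewrite hw mulVKg.
have oI : open I.
  rewrite openE => x [v _ <-]; apply: filterS (near_ex (ex v)) => y [w ->].
  by exists (P v w); rewrite ?exP.
have cI : closed I.
  rewrite -openC openE => x Ix; apply: filterS (near_ex x) => y [w yw] [v _ hv].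
  apply: Ix; exists (P v (- w)) => //.
  by rewrite exP hv yw ex_N// mulgK.
have E : I = [set: N].
  apply: cN; first by exists 1%g; exists 0 => //; exact: ex0.
    by exists I => //; rewrite setTI.
  by exists I => //; rewrite setTI.
by move=> g; have : I g by [rewrite E]; move=> [v _ <-]; exists v.
Qed.

Lemma Plaw_step x y z u v w s : P x y = P z u -> P u v = P w s -> P x (P y v) = P (P z w) s.
Proof. by move=> h1 h2; rewrite -PlawA h1 PlawA h2 PlawA. Qed.

Lemma Plaw_small : exists2 e : R, 0 < e & forall x y, `|x| <= e -> `|y| <= e -> `|P x y| <= q.
Proof.
have q0 := exr_gt0 lc.
have cP : continuous (fun p : 'rV[R]_n * 'rV[R]_n => P p.1 p.2).
  by apply: polymap2_cont => // p; [exact: cvg_fst | exact: cvg_snd].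
have /cvgrPdist_le/(_ _ q0) := cP (0, 0); rewrite /= PlawX0 => -[[U1 U2] /= [h1 h2] sub].
have [e1 e10 he1] := (nbhs_norm0P (P := U1)).1 h1.
have [e2 e20 he2] := (nbhs_norm0P (P := U2)).1 h2.
pose e := Num.min e1 e2; have e0 : 0 < e by rewrite lt_min e10.
exists (e / 2) => [|x y hx hy]; first by rewrite divr_gt0.
have e2e : e / 2 < e by rewrite ltr_pdivrMr// ltr_pMr// ltr1n.
have := sub (x, y); rewrite /= sub0r normrN; apply; split.
  by apply: he1; apply: le_lt_trans hx _; apply: lt_le_trans e2e _; rewrite ge_min lexx.
by apply: he2; apply: le_lt_trans hy _; apply: lt_le_trans e2e _; rewrite ge_min lexx orbT.
Qed.

Let K : set (R * R) := `[0, 1] `*` `[0, 1].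

(** Uniform continuity of a homotopy on the compact square, measured by left quotients; it provides
    the grid used in [exp_ker]. *)
Lemma unif_small (h : R * R -> N) (a : R) : 0 < a -> {within K, continuous h} ->
  \forall m \near \oo, forall p p', K p -> K p' -> `|p.1 - p'.1| <= m.+1%:R^-1 ->
    `|p.2 - p'.2| <= m.+1%:R^-1 -> sm a ((h p)^-1 * h p')%g.
Proof.
move=> a0 hc.
have cK : compact K by apply: compact_setX; exact: segment_compact.
have nK := (near_covering_withinP K).2 ((compact_near_coveringP K).1 cK).
pose Q (m : nat) (p : R * R) := forall p', K p' -> `|p.1 - p'.1| <= m.+1%:R^-1 ->
    `|p.2 - p'.2| <= m.+1%:R^-1 -> sm a ((h p)^-1 * h p')%g.
suff H : \forall m \near \oo, K `<=` Q m.
  by apply: filterS H => m Hm p p' Kp; exact: Hm.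
apply: nK => x Kx.
have sN := near_sm lc a0.
have cont : (fun g : N * N => g.1^-1 * g.2)%g @ (h x, h x) --> (1%g : N).
  rewrite -(mulVg (h x)).
  apply: (@cvg_comp _ _ _ (fun g : N * N => (g.1^-1, g.2)%g) (fun p : N * N => p.1 * p.2)%g _
    (nbhs (((h x)^-1)%g, h x))); last exact: (@mulg_continuous N (((h x)^-1)%g, h x)).
  apply: cvg_pair; last exact: cvg_snd.
  apply: (@cvg_comp _ _ _ (fun g : N * N => g.1) (fun x : N => x^-1)%g _ (nbhs (h x))).
    exact: cvg_fst.
  exact: invg_continuous.
have [[W1 W2] /= [w1 w2] sub] := cont _ sN.
have/subspace_continuousP/(_ x Kx) hx := hc.
have wW : nbhs (h x) (W1 `&` W2) by exact: filterI.
have [[B1 B2] /= [b1 b2] subB] := hx _ wW.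
have /nbhs_ballP[e1 /= e10 he1] := b1; have /nbhs_ballP[e2 /= e20 he2] := b2.
pose e := Num.min e1 e2; have e0 : 0 < e by rewrite lt_min e10.
have e2' : 0 < e / 2 by rewrite divr_gt0.
have inB p : `|x.1 - p.1| < e -> `|x.2 - p.2| < e -> K p -> W1 (h p) /\ W2 (h p).
  move=> h1 h2 Kp; apply: (subB p) => //; split => /=.
    by apply: he1; rewrite /ball /=; apply: lt_le_trans h1 _; rewrite ge_min lexx.
  by apply: he2; rewrite /ball /=; apply: lt_le_trans h2 _; rewrite ge_min lexx orbT.
have near1 : \forall m \near \oo, (m.+1%:R^-1 : R) < e / 2.
  by have /cvgrPdist_lt/(_ _ e2') := @inv_cvg0 R; apply: filterS => m; rewrite sub0r normrN ger0_norm// invr_ge0.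
have near2 : \forall y \near x, `|x.1 - y.1| < e / 2 /\ `|x.2 - y.2| < e / 2.
  exists (ball x.1 (e / 2), ball x.2 (e / 2)) => /=; first by split; exact: nbhsx_ballx.
  by move=> y [].
have : \forall y \near x & m \near \oo, (`|x.1 - y.1| < e / 2 /\ `|x.2 - y.2| < e / 2) /\ (m.+1%:R^-1 : R) < e / 2.
  by exists ([set y | `|x.1 - y.1| < e / 2 /\ `|x.2 - y.2| < e / 2], [set m | (m.+1%:R^-1 : R) < e / 2]) => //= -[].
move=> near3; apply: filterS near3 => -[y m] /= [[y1 y2] hm] Ky p' Kp' d1 d2.
apply: (sub (h y, h p')); split => /=.
  have [|| //] := inB y _ _ Ky; lra.
have q1 : `|x.1 - p'.1| < e by apply: le_lt_trans (ler_distD y.1 _ _) _; apply: (lt_le_trans (ltr_leD y1 (le_trans d1 (ltW hm)))); rewrite -splitr.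
have q2 : `|x.2 - p'.2| < e by apply: le_lt_trans (ler_distD y.2 _ _) _; apply: (lt_le_trans (ltr_leD y2 (le_trans d2 (ltW hm)))); rewrite -splitr.
by have [_ ?] := inB p' q1 q2 Kp'.
Qed.

(** A null-homotopy of the loop t |-> exp (t v) is lifted on a fine grid. Logarithms of the small
    edges satisfy the relation of each small square exactly, so the [P]-product [V] along a row is
    the same for all rows: it is v for the loop and 0 for the constant row. *)
Lemma exp_ker v : loops_contractible R N -> ex v = 1%g -> v = 0.
Proof.
move=> sc v1; have q0 := exr_gt0 lc.
have [e e0 he] := Plaw_small.
(* Edge logarithms have norm at most 2 a <= e, so that products of two of them stay in the ball of
   radius q where exp is injective. *)
pose a := Num.min (e / 2) (q / 2); have a0 : 0 < a by rewrite lt_min; apply/andP; split; exact: divr_gt0.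
have [a1 a2] : 2 * a <= e /\ a <= q / 2.
  split; last by rewrite ge_min lexx orbT.
  have : a <= e / 2 by rewrite ge_min lexx.
  by rewrite ler_pdivlMr// mulrC.
pose l g : 'rV[R]_n := xget 0 [set w | `|w| <= 2 * a /\ ex w = g].
have lP g : sm a g -> `|l g| <= 2 * a /\ ex (l g) = g.
  move=> sg; have [w w1 w2] := ex_surj (sm_le a2 sg).
  apply: (@xgetPex _ 0 [set w | `|w| <= 2 * a /\ ex w = g]); exists w; split => //.
  by apply: le_trans w1 _; rewrite ler_pM2l//; case: sg.
have lE g w : sm a g -> `|w| <= q -> ex w = g -> l g = w.
  move=> sg wq wg; have [h1 h2] := lP g sg.
  by apply: (ex_inj (_ : `|l g| <= q) wq); [lra | rewrite wg].
have cont : {within `[0, 1], continuous (fun t : R => ex (t *: v))}.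
  by apply: continuous_subspaceT; exact: ex_line_cont.
have [|h [hc h0 h1 hb]] := sc _ cont; first by rewrite scale0r ex0 scale1r v1.
have us := unif_small a0 hc.
have ms : \forall m \near \oo, m.+1%:R^-1 * `|v| <= q.
  have H : (fun m : nat => (m.+1%:R^-1 : R) * `|v|) @ \oo --> (0 : R).
    by rewrite -(mul0r `|v|); apply: cvgMr_tmp; exact: inv_cvg0.
  by have /cvgrPdist_le/(_ _ q0) := H; apply: filterS => m; rewrite sub0r normrN ger0_norm// mulr_ge0// invr_ge0.
have [m _ Hm] := filterI us ms.
have {Hm} [us' ms'] := Hm m (leqnn m).
pose M := m.+1; pose tt i : R := i%:R / M%:R.
have M0 : (0 : R) < M%:R by rewrite ltr0n.
have tt01 i : (i <= M)%N -> tt i \in `[0, 1].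
  move=> iM; rewrite in_itv /= divr_ge0//= ler_pdivrMr// mul1r ler_nat //.
have ttS i : tt i.+1 = tt i + M%:R^-1 by rewrite /tt -natr1 mulrDl mul1r.
have dtt i : `|tt i - tt i.+1| <= M%:R^-1.
  by rewrite ttS opprD addrA subrr sub0r normrN ger0_norm ?invr_ge0.
have dtt0 i : `|tt i - tt i| <= M%:R^-1 by rewrite subrr normr0 invr_ge0.
pose H i j := h (tt i, tt j).
have KH i j : (i <= M)%N -> (j <= M)%N -> K (tt i, tt j).
  by move=> iM jM; split; exact: tt01.
pose b i j := l ((H i j)^-1 * H i j.+1)%g; pose al i j := l ((H i j)^-1 * H i.+1 j)%g.
have sb i j : (i <= M)%N -> (j < M)%N -> sm a ((H i j)^-1 * H i j.+1)%g.
  by move=> iM jM; apply: us' => //=; apply: KH => //; exact: ltnW.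
have sal i j : (i < M)%N -> (j <= M)%N -> sm a ((H i j)^-1 * H i.+1 j)%g.
  by move=> iM jM; apply: us' => //=; apply: KH => //; exact: ltnW.
have sq i j : (i < M)%N -> (j < M)%N -> P (al i j) (b i.+1 j) = P (b i j) (al i j.+1).
  move=> iM jM; have iM' := ltnW iM; have jM' := ltnW jM.
  have [x1 y1] := lP _ (sal i j iM jM'); have [x2 y2] := lP _ (sb i.+1 j iM jM).
  have [x3 y3] := lP _ (sb i j iM' jM); have [x4 y4] := lP _ (sal i j.+1 iM jM).
  apply: ex_inj; [by apply: he; lra | by apply: he; lra |].
  apply: (eq_trans (exP _ _)); apply: (eq_trans _ (esym (exP _ _))).
  by rewrite /al /b y1 y2 y3 y4; exact: quotient_telescope.
pose V i := fix V k := if k is j.+1 then P (V j) (b i j) else 0.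
have claim i k : (i < M)%N -> (k <= M)%N -> P (al i 0%N) (V i.+1 k) = P (V i k) (al i k).
  move=> iM; elim: k => [|k IH] kM; first by rewrite /= PlawX0 Plaw0X.
  exact: (Plaw_step (IH (ltnW kM)) (sq i k iM kM)).
have l1 : l 1%g = 0.
  apply: lE; [split; [exact: nbhs_singleton (ccK_near lc) | by rewrite cc1 normr0 ltW] | by rewrite normr0 ltW | exact: ex0].
have tt0 : tt 0%N = 0 by rewrite /tt mul0r.
have ttM : tt M = 1 by rewrite /tt mulfV// gt_eqF.
have H0 i : (i <= M)%N -> H i 0%N = ex (0 *: v).
  by move=> iM; rewrite /H tt0; case: (hb _ (tt01 i iM)).
have HM i : (i <= M)%N -> H i M = ex (0 *: v).
  by move=> iM; rewrite /H ttM; case: (hb _ (tt01 i iM)).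
have al0 i : (i < M)%N -> al i 0%N = 0.
  by move=> iM; rewrite /al !H0 ?(ltnW iM)// mulVg.
have alM i : (i < M)%N -> al i M = 0.
  by move=> iM; rewrite /al !HM ?(ltnW iM)// mulVg.
have Vcst i : (i <= M)%N -> V i M = V 0%N M.
  elim: i => [|i IH] iM //; rewrite -IH ?(ltnW iM)//.
  by have := claim i M iM (leqnn M); rewrite al0// alM// PlawX0 Plaw0X.
have VM : V M M = 0.
  have : forall k, (k <= M)%N -> V M k = 0.
    elim=> [|k IH] kM //=; rewrite IH ?(ltnW kM)// Plaw0X /b /H ttM.
    by rewrite !h1 ?mulVg//; apply: tt01 => //; exact: ltnW.
  exact.
have V0 : forall k, (k <= M)%N -> V 0%N k = tt k *: v.
  elim=> [|k IH] kM /=; first by rewrite tt0 scale0r.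
  rewrite IH ?(ltnW kM)// ttS -Plaw_line; congr (P _ _).
  apply: lE; [exact: sb | by rewrite normrZ ger0_norm ?invr_ge0 |].
  rewrite /H tt0 !h0 ?tt01 ?(ltnW kM)// ttS.
  by rewrite -(ex_add lc hN) mulKg.
by rewrite -[v]scale1r -ttM -V0// -(Vcst M)// VM.
Qed.

Lemma exp_inj : loops_contractible R N -> injective ex.
Proof.
move=> sc v w vw.
have : P (- w) v = 0 by apply: exp_ker => //; rewrite exP vw ex_N// mulVg.
by move=> h; rewrite -[v]Plaw0X -(PlawXN w) PlawA h PlawX0.
Qed.

End ExpBij.

Lemma bigO_is_derive (R : realType) n (f : R -> 'rV[R]_n) (w : 'rV[R]_n) :
  bigO 2 (fun h => `|f h - f 0 - h *: w|) -> is_derive (0 : R) (1 : R) f w.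
Proof.
move=> [K K0 H].
have cv : (fun h : R => h^-1 *: ((f \o shift 0) (h *: (1 : R)) - f 0)) @ 0^' --> w.
  apply/cvgrPdist_le => eps eps0.
  have K1 : 0 < K + 1 by rewrite ltr_wpDl.
  have h1 := near_abs_le (divr_gt0 eps0 K1).
  have : \forall h \near (0 : R)^', (`|f h - f 0 - h *: w| <= K * `|h| ^+ 2 /\ `|h| <= eps / (K + 1)) /\ h != 0.
    apply: filterI; last exact: withinT.
    by apply: nbhs_dnbhs; exact: filterI.
  apply: filterS => h [[h2 h3] h0]; rewrite /= [h *: 1]mulr1 addr0.
  have hp : 0 < `|h| by rewrite normr_gt0.
  have -> : w - h^-1 *: (f h - f 0) = - (h^-1 *: (f h - f 0 - h *: w)).
    by rewrite [in RHS]scalerBr scalerA mulVf// scale1r opprB.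
  rewrite normrN normrZ normfV ler_pdivrMl//; apply: le_trans h2 _.
  rewrite expr2 mulrA [leRHS]mulrC; apply: ler_wpM2r => //.
  apply: le_trans (ler_wpM2l K0 h3) _.
  by rewrite mulrA ler_pdivrMr// mulrC ler_pM2l// lerDl.
by split; [apply/cvg_ex; exists w | apply/cvg_lim].
Qed.

Lemma diff_quad (R : realType) n m (f : 'rV[R]_n -> 'rV[R]_m) (p : 'rV[R]_n) (M : 'M[R]_(n, m)) (K : R) :
  (\forall v \near (0 : 'rV[R]_n), `|f (v + p) - f p - v *m M| <= K * `|v| ^+ 2) ->
  jacobian f p = M.
Proof.
move=> H; have K1 : 0 < `|K| + 1 by rewrite ltr_wpDl.
pose g : {linear 'rV[R]_n -> 'rV[R]_m} := mulmxr M.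
have cg : continuous g.
  apply: mxin_continuous; apply: mxin_mul; first exact: cont_subalg.
    by apply: continuous_mxin => x; exact: cvg_id.
  by apply: mxin_cst; exact: cont_subalg.
have := @diff_unique R _ _ f g p cg _; move=> D.
suff E : 'd f p = g :> ('rV[R]_n -> 'rV[R]_m).
  by apply: mx_ext => v; rewrite /jacobian mul_rV_lin1 E.
apply: D; apply/eqaddoP => eps eps0.
have e1 : 0 < eps / (`|K| + 1) by rewrite divr_gt0.
have h1 : \forall v \near (0 : 'rV[R]_n), `|v| <= eps / (`|K| + 1).
  have /cvgrPdist_le/(_ _ e1) := @cvg_id _ (nbhs (0 : 'rV[R]_n)).
  by apply: filterS => v; rewrite sub0r normrN.
apply: filterS2 H h1 => v h2 h3.
have -> : (f \o shift p - (cst (f p) + g)) v = f (v + p) - f p - v *m M.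
  by rewrite /= !fctE /= opprD addrA.
apply: le_trans h2 _; rewrite expr2 mulrA; apply: ler_wpM2r => //.
apply: le_trans (ler_wpM2r (normr_ge0 _) (ler_norm K)) _.
apply: le_trans (ler_wpM2l (normr_ge0 _) h3) _.
by rewrite mulrA ler_pdivrMr// mulrC ler_pM2l// lerDl.
Qed.

(** * Logarithmic coordinates on N *)

Section LogChart.
Variables (R : realType) (n : nat) (N : topGroupType) (lc : loc_chart R n N).
Hypothesis hN : hausdorff_space N.
Hypothesis nilN : nilpotent_group N.
Implicit Types v w x y z : 'rV[R]_n.
Local Notation c := (cc lc).
Local Notation C := (lC lc).
Local Notation q := (exr lc).
Local Notation ex := (ex lc).
Local Notation sm := (sm lc).
Local Notation P := (Plaw lc).

Lemma ex_derive0 w : bigO 2 (fun h => `|c (ex (h *: w)) - c (ex (0 *: w)) - h *: w|).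
Proof.
have C0 := lC_ge0 lc; have q0 := exr_gt0 lc.
have yq : 0 < q / (`|w| + 1) by rewrite divr_gt0// ltr_wpDl.
exists (2 * C * `|w| ^+ 2); first by rewrite !mulr_ge0// sqr_ge0.
apply: filterS (near_abs_le yq) => h hq.
have hw : `|h *: w| <= q.
  move: hq; rewrite normrZ ler_pdivlMr ?ltr_wpDl//.
  by apply: le_trans; apply: ler_wpM2l => //; rewrite lerDl.
rewrite scale0r ex0 cc1 subr0; apply: le_trans (c_ex_approx hw) _.
by rewrite normrZ; apply: ler_eq; ring.
Qed.

(** The chart and the logarithm agree to first order at 1, so a map that is linear in logarithmic
    coordinates has the same matrix as its Jacobian in the chart. This relates [lie_diff] to exp. *)
Lemma chart_linear (f : N -> N) (M : 'M[R]_n) : (forall v, f (ex v) = ex (v *m M)) ->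
  exists K : R, \forall v \near (0 : 'rV[R]_n), `|c (f (ci lc v)) - v *m M| <= K * `|v| ^+ 2.
Proof.
move=> fM; have C0 := lC_ge0 lc; have q0 := exr_gt0 lc; have qr := exr_le lc.
have [L L1 hL] := mx_bound M.
have L0 : 0 < L by lra.
have e1 : 0 < q / (2 * L) by rewrite divr_gt0// mulr_gt0.
exists (8 * C * L ^+ 2 + L * (8 * C)).
have h1 : \forall v \near (0 : 'rV[R]_n), `|v| <= q / (2 * L).
  have /cvgrPdist_le/(_ _ e1) := @cvg_id _ (nbhs (0 : 'rV[R]_n)).
  by apply: filterS => v; rewrite sub0r normrN.
apply: filterS h1 => v hv.
have hv2 : 2 * L * `|v| <= q by rewrite mulrC -ler_pdivlMr// mulr_gt0.
have v0 := normr_ge0 v.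
have vL : `|v| <= L * `|v| by rewrite ler_peMl.
have hvr : `|v| <= lr lc by lra.
have s : sm (q / 2) (ci lc v) by split; rewrite ciK//; lra.
have [w w1 w2] := ex_surj s; rewrite ciK// in w1.
have wq : `|w| <= q by lra.
have E : c (ex w) = v by rewrite w2 ciK.
rewrite -w2 fM; have wM := hL w.
have Lw : L * `|w| <= 2 * L * `|v| by have := ler_wpM2l (ltW L0) w1; lra.
have wMq : `|w *m M| <= q by lra.
have a1 := c_ex_approx wMq; have a2 := c_ex_approx wq; rewrite E in a2.
have a3 := hL (w - v).
have s1 : `|w *m M| ^+ 2 <= 4 * L ^+ 2 * `|v| ^+ 2.
  apply: (@le_trans _ _ ((2 * L * `|v|) ^+ 2)); last by apply: ler_eq; ring.
  by rewrite ler_sqr ?nnegrE// ?mulr_ge0//; lra.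
have s2 : `|w| ^+ 2 <= 4 * `|v| ^+ 2.
  apply: (@le_trans _ _ ((2 * `|v|) ^+ 2)); last by apply: ler_eq; ring.
  by rewrite ler_sqr ?nnegrE// ?mulr_ge0.
have -> : c (ex (w *m M)) - v *m M = (c (ex (w *m M)) - w *m M) + (w - v) *m M.
  by rewrite mulmxBl addrA subrK.
have b1 := ler_wpM2l (mulr_ge0 (ler0n R 2) C0) s1.
have b2 := ler_wpM2l (mulr_ge0 (ler0n R 2) C0) s2.
rewrite distrC in a2.
have b3 := ler_wpM2l (ltW L0) (le_trans a2 b2).
apply: le_trans (ler_normD _ _) _; apply: le_trans (lerD (le_trans a1 b1) (le_trans a3 b3)) _.
by apply: ler_eq; ring.
Qed.

Hypothesis conN : connected [set: N].
Hypothesis scN : loops_contractible R N.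

Definition lg (x : N) : 'rV[R]_n := sval (cid (exp_surj lc hN nilN conN x)).

Lemma lgK (x : N) : ex (lg x) = x. Proof. exact: svalP (cid (exp_surj lc hN nilN conN x)). Qed.

Lemma exK v : lg (ex v) = v.
Proof. by apply: (@exp_inj _ _ _ lc hN nilN scN); exact: lgK. Qed.

Lemma lg_cont : continuous lg.
Proof.
move=> g; have q0 := exr_gt0 lc.
have c1 : lg @ (1%g : N) --> (0 : 'rV[R]_n).
  apply/cvgrPdist_le => eps eps0.
  pose a := Num.min (eps / 2) (q / 2).
  have a0 : 0 < a by rewrite lt_min; apply/andP; split; exact: divr_gt0.
  apply: filterS (near_sm lc a0) => x sx.
  have sx2 : sm (q / 2) x by apply: sm_le sx; rewrite ge_min lexx orbT.
  have [w w1 w2] := ex_surj sx2; rewrite -w2 exK sub0r normrN; apply: le_trans w1 _.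
  have : `|c x| <= eps / 2 by case: sx => _; rewrite le_min => /andP[].
  by rewrite ler_pdivlMr// mulrC.
have c2 : (fun y : N => g^-1 * y)%g @ g --> (1%g : N).
  by move=> U hU; exact: (near_left g hU).
have c3 : continuous (P (lg g)).
  apply: (@polymap2_cont R n n n P _ (fun _ => lg g) id) => //.
  - exact: (Plaw_poly lc hN nilN).
  - exact: cst_continuous.
  - by move=> x; exact: cvg_id.
(* Continuity at g is transported from continuity at 1, left translation being the polynomial map P
   (lg g). *)
have -> : lg = (P (lg g) \o lg) \o (fun y : N => g^-1 * y)%g.
  apply/funext => y; rewrite /=; apply: (@exp_inj _ _ _ lc hN nilN scN).
  by rewrite ex_Plaw// !lgK mulVKg.
have c4 : (P (lg g) \o lg) @ (1%g : N) --> P (lg g) 0.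
  by apply: (@cvg_comp _ _ _ lg (P (lg g)) (nbhs (1%g : N)) (nbhs (0 : 'rV[R]_n))); [exact: c1 | exact: c3].
have E : P (lg g) 0 = (P (lg g) \o lg) (g^-1 * g)%g.
  by rewrite /= mulVg; congr (P _ _); rewrite -(ex0 lc) exK.
rewrite /continuous_at.
have -> : ((P (lg g) \o lg) \o (fun y : N => g^-1 * y)%g) g = P (lg g) 0 by exact: esym E.
exact: (@cvg_comp _ _ _ (fun y : N => g^-1 * y)%g (P (lg g) \o lg) (nbhs g) (nbhs (1%g : N))).
Qed.

End LogChart.

Section LieExp.
Variables (R : realType) (n : nat) (N : lieGroupType R n).

Definition lie_lc : loc_chart R n N := sval (cid (@lie_loc_chart R n N)).

Lemma lie_lcE x : cc lie_lc x = one_chart N x - one_chart N 1%g.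
Proof. exact: (svalP (cid (@lie_loc_chart R n N))).1. Qed.

Lemma lie_lciE v : ci lie_lc v = chart_inv (one_chart N) (v + one_chart N 1%g).
Proof. exact: (svalP (cid (@lie_loc_chart R n N))).2. Qed.

Definition lexp : 'rV[R]_n -> N := ex lie_lc.

Lemma is_exp_ex (v : 'rV[R]_n) (x : N) : is_exp v x <-> lexp v = x.
Proof.
have hN : hausdorff_space N := lie_hausdorff.
have der w : is_derive (0 : R) (1 : R) (fun t : R => one_chart N (lexp (t *: w))) w.
  apply: bigO_is_derive; have := ex_derive0 lie_lc w; apply: bigO_le.
  apply: filterS (near_abs_le ltr01) => h _; apply: ler_eq; congr (`|_|); congr (_ - _).
  by rewrite !lie_lcE opprB addrA subrK.
split=> [[X [cX XD dX <-]]|<-].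
  have [w hw] := one_param lie_lc hN cX XD.
  have E : X = (fun t => lexp (t *: w)) by exact/funext.
  rewrite E in dX; have := @derive_val _ _ _ _ _ _ _ dX; rewrite (@derive_val _ _ _ _ _ _ _ (der w)) => wv.
  by rewrite hw scale1r wv.
exists (fun t => lexp (t *: v)); split.
- exact: ex_line_cont.
- by move=> s t; rewrite /lexp ex_add.
- exact: der.
- by rewrite scale1r.
Qed.

Hypothesis cscN : connected_sc_nilpotent N.

Let hN : hausdorff_space N := lie_hausdorff.
Let conN : connected [set: N]. Proof. by case: cscN. Qed.
Let scN : loops_contractible R N. Proof. by case: cscN. Qed.
Let nilN : nilpotent_group N. Proof. by case: cscN. Qed.

Lemma lexp_inj : injective lexp. Proof. exact: exp_inj. Qed.

Lemma lie_logE : @lie_log R n N = lg lie_lc hN nilN conN.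
Proof.
apply/funext => x; have := @xgetPex _ 0 [set v | is_exp v x] (ex_intro _ (lg lie_lc hN nilN conN x)
  ((is_exp_ex _ _).2 (lgK lie_lc hN nilN conN x))).
move/is_exp_ex => h; apply: lexp_inj; rewrite -/(lie_log x) in h.
by rewrite h; apply/esym; exact: lgK.
Qed.

Lemma lie_logK x : lexp (lie_log x) = x.
Proof. by rewrite lie_logE; exact: lgK. Qed.

Lemma lexpK v : lie_log (lexp v) = v.
Proof. by apply: lexp_inj; exact: lie_logK. Qed.

Lemma lie_log_cont : continuous (@lie_log R n N).
Proof. by rewrite lie_logE; exact: lg_cont. Qed.

Lemma lexp_cont : continuous lexp. Proof. exact: ex_cont. Qed.

Lemma lie_diffE (a : aut N) v : a (lexp v) = lexp (v *m lie_diff a).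
Proof.
have [M hM] := hom_linear lie_lc lie_lc hN hN (aut_funP a).
rewrite /lexp hM; congr (ex _ (v *m _)).
have [K hK] := chart_linear hM.
apply/esym/(@diff_quad _ _ _ _ _ _ K); apply: filterS hK => w.
rewrite lie_lciE lie_lcE.
suff -> : one_chart N (a (chart_inv (one_chart N) (one_chart N 1%g))) = one_chart N 1%g by [].
have -> : chart_inv (one_chart N) (one_chart N 1%g) = 1%g.
  have := nbhs_singleton (ccK_near lie_lc); rewrite lie_lciE lie_lcE subrr add0r//.
by rewrite aut1.
Qed.

End LieExp.

Lemma lie_hom_linear (R : realType) n n' (N : lieGroupType R n) (N' : lieGroupType R n') (f : N -> N') :
  cont_morphism f -> exists M : 'M[R]_(n, n'), forall v, f (lexp N v) = lexp N' (v *m M).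
Proof. by move=> h; exact: (hom_linear (lie_lc N) (lie_lc N') lie_hausdorff lie_hausdorff h). Qed.

(** * Virtually polycyclic groups *)

Section VirtuallySolvable.
Variable G : groupType.
Implicit Types (A B C H K : set G) (x y z : G).
Local Open Scope group_scope.

Lemma subg1 H : subgroup H -> H 1. Proof. by case. Qed.
Lemma subgV H x : subgroup H -> H x -> H x^-1.
Proof. by move=> [h1 h] hx; rewrite -[x^-1]mul1g; exact: h. Qed.
Lemma subgM H x y : subgroup H -> H x -> H y -> H (x * y).
Proof. by move=> hH hx hy; rewrite -[y]invgK; apply: hH.2 => //; exact: subgV. Qed.
Lemma subgX H x k : subgroup H -> H x -> H (x ^+ k).
Proof.
move=> hH hx; elim: k => [|k IH]; first by rewrite expg0; exact: subg1.
by rewrite expgS; exact: subgM.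
Qed.

Lemma commutator_sub A B H : subgroup H -> (forall a b, A a -> B b -> H [~ a, b]) ->
  commutator A B `<=` H.
Proof.
move=> hH h x; apply; split => // _ [a Aa [b Bb <-]]; exact: h.
Qed.

Lemma commutator_in A B a b : A a -> B b -> commutator A B [~ a, b].
Proof. by move=> Aa Bb H [_]; apply; exists a => //; exists b. Qed.

Lemma subgroup_commutator A B : subgroup (commutator A B).
Proof.
split=> [H [hH _]|x y hx hy H hH]; first exact: subg1.
by apply: hH.1.2; [exact: hx | exact: hy].
Qed.

Definition sol k A := derived_series k A `<=` [set 1].

Lemma derivedSr k A : derived_series k.+1 A = derived_series k (commutator A A).
Proof. by rewrite /derived_series iterSr. Qed.

Lemma commutator_mono A B : A `<=` B -> commutator A A `<=` commutator B B.
Proof.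
move=> AB; apply: commutator_sub; first exact: subgroup_commutator.
by move=> a b Aa Ab; apply: commutator_in; exact: AB.
Qed.

Lemma derived_mono k A B : A `<=` B -> derived_series k A `<=` derived_series k B.
Proof.
by elim: k A B => [|k IH] A B AB //; rewrite !derivedSr; apply: IH; exact: commutator_mono.
Qed.

Lemma sol_sub k A B : A `<=` B -> sol k B -> sol k A.
Proof. by move=> AB h; apply: subset_trans h; exact: derived_mono. Qed.

Lemma sol_ext k A B : subgroup B -> (forall x y, A x -> A y -> B [~ x, y]) -> sol k B -> sol k.+1 A.
Proof.
by move=> sB h sk; rewrite /sol derivedSr; apply: sol_sub sk; exact: commutator_sub.
Qed.

Lemma sol_solvable k A : subgroup A -> sol k A -> solvable_subgroup A.
Proof.
move=> sA hk; split => //; exists k; apply/seteqP; split => // _ ->.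
by case: k {hk} => [|k]; [exact: subg1 | apply: subg1; exact: subgroup_commutator].
Qed.

Section Congruence.
Variables (K B : set G).
Hypothesis nBK : normal_in B K.

Let sB : subgroup B. Proof. by case: nBK. Qed.
Let sK : subgroup K. Proof. by case: nBK. Qed.
Let BK : B `<=` K. Proof. by case: nBK. Qed.
Let nB x y : K x -> B y -> B (y ^ x). Proof. by case: nBK => _ _ _; apply. Qed.

Definition eqB x y := B (x^-1 * y).

Lemma eqB_refl x : eqB x x. Proof. by rewrite /eqB mulVg; exact: subg1. Qed.
Lemma eqB_sym x y : eqB x y -> eqB y x.
Proof. by rewrite /eqB => h; have := subgV sB h; rewrite invgM invgK. Qed.
Lemma eqB_trans x y z : eqB x y -> eqB y z -> eqB x z.
Proof. by rewrite /eqB => h1 h2; have := subgM sB h1 h2; rewrite -mulgA mulVKg. Qed.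
Lemma eqB_mul x x' y y' : K y -> eqB x x' -> eqB y y' -> eqB (x * y) (x' * y').
Proof.
rewrite /eqB => Ky h1 h2; have := subgM sB (nB Ky h1) h2.
by rewrite /conjg !mulgA mulgK invgM -!mulgA.
Qed.
Lemma eqB_conj x y z : K z -> eqB x y -> eqB (x ^ z) (y ^ z).
Proof. by rewrite /eqB => Kz h; rewrite -conjVg -conjMg; exact: nB. Qed.
Lemma eqB_inv x y : K x -> eqB x y -> eqB x^-1 y^-1.
Proof.
rewrite /eqB => Kx /eqB_sym h; have := nB (subgV sK Kx) h.
by rewrite /conjg invgK !mulgA mulgK => h1; have := subgV sB h1; rewrite invgM !invgK.
Qed.

Lemma prod_normal C : subgroup C -> C `<=` K ->
  subgroup [set x | exists2 a, C a & exists2 b, B b & x = a * b].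
Proof.
move=> sC CK; split; first by exists 1; [exact: subg1|exists 1; [exact: subg1|rewrite mulg1]].
move=> _ _ [a Ca [b Bb ->]] [a' Ca' [b' Bb' ->]].
exists (a * a'^-1); first exact: sC.2.
exists ((b * b'^-1) ^ a'^-1); first by apply: nB; [apply: subgV => //; exact: CK | exact: sB.2].
by rewrite /conjg invgK invgM !mulgA mulgVK.
Qed.

(** Modulo the normal subgroup B, the commutator of a b and a' b' is the commutator of a and a'. *)
Lemma derived_prod k C : subgroup C -> C `<=` K ->
  derived_series k [set x | exists2 a, C a & exists2 b, B b & x = a * b] `<=`
  [set x | exists2 a, derived_series k C a & exists2 b, B b & x = a * b].
Proof.
elim: k C => [|k IH] C sC CK; first exact.
have CK' : commutator C C `<=` K.
  apply: commutator_sub => // a b /CK Ka /CK Kb.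
  rewrite /commg /conjg; apply: (subgM sK (subgV sK Ka)); apply: (subgM sK (subgV sK Kb)).
  exact: (subgM sK).
rewrite !derivedSr; apply: subset_trans (IH _ (subgroup_commutator _ _) CK').
apply: derived_mono; apply: commutator_sub; first exact: prod_normal (subgroup_commutator _ _) CK'.
move=> _ _ [a Ca [b Bb ->]] [a' Ca' [b' Bb' ->]].
have Ka := CK _ Ca; have Ka' := CK _ Ca'.
have e1 : eqB a (a * b) by rewrite /eqB mulKg.
have e2 : eqB a' (a' * b') by rewrite /eqB mulKg.
exists [~ a, a']; first exact: commutator_in.
exists ([~ a, a']^-1 * [~ a * b, a' * b']); last by rewrite mulVKg.
apply: eqB_mul; [|exact: eqB_inv|].
  by rewrite /conjg; apply: subgM => //; [exact: subgV | exact: subgM].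
rewrite /conjg; apply: eqB_mul; [by apply: subgM | exact: eqB_inv |].
by apply: eqB_mul.
Qed.

End Congruence.

Lemma prod_normal_in K A B : normal_in A K -> normal_in B K ->
  normal_in [set x | exists2 a, A a & exists2 b, B b & x = a * b] K.
Proof.
move=> nA nB; have [sA sK AK hA] := nA; have [sB _ BK hB] := nB; split => //.
- exact: (prod_normal nB).
- by move=> _ [a Aa [b Bb ->]]; apply: subgM => //; [exact: AK | exact: BK].
- move=> x _ Kx [a Aa [b Bb ->]]; exists (a ^ x); first exact: hA.
  by exists (b ^ x); [exact: hB | rewrite conjMg].
Qed.

Lemma sol_prod K A B k l : normal_in A K -> normal_in B K -> sol k A -> sol l B ->
  sol (l + k) [set x | exists2 a, A a & exists2 b, B b & x = a * b].
Proof.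
move=> nA nB sk sl x; rewrite /derived_series iterD -/(derived_series _ _) -/(derived_series _ _).
have [sA _ AK _] := nA.
move=> h; apply: sl; apply: derived_mono h => y /(derived_prod nB sA AK) [a /sk -> [b Bb ->]].
by rewrite mul1g.
Qed.

Lemma sol_conj k A x : sol k A -> sol k [set y ^ x | y in A].
Proof.
suff H : derived_series k [set y ^ x | y in A] `<=` [set y ^ x | y in derived_series k A].
  by move=> h y /H [z /h -> <-]; rewrite conj1g.
elim: k A => [|k IH] A; first exact.
rewrite !derivedSr; apply: subset_trans (IH _); apply: derived_mono; apply: commutator_sub.
  split; first by exists 1; [apply: subg1; exact: subgroup_commutator | rewrite conj1g].
  move=> _ _ [a ha <-] [b hb <-]; exists (a * b^-1); last by rewrite conjMg conjVg.
  exact: (subgroup_commutator A A).2.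
move=> _ _ [a ha <-] [b hb <-]; exists [~ a, b]; first exact: commutator_in.
by rewrite conjRg.
Qed.

(** Finite index of A in H, encoded by a map to a finite type whose fibres in H lie in single left
    cosets of A; such maps are easy to compose and to build from permutations. *)
Definition findex H A := exists (T : finType) (f : G -> T),
  forall x y, H x -> H y -> f x = f y -> A (x^-1 * y).

Lemma findex_quotient K H : subgroup H -> finite_quotient K H -> findex K H.
Proof.
move=> sH /finite_seqP[s hs]; exists 'I_(size s).+1, (fun x => inord (index (lcoset x H) s)).
have inS x : K x -> lcoset x H \in s.
  by move=> Kx; have : [set lcoset x H | x in K] (lcoset x H) by [exists x]; rewrite hs.
move=> x y Kx Ky /(congr1 (@nat_of_ord _)).
have sx := inS x Kx; have sy := inS y Ky.
rewrite !inordK ?ltnS ?index_size// => E.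
have {}E : lcoset x H = lcoset y H by rewrite -(nth_index set0 sx) E nth_index.
have : lcoset x H y by rewrite E; exists 1; [exact: subg1 | rewrite mulg1].
by move=> [h Hh <-]; rewrite mulKg.
Qed.

Lemma findex_trans K2 K A : findex K2 K -> findex K A -> findex K2 A.
Proof.
move=> [T1 [f1 h1]] [T2 [f2 h2]].
pose r t := xget 1 [set x | K2 x /\ f1 x = t].
have rP x : K2 x -> K2 (r (f1 x)) /\ f1 (r (f1 x)) = f1 x.
  by move=> Kx; apply: (@xgetPex _ 1 [set y | K2 y /\ f1 y = f1 x]); exists x.
exists (T1 * T2)%type, (fun x => (f1 x, f2 ((r (f1 x))^-1 * x))) => x y Kx Ky [E1 E2].
have [r1 r2] := rP x Kx.
have := h2 ((r (f1 x))^-1 * x) ((r (f1 y))^-1 * y).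
rewrite -E1 invgM invgK -mulgA mulVKg; apply; [exact: h1 | |by rewrite E2 E1].
by apply: h1 => //; rewrite r2.
Qed.

(** A is the largest solvable normal subgroup of K. Its invariance under all conjugations preserving
    K is what lets normality climb a subnormal series. *)
Definition maxsol K A := normal_in A K /\ (exists l, sol l A) /\
  forall B, normal_in B K -> (exists l, sol l B) -> B `<=` A.

(** Among the solvable normal B containing A, one meeting the most classes of K modulo A is chosen.
    For another solvable normal C the product B C meets no new class, and two elements of one class
    differ by an element of A, which lies in B. *)
Lemma maxsol_exists K A : normal_in A K -> (exists l, sol l A) -> findex K A ->
  exists2 A', maxsol K A' & findex K A'.
Proof.
move=> nA sA fA; have [T [f hf]] := fA.
pose cls B : {set T} := finset (fun t => `[< exists2 x, B x & f x = t >]).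
pose good B := [/\ normal_in B K, exists l, sol l B & A `<=` B].
pose Pm m := `[< exists2 B, good B & #|cls B| = m >].
have exP : exists m, Pm m by exists #|cls A|; apply/asboolP; exists A => //; split.
have bP m : Pm m -> (m <= #|T|)%N by move=> /asboolP[B _ <-]; exact: max_card.
case: (ex_maxnP exP bP) => m /asboolP[B [nB sB AB] Bm] mmax.
exists B; last first.
  by exists T, f => x y Kx Ky fxy; apply: AB; exact: hf.
split => //; split => // C nC [l sC].
pose D := [set x | exists2 a, B a & exists2 b, C b & x = a * b].
have BD : B `<=` D by move=> b Bb; exists b => //; exists 1; [apply: subg1; case: nC|rewrite mulg1].
have nD : normal_in D K by exact: prod_normal_in.
have gD : good D.
  split => //; last exact: subset_trans BD.
  by case: sB => k sB; exists (l + k)%N; exact: (sol_prod nB nC).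
have cBD : cls B \subset cls D.
  by apply/fintype.subsetP => t; rewrite !finset.in_set => /asboolP[x Bx fx]; apply/asboolP; exists x; [exact: BD | exact: fx].
have E : cls B = cls D.
  apply/eqP; rewrite eqEcard cBD Bm; apply: mmax; apply/asboolP; by exists D.
have [sgB sK BK _] := nB; have [_ _ DK _] := nD; have [_ _ CK _] := nC.
move=> x Cx; have Dx : D x by exists 1; [exact: subg1|exists x => //; rewrite mul1g].
have : f x \in cls D by rewrite finset.in_set; apply/asboolP; exists x.
rewrite -E finset.in_set => /asboolP[b Bb fb].
rewrite -[x](mulVKg b); apply: subgM => //; apply: AB; apply: hf => //; [exact: BK | exact: DK].
Qed.

(** A conjugate of A by an element of K2 is again solvable and normal in K, hence contained in A. *)
Lemma maxsol_normal K K2 A : maxsol K A -> normal_in K K2 -> normal_in A K2.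
Proof.
move=> [nA [[l sA] mA]] [sK sK2 KK2 nK]; have [sgA _ AK hA] := nA; split => //.
  exact: subset_trans KK2.
move=> x y K2x Ay; have K2V : K2 x^-1 by exact: subgV.
apply: (mA [set y ^ x | y in A]); last by exists y.
  split => //.
  - split; first by exists 1; [exact: subg1|rewrite conj1g].
    by move=> _ _ [a ha <-] [b hb <-]; exists (a * b^-1); [exact: sgA.2|rewrite conjMg conjVg].
  - by move=> _ [a ha <-]; apply: nK => //; exact: AK.
  - move=> z _ Kz [a ha <-]; exists (a ^ (z ^ x^-1)); first by apply: hA => //; exact: nK.
    by rewrite -!conjgM; congr (_ ^ _); rewrite /conjg invgK !mulgA mulgVK.
by exists l; exact: sol_conj.
Qed.

Lemma centralizer_mod_normal K K2 A : normal_in A K2 -> normal_in K K2 ->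
  normal_in [set x | K2 x /\ forall y, K y -> eqB A (y * x) (x * y)] K2.
Proof.
move=> nA2 nK; have [sgA sK2 AK2 hA2] := nA2; have [sK _ KK2 hK] := nK.
set C := [set x | _].
have tr := eqB_trans nA2; have ml := eqB_mul nA2.
have sC : subgroup C.
  split; first by split=> [|y _]; [exact: subg1 | rewrite mulg1 mul1g; exact: eqB_refl nA2 _].
  move=> x x' [Kx hx] [Kx' hx']; have Kx'V := subgV sK2 Kx'.
  split; first exact: subgM.
  move=> y Ky; have K2y := KK2 _ Ky.
  have e1 := ml _ _ _ _ Kx'V (hx y Ky) (eqB_refl nA2 x'^-1).
  have e2 : eqB A (y * x'^-1) (x'^-1 * y).
    have h := ml _ _ _ _ Kx'V (ml _ _ _ _ (subgM sK2 K2y Kx') (eqB_refl nA2 x'^-1) (hx' y Ky)) (eqB_refl nA2 x'^-1).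
    apply: (eqB_sym nA2); rewrite !mulgA in h; rewrite mulgK in h.
    by rewrite mulVg mul1g in h.
  have e3 := ml _ _ _ _ (subgM sK2 K2y Kx'V) (eqB_refl nA2 x) e2.
  by rewrite !mulgA in e1 e3 *; exact: tr e1 e3.
split => //; first by move=> x [].
move=> z x K2z [K2x hx]; split; first by rewrite /conjg; apply: subgM; [|exact: subgV|exact: subgM].
move=> y Ky; have Kz : K (y ^ z^-1) by apply: hK => //; exact: subgV.
have := eqB_conj nA2 K2z (hx _ Kz).
by rewrite (conjMg (y ^ z^-1) x z) (conjMg x (y ^ z^-1) z) conjgKV.
Qed.

(** C is the centralizer of K modulo A in K2. It is solvable because [C, C] lies in C and K while
    [C and K, C and K] lies in A, whence [l.+2]; it has finite index because K2 permutes the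
    finitely many classes of K modulo A. *)
Lemma cyclic_step K K2 A : maxsol K A -> findex K A -> normal_in K K2 ->
  (forall x y, K2 x -> K2 y -> K [~ x, y]) ->
  exists C, [/\ normal_in C K2, exists l, sol l C & findex K2 C].
Proof.
move=> mA [T [f hf]] nK abK; have nA2 := maxsol_normal mA nK.
have [_ [[l sA] _]] := mA; have [sgA sK2 AK2 hA2] := nA2; have [sK _ KK2 hK] := nK.
pose C := [set x | K2 x /\ forall y, K y -> eqB A (y * x) (x * y)].
have cE x y : [~ x, y] = (y * x)^-1 * (x * y) by rewrite /commg /conjg invgM !mulgA.
have tr := eqB_trans nA2; have ml := eqB_mul nA2.
have nC : normal_in C K2 by exact: centralizer_mod_normal.
have sC : subgroup C by case: nC.
exists C; split => //.
- exists l.+2; apply: (@sol_ext _ _ (C `&` K)).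
  + split; first by split; exact: subg1.
    by move=> x y [Cx Kx] [Cy Ky]; split; [exact: sC.2 | exact: sK.2].
  + move=> x y Cx Cy; split; last by apply: abK; [case: Cx | case: Cy].
    apply: subgM => //; first exact: subgV.
    by rewrite /conjg; apply: subgM => //; [exact: subgV | exact: subgM].
  + apply: (@sol_ext _ _ A) => // x y [[_ hx] _] [_ Ky].
    by rewrite cE; exact: hx.
pose r t := xget 1 [set x | K x /\ f x = t].
have rP x : K x -> K (r (f x)) /\ f (r (f x)) = f x.
  by move=> Kx; apply: (@xgetPex _ 1 [set y | K y /\ f y = f x]); exists x.
(* The class of x is the map that conjugation by x induces on chosen representatives of K modulo
   A. *)
exists {ffun T -> T}, (fun x => [ffun t => f ((r t) ^ x^-1)]) => x x' K2x K2x' /ffunP E.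
set z := x^-1 * x'; have K2z : K2 z by apply: subgM => //; exact: subgV.
split => // y Ky; have [Kr fr] := rP y Ky; have {E} := E (f y); rewrite !ffunE => E.
have h1 : A ((r (f y) ^ x^-1)^-1 * r (f y) ^ x'^-1).
  by apply: hf => //; apply: hK => //; exact: subgV.
have h2 : eqB A (r (f y) * z) (z * r (f y)).
  have := hA2 _ _ K2z (hA2 _ _ K2x h1).
  by rewrite /eqB /z /conjg !invgM !invgK !mulgA !mulgK ?mulgVK -!mulgA ?mulKg ?mulVKg.
have h3 : eqB A (r (f y)) y by apply: hf.
have K2r := KK2 _ Kr; have K2y := KK2 _ Ky.
apply: (tr _ (r (f y) * z)); first by apply: ml => //; [exact: eqB_sym nA2 _ _ h3 | exact: eqB_refl nA2 _].
by apply: tr h2 _; apply: ml => //; exact: eqB_refl nA2 _.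
Qed.

Lemma virtually_polycyclic_solvable : virtually_polycyclic G ->
  exists A, [/\ normal_in A setT, exists l, sol l A & findex setT A].
Proof.
move=> [k [S [S0 Sk Sstep]]].
suff H i : (i <= k)%N -> exists2 A, maxsol (S i) A & findex (S i) A.
  have [A [nA [sA _]] fA] := H k (leqnn k); rewrite Sk in nA fA; by exists A.
elim: i => [|i IH] ik.
  apply: (@maxsol_exists _ [set 1]).
  - have s1 : subgroup [set (1 : G)] by split => // x y -> ->; rewrite mulgV.
    by rewrite S0; split => // x y -> ->; rewrite conj1g.
  - by exists 0%N.
  - exists unit, (fun _ => tt) => x y; rewrite S0 => -> -> _.
    by rewrite mulVg.
have [A mA fA] := IH (ltnW ik); have [nS [fq|[f [fM f0 _]]]] := Sstep i ik.
  have [sS _ _ _] := nS.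
  apply: (@maxsol_exists _ A); [exact: maxsol_normal nS | by case: mA => _ [] |].
  by apply: findex_trans fA; exact: findex_quotient.
have [sS sS2 SS hS] := nS.
have [C [h1 h2 h3]] : exists C, [/\ normal_in C (S i.+1), exists l, sol l C & findex (S i.+1) C].
  apply: (cyclic_step mA fA nS) => x y hx hy.
  have f1 : f 1 = 0%R by apply/f0; [exact: subg1|exact: subg1].
  have fV u : S i.+1 u -> f u^-1 = (- f u)%R.
    by move=> hu; apply/eqP; rewrite -addr_eq0 -fM ?mulVg ?f1//; exact: subgV.
  have hxV := subgV sS2 hx; have hyV := subgV sS2 hy.
  have hxy := subgM sS2 hx hy; have h := subgM sS2 hyV hxy.
  apply/f0; first by rewrite /commg /conjg; exact: subgM.
  rewrite /commg /conjg !fM// !fV//; ring.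
exact: maxsol_exists h1 h2 h3.
Qed.

End VirtuallySolvable.

(** * Exponential polynomials and unipotent parts *)

Section ExpPoly.
Variable F : numClosedFieldType.
Implicit Types (p q r : {poly F}) (L : seq (F * {poly F})) (a b : nat -> F) (m z : F).

Definition ev L n : F := \sum_(c <- L) c.1 ^+ n * c.2.[n%:R].
Definition evgood L := all (fun c => c.1 != 0) L.
Definition csum L : {poly F} := \sum_(c <- L) c.2.

(* a(n) = sum_j m_j^n p_j(n) with all m_j <> 0, and p = sum_j p_j is obtained
   by letting every m_j tend to 1. *)
Definition exppoly a p := exists L, [/\ evgood L, forall n, a n = ev L n & p = csum L].

(** On the sequence m^n p(n), the operator a |-> a(n+1) - z a(n) acts by this transformation of
    p. *)
Definition dop m z p : {poly F} := m *: (p \Po ('X + 1%:P)) - z *: p.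

Lemma dopE m z p n : (dop m z p).[n%:R] = m * p.[n.+1%:R] - z * p.[n%:R].
Proof. by rewrite hornerD hornerN !hornerZ horner_comp hornerD hornerX hornerC natr1. Qed.

Lemma sizeX1 : size ('X + 1%:P : {poly F}) = 2%N.
Proof. by rewrite size_XaddC. Qed.

Lemma size_shift p : size (p \Po ('X + 1%:P)) = size p.
Proof. by rewrite size_comp_poly2 // sizeX1. Qed.

Lemma lead_shift p : lead_coef (p \Po ('X + 1%:P)) = lead_coef p.
Proof. by rewrite lead_coef_comp ?sizeX1// lead_coefXaddC expr1n mulr1. Qed.

Lemma size_dop m z p : (size (dop m z p) <= size p)%N.
Proof.
apply: leq_trans (size_polyD _ _) _; rewrite size_polyN geq_max.
by rewrite !(leq_trans (size_scale_leq _ _))// size_shift.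
Qed.

Lemma dop_lead m z p : (dop m z p)`_(size p).-1 = (m - z) * lead_coef p.
Proof.
rewrite coefB !coefZ -[in X in m * X](size_shift p) -/(lead_coef _) lead_shift mulrBl.
by [].
Qed.

Lemma dop_eq0 m z p : m != z -> dop m z p = 0 -> p = 0.
Proof.
move=> mz h; apply/eqP; rewrite -lead_coef_eq0; have := dop_lead m z p.
by rewrite h coef0 => /esym/eqP; rewrite mulf_eq0 subr_eq0 (negPf mz).
Qed.

Lemma size_dop_lt m p : p != 0 -> (size (dop m m p) < size p)%N.
Proof.
move=> p0; have sp : (0 < size p)%N by rewrite size_poly_gt0.
rewrite -(prednK sp) ltnS; apply/leq_sizeP => j; rewrite leq_eqVlt => /orP[/eqP <-|].
  by rewrite dop_lead subrr mul0r.
by rewrite (ltn_predK sp) => hj; apply: nth_default; exact: leq_trans (size_dop _ _ _) hj.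
Qed.

Lemma ev_dop z L n : ev [seq (c.1, dop c.1 z c.2) | c <- L] n = ev L n.+1 - z * ev L n.
Proof.
rewrite /ev big_map mulr_sumr -sumrB; apply: eq_bigr => c _ /=.
by rewrite dopE exprS; ring.
Qed.

Lemma poly_nat0 p : (forall n : nat, p.[n%:R] = 0) -> p = 0.
Proof.
move=> h; apply: (@roots_geq_poly_eq0 _ p [seq i%:R | i <- iota 0 (size p).+1]).
- by apply/allP => x /mapP[i _ ->]; apply/rootP.
- rewrite map_inj_uniq ?iota_uniq// => i j /eqP; rewrite eqr_nat => /eqP //.
- by rewrite size_map size_iota.
Qed.

(** Applying a(n+1) - z a(n), with z an eigenvalue whose polynomial is nonzero, lowers the total
    size and kills no nonzero polynomial attached to another eigenvalue. Induction leaves that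
    single eigenvalue, whose power never vanishes. *)
Lemma ev_indep L : uniq (unzip1 L) -> evgood L -> (forall n, ev L n = 0) ->
  forall c, c \in L -> c.2 = 0.
Proof.
have [k hk] : exists k, (\sum_(c <- L) size c.2 <= k)%N by exists (\sum_(c <- L) size c.2)%N.
elim: k L hk => [|k IH] L hk uL gL eL c cL.
  have : (size c.2 <= \sum_(c <- L) size c.2)%N by rewrite (big_rem c)//= leq_addr.
  by move/leq_trans/(_ hk); rewrite leqn0 size_poly_eq0 => /eqP.
have [/allP/(_ c cL)/eqP //|/allPn[c0 c0L c00]] := boolP (all (fun c => c.2 == 0) L).
pose L' := [seq (c.1, dop c.1 c0.1 c.2) | c <- L].
have H : forall c', c' \in L' -> c'.2 = 0.
  apply: IH.
  - rewrite -ltnS; apply: leq_trans hk; rewrite big_map (big_rem c0)//= [in X in (_ < X)%N](big_rem c0)//=.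
    rewrite -addSn; apply: leq_add; first exact: size_dop_lt.
    by apply: leq_sum => i _; exact: size_dop.
  - by rewrite /unzip1 -map_comp.
  - by rewrite /evgood all_map.
  - by move=> n; rewrite ev_dop !eL mulr0 subr0.
have H2 c' : c' \in L -> c' != c0 -> c'.2 = 0.
  move=> c'L cc0; have := H (c'.1, dop c'.1 c0.1 c'.2); rewrite (map_f (fun c => (c.1, dop c.1 c0.1 c.2)) c'L) => /(_ isT) /=.
  apply: dop_eq0; apply: contra cc0 => /eqP E; apply/eqP.
  have := uniqP (0, 0) (s := L); have uL' : uniq L by exact: map_uniq uL.
  move=> _; apply/eqP; move: E => /eqP.
  rewrite -(nth_index (0, 0) c'L) -(nth_index (0, 0) c0L).
  rewrite -!(nth_map (0, 0) 0 (fun c => c.1)) ?index_mem// -/(unzip1 L).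
  by rewrite (nth_uniq 0 _ _ uL) ?size_map ?index_mem// => /eqP ->.
suff c02 : c0.2 = 0 by move: c00; rewrite c02 eqxx.
apply: poly_nat0 => n; have := eL n; rewrite /ev (big_rem c0)//= big_seq big1 ?addr0 => [/eqP|i ir].
  by rewrite mulf_eq0 expf_eq0 (negPf (allP gL c0 c0L)) andbF => /eqP.
have uL' : uniq L by exact: map_uniq uL.
have iL : i \in L by exact: mem_rem ir.
rewrite H2 ?horner0 ?mulr0//; apply: contraL ir => /eqP ->.
by rewrite mem_rem_uniq// !inE eqxx.
Qed.

Definition gather L : seq (F * {poly F}) :=
  [seq (m, \sum_(c <- L | c.1 == m) c.2) | m <- undup (unzip1 L)].

Lemma gather_sum L (V : zmodType) (G : F -> {poly F} -> V) :
  (forall m, {morph G m : p q / p + q}) -> (forall m, G m 0 = 0) ->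
  \sum_(c <- gather L) G c.1 c.2 = \sum_(c <- L) G c.1 c.2.
Proof.
move=> GD G0; rewrite big_map /=.
under eq_bigr => m _ do rewrite (big_morph (G m) (GD m) (G0 m)).
under eq_bigr => m _ do rewrite big_mkcond /=.
rewrite exchange_big /= big_seq [RHS]big_seq; apply: eq_bigr => c cL.
rewrite (bigD1_seq c.1) ?undup_uniq ?mem_undup ?map_f//= eqxx big1 ?addr0// => m.
by rewrite eq_sym => /negPf ->.
Qed.

Lemma csum_eq0 L : evgood L -> (forall n, ev L n = 0) -> csum L = 0.
Proof.
move=> gL eL; rewrite /csum -(@gather_sum L _ (fun _ p => p))// big_seq big1// => c cL.
apply: (@ev_indep (gather L)) cL.
- by rewrite /unzip1 -map_comp map_id undup_uniq.
- apply/allP => _ /mapP[m hm ->] /=; move: hm; rewrite mem_undup => /mapP[c' c'L ->].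
  exact: (allP gL).
- move=> n; rewrite -(eL n) /ev (@gather_sum L _ (fun m p => m ^+ n * p.[n%:R]))// => [m p q|m].
    by rewrite hornerD mulrDr.
  by rewrite horner0 mulr0.
Qed.

Lemma exppoly_uniq a p q : exppoly a p -> exppoly a q -> p = q.
Proof.
move=> [L [g1 h1 ->]] [L' [g2 h2 ->]]; apply/eqP; rewrite -subr_eq0; apply/eqP.
have := @csum_eq0 (L ++ [seq (c.1, - c.2) | c <- L']).
rewrite /csum big_cat big_map sumrN; apply; first by rewrite /evgood all_cat all_map; apply/andP.
move=> n; rewrite /ev big_cat big_map /=; under [X in _ + X]eq_bigr do rewrite hornerN mulrN.
by rewrite sumrN; apply/eqP; rewrite subr_eq0; apply/eqP; rewrite -/(ev L n) -/(ev L' n) -h1 -h2.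
Qed.

Lemma exppoly_cst c : exppoly (fun _ => c) c%:P.
Proof.
exists [:: (1, c%:P)]; split; rewrite /csum ?big_seq1 ?hornerC//.
  by rewrite /evgood /= oner_neq0.
by move=> n; rewrite /ev big_seq1 expr1n mul1r hornerC.
Qed.

Lemma exppoly_add a b p q : exppoly a p -> exppoly b q -> exppoly (fun n => a n + b n) (p + q).
Proof.
move=> [L [g1 h1 ->]] [L' [g2 h2 ->]]; exists (L ++ L'); split.
- by rewrite /evgood all_cat; apply/andP.
- by move=> n; rewrite h1 h2 /ev big_cat.
- by rewrite /csum big_cat.
Qed.

Lemma exppoly_mul a b p q : exppoly a p -> exppoly b q -> exppoly (fun n => a n * b n) (p * q).
Proof.
move=> [L [g1 h1 ->]] [L' [g2 h2 ->]].
exists [seq (c.1 * c'.1, c.2 * c'.2) | c <- L, c' <- L']; split.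
- apply/allP => _ /allpairsP[[c c'] [/= cL c'L ->]] /=.
  by rewrite mulf_neq0 ?(allP g1 _ cL) ?(allP g2 _ c'L).
- move=> n; rewrite h1 h2 /ev big_allpairs_dep /= big_distrl /=; apply: eq_bigr => c _.
  rewrite big_distrr /=; apply: eq_bigr => c' _.
  by rewrite exprMn hornerM; ring.
- rewrite /csum big_allpairs_dep /= big_distrl /=; apply: eq_bigr => c _.
  by rewrite big_distrr.
Qed.

Lemma exppoly_poly p : exppoly (fun n => p.[n%:R]) p.
Proof.
exists [:: (1, p)]; split; rewrite /csum ?big_seq1//.
  by rewrite /evgood /= oner_neq0.
by move=> n; rewrite /ev big_seq1 expr1n mul1r.
Qed.

Lemma exppoly_sum (I : Type) (s : seq I) (f : I -> nat -> F) (g : I -> {poly F}) :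
  (forall i, exppoly (f i) (g i)) ->
  exppoly (fun n => \sum_(i <- s) f i n) (\sum_(i <- s) g i).
Proof.
move=> H; elim: s => [|i s [L [h1 h2 h3]]].
  have [L [h1 h2 h3]] := exppoly_cst 0; exists L; split=> //; last by rewrite big_nil -h3 polyC0.
  by move=> n; rewrite big_nil.
have [L' [h1' h2' h3']] := exppoly_add (H i) (ex_intro _ L (And3 h1 h2 h3)).
exists L'; split => //; last by rewrite big_cons.
by move=> n; rewrite big_cons -h2'.
Qed.

Lemma coef_X1n k j : (('X + 1%:P) ^+ k : {poly F})`_j = 'C(k, j)%:R.
Proof.
rewrite exprD1n coef_sum; under eq_bigr do rewrite coefMn coefXn.
have [jk|kj] := ltnP j k.+1; last first.
  rewrite bin_small// big1// => i _; case: eqP => [E|]; last by rewrite mul0rn.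
  by move: (ltn_ord i); rewrite -E ltnNge kj.
rewrite (bigD1 (Ordinal jk))//= eqxx big1 ?addr0// => i; rewrite -val_eqE /= eq_sym => /negPf ->.
by rewrite mul0rn.
Qed.

(** Triangularity in the degree: the top term of p is reached from X^k when m differs from z, and
    from X^(k + 1) when m = z, since the degree then drops by one. *)
Lemma dop_surj m z p : m != 0 -> exists q, dop m z q = p.
Proof.
move=> m0; have [k hk] : exists k, (size p <= k)%N by exists (size p).
elim: k p hk => [|k IH] p hp.
  exists 0; move: hp; rewrite leqn0 size_poly_eq0 => /eqP ->.
  by rewrite /dop comp_poly0 !scaler0 subrr.
have dopD u v : dop m z (u + v) = dop m z u + dop m z v.
  by rewrite /dop comp_polyD !scalerDr opprD addrACA.
have dopZ c u : dop m z (c *: u) = c *: dop m z u.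
  by rewrite /dop comp_polyZ scalerBr !scalerA ![c * _]mulrC.
have cX e j : (dop m z 'X^e)`_j = m * 'C(e, j)%:R - z * (j == e)%:R.
  by rewrite coefB !coefZ comp_Xn_poly coef_X1n coefXn.
suff [u [hu1 hu2]] : exists u, (dop m z u)`_k = 1 /\ forall j, (k < j)%N -> (dop m z u)`_j = 0.
  have [|v hv] := IH (p - p`_k *: dop m z u).
    apply/leq_sizeP => j; rewrite leq_eqVlt => /orP[/eqP <-|kj].
      by rewrite coefB coefZ hu1 mulr1 subrr.
    by rewrite coefB coefZ hu2// mulr0 subr0; apply: nth_default; exact: leq_trans hp kj.
  by exists (v + p`_k *: u); rewrite dopD hv dopZ subrK.
have [<-|mz] := eqVneq m z.
  exists ((m * k.+1%:R)^-1 *: 'X^(k.+1)).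
  have nz : m * k.+1%:R != 0 by rewrite mulf_neq0// pnatr_eq0.
  have cX' e j : (dop m m 'X^e)`_j = m * 'C(e, j)%:R - m * (j == e)%:R.
    by rewrite coefB !coefZ comp_Xn_poly coef_X1n coefXn.
  have dopZ' c u : dop m m (c *: u) = c *: dop m m u.
    by rewrite /dop comp_polyZ scalerBr !scalerA ![c * _]mulrC.
  split=> [|j kj]; rewrite dopZ' coefZ cX'.
    by rewrite binSn (ltn_eqF (ltnSn k)) mulr0 subr0 mulVf.
  move: kj; rewrite leq_eqVlt => /orP[/eqP <-|kj].
    by rewrite binn eqxx subrr mulr0.
  by rewrite bin_small// (gtn_eqF kj) !mulr0 subrr mulr0.
exists ((m - z)^-1 *: 'X^k); have nz : m - z != 0 by rewrite subr_eq0.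
split=> [|j kj]; rewrite dopZ coefZ cX.
  by rewrite binn eqxx !mulr1 mulVf.
by rewrite bin_small// (gtn_eqF kj) !mulr0 subrr mulr0.
Qed.

Lemma ev_solve z L : evgood L -> exists2 L', evgood L' & forall n, ev L' n.+1 - z * ev L' n = ev L n.
Proof.
elim: L => [|[m p] L IH] /=; first by exists [::] => // n; rewrite /ev !big_nil mulr0 subr0.
move=> /andP[m0 /IH[L' g' h']]; have [q hq] := dop_surj z p m0.
exists ((m, q) :: L'); first by rewrite /evgood /= m0.
move=> n; rewrite {3}/ev big_cons /= -/(ev L n) -h' -hq dopE /ev !big_cons /= exprS; ring.
Qed.

Fixpoint ann (s : seq F) a : Prop :=
  if s is z :: s' then ann s' (fun n => a n.+1 - z * a n) else forall n, a n = 0.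

(** First-order recurrences are solved one at a time: a particular solution from [ev_solve], plus a
    multiple of z^n adjusted at n = 0. *)
Lemma ann_ev s a : all (fun z => z != 0) s -> ann s a -> exists2 L, evgood L & forall n, a n = ev L n.
Proof.
elim: s a => [|z s IH] a /=; first by move=> _ h; exists [::] => // n; rewrite h /ev big_nil.
move=> /andP[z0 s0] /(IH _ s0)[L gL hL]; have [L' g' h'] := ev_solve z gL.
exists ((z, (a 0%N - ev L' 0)%:P) :: L'); first by rewrite /evgood /= z0.
move=> n; rewrite /ev big_cons /= hornerC -/(ev L' n).
elim: n => [|n IHn]; first by rewrite expr0 mul1r subrK.
have h1 : a n.+1 = z * a n + ev L n by rewrite -hL; ring.
have h2 : ev L' n.+1 = z * ev L' n + ev L n by rewrite -h'; ring.
by rewrite h1 h2 exprS {1}IHn; ring.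
Qed.

Definition pact p a n : F := \sum_(i < size p) p`_i * a (n + i)%N.

Lemma pact_wide p a n k : (size p <= k)%N -> pact p a n = \sum_(i < k) p`_i * a (n + i)%N.
Proof.
move=> pk; rewrite /pact (big_ord_widen k (fun i => p`_i * a (n + i)%N) pk) big_mkcond /=.
by apply: eq_bigr => i _; case: ltnP => // h; rewrite nth_default ?mul0r.
Qed.

Lemma pact_mulX p z a n : pact (p * ('X - z%:P)) a n = pact p (fun n => a n.+1 - z * a n) n.
Proof.
have sz : (size (p * ('X - z%:P))%R <= (size p).+1)%N.
  by apply: leq_trans (size_polyMleq _ _) _; rewrite size_XsubC addn2.
rewrite (pact_wide _ _ sz).
under eq_bigr do rewrite mulrBr coefB coefMX coefMC mulrBl.
rewrite sumrB big_ord_recl /= mul0r add0r.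
have -> : \sum_(i < (size p).+1) p`_i * z * a (n + i)%N = z * pact p a n.
  rewrite (@pact_wide p a n (size p).+1)// mulr_sumr; apply: eq_bigr => i _; ring.
rewrite /pact mulr_sumr -sumrB; apply: eq_bigr => i _.
by rewrite /= /bump /= add1n addnS; ring.
Qed.

Lemma pact_ann s a : (forall n, pact (\prod_(z <- s) ('X - z%:P)) a n = 0) -> ann s a.
Proof.
elim: s a => [|z s IH] a h /=.
  by move=> n; have := h n; rewrite big_nil /pact size_poly1 big_ord1 coef1 mul1r addn0.
by apply: IH => n; rewrite -pact_mulX -(h n) big_cons mulrC.
Qed.

(** The characteristic polynomial is split into linear factors; its constant coefficient is nonzero,
    so no eigenvalue is 0, as [evgood] demands. *)
Lemma recurrence_exppoly (k : nat) (c : 'I_k -> F) a (i0 : 'I_k) : i0 = 0%N :> nat -> c i0 != 0 ->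
  (forall n, \sum_(i < k) c i * a (n + i)%N = 0) -> exists p, exppoly a p.
Proof.
move=> i00 c0 H; pose p : {poly F} := \poly_(i < k) (if insub i is Some j then c j else 0).
have pE (i : 'I_k) : p`_i = c i by rewrite coef_poly ltn_ord valK.
have p0 : p.[0] != 0 by rewrite horner_coef0 -[0%N]i00 pE.
have pn0 : p != 0 by apply: contra p0 => /eqP ->; rewrite horner0.
have [s hs] := closed_field_poly_normal p.
have lp : lead_coef p != 0 by rewrite lead_coef_eq0.
have s0 : all (fun z => z != 0) s.
  apply/allP => z zs; apply: contra p0 => /eqP z0; rewrite hs hornerZ horner_prod.
  by rewrite (big_rem z)//= z0 hornerXsubC subrr mul0r mulr0.
have : ann s a.
  apply: pact_ann => n; set P := \prod_(z <- s) _ in hs *.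
  have PE : P = (lead_coef p)^-1 *: p.
    by have := congr1 (GRing.scale (lead_coef p)^-1) hs; rewrite scalerA mulVf// scale1r.
  have sP : (size P <= k)%N.
    by rewrite PE; apply: leq_trans (size_scale_leq _ _) _; exact: size_poly.
  rewrite (pact_wide _ _ sP).
  transitivity ((lead_coef p)^-1 * \sum_(i < k) c i * a (n + i)%N); last by rewrite H mulr0.
  by rewrite mulr_sumr; apply: eq_bigr => i _; rewrite PE coefZ pE mulrA.
move=> /(ann_ev s0)[L gL hL]; by exists (csum L), L.
Qed.

Lemma exppoly_conj a p : exppoly a p -> exppoly (fun n => (a n)^*) (map_poly Num.conj p).
Proof.
move=> [L [gL hL ->]]; exists [seq (c.1^*, map_poly Num.conj c.2) | c <- L]; split.
- by rewrite /evgood all_map; apply/allP => c /(allP gL) /=; rewrite fmorph_eq0.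
- move=> n; rewrite hL /ev big_map rmorph_sum; apply: eq_bigr => c _ /=.
  by rewrite rmorphM rmorphXn; congr (_ * _); rewrite -horner_map /= rmorph_nat.
- by rewrite /csum big_map rmorph_sum.
Qed.

End ExpPoly.

Section Tensor.
Variables (R : realType) (X Y : Type) (O1 : set (X -> R)) (O2 : set (Y -> R)).
Hypotheses (h1 : is_subalg O1) (h2 : is_subalg O2).

Definition tens : set (X * Y -> R) := [set F | exists (I : finType) (a : I -> X -> R) (b : I -> Y -> R),
  (forall i, O1 (a i) /\ O2 (b i)) /\ forall x y, F (x, y) = \sum_i a i x * b i y].

Lemma tens_subalg : is_subalg tens.
Proof.
split.
- move=> c; exists 'I_1, (fun _ _ => c), (fun _ _ => 1); split.
    by move=> _; split; exact: sa_cst.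
  by move=> x y; rewrite big_ord1 mulr1.
- move=> F F' [I [a [b [h hF]]]] [I' [a' [b' [h' hF']]]].
  exists (I + I')%type, (fun i => match i with inl i => a i | inr i => a' i end),
    (fun i => match i with inl i => b i | inr i => b' i end); split; first by case.
  by move=> x y; rewrite hF hF' big_sumType.
- move=> F F' [I [a [b [h hF]]]] [I' [a' [b' [h' hF']]]].
  exists (I * I')%type, (fun i x => a i.1 x * a' i.2 x), (fun i x => b i.1 x * b' i.2 x); split.
    by move=> [i i'] /=; have [? ?] := h i; have [? ?] := h' i'; split; apply: sa_mul.
  move=> x y; rewrite hF hF' big_distrl /= -(pair_big xpredT xpredT (fun i i' => a i x * a' i' x * (b i y * b' i' y))) /=.
  by apply: eq_bigr => i _; rewrite big_distrr /=; apply: eq_bigr => i' _; ring.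
Qed.

Lemma tens_fst f : O1 f -> tens (fun p => f p.1).
Proof.
move=> hf; exists 'I_1, (fun _ => f), (fun _ _ => 1); split; first by move=> _; split => //; exact: sa_cst.
by move=> x y; rewrite big_ord1 mulr1.
Qed.

Lemma tens_snd f : O2 f -> tens (fun p => f p.2).
Proof.
move=> hf; exists 'I_1, (fun _ _ => 1), (fun _ => f); split; first by move=> _; split => //; exact: sa_cst.
by move=> x y; rewrite big_ord1 mul1r.
Qed.

End Tensor.

(** * Algebraic groups described by their regular functions *)

Section AlgGroup.
Variables (R : realType) (G : groupType).
Implicit Types (O : set (G -> R)) (A B D : set G) (f : G -> R) (g h s u : G).

(** The group of real points of an affine algebraic group, given by the algebra O of its regular
    functions. By [ag_pts] every real character of O is a point of G; this is where unipotent
    components come from. *)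
Record alg_group O : Prop := AlgGroup {
  ag_sub : is_subalg O;
  ag_coalg : forall f, O f -> tens O O (fun p : G * G => f (p.1 * p.2)%g);
  ag_inv : forall f, O f -> O (fun g => f g^-1%g);
  ag_sep : forall g h, (forall f, O f -> f g = f h) -> g = h;
  ag_pts : forall chi : (G -> R) -> R, (forall c, chi (fun _ => c) = c) ->
    (forall f f', O f -> O f' -> chi (fun g => f g + f' g) = chi f + chi f') ->
    (forall f f', O f -> O f' -> chi (fun g => f g * f' g) = chi f * chi f') ->
    exists g, forall f, O f -> f g = chi f }.

Definition Delta g f : G -> R := fun h => f (h * g)%g - f h.
Definition unip O g := forall f, O f -> exists k, iter k (Delta g) f = cst 0.
Definition zclosure O A : set G := [set g | forall f, O f -> (forall a, A a -> f a = 0) -> f g = 0].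

Variable O : set (G -> R).
Hypothesis hO : alg_group O.
Let hS := ag_sub hO.
Local Notation zcl := (zclosure O).

Lemma O_transl h f : O f -> O (fun g => f (h * g)%g).
Proof.
move=> /(ag_coalg hO)[I [a [b [hab E]]]]; under eq_fun do rewrite (E h).
by apply: sa_sum => // i _; apply: sa_mul => //; [exact: sa_cst | case: (hab i)].
Qed.

Lemma O_transr h f : O f -> O (fun g => f (g * h)%g).
Proof.
move=> /(ag_coalg hO)[I [a [b [hab E]]]]; under eq_fun do rewrite (E _ h).
by apply: sa_sum => // i _; apply: sa_mul => //; [case: (hab i) | exact: sa_cst].
Qed.

Lemma sub_zcl A : A `<=` zcl A. Proof. by move=> a Aa f _; apply. Qed.

Lemma zcl_map A B (phi : G -> G) : (forall f, O f -> O (f \o phi)) ->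
  (forall a, A a -> zcl B (phi a)) -> forall g, zcl A g -> zcl B (phi g).
Proof. by move=> h1 h2 g Ag f Of fB; apply: (Ag (f \o phi)); [exact: h1 | move=> a /h2; apply]. Qed.

Lemma zcl_mono A B : A `<=` B -> zcl A `<=` zcl B.
Proof. by move=> AB g Ag f Of fB; apply: Ag => // a /AB; exact: fB. Qed.

Lemma zcl_idem A : zcl (zcl A) `<=` zcl A.
Proof. by move=> g hg f Of fA; apply: hg => // a; apply. Qed.

Lemma zcl_subgroup A : subgroup A -> subgroup (zcl A).
Proof.
move=> sA; have hV g : zcl A g -> zcl A g^-1%g.
  apply: (@zcl_map A A (fun g => g^-1%g)) => [f Of|a Aa]; first exact: (ag_inv hO Of).
  by apply: sub_zcl; exact: subgV.
have hM a g : A a -> zcl A g -> zcl A (a * g)%g.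
  move=> Aa; apply: (@zcl_map A A (fun g => a * g)%g) => [f Of|b Ab]; first exact: O_transl.
  by apply: sub_zcl; exact: subgM.
split=> [|x y hx hy]; first by apply: sub_zcl; exact: subg1.
apply: (@zcl_map A A (fun x => (x * y^-1)%g)) hx => [f Of|a Aa]; first exact: O_transr.
by apply: hM => //; exact: hV.
Qed.

Lemma O_conj h f : O f -> O (fun g => f (g ^ h)%g).
Proof. by move=> Of; rewrite /conjg; exact: (O_transr h (O_transl h^-1%g Of)). Qed.

Lemma O_conjr x f : O f -> O (fun h => f (x ^ h)%g).
Proof.
move=> /(ag_coalg hO)[I [a [b [hab E]]]]; under eq_fun do rewrite /conjg E.
apply: sa_sum => // i _; have [ha hb] := hab i; apply: sa_mul => //.
  exact: (ag_inv hO ha).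
exact: O_transl.
Qed.

Lemma zcl_normal A B : normal_in A B -> normal_in (zcl A) (zcl B).
Proof.
move=> [sA sB AB nA]; split; [exact: zcl_subgroup | exact: zcl_subgroup | exact: zcl_mono |].
move=> x y hx hy; apply: (@zcl_map B A (fun h => y ^ h)%g) hx => [f Of|b Bb]; first exact: O_conjr.
apply: (@zcl_map A A (fun y => y ^ b)%g) hy => [f Of|a Aa]; first exact: O_conj.
by apply: sub_zcl; exact: nA.
Qed.

Lemma zcl_commutator A B : subgroup B -> (forall a b, A a -> A b -> B [~ a, b]%g) ->
  forall a b, zcl A a -> zcl A b -> zcl B [~ a, b]%g.
Proof.
move=> sB h a b ha hb.
apply: (@zcl_map A B (fun a => [~ a, b]%g)) ha => [f Of|{}a Aa].
  have -> : (f \o (fun a => [~ a, b]%g)) = (fun a => f (a^-1 * (b^-1 * a * b)))%g.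
    by apply/funext => x; rewrite /= /commg /conjg !mulgA.
  have [I [a' [b' [hab E]]]] := ag_coalg hO Of; under eq_fun do rewrite E.
  apply: sa_sum => // i _; have [h1 h2] := hab i; apply: sa_mul => //.
    exact: (ag_inv hO h1).
  exact: (O_transl b^-1%g (O_transr b h2)).
apply: (@zcl_map A B (fun b => [~ a, b]%g)) hb => [f Of|b' Ab'].
  by rewrite /commg; exact: (O_conjr a (O_transl a^-1%g Of)).
by apply: sub_zcl; exact: h.
Qed.

Lemma zcl_derived k A : subgroup A -> derived_series k (zcl A) `<=` zcl (derived_series k A).
Proof.
elim: k A => [|k IH] A sA; first exact.
rewrite !derivedSr; apply: subset_trans (IH _ (subgroup_commutator A A)); apply: derived_mono.
apply: commutator_sub; first by apply: zcl_subgroup; exact: subgroup_commutator.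
apply: zcl_commutator; first exact: subgroup_commutator.
by move=> a b Aa Ab; exact: commutator_in.
Qed.

Lemma zcl1 : zcl [set 1%g] `<=` [set 1%g].
Proof.
move=> g hg; apply: (ag_sep hO) => f Of; apply/eqP; rewrite -subr_eq0; apply/eqP.
by apply: (hg (fun x => f x - f 1%g)) => [|a ->]; [apply: sa_sub => //; exact: sa_cst | rewrite subrr].
Qed.

Lemma sol_zcl k A : subgroup A -> sol k A -> sol k (zcl A).
Proof. by move=> sA sk g /(zcl_derived sA) h; apply: zcl1; apply: zcl_mono h. Qed.

(** Newton's forward difference formula for the right translation by g, truncated where the
    differences vanish. *)
Lemma newton g f k : iter k (Delta g) f = cst 0 -> forall n h,
  f (h * g ^+ n)%g = \sum_(j < k) 'C(n, j)%:R * iter j (Delta g) f h.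
Proof.
move=> fk; elim=> [|n IH] h.
  rewrite expg0 mulg1; case: k fk => [/= ->|k _]; first by rewrite big_ord0.
  by rewrite big_ord_recl /= bin0 mul1r big1 ?addr0// => i _; rewrite bin0n mul0r.
have E j : iter j (Delta g) f (h * g)%g = iter j (Delta g) f h + iter j.+1 (Delta g) f h.
  by rewrite /= /Delta addrC subrK.
rewrite expgS mulgA IH; under eq_bigr do rewrite E mulrDr.
rewrite big_split /=.
have -> : \sum_(i < k) 'C(n, i)%:R * Delta g (iter i (Delta g) f) h =
   \sum_(i < k.+1) (if nat_of_ord i is j.+1 then 'C(n, j)%:R * iter j.+1 (Delta g) f h else 0).
  by rewrite big_ord_recl /= add0r.
rewrite big_ord_recr /=; case: k fk {IH} => [|k] fk; first by rewrite !big_ord0 !addr0.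
rewrite -[X in _ + (_ + X)]/('C(n, k)%:R * iter k.+1 (Delta g) f h) fk /= mulr0 addr0 -big_split /=.
apply: eq_bigr => -[[|j] hj] _ /=; first by rewrite !bin0 addr0.
by rewrite binS natrD mulrDl.
Qed.

Lemma unip_powp g f : unip O g -> O f -> exists p : {poly R}, forall n : nat, f (g ^+ n)%g = p.[n%:R].
Proof.
move=> ug Of; have [k hk] := ug f Of.
exists (\sum_(j < k) iter j (Delta g) f 1%g *: bp R j) => n.
rewrite -[(g ^+ n)%g]mul1g (newton hk) horner_sum; apply: eq_bigr => j _.
by rewrite hornerZ bp_nat mulrC.
Qed.

(** Along the powers of a unipotent u a regular function is a polynomial in the exponent; if it
    vanishes at all multiples of k > 0, it vanishes at 1. *)
Lemma unip_root A u k : subgroup A -> unip O u -> (0 < k)%N -> zcl A (u ^+ k)%g -> zcl A u.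
Proof.
move=> sA uu k0 hk f Of fA; have [p hp] := unip_powp uu Of.
suff p0 : p = 0 by have := hp 1%N; rewrite expg1 p0 horner0.
apply: (@poly_inj0 R p (fun j => (k * j)%:R)).
  by move=> i j /eqP; rewrite eqr_nat eqn_pmul2l// => /eqP.
move=> j; rewrite -hp (_ : u ^+ (k * j) = (u ^+ k) ^+ j)%g; last first.
  by elim: j => [|j IH]; rewrite ?muln0 // mulnS expgnDr IH expgS.
by apply: (subgX j (zcl_subgroup sA) hk) => //.
Qed.

(** A finite union of translates of a closed set is closed: equations separating g from each
    translate are multiplied. *)
Lemma zcl_findex (A B : set G) (T : finType) (c : T -> G) :
  (forall b, B b -> exists t, A ((c t)^-1 * b)%g) ->
  forall g, zcl B g -> exists t, zcl A ((c t)^-1 * g)%g.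
Proof.
move=> h g Bg; apply: contrapT => /forallNP H.
have /choice[f hf] : forall t, exists f, [/\ O f, forall a, A a -> f a = 0 & f ((c t)^-1 * g)%g != 0].
  move=> t; apply: contrapT => /forallNP F; apply: (H t) => f Of fA.
  by apply: contrapT => /eqP fg; apply: (F f).
have : (fun g => \prod_t f t ((c t)^-1 * g)%g) g = 0.
  apply: (Bg (fun g => \prod_t f t ((c t)^-1 * g)%g)) => [|b /h[t At]].
    by apply: sa_prod => // t _; apply: O_transl; case: (hf t).
  rewrite (bigD1 t)//=; have -> : f t ((c t)^-1 * b)%g = 0 by case: (hf t) => _ h2 _; exact: h2.
    by rewrite mul0r.
by move/eqP/prodf_eq0 => [t _]; case: (hf t) => _ _ /negPf ->.
Qed.

(** Two powers of u lie in the same coset of the closure of A by the pigeonhole principle, so a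
    positive power of u lies in this closure, and [unip_root] concludes. *)
Lemma unip_findex (A B : set G) (T : finType) (c : T -> G) u : subgroup A -> subgroup B ->
  (forall b, B b -> exists t, A ((c t)^-1 * b)%g) -> unip O u -> zcl B u -> zcl A u.
Proof.
move=> sA sB h uu hu; have sz := zcl_subgroup sA.
have cos n : exists t, zcl A ((c t)^-1 * u ^+ n)%g.
  by apply: (zcl_findex h); exact: (subgX n (zcl_subgroup sB) hu).
have [t ht] := choice cos.
have /injectivePn[i [j ij tij]] : ~~ injectiveb [ffun i : 'I_#|T|.+1 => t i].
  apply/negP => /injectiveP /leq_card; by rewrite card_ord ltnn.
rewrite !ffunE in tij.
wlog lij : i j ij tij / (i < j)%N.
  move=> W; have [ij'|ji|/val_inj E] := ltngtP i j; [exact: (W i j) | | by rewrite E eqxx in ij].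
  by apply: (W j i) => //; rewrite eq_sym.
apply: (@unip_root _ _ (j - i)) => //; first by rewrite subn_gt0.
have h1 := ht i; have h2 := ht j; rewrite -tij in h2.
have := subgM sz (subgV sz h1) h2.
rewrite invgM invgK -mulgA mulVKg.
have -> : (u ^+ j = u ^+ i * u ^+ (j - i))%g by rewrite -expgnDr subnKC// ltnW.
by rewrite mulKg.
Qed.

(** A solvable normal subgroup of finite index in the group has a closed solvable normal closure,
    which contains all unipotent elements by [unip_findex]. This makes the unipotent radical of the
    closure the set of all its unipotent elements. *)
Lemma unip_virtually_solvable (Gam : groupType) (rho : Gam -> G) :
  (forall x y, rho (x * y) = rho x * rho y)%g -> virtually_polycyclic Gam ->
  exists A, [/\ normal_in A (zcl (range rho)), exists l, sol l A, zcl A `<=` A &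
     forall u, unip O u -> zcl (range rho) u -> A u].
Proof.
move=> rM /virtually_polycyclic_solvable[A0 [nA [l sA] [T [f hf]]]].
have r1 : rho 1%g = 1%g by apply: (mulgI (rho 1%g)); rewrite -rM !mulg1.
have rV x : rho (x^-1)%g = (rho x)^-1%g by apply: (mulgI (rho x)); rewrite -rM !mulgV.
pose A := rho @` A0; have [sA0 _ _ hA0] := nA.
have sgA : subgroup A.
  split; first by exists 1%g => //; exact: subg1.
  by move=> _ _ [a Aa <-] [b Ab <-]; exists (a * b^-1)%g; [exact: sA0.2 | rewrite rM rV].
have solA : sol l A.
  suff H : forall k (B : set Gam), subgroup B -> derived_series k (rho @` B) `<=` rho @` (derived_series k B).
    by move=> x /(H _ _ sA0)[y /sA -> <-]; rewrite r1.
  elim=> [|k IH] B sB; first exact.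
  rewrite !derivedSr; apply: subset_trans (IH _ (subgroup_commutator B B)); apply: derived_mono.
  apply: commutator_sub.
    split; first by exists 1%g => //; apply: subg1; exact: subgroup_commutator.
    move=> _ _ [a Aa <-] [b Ab <-]; exists (a * b^-1)%g; last by rewrite rM rV.
    exact: (subgroup_commutator B B).2.
  move=> _ _ [a Aa <-] [b Ab <-]; exists [~ a, b]%g; first exact: commutator_in.
  by rewrite /commg /conjg !rM !rV.
have sr : subgroup (range rho).
  split; first by exists 1%g.
  by move=> _ _ [a _ <-] [b _ <-]; exists (a * b^-1)%g => //; rewrite rM rV.
exists (zcl A); split.
- apply: zcl_normal; split => //; first by move=> _ [a _ <-]; exists a.
  by move=> _ _ [x _ <-] [a Aa <-]; exists (a ^ x)%g; [exact: hA0 | rewrite /conjg !rM !rV].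
- by exists l; exact: sol_zcl.
- exact: zcl_idem.
move=> u uu hu.
pose r t := xget 1%g [set x | f x = t].
have rP x : f (r (f x)) = f x by apply: (@xgetPex _ 1%g [set y | f y = f x]); exists x.
apply: (@unip_findex A (range rho) T (rho \o r)) => //.
move=> _ [x _ <-]; exists (f x); exists ((r (f x))^-1 * x)%g; last by rewrite rM rV.
by apply: hf.
Qed.

End AlgGroup.

(** * Unipotent components of elements *)

Section UnipotentPart.
Variables (R : realType) (G : groupType) (O : set (G -> R)).
Hypothesis hO : alg_group O.
Implicit Types (A B D : set G) (f : G -> R) (g h s u : G).
Let hS := ag_sub hO.
Local Notation C := (R[i]).
Local Notation cx x := (real_complex R x).
Local Notation zcl := (zclosure O).

(** If f (h g) is the sum of a_i(h) b_i(g) over K indices, the K + 1 vectors of values b_i(s^j), j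
    <= K, are dependent, which gives a linear recurrence valid for all h. *)
Lemma seq_exppoly s f : O f -> exists p, exppoly (fun n => cx (f (s ^+ n)%g)) p.
Proof.
move=> /(ag_coalg hO)[I [a [b [hab E]]]].
pose K := #|I|; pose B : 'M[R]_(K.+1, K) := \matrix_(j, i) b (enum_val i) (s ^+ j)%g.
have : kermx B != 0.
  rewrite kermx_eq0 /row_free; apply/eqP => rB; have := rank_leq_col B; rewrite rB ltnn//.
move=> /rowV0Pn[c /sub_kermxP cB c0].
pose ct j : R := c 0 (inord j).
have rel h : \sum_(0 <= j < K.+1) ct j * f (h * s ^+ j)%g = 0.
  rewrite big_mkord.
  transitivity (\sum_(i < K) a (enum_val i) h * (c *m B) 0 i); last first.
    by rewrite cB big1// => i _; rewrite mxE mulr0.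
  under [RHS]eq_bigr do rewrite mxE mulr_sumr.
  rewrite exchange_big /=; apply: eq_bigr => j _; rewrite E mulr_sumr /ct inord_val.
  rewrite (reindex _ (onW_bij _ (enum_val_bij I))) /=; apply: eq_bigr => i _.
  by rewrite mxE; ring.
have ex0 : exists j, (j < K.+1)%N && (ct j != 0).
  have [j cj] : exists j, c 0 j != 0.
    apply: contrapT => /forallNP H; move/eqP: c0; apply; apply/rowP => j; rewrite mxE.
    by apply/eqP; apply: contrapT => /negP; exact: H.
  by exists j; rewrite ltn_ord /ct inord_val.
case: (ex_minnP ex0) => j0 /andP[j0K cj0] jmin.
have kp : (0 < K.+1 - j0)%N by rewrite subn_gt0.
apply: (@recurrence_exppoly _ _ (fun i : 'I_(K.+1 - j0) => cx (ct (i + j0)%N)) _ (Ordinal kp)) => //=.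
  by rewrite add0n; apply: contra cj0 => /eqP [->].
(* The recurrence is shifted by the least index j0 with a nonzero coefficient, using that s is
   invertible; its constant coefficient is then nonzero. *)
move=> n; have := rel (s ^+ n * (s ^+ j0)^-1)%g.
rewrite (big_cat_nat (n := j0))//=; last exact: ltnW.
rewrite big_nat big1 ?add0r => [|j /andP[_ jj0]]; last first.
  have [->|cj] := eqVneq (ct j) 0; first by rewrite mul0r.
  by have := jmin j; rewrite cj (ltn_trans jj0 j0K) => /(_ isT); rewrite leqNgt jj0.
rewrite -{1}[j0]add0n big_addn big_mkord => H.
transitivity (cx (\sum_(i < K.+1 - j0) ct (i + j0)%N * f (s ^+ n * (s ^+ j0)^-1 * s ^+ (i + j0))%g)); last by rewrite H.
rewrite rmorph_sum; apply: eq_bigr => i _; rewrite rmorphM; congr (_ * cx (f _)).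
by rewrite (addnC i j0) !expgnDr -!mulgA mulKg.
Qed.

Definition pol s f : {poly C} := xget 0 [set p | exppoly (fun n => cx (f (s ^+ n)%g)) p].

Lemma polP s f : O f -> exppoly (fun n => cx (f (s ^+ n)%g)) (pol s f).
Proof. by move=> Of; apply: (@xgetPex _ 0 [set p | exppoly _ p]); exact: seq_exppoly. Qed.

Lemma pol_eq s f p : O f -> exppoly (fun n => cx (f (s ^+ n)%g)) p -> pol s f = p.
Proof. by move=> Of; apply: exppoly_uniq; exact: polP. Qed.

(** Complex conjugation fixes the real sequence, hence its polynomial, by uniqueness. *)
Lemma pol_real s f : O f -> (pol s f).[1] = cx (complex.Re (pol s f).[1]).
Proof.
move=> Of; have H : map_poly Num.conj (pol s f) = pol s f.
  apply/esym/pol_eq => //; have := exppoly_conj (polP s Of).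
  by under eq_fun do rewrite [Num.conj _]conjc_real.
have : ((pol s f).[1])^* = (pol s f).[1] by rewrite -[in RHS]H -[1 in RHS](rmorph1 Num.conj) horner_map.
case: ((pol s f).[1]) => x y [] /= /eqP; rewrite eq_sym -addr_eq0 -mulr2n mulrn_eq0 /= => /eqP ->.
by [].
Qed.

(* The unipotent Jordan component of [s]: the eigenvalues occurring in the
   exponential polynomials [n |-> f (s ^+ n)] are replaced by 1. *)
Lemma upoint s : exists u, forall f, O f -> cx (f u) = (pol s f).[1].
Proof.
have inj : injective (fun x : R => cx x) by move=> x y [].
have [|||u hu] := @ag_pts _ _ _ hO (fun f => complex.Re (pol s f).[1]).
- move=> c; rewrite (@pol_eq s (fun _ => c) (cx c)%:P) ?hornerC//; first exact: sa_cst.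
  exact: exppoly_cst.
- move=> f f' Of Of'; apply: inj; rewrite -pol_real; last exact: sa_add.
  rewrite (@pol_eq s (fun g => f g + f' g) (pol s f + pol s f')); last 2 first.
  + exact: sa_add.
  + by under eq_fun do rewrite rmorphD; apply: exppoly_add; exact: polP.
  by rewrite hornerD {1}(pol_real s Of) {1}(pol_real s Of') rmorphD.
- move=> f f' Of Of'; apply: inj; rewrite -pol_real; last exact: sa_mul.
  rewrite (@pol_eq s (fun g => f g * f' g) (pol s f * pol s f')); last 2 first.
  + exact: sa_mul.
  + by under eq_fun do rewrite rmorphM; apply: exppoly_mul; exact: polP.
  by rewrite hornerM {1}(pol_real s Of) {1}(pol_real s Of') rmorphM.
by exists u => f Of; rewrite hu// -pol_real.
Qed.

Section Point.
Variables (s u : G).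
Hypothesis hu : forall f, O f -> cx (f u) = (pol s f).[1].

Lemma upoint_zcl A : subgroup A -> zcl A s -> zcl A u.
Proof.
move=> sA hs f Of fA; have := hu Of; rewrite (@pol_eq s f 0)//.
  by rewrite horner0 => -[].
have -> : (fun n => cx (f (s ^+ n)%g)) = (fun _ => 0).
  by apply/funext => n; rewrite (subgX n (zcl_subgroup hO sA) hs f Of fA).
by have := @exppoly_cst C 0; rewrite polyC0.
Qed.

Lemma upoint_step f h (L : seq (C * {poly C})) : O f -> evgood L ->
  (forall n, cx (f (h * s ^+ n)%g) = ev L n) ->
  forall n, cx (f (h * u * s ^+ n)%g) = ev [seq (c.1, c.2 \Po ('X + 1%:P)) | c <- L] n.
Proof.
move=> Of gL hL n; pose phi g := f (h * g * s ^+ n)%g.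
have Ophi : O phi by exact: (O_transl hO h (O_transr hO (s ^+ n)%g Of)).
pose Ln := [seq (c.1, c.1 ^+ n *: (c.2 \Po ('X + n%:R%:P))) | c <- L].
have e : exppoly (fun m => cx (phi (s ^+ m)%g)) (csum Ln).
  exists Ln; split => //; first by rewrite /evgood all_map.
  move=> m; rewrite /phi -mulgA -expgnDr hL /ev big_map; apply: eq_bigr => c _ /=.
  by rewrite hornerZ horner_comp hornerD hornerX hornerC exprD natrD mulrA.
rewrite -[LHS]/(cx (phi u)) (hu Ophi) (pol_eq Ophi e) /csum horner_sum big_map /ev big_map.
apply: eq_bigr => c _ /=.
by rewrite hornerZ !horner_comp !hornerD !hornerX !hornerC addrC.
Qed.

(** Each factor u shifts the polynomials by one and leaves the eigenvalues unchanged, so f (h u^k)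
    is polynomial in k. *)
Lemma upoint_pow f k h (L : seq (C * {poly C})) : O f -> evgood L ->
  (forall n, cx (f (h * s ^+ n)%g) = ev L n) ->
  cx (f (h * u ^+ k)%g) = (csum L).[k%:R].
Proof.
move=> Of; elim: k h L => [|k IH] h L gL hL.
  rewrite expg0 mulg1 -[h]mulg1 -(expg0 s) hL /ev /csum horner_sum; apply: eq_bigr => c _.
  by rewrite expr0 mul1r.
rewrite expgS mulgA (IH _ [seq (c.1, c.2 \Po ('X + 1%:P)) | c <- L]).
- rewrite /csum !horner_sum big_map; apply: eq_bigr => c _ /=.
  by rewrite horner_comp hornerD hornerX hornerC natr1.
- by rewrite /evgood all_map.
- exact: upoint_step.
Qed.

Lemma Delta_nilp K f : (forall h, exists2 p : {poly C}, (size p <= K)%N &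
    forall k : nat, cx (f (h * u ^+ k)%g) = p.[k%:R]) -> iter K (Delta u) f = cst 0.
Proof.
elim: K f => [|K IH] f H.
  apply/funext => h; have [p] := H h; rewrite leqn0 size_poly_eq0 => /eqP -> /(_ 0%N).
  by rewrite expg0 mulg1 horner0 => -[].
rewrite iterSr; apply: IH => h; have [p sp hp] := H h; exists (dop 1 1 p).
  have [->|p0] := eqVneq p 0; first by rewrite /dop comp_poly0 !scaler0 subrr size_poly0.
  by rewrite -ltnS; apply: leq_trans sp; exact: size_dop_lt.
move=> k; by rewrite dopE !mul1r /Delta -!hp expgSr mulgA rmorphB.
Qed.

(** The degree of f (h u^k) in k is bounded independently of h, because the finitely many functions
    b_i of the coproduct of f do not depend on h; enough differences then vanish. *)
Lemma upoint_unip : unip O u.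
Proof.
move=> f Of; have [I [a [b [hab E]]]] := ag_coalg hO Of.
exists (\max_i size (pol s (b i)))%N; apply: Delta_nilp => h.
pose p := \sum_i cx (a i h) *: pol s (b i).
have e : exppoly (fun n => cx (f (h * s ^+ n)%g)) p.
  under eq_fun do rewrite E rmorph_sum; apply: exppoly_sum => i.
  under eq_fun do rewrite rmorphM; rewrite -mul_polyC; apply: exppoly_mul; first exact: exppoly_cst.
  by apply: polP; case: (hab i).
exists p; last first.
  by have [L [gL hL ->]] := e; move=> k; exact: upoint_pow.
apply: leq_trans (size_sum _ _ _) _; apply/bigmax_leqP => i _.
apply: leq_trans (size_scale_leq _ _) _; exact: (@leq_bigmax _ (fun i => size (pol s (b i)))).
Qed.

Lemma upoint_poly f (p : {poly R}) : O f -> (forall n : nat, f (s ^+ n)%g = p.[n%:R]) -> f u = p.[1].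
Proof.
move=> Of hp; have inj : injective (fun x : R => cx x) by move=> x y [].
apply: inj; rewrite (hu Of) (@pol_eq s f (map_poly (real_complex R) p))//.
  by rewrite -[1 in LHS](rmorph1 (real_complex R)) horner_map.
have -> : (fun n => cx (f (s ^+ n)%g)) = (fun n => (map_poly (real_complex R) p).[n%:R]).
  by apply/funext => n; rewrite hp -(rmorph_nat (real_complex R) n) horner_map.
exact: exppoly_poly.
Qed.

(** With y = x (w(s) - 1) fixed by w(s), the sequence x w(s^n) = x + n y is polynomial, so its value
    at the unipotent component u is x + y. As u fixes x, y = 0. *)
Lemma upoint_semisimple m (w : G -> 'M[R]_m) (x : 'rV[R]_m) :
  mxin O w -> (forall n : nat, x *m w (s ^+ n)%g = x *m w s ^+ n) -> x *m w u = x ->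
  x *m (w s - 1) *m (w s - 1) = 0 -> x *m (w s - 1) = 0.
Proof.
move=> hw wX wu; set y := x *m (w s - 1) => y0.
have yw : y *m w s = y by apply/eqP; rewrite -subr_eq0 -{2}[y]mulmx1 -mulmxBr y0.
have xw n : x *m w (s ^+ n)%g = x + n%:R *: y.
  rewrite wX; elim: n => [|n IH]; first by rewrite expr0 mulmx1 scale0r addr0.
  rewrite exprSr -[_ * w s]/(_ *m w s) mulmxA IH mulmxDl -scalemxAl yw -natr1 scalerDl scale1r.
  by rewrite (_ : x *m w s = x + y) -?addrA 1?[y + _]addrC// /y mulmxBr mulmx1 addrC subrK.
apply/rowP => j; rewrite [RHS]mxE.
have Of : O (fun g => (x *m w g) 0 j).
  by apply: mxin_mul => //; exact: mxin_cst.
have := @upoint_poly _ ((x 0 j)%:P + y 0 j *: 'X) Of; rewrite wu.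
rewrite hornerD hornerC hornerZ hornerX mulr1 => H.
have {}H : x 0 j = x 0 j + y 0 j.
  apply: H => n; rewrite xw hornerD hornerC hornerZ hornerX mxE [X in _ + X = _]mxE.
  by rewrite mulrC.
by apply: (addrI (x 0 j)); rewrite addr0 -H.
Qed.

End Point.
End UnipotentPart.

Lemma poly_div0 (R : realType) (f : R -> R) : polyfun f -> f 0 = 0 ->
  exists2 g, polyfun g & forall t, f t = t * g t.
Proof.
move=> [p hp] f0; have : root p 0 by rewrite /root -hp f0.
move=> /factor_theorem[q hq]; exists (fun t => q.[t]); first by exists q.
by move=> t; rewrite hp hq hornerM hornerXsubC subr0 mulrC.
Qed.

Lemma lin_set_mx (R : realType) n (H : set 'rV[R]_n) : H 0 ->
  (forall x y, H x -> H y -> H (x + y)) -> (forall (t : R) x, H x -> H (t *: x)) ->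
  exists B : 'M[R]_n, forall v, H v <-> (v <= B)%MS.
Proof.
move=> H0 HD HZ.
pose good m := `[< exists B : 'M[R]_n, (forall v : 'rV[R]_n, (v <= B)%MS -> H v) /\ \rank B = m >].
have ex0 : exists m, good m.
  exists 0%N; apply/asboolP; exists 0; rewrite mxrank0; split => // v.
  by rewrite submx0 => /eqP ->.
have bd m : good m -> (m <= n)%N by move=> /asboolP[B [_ <-]]; exact: rank_leq_row.
case: (ex_maxnP ex0 bd) => m /asboolP[B [hB rB]] mmax; exists B => v; split; last exact: hB.
move=> Hv; have : good (\rank (B + v)%MS).
  apply/asboolP; exists <<(B + v)%MS>>%MS; rewrite mxrank_gen; split => // u.
  rewrite genmxE => /sub_addsmxP[[a b] /= ->]; apply: HD; first by apply: hB; exact: submxMl.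
  by rewrite [b]mx11_scalar mul_scalar_mx; exact: HZ.
move=> /mmax h; have hs : (B <= B + v)%MS by exact: addsmxSl.
have : (B + v <= B)%MS by rewrite -(mxrank_leqif_sup hs).2 eqn_leq mxrankS//= rB.
exact: submx_trans (addsmxSr _ _).
Qed.

Definition polyfn (R : realType) n (f : 'rV[R]_n -> R) :=
  forall (X : Type) (A : set (X -> R)), is_subalg A ->
  forall g : X -> 'rV[R]_n, mxin A g -> A (fun x => f (g x)).

(* The law of a unipotent group in logarithmic coordinates. *)
Record plaw (R : realType) n (P : 'rV[R]_n -> 'rV[R]_n -> 'rV[R]_n) : Prop := PLaw {
  plA : forall x y z, P (P x y) z = P x (P y z);
  plx0 : forall x, P x 0 = x;
  pl_line : forall x (s t : R), P (s *: x) (t *: x) = (s + t) *: x;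
  pl_poly : polymap2 P }.

(** * Affine actions in logarithmic coordinates *)

Section PLawTheory.
Variables (R : realType) (n : nat) (P : 'rV[R]_n -> 'rV[R]_n -> 'rV[R]_n).
Hypothesis hP : plaw P.
Implicit Types (x y z v : 'rV[R]_n) (s t : R) (H : set 'rV[R]_n).
Let hs := polyfun_subalg R.

Lemma pl0x x : P 0 x = x.
Proof. by have := pl_line hP x 0 1; rewrite scale0r add0r scale1r. Qed.

Lemma plxN x : P x (- x) = 0.
Proof. by have := pl_line hP x 1 (-1); rewrite scale1r scaleN1r subrr scale0r. Qed.

Lemma plNx x : P (- x) x = 0.
Proof. by have := plxN (- x); rewrite opprK. Qed.

Lemma plKN x y : P (- x) (P x y) = y. Proof. by rewrite -(plA hP) plNx pl0x. Qed.
Lemma plNK x y : P x (P (- x) y) = y. Proof. by rewrite -(plA hP) plxN pl0x. Qed.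
Lemma plK x y : P (P y x) (- x) = y. Proof. by rewrite (plA hP) plxN (plx0 hP). Qed.
Lemma plKr x y : P (P y (- x)) x = y. Proof. by rewrite (plA hP) plNx (plx0 hP). Qed.

Lemma plI x y z : P x y = P x z -> y = z.
Proof. by move=> h; rewrite -(plKN x y) h plKN. Qed.

Lemma plNP x y : - P x y = P (- y) (- x).
Proof. by apply: (@plI (P x y)); rewrite plxN -(plA hP) plK plxN. Qed.

Lemma line_fun x : mxin (@polyfun R) (fun t => t *: x).
Proof. by apply: mxin_scale => //; [exact: polyfun_id | exact: mxin_cst]. Qed.

(** P (s x, t y) - s x - t y vanishes for s = 0 and for t = 0, hence is divisible by s t; then t =
    s. *)
Lemma P_first (x y : R -> 'rV[R]_n) : mxin (@polyfun R) x -> mxin (@polyfun R) y ->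
  exists q : R -> 'rV[R]_n, [/\ mxin (@polyfun R) q, q 0 = x 0 + y 0 &
  forall s, P (s *: x s) (s *: y s) = s *: q s].
Proof.
move=> hx hy; have key j : exists2 e, polyfun e & forall s, P (s *: x s) (s *: y s) 0 j = s * (x s 0 j + y s 0 j) + s ^+ 2 * e s.
  have hpA := polyA_subalg hs.
  pose F (st : R * R) := P (st.1 *: x st.1) (st.2 *: y st.1) 0 j - st.1 * x st.1 0 j - st.2 * y st.1 0 j.
  have x1 : mxin (polyA (@polyfun R)) (fun st : R * R => x st.1) by move=> a b; exact: (polyA_fst hs (hx a b)).
  have y1 : mxin (polyA (@polyfun R)) (fun st : R * R => y st.1) by move=> a b; exact: (polyA_fst hs (hy a b)).
  have lin1 : mxin (polyA (@polyfun R)) (fun st : R * R => st.1 *: x st.1).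
    by apply: mxin_scale => //; exact: (polyA_fst hs (polyfun_id R)).
  have lin2 : mxin (polyA (@polyfun R)) (fun st : R * R => st.2 *: y st.1).
    by apply: mxin_scale => //; exact: polyA_snd.
  have : polyA (@polyfun R) F.
    apply: sa_sub => //; [apply: sa_sub => //|].
    - exact: (pl_poly hP hpA lin1 lin2).
    - by apply: sa_mul => //; exact: (polyA_fst hs (polyfun_id R)).
    - by apply: sa_mul => //; exact: polyA_snd.
  move=> [m [p [h1 h2 h3]]].
  have F0t t : F (0, t) = 0 by rewrite /F /= scale0r pl0x mxE mul0r subr0 subrr.
  have Fs0 s : F (s, 0) = 0 by rewrite /F /= scale0r (plx0 hP) mxE mul0r subr0 subrr.
  have c0 s : (p s)`_0 = 0 by rewrite -horner_coef0 -h3 Fs0.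
  have ck k : exists2 d, polyfun d & forall s, (p s)`_k = s * d s.
    apply: poly_div0 => //; suff -> : p 0 = 0 by rewrite coef0.
    by apply: poly_ext => t; rewrite -h3 F0t horner0.
  have /choice[d hd] : forall k, exists d, polyfun d /\ forall s, (p s)`_k = s * d s.
    by move=> k; have [d] := ck k; exists d.
  exists (fun s => \sum_(k < m) (if nat_of_ord k is k'.+1 then d k s * s ^+ k' else 0)).
    apply: sa_sum => // -[[|k] hk] _ /=; first exact: sa_cst.
    by apply: sa_mul => //; [case: (hd k.+1) | apply: sa_exp => //; exact: polyfun_id].
  move=> s; have := h3 s s; rewrite /F /= (horner_coef_wide _ (h2 s)) mulr_sumr => E.
  have -> : \sum_(i < m) s ^+ 2 * (if nat_of_ord i is k'.+1 then d i s * s ^+ k' else 0) =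
     \sum_(i < m) (p s)`_i * s ^+ i.
    apply: eq_bigr => -[[|k] hk] _ /=; first by rewrite c0 mul0r mulr0.
    by rewrite (hd k.+1).2 (exprS s k); ring.
  by rewrite -E; ring.
have /choice[e he] : forall j, exists e, polyfun e /\ forall s, P (s *: x s) (s *: y s) 0 j = s * (x s 0 j + y s 0 j) + s ^+ 2 * e s.
  by move=> j; have [e] := key j; exists e.
exists (fun s => \row_j (x s 0 j + y s 0 j + s * e j s)); split.
- move=> i j; under eq_fun do rewrite mxE.
  apply: sa_add => //; first by apply: (sa_add hs); [exact: (hx 0 j) | exact: (hy 0 j)].
  by apply: (sa_mul hs); [exact: polyfun_id | exact: (he j).1].
- by apply/rowP => j; rewrite !mxE mul0r addr0.
- by move=> s; apply/rowP => j; rewrite (he j).2 !mxE; ring.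
Qed.

(* Polynomial equations turn closure under integer multiples into closure under
   real ones; sums are then limits of [s^-1 *: P (s *: x) (s *: y)]. *)
Lemma log_linear_subgroup H (Fs : set ('rV[R]_n -> R)) : H 0 -> (forall x y, H x -> H y -> H (P x y)) ->
  (forall f, Fs f -> polyfn f) -> (forall v, H v <-> forall f, Fs f -> f v = 0) ->
  exists B : 'M[R]_n, forall v, H v <-> (v <= B)%MS.
Proof.
move=> H0 HM hF HE.
have HZ (t : R) x : H x -> H (t *: x).
  move=> Hx; apply/HE => f Ff; move: t; apply: polyfun_nat0.
    by apply: (hF f Ff) => //; exact: line_fun.
  move=> k; have Hk : H (k%:R *: x).
    elim: k => [|k IH]; first by rewrite scale0r.
    by rewrite -natr1 -(pl_line hP) scale1r; exact: HM.
  by apply/(HE _).1.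
apply: lin_set_mx => // x y Hx Hy; have hc z : mxin (@polyfun R) (fun _ => z : 'rV[R]_n) by exact: mxin_cst.
have [q [hq q0 hPq]] := P_first (hc x) (hc y).
apply/HE => f Ff; rewrite -q0; apply: (@polyfun_small0 R (fun s => f (q s)) 1) => //.
  exact: (hF f Ff).
move=> s s0 _; have Hq : H (q s).
  have -> : q s = s^-1 *: P (s *: x) (s *: y) by rewrite hPq scalerA mulVf ?scale1r ?gt_eqF.
  by apply: (HZ); apply: (HM); exact: (HZ).
by apply/(HE _).1.
Qed.

End PLawTheory.

(** * Invariant vectors along a polycyclic series *)

Section FixedVector.
Variables (R : realType) (G : groupType) (O : set (G -> R)) (Gam : groupType) (rho : Gam -> G).
Hypothesis hO : alg_group O.
Hypothesis rM : forall x y, (rho (x * y) = rho x * rho y)%g.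
Variables (k : nat) (S : nat -> set Gam).
Hypothesis S0 : S 0%N = [set 1%g].
Hypothesis Sstep : forall i, (i < k)%N -> normal_in (S i) (S i.+1) /\
  (finite_quotient (S i.+1) (S i) \/ infinite_cyclic_quotient (S i.+1) (S i)).
Variables (m : nat) (w : G -> 'M[R]_m) (W : 'M[R]_m) (l : 'cV[R]_m) (i0 : nat).
Hypothesis i0k : (i0 <= k)%N.
Hypothesis hw : mxin O w.
Hypothesis wW : forall a (x : 'rV[R]_m), S i0 a -> (x <= W)%MS -> (x *m w (rho a) <= W)%MS.
Hypothesis wM : forall a b (x : 'rV[R]_m), S i0 a -> S i0 b -> (x <= W)%MS ->
  x *m w (rho (a * b)%g) = x *m w (rho b) *m w (rho a).
Hypothesis w1 : forall x : 'rV[R]_m, (x <= W)%MS -> x *m w 1%g = x.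
Hypothesis wu : forall u, unip O u -> zclosure O (range rho) u ->
  forall x : 'rV[R]_m, (x <= W)%MS -> x *m w u = x.
Hypothesis wl : forall a (x : 'rV[R]_m), S i0 a -> (x <= W)%MS -> x *m w (rho a) *m l = x *m l.

Lemma S_mono i j : (i <= j)%N -> (j <= k)%N -> S i `<=` S j.
Proof.
elim: j => [|j IH]; first by rewrite leqn0 => /eqP -> _.
rewrite leq_eqVlt => /orP[/eqP ij|ij] jk; first by rewrite ij.
apply: subset_trans (IH ij (ltnW jk)) _.
by case: (Sstep jk) => -[].
Qed.

Lemma S_sub i : (i <= k)%N -> subgroup (S i).
Proof.
case: i => [|i] ik; last by case: (Sstep ik) => -[].
by rewrite S0; split => // x y -> ->; rewrite mulgV.
Qed.

Lemma fixv_rho1 : rho 1%g = 1%g.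
Proof. by apply: (mulgI (rho 1%g)); rewrite -rM !mulg1. Qed.

Lemma fixv_semisimple a (x : 'rV[R]_m) : S i0 a -> (x <= W)%MS ->
  x *m (w (rho a) - 1) *m (w (rho a) - 1) = 0 -> x *m (w (rho a) - 1) = 0.
Proof.
move=> Sa xW; have [u hu] := upoint hO (rho a).
have sr : subgroup (range rho).
  split; first by exists 1%g => //; exact: fixv_rho1.
  move=> _ _ [b _ <-] [c _ <-]; exists (b * c^-1)%g => //; rewrite rM; congr (_ * _)%g.
  by apply: (mulgI (rho c)); rewrite -rM !mulgV fixv_rho1.
have hra : zclosure O (range rho) (rho a) by apply: sub_zcl; exists a.
apply: (upoint_semisimple hO hu hw); last first.
  by apply: wu xW; [exact: upoint_unip hu | exact: upoint_zcl hra].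
have rX j : rho (a ^+ j)%g = (rho a ^+ j)%g.
  by elim: j => [|j IH]; rewrite ?expg0 ?fixv_rho1// !expgS rM IH.
elim=> [|j IH]; first by rewrite !expg0 expr0 mulmx1 w1.
rewrite -rX expgS wM//; last by apply: subgX => //; exact: S_sub.
by rewrite rX IH exprSr mulmxA.
Qed.

(** One term of the series at a time. For a finite quotient the orbit is averaged. For an infinite
    cyclic one, generated by t, the vectors fixed so far split into the image and the kernel of w(t)
    - 1; the invariant form l kills the image, so the component in the kernel keeps the value 1. *)
Lemma fixed_vector (r0 : 'rV[R]_m) : (r0 <= W)%MS -> (r0 *m l) 0 0 = 1 ->
  exists r : 'rV[R]_m, [/\ (r <= W)%MS, (r *m l) 0 0 = 1 & forall a, S i0 a -> r *m w (rho a) = r].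
Proof.
move=> r0W r0l.
suff H i : (i <= i0)%N -> exists r : 'rV[R]_m, [/\ (r <= W)%MS, (r *m l) 0 0 = 1 &
    forall a, S i a -> r *m w (rho a) = r] by exact: H.
elim: i => [|i IH] ii0.
  by exists r0; split => // a; rewrite S0 => ->; rewrite fixv_rho1 w1.
have [r [rW rl rf]] := IH (ltnW ii0).
have ik := leq_trans ii0 i0k.
have [nS fq] := Sstep ik; have [sS sS2 SS hS] := nS.
have S20 := S_mono ii0 i0k.
have invol a (x : 'rV[R]_m) : S i0 a -> (x <= W)%MS -> x *m w (rho a) *m w (rho a^-1%g) = x.
  move=> Sa xW; have sa : S i0 a^-1%g by apply: subgV => //; exact: S_sub.
  by rewrite -wM// mulVg fixv_rho1 w1.
case: fq => [/(findex_quotient sS)[T [f hf]]|[f [fM f0 fsurj]]].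
  pose rep t := xget 1%g [set a | S i.+1 a /\ f a = t].
  have repP a : S i.+1 a -> S i.+1 (rep (f a)) /\ f (rep (f a)) = f a.
    by move=> Sa; apply: (@xgetPex _ 1%g [set b | S i.+1 b /\ f b = f a]); exists a.
  (* The orbit of r as a list without repetition, so that every group element permutes it. *)
  pose s := undup [seq r *m w (rho (rep t)) | t <- enum T & `[< exists2 a, S i.+1 a & f a = t >]].
  have rep_eq a b : S i.+1 a -> S i.+1 b -> f a = f b -> r *m w (rho a) = r *m w (rho b).
    move=> Sa Sb fab; have h := hf a b Sa Sb fab.
    by rewrite -[b](mulVKg a) (wM (S20 _ Sa) (S20 _ (SS _ h)) rW) (rf _ h).
  have sE v : (v \in s) <-> exists2 a, S i.+1 a & v = r *m w (rho a).
    rewrite mem_undup; split.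
      move=> /mapP[t]; rewrite mem_filter => /andP[/asboolP[a Sa <-] _] ->.
      by exists (rep (f a)) => //; case: (repP a Sa).
    move=> [a Sa ->]; apply/mapP; exists (f a).
      by rewrite mem_filter mem_enum andbT; apply/asboolP; exists a.
    by have [h1 h2] := repP a Sa; exact: rep_eq.
  have us : uniq s by exact: undup_uniq.
  have sW v : v \in s -> (v <= W)%MS by move=> /sE[a Sa ->]; apply: wW => //; exact: S20.
  have sl v : v \in s -> (v *m l) 0 0 = 1 by move=> /sE[a Sa ->]; rewrite wl//; exact: S20.
  have rs : r \in s by apply/sE; exists 1%g; [exact: subg1 | rewrite fixv_rho1 w1].
  have N0 : ((size s)%:R : R) != 0.
    by rewrite pnatr_eq0 -lt0n; case: (s) rs.
  exists ((size s)%:R^-1 *: \sum_(v <- s) v); split.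
  - by rewrite scalemx_sub// big_seq summx_sub.
  - rewrite -scalemxAl mxE mulmx_suml summxE big_seq (eq_bigr (fun _ => 1)) => [|v /sl //].
    by rewrite -big_seq big_const_seq count_predT iter_addr_0 mulVf.
  move=> a Sa; rewrite -scalemxAl mulmx_suml; congr (_ *: _).
  rewrite -[LHS](big_map (fun v => v *m w (rho a)) xpredT (fun v => v)).
  apply: perm_big; have inj : {in s &, injective (fun v : 'rV[R]_m => v *m w (rho a))}.
    by move=> v v' vs vs' E; rewrite -(invol a v) ?E ?invol ?sW//; exact: S20.
  have um : uniq [seq v *m w (rho a) | v <- s] by rewrite map_inj_in_uniq.
  apply: uniq_perm => //; have sub : {subset [seq v *m w (rho a) | v <- s] <= s}.
    move=> _ /mapP[v /sE[b Sb ->] ->]; apply/sE; exists (a * b)%g; first exact: subgM.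
    by rewrite wM//; exact: S20.
  by have [_ h] := uniq_min_size um sub (eq_leq (esym (size_map _ _))).
have [t St ft] := fsurj 1.
have [B hB] : exists B : 'M[R]_m, forall v : 'rV[R]_m,
    ((v <= W)%MS /\ forall a, S i a -> v *m w (rho a) = v) <-> (v <= B)%MS.
  apply: (@lin_set_mx R m [set v | (v <= W)%MS /\ forall a, S i a -> v *m w (rho a) = v]) => /=.
  - by split; [exact: sub0mx | move=> a _; rewrite mul0mx].
  - by move=> x y [h1 h2] [h3 h4]; split; [exact: addmx_sub | move=> a Sa; rewrite mulmxDl h2// h4].
  - by move=> c x [h1 h2]; split; [exact: scalemx_sub | move=> a Sa; rewrite -scalemxAl h2].
pose T := w (rho t) - 1.
have BT : (B *m T <= B)%MS.
  apply/row_subP => j; rewrite row_mul; set x := row j B.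
  have /hB[xW xf] : (x <= B)%MS by exact: row_sub.
  rewrite /T mulmxBr mulmx1; apply: addmx_sub; last by rewrite eqmx_opp row_sub.
  apply/hB; split; first by apply: wW => //; exact: S20.
  move=> a Sa; have Sa' := SS _ Sa; have Sc : S i (a ^ t)%g by exact: hS.
  rewrite -wM//; [|exact: S20|exact: S20].
  have -> : (a * t = t * a ^ t)%g by rewrite /conjg mulVKg.
  by rewrite (wM (S20 _ St) (S20 _ (SS _ Sc)) xW) (xf _ Sc).
(* Semisimplicity enters here: a vector in both the image and the kernel of T would come from a
   Jordan block of size two. Rank-nullity then yields the decomposition of B. *)
have cap0 : ((B *m T) :&: (B :&: kermx T) = 0)%MS.
  apply/eqP; rewrite -submx0; apply/rV_subP => v; rewrite !sub_capmx => /and3P[/submxP[c vE] vB /sub_kermxP vT].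
  rewrite submx0 vE mulmxA; apply/eqP; apply: fixv_semisimple; first exact: S20.
    by have /hB[] : (c *m B <= B)%MS by exact: submxMl.
  by rewrite -/T -[c *m B *m T]mulmxA -vE.
have rB : (r <= B)%MS by apply/hB.
have : (r <= B *m T + (B :&: kermx T))%MS.
  apply: submx_trans rB _; have h1 : (B *m T + (B :&: kermx T) <= B)%MS by rewrite addsmx_sub BT capmxSl.
  have := (mxrank_leqif_sup h1).2; rewrite mxrank_disjoint_sum// mxrank_mul_ker eqxx => /esym //.
move=> /sub_addsmxP[[c e] /= rE].
have hb : (e *m (B :&: kermx T) <= B :&: kermx T)%MS by exact: submxMl.
move: hb; set b := e *m _ in rE *; rewrite sub_capmx => /andP[/hB[bW bf] /sub_kermxP bT].
have bt : b *m w (rho t) = b by apply/eqP; rewrite -subr_eq0 -{2}[b]mulmx1 -mulmxBr bT.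
exists b; split => //.
  rewrite -rl rE mulmxDl mulmxA /T mulmxBr mulmx1 mulmxBl wl ?subrr ?add0r//; first exact: S20.
  by have /hB[] : (c *m B <= B)%MS by exact: submxMl.
pose Fx := [set a | S i.+1 a /\ b *m w (rho a) = b].
have sF : subgroup Fx.
  split; first by split; [exact: subg1 | rewrite fixv_rho1 w1].
  move=> x y [Sx bx] [Sy by_]; have SyV := subgV sS2 Sy; split; first exact: subgM.
  have byV : b *m w (rho y^-1%g) = b by rewrite -{1}by_ invol//; exact: S20.
  by rewrite wM ?byV//; exact: S20.
have f1 : f 1%g = 0 by apply/f0; exact: subg1.
have fV u : S i.+1 u -> f u^-1%g = - f u.
  by move=> hu; apply/eqP; rewrite -addr_eq0 -fM ?mulVg ?f1//; exact: subgV.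
have Ft j : Fx (t ^+ j)%g /\ f (t ^+ j)%g = j%:Z.
  have FtX : Fx (t ^+ j)%g by apply: subgX => //.
  split => //; elim: j {FtX} => [|j IHj]; first by rewrite expg0.
  by rewrite expgS fM// ?ft ?IHj ?intS//; exact: subgX.
have Fm z : exists2 g, Fx g & f g = z.
  case: z => j; first by have [h1 h2] := Ft j; exists (t ^+ j)%g.
  have [h1 h2] := Ft j.+1; exists (t ^+ j.+1)^-1%g; first exact: subgV.
  by rewrite fV ?h2 ?NegzE//; case: h1.
move=> a Sa; have [g Fg fg] := Fm (f a); have [Sg _] := Fg.
suff [] : Fx a by [].
rewrite -[a](mulVKg g); apply: subgM => //; have SgV := subgV sS2 Sg.
have Sga : S i (g^-1 * a)%g by apply/f0; [exact: subgM | rewrite fM// fV// fg addNr].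
by split; [exact: SS | exact: bf].
Qed.

End FixedVector.

Section PLawMore.
Variables (R : realType) (n : nat) (P : 'rV[R]_n -> 'rV[R]_n -> 'rV[R]_n).
Hypothesis hP : plaw P.
Implicit Types (x y z v : 'rV[R]_n) (s t : R).
Let hs := polyfun_subalg R.

(** By [P_first] the displayed product is t (y + z - x) up to higher order in t; dividing by t and
    setting t = 0 stays in the subspace. *)
Lemma lin_diff M x y z : (forall t, (P (- (t *: x)) (P (t *: y) (t *: z)) <= (M : 'M[R]_n))%MS) ->
  (y + z - x <= M)%MS.
Proof.
move=> H; have hc u : mxin (@polyfun R) (fun _ => u : 'rV[R]_n) by exact: mxin_cst.
have [q [hq q0 hPq]] := P_first hP (hc y) (hc z).
have [q' [hq' q'0 hPq']] := P_first hP (hc (- x)) hq.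
rewrite addrC -q0 -q'0 submxE; apply/eqP/rowP => j; rewrite [RHS]mxE.
apply: (@polyfun_small0 R (fun s => (q' s *m cokermx M) 0 j) 1) => //.
  by apply: mxin_mul => //; exact: mxin_cst.
move=> s s0 _; have : (q' s <= M)%MS.
  have := H s; rewrite hPq -scalerN hPq'.
  by rewrite eqmx_scale// gt_eqF.
by rewrite submxE => /eqP ->; rewrite mxE.
Qed.

Fixpoint uc i : set 'rV[R]_n :=
  if i is j.+1 then [set z | forall y, uc j (P (- (P y z)) (P z y))] else [set 0].

Lemma uc0 i : uc i 0.
Proof. by elim: i => //= i IH y; rewrite (plx0 hP) (pl0x hP) (plNx hP). Qed.

Lemma uc_mono i : uc i `<=` uc i.+1.
Proof.
elim: i => [_ -> y|i IH z hz y] /=; first by rewrite (plx0 hP) (pl0x hP) (plNx hP).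
by apply: IH; exact: hz.
Qed.

Lemma uc_le i j : (i <= j)%N -> uc i `<=` uc j.
Proof.
elim: j => [|j IH]; first by rewrite leqn0 => /eqP ->.
rewrite leq_eqVlt => /orP[/eqP -> //|ij]; apply: subset_trans (IH ij) (@uc_mono j).
Qed.

End PLawMore.

(* [g] acts on R^n by [x |-> P (tr g) (x *m ln g)], and [tau v] is the left
   translation by [v]; [uc] is the upper central series of [P]. *)
Record aff_struct (R : realType) n (P : 'rV[R]_n -> 'rV[R]_n -> 'rV[R]_n) (G : groupType)
  (O : set (G -> R)) (tr : G -> 'rV[R]_n) (ln : G -> 'M[R]_n) (tau : 'rV[R]_n -> G) : Prop := AffStruct {
  as_P : plaw P;
  as_O : alg_group O;
  as_tr : mxin O tr;
  as_ln : mxin O ln;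
  as_trM : forall g h, tr (g * h)%g = P (tr g) (tr h *m ln g);
  as_lnM : forall g h, ln (g * h)%g = ln h *m ln g;
  as_lnP : forall g x y, P x y *m ln g = P (x *m ln g) (y *m ln g);
  as_inj : forall g h, tr g = tr h -> ln g = ln h -> g = h;
  as_trt : forall v, tr (tau v) = v;
  as_lnt : forall v, ln (tau v) = 1%:M;
  as_tau : forall f, O f -> polyfn (fun v => f (tau v));
  as_nil : exists k, forall v, uc P k v }.

(** * Translations, conjugation and the upper central series *)

Section AffStruct.
Variables (R : realType) (n : nat) (P : 'rV[R]_n -> 'rV[R]_n -> 'rV[R]_n) (G : groupType).
Variables (O : set (G -> R)) (tr : G -> 'rV[R]_n) (ln : G -> 'M[R]_n) (tau : 'rV[R]_n -> G).
Hypothesis hA : aff_struct P O tr ln tau.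
Implicit Types (x y z v u : 'rV[R]_n) (g h : G) (A D : set G).
Let hP := as_P hA.
Let hO := as_O hA.
Let hS := ag_sub hO.
Local Notation zcl := (zclosure O).
Local Notation uc := (uc P).

Lemma tau0 : tau 0 = 1%g.
Proof.
apply: (mulgI (tau 0)); rewrite mulg1; apply: (as_inj hA).
  by rewrite (as_trM hA) !(as_trt hA) (as_lnt hA) mulmx1 (plx0 hP).
by rewrite (as_lnM hA) !(as_lnt hA) mulmx1.
Qed.

Lemma ln1 : ln 1%g = 1%:M. Proof. by rewrite -tau0 (as_lnt hA). Qed.

Lemma tauM x y : tau (P x y) = (tau x * tau y)%g.
Proof.
apply: (as_inj hA); rewrite ?(as_trM hA) ?(as_lnM hA) !(as_lnt hA) ?mulmx1 //.
by rewrite !(as_trt hA).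
Qed.

Lemma tauN x : tau (- x) = (tau x)^-1%g.
Proof. by apply: (mulgI (tau x)); rewrite -tauM (plxN hP) mulgV tau0. Qed.

Lemma tauX x (k : nat) : tau (k%:R *: x) = (tau x ^+ k)%g.
Proof.
elim: k => [|k IH]; first by rewrite scale0r expg0 tau0.
have -> : k.+1%:R *: x = P (k%:R *: x) x by rewrite -natr1 -(pl_line hP) scale1r.
by rewrite tauM IH expgSr.
Qed.

Lemma tau_inj x y : tau x = tau y -> x = y.
Proof. by move=> h; rewrite -(as_trt hA x) h (as_trt hA). Qed.

Lemma tau_of g : ln g = 1%:M -> g = tau (tr g).
Proof. by move=> h; apply: (as_inj hA); rewrite ?(as_trt hA) ?(as_lnt hA). Qed.

Lemma lnV g : ln g^-1%g *m ln g = 1%:M. Proof. by rewrite -(as_lnM hA) mulgV ln1. Qed.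
Lemma lnVr g : ln g *m ln g^-1%g = 1%:M. Proof. by rewrite -(as_lnM hA) mulVg ln1. Qed.

Definition cj g v := P (P (tr g) (v *m ln g)) (- tr g).

Lemma cjE g v : (g * tau v * g^-1)%g = tau (cj g v).
Proof.
apply: (mulIg g); rewrite mulgVK; apply: (as_inj hA).
  rewrite !(as_trM hA) !(as_trt hA) (as_lnt hA) mulmx1 /cj (plKr hP)//.
by rewrite !(as_lnM hA) !(as_lnt hA) mulmx1 mul1mx.
Qed.

Lemma cjM g x y : cj g (P x y) = P (cj g x) (cj g y).
Proof. by apply: tau_inj; rewrite tauM -(cjE g (P x y)) -(cjE g x) -(cjE g y) tauM -!mulgA mulKg. Qed.

Definition act g x := P (tr g) (x *m ln g).

Lemma act_tau v x : act (tau v) x = P v x.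
Proof. by rewrite /act (as_trt hA) (as_lnt hA) mulmx1. Qed.

Lemma actM g h x : act (g * h)%g x = act g (act h x).
Proof. by rewrite /act (as_trM hA) (as_lnM hA) (as_lnP hA) (plA hP) mulmxA. Qed.

Lemma act1 x : act 1%g x = x.
Proof. by rewrite -tau0 act_tau (pl0x hP). Qed.

Lemma act_P g v x : act g (P v x) = P (cj g v) (act g x).
Proof. by rewrite -act_tau -actM -act_tau -actM -cjE mulgVK. Qed.

Lemma act_in x : mxin O (fun g => act g x).
Proof.
apply: (pl_poly hP hS); first exact: (as_tr hA).
by apply: mxin_mul => //; [exact: mxin_cst | exact: (as_ln hA)].
Qed.

(* The translation taking the base point [x] to [g x]. *)
Definition dis x g := P (act g x) (- x).

Lemma disE x g : act g x = P (dis x g) x.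
Proof. by rewrite /dis (plKr hP). Qed.

Lemma dis_in x : mxin O (dis x).
Proof. by apply: (pl_poly hP hS); [exact: act_in | exact: mxin_cst]. Qed.

Lemma disM x g h : dis x (g * h)%g = P (cj g (dis x h)) (dis x g).
Proof. by rewrite /dis actM {1}(disE x h) act_P (plA hP). Qed.

Lemma dis_tau x v : dis x (tau v) = v.
Proof. by rewrite /dis act_tau (plK hP). Qed.

Lemma dis_id x : dis x 1%g = 0.
Proof. by rewrite /dis act1 (plxN hP). Qed.

(** The powers of a translation are tau (k v), on which regular functions are polynomial in k, with
    degree bounded uniformly over left translates. *)
Lemma unip_tau v : unip O (tau v).
Proof.
move=> f Of; have [I [a [b [hab E]]]] := ag_coalg hO Of.
have hp i : polyfun (fun t => b i (tau (t *: v))).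
  have [_ hb] := hab i; have := as_tau hA hb (polyfun_subalg R); apply.
  exact: line_fun.
have [p Hp] := choice hp.
exists (\max_i size (p i))%N; apply: Delta_nilp => h.
exists (\sum_i real_complex R (a i h) *: map_poly (real_complex R) (p i)); last first.
  move=> k; rewrite (E h (tau v ^+ k)%g) rmorph_sum horner_sum; apply: eq_bigr => i _.
  by rewrite rmorphM hornerZ -tauX Hp -(rmorph_nat (real_complex R)) horner_map.
apply: leq_trans (size_sum _ _ _) _; apply/bigmax_leqP => i _.
apply: leq_trans (size_scale_leq _ _) _; rewrite size_map_poly.
exact: (@leq_bigmax _ (fun i => size (p i))).
Qed.

Lemma trans_lin A : subgroup A -> exists Um : 'M[R]_n, forall v, zcl A (tau v) <-> (v <= Um)%MS.
Proof.
move=> sA; have sz := zcl_subgroup hO sA.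
apply: (@log_linear_subgroup _ _ P hP [set v | zcl A (tau v)]
  [set F | exists f, [/\ O f, forall a, A a -> f a = 0 & F = fun v => f (tau v)]]) => /=.
- by rewrite tau0; exact: subg1.
- by move=> x y hx hy; rewrite tauM; exact: (subgM sz).
- by move=> _ [f [Of _ ->]]; exact: (as_tau hA).
move=> v; split => [hv _ [f [Of fA ->]]|hv f Of fA]; first exact: hv.
by apply: (hv (fun v => f (tau v))); exists f.
Qed.

Lemma uc_ln i g z : uc i z -> uc i (z *m ln g).
Proof.
elim: i z => [|i IH] z /=; first by move=> ->; rewrite mul0mx.
move=> hz y; pose y' := y *m ln g^-1%g.
have -> : y = y' *m ln g by rewrite /y' -mulmxA lnV mulmx1.
by rewrite -!(as_lnP hA) -mulNmx -(as_lnP hA); exact: IH.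
Qed.

Definition ZG i : set G := [set tau z | z in uc i].

Lemma ZGE i v : ZG i (tau v) <-> uc i v.
Proof. by split=> [[z hz /tau_inj <-//]|hv]; exists v. Qed.

Lemma range_normal : normal_in (range tau) [set: G].
Proof.
have sT : subgroup [set: G] by split.
split; [|exact: sT|by []|].
- split; first by exists 0 => //; exact: tau0.
  by move=> _ _ [x _ <-] [y _ <-]; exists (P x (- y)) => //; rewrite tauM tauN.
- move=> g _ _ [v _ <-]; exists (cj g^-1%g v) => //; by rewrite -cjE invgK /conjg mulgA.
Qed.

Lemma ZG_normal i : normal_in (ZG i) [set: G].
Proof.
elim: i => [|i IH].
  have -> : ZG 0 = [set 1%g].
    by apply/seteqP; split => [_ [z -> <-]|_ ->]; [exact: tau0 | exists 0; rewrite // tau0].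
  by split=> [|//|//|x _ _ ->]; [split => // _ _ -> ->; rewrite mulgV | rewrite conj1g].
have [sC _ _ nC] := centralizer_mod_normal IH range_normal.
have [sr _ _ nr] := range_normal.
have E (x : G) : ZG i.+1 x <-> range tau x /\
   ([set: G] x /\ forall y : G, range tau y -> eqB (ZG i) (y * x)%g (x * y)%g).
  split=> [[z hz <-]|[[z _ <-] [_ hz]]]; last first.
    exists z => // y /=; apply/ZGE; rewrite tauM tauN !tauM.
    by apply: hz; exists y.
  split; first by exists z.
  split => // _ [y _ <-]; rewrite /eqB -!tauM -tauN -tauM; apply/ZGE; exact: hz.
split => //.
- split; first by apply/E; split; [exact: (subg1 sr) | exact: (subg1 sC)].
  by move=> x y /E[rx Cx] /E[ry Cy]; apply/E; split; [exact: (sr.2 _ _ rx ry) | exact: (sC.2 _ _ Cx Cy)].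
- by move=> x y _ /E[ry Cy]; apply/E; split; [exact: (nr _ _ I ry) | exact: (nC _ _ I Cy)].
Qed.

Lemma uc_P i x y : uc i x -> uc i y -> uc i (P x y).
Proof.
have [s _ _ _] := ZG_normal i; move=> /ZGE hx /ZGE hy; apply/ZGE.
by rewrite tauM; exact: subgM.
Qed.

Lemma uc_cj i g x : uc i x -> uc i (cj g x).
Proof.
have [s _ _ h] := ZG_normal i; move=> /ZGE hx; apply/ZGE.
by have := h g^-1%g _ I hx; rewrite -cjE /conjg invgK mulgA.
Qed.

Lemma uc_mx i : exists Zm : 'M[R]_n, forall v, uc i v <-> (v <= Zm)%MS.
Proof.
elim: i => [|i [Zm IH]].
  by exists 0 => v; rewrite submx0; split => [->|/eqP].
apply: (@log_linear_subgroup _ _ P hP (uc i.+1)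
  [set F | exists y j, F = fun v => (P (- (P y v)) (P v y) *m cokermx Zm) 0 j]).
- exact: uc0.
- exact: uc_P.
- move=> _ [y [j ->]] X A sA g Ag; apply: mxin_mul => //; last exact: mxin_cst.
  have hy : mxin A (fun _ => y) by exact: mxin_cst.
  apply: (pl_poly hP sA); last exact: (pl_poly hP sA).
  by apply: mxin_opp => //; exact: (pl_poly hP sA).
move=> v; split=> [hv _ [y [j ->]]|hv y].
  by have /IH := hv y; rewrite submxE => /eqP ->; rewrite mxE.
suff : uc i (P (- P y v) (P v y)) by [].
by apply/IH; rewrite submxE; apply/eqP/rowP => j; rewrite [RHS]mxE; apply: (hv (fun v => (P (- P y v) (P v y) *m cokermx Zm) 0 j)); exists y, j.
Qed.

Lemma comm_pow i (a b : G) : eqB (ZG i) (b * a)%g (a * b)%g ->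
  forall k, eqB (ZG i) ((a * b) ^+ k)%g (a ^+ k * b ^+ k)%g.
Proof.
set N := ZG i; move=> ab; have nN := ZG_normal i.
have rf (x : G) : eqB N x x by exact: eqB_refl nN x.
have bk k : eqB N (b ^+ k * a)%g (a * b ^+ k)%g.
  elim: k => [|k IH]; first by rewrite expg0 mulg1 mul1g.
  have e1 := eqB_mul nN I (rf b) IH; have e2 := eqB_mul nN I ab (rf (b ^+ k)%g).
  rewrite -!mulgA in e1 e2; rewrite expgS -!mulgA; exact: (eqB_trans nN e1 e2).
elim=> [|k IH]; first by rewrite !expg0 mulg1.
have e1 := eqB_mul nN I IH (rf (a * b)%g).
have e2 := eqB_mul nN I (eqB_mul nN I (rf (a ^+ k)%g) (bk k)) (rf b).
rewrite -!mulgA in e1 e2; rewrite !expgSr -!mulgA; exact: (eqB_trans nN e1 e2).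
Qed.

(** One factor being central modulo [uc i], (x y)^k and x^k y^k agree modulo [uc i] for all k. This
    is a polynomial condition in k, so it holds for real exponents, and [lin_diff] extracts the
    linear term. *)
Lemma uc_add i (Zm : 'M[R]_n) x y : (forall v, uc i v <-> (v <= Zm)%MS) ->
  uc i.+1 x \/ uc i.+1 y -> (P x y - (x + y) <= Zm)%MS.
Proof.
move=> hZ hxy; rewrite -eqmx_opp opprB; apply: (lin_diff hP) => t; rewrite submxE.
apply/eqP/rowP => j; rewrite [RHS]mxE; move: t; apply: polyfun_nat0.
  have hs := polyfun_subalg R.
  apply: mxin_mul => //; last exact: mxin_cst.
  apply: (pl_poly hP hs); first by apply: mxin_opp => //; exact: line_fun.
  by apply: (pl_poly hP hs); exact: line_fun.
move=> k; suff : (P (- (k%:R *: P x y)) (P (k%:R *: x) (k%:R *: y)) <= Zm)%MS.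
  by rewrite submxE => /eqP ->; rewrite mxE.
apply/hZ/ZGE; rewrite !tauM tauN !tauX tauM; apply: comm_pow.
have nN := ZG_normal i; case: hxy => h.
  by have /ZGE := h y; rewrite tauM tauN !tauM.
by apply: (eqB_sym nN); have /ZGE := h x; rewrite tauM tauN !tauM.
Qed.

(** Conjugation by the translation part of g is trivial on [uc i.+1] modulo [uc i], so only the
    linear part of g remains. *)
Lemma cj_ln i (Zm : 'M[R]_n) g z : (forall v, uc i v <-> (v <= Zm)%MS) ->
  uc i.+1 z -> (cj g z - z *m ln g <= Zm)%MS.
Proof.
move=> hZ hz; have hz1 := uc_ln g hz; rewrite /cj; set z1 := z *m ln g in hz1 *.
have := hz1 (- tr g); rewrite (plNP hP) opprK; set c := P _ _ => hc.
have -> : P (P (tr g) z1) (- tr g) = P z1 c.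
  by rewrite /c -!(plA hP) (plxN hP) (pl0x hP).
have -> : P z1 c - z1 = (P z1 c - (z1 + c)) + c by rewrite opprD addrA addrNK.
by apply: addmx_sub; [apply: (uc_add hZ); left | exact/hZ].
Qed.

End AffStruct.

Lemma mxin_block (R : realType) (X : Type) (A : set (X -> R)) m1 m2 n1 n2
  (a : X -> 'M[R]_(m1, n1)) (b : X -> 'M[R]_(m1, n2)) (c : X -> 'M[R]_(m2, n1)) (d : X -> 'M[R]_(m2, n2)) :
  mxin A a -> mxin A b -> mxin A c -> mxin A d -> mxin A (fun x => block_mx (a x) (b x) (c x) (d x)).
Proof.
move=> ha hb hc hd i j; rewrite -(splitK i) -(splitK j).
case: (fintype.split i) => i'; case: (fintype.split j) => j' /=.
- by under eq_fun do rewrite block_mxEul; exact: ha.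
- by under eq_fun do rewrite block_mxEur; exact: hb.
- by under eq_fun do rewrite block_mxEdl; exact: hc.
- by under eq_fun do rewrite block_mxEdr; exact: hd.
Qed.

Section AffineFixed.
Variables (R : realType) (G : groupType) (O : set (G -> R)) (Gam : groupType) (rho : Gam -> G).
Hypothesis hO : alg_group O.
Hypothesis rM : forall x y, (rho (x * y) = rho x * rho y)%g.
Hypothesis vp : virtually_polycyclic Gam.
Variables (m : nat) (w : G -> 'M[R]_m) (b : G -> 'rV[R]_m) (V : 'M[R]_m).
Hypotheses (hw : mxin O w) (hb : mxin O b).
Hypothesis wV : forall a (x : 'rV[R]_m), (x <= V)%MS -> (x *m w (rho a) <= V)%MS.
Hypothesis bV : forall a, (b (rho a) <= V)%MS.
Hypothesis wM : forall a c (x : 'rV[R]_m), (x <= V)%MS -> x *m w (rho (a * c)%g) = x *m w (rho c) *m w (rho a).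
Hypothesis bM : forall a c, b (rho (a * c)%g) = b (rho c) *m w (rho a) + b (rho a).
Hypothesis w1 : forall x : 'rV[R]_m, (x <= V)%MS -> x *m w 1%g = x.
Hypothesis b1 : b 1%g = 0.
Hypothesis wu : forall u, unip O u -> zclosure O (range rho) u ->
  b u = 0 /\ forall x : 'rV[R]_m, (x <= V)%MS -> x *m w u = x.

(** Homogenization: an affine action on V is linear on V + R and preserves the last coordinate l, so
    a fixed vector with l = 1 is a fixed point. *)
Lemma affine_fixed : exists2 z : 'rV[R]_m, (z <= V)%MS & forall a, z *m w (rho a) + b (rho a) = z.
Proof.
have [k [S [S0 Sk Sstep]]] := vp.
pose w' g : 'M[R]_(m + 1) := block_mx (w g) 0 (b g) 1%:M.
pose W : 'M[R]_(m + 1) := block_mx V 0 0 1%:M.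
pose l : 'cV[R]_(m + 1) := col_mx 0 1%:M.
have mulw (z : 'rV[R]_m) (c : 'M[R]_1) g : row_mx z c *m w' g = row_mx (z *m w g + c *m b g) c.
  by rewrite mul_row_block mulmx0 mulmx1 add0r.
have inW (z : 'rV[R]_m) (c : 'M[R]_1) : (row_mx z c <= W)%MS <-> (z <= V)%MS.
  split=> [/submxP[e]|/submxP[e ->]].
    rewrite -[e]hsubmxK mul_row_block !mulmx0 addr0 => /eq_row_mx[-> _]; exact: submxMl.
  by apply/submxP; exists (row_mx e c); rewrite mul_row_block !mulmx0 mulmx1 addr0 add0r.
have cE (c : 'M[R]_1) (x : 'rV[R]_m) : c *m x = c 0 0 *: x by rewrite {1}[c]mx11_scalar mul_scalar_mx.
have [||||||||r [rW rl rf]] := @fixed_vector R G O Gam rho hO rM k S S0 Sstep (m + 1) w' W l k (leqnn k) _ _ _ _ _ _ (row_mx 0 1%:M).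
- by apply: mxin_block => //; apply: mxin_cst; exact: (ag_sub hO).
- move=> a x _; rewrite -[x]hsubmxK mulw !inW => xV; apply: addmx_sub; first exact: wV.
  by rewrite cE; apply: scalemx_sub.
- move=> a c x _ _; rewrite -[x]hsubmxK inW => xV; rewrite !mulw wM// bM mulmxDr mulmxDl !mulmxA.
  by congr row_mx; rewrite addrA.
- by move=> x; rewrite -[x]hsubmxK inW => xV; rewrite mulw w1// b1 mulmx0 addr0.
- move=> u uu hu x; have [bu wu'] := wu uu hu; rewrite -[x]hsubmxK inW => xV.
  by rewrite mulw bu mulmx0 addr0 wu'.
- by move=> a x _; rewrite -[x]hsubmxK mulw !mul_row_col !mulmx0 !add0r.
- by rewrite inW sub0mx.
- by rewrite mul_row_col mulmx0 mulmx1 add0r mxE.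
move: rW rl rf; rewrite -[r]hsubmxK inW mul_row_col mulmx0 mulmx1 add0r => zV c1 rf.
exists (lsubmx r) => // a; have := rf a; rewrite Sk mulw => /(_ I)/eq_row_mx[h _].
by rewrite -[RHS]h cE c1 scale1r.
Qed.

End AffineFixed.

(** * A base point whose orbit under the closure is an orbit of translations *)

Section BasePoint.
Variables (R : realType) (n : nat) (P : 'rV[R]_n -> 'rV[R]_n -> 'rV[R]_n) (G : groupType).
Variables (O : set (G -> R)) (tr : G -> 'rV[R]_n) (ln : G -> 'M[R]_n) (tau : 'rV[R]_n -> G).
Hypothesis hA : aff_struct P O tr ln tau.
Variables (Gam : groupType) (rho : Gam -> G).
Hypothesis rM : forall x y, (rho (x * y) = rho x * rho y)%g.
Hypothesis vp : virtually_polycyclic Gam.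
Implicit Types (x y z v u : 'rV[R]_n) (g h : G) (A D : set G).
Let hP := as_P hA.
Let hO := as_O hA.
Let hS := ag_sub hO.
Local Notation zcl := (zclosure O).
Local Notation uc := (uc P).
Local Notation D := (zcl (range rho)).
Local Notation act := (act P tr ln).
Local Notation cj := (cj P tr ln).
Local Notation dis := (dis P tr ln).
Hypothesis TL : forall u : G, unip O u -> D u -> ln u = 1%:M.

Lemma rho1 : rho 1%g = 1%g.
Proof. by apply: (mulgI (rho 1%g)); rewrite -rM !mulg1. Qed.

Lemma rhoV a : rho a^-1%g = (rho a)^-1%g.
Proof. by apply: (mulgI (rho a)); rewrite -rM !mulgV rho1. Qed.

Lemma image_subgroup (H : set Gam) : subgroup H -> subgroup (rho @` H).
Proof.
move=> [H1 HM]; split; first by exists 1%g => //; exact: rho1.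
by move=> _ _ [a Ha <-] [b Hb <-]; exists (a * b^-1)%g; [exact: HM | rewrite rM rhoV].
Qed.

Lemma D_subgroup : subgroup D.
Proof. by apply: (zcl_subgroup hO); apply: image_subgroup; split. Qed.

Lemma rhoD a : D (rho a). Proof. by apply: sub_zcl; exists a. Qed.

Section Step.
Variables (Um : 'M[R]_n) (i : nat) (Zm Zm1 : 'M[R]_n).
Hypothesis hU : forall v, D (tau v) <-> (v <= Um)%MS.
Hypothesis hZ : forall v, uc i v <-> (v <= Zm)%MS.
Hypothesis hZ1 : forall v, uc i.+1 v <-> (v <= Zm1)%MS.
Local Notation B := (Um + Zm)%MS.
Local Notation B1 := (Um + Zm1)%MS.

Lemma Um_P u v : (u <= Um)%MS -> (v <= Um)%MS -> (P u v <= Um)%MS.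
Proof. by move=> /hU hu /hU hv; apply/hU; rewrite (tauM hA); exact: (subgM D_subgroup). Qed.

Lemma Um_cj g u : D g -> (u <= Um)%MS -> (cj g u <= Um)%MS.
Proof.
move=> Dg /hU hu; apply/hU; rewrite -(cjE hA); have s := D_subgroup.
by apply: (subgM s); [exact: (subgM s) | exact: (subgV s)].
Qed.

Lemma Zm_B : (Zm <= Zm1)%MS.
Proof. by apply/rV_subP => v /hZ h; apply/hZ1; apply: (uc_mono hP). Qed.

Lemma B_prod1 u z : (u <= Um)%MS -> (z <= Zm1)%MS -> (P u z - (u + z) <= Zm)%MS.
Proof. by move=> hu /hZ1 hz; apply: (uc_add hA hZ); right. Qed.

Lemma B_prod u z : (u <= Um)%MS -> (z <= Zm1)%MS -> (P u z <= B1)%MS.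
Proof.
move=> hu hz; have := B_prod1 hu hz => h; rewrite -[P u z](subrK (u + z)).
apply: addmx_sub; first by apply: submx_trans h _; apply: submx_trans Zm_B _; exact: addsmxSr.
by apply: addmx_sub_adds.
Qed.

(** Identifies the linear sum of U and a central term with the set of products u z, so that it can
    be handled both as a vector space and through the group law. *)
Lemma B_split_step : (forall b : 'rV[R]_n, (b <= B)%MS -> exists u z, [/\ (u <= Um)%MS, (z <= Zm)%MS & b = P u z]) ->
  forall b : 'rV[R]_n, (b <= B1)%MS -> exists u z, [/\ (u <= Um)%MS, (z <= Zm1)%MS & b = P u z].
Proof.
move=> H b /sub_addsmxP[[e f] /= bE].
have hu : (e *m Um <= Um)%MS by exact: submxMl.
have hz : (f *m Zm1 <= Zm1)%MS by exact: submxMl.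
move: hu hz bE; set u := e *m Um; set z := f *m Zm1 => hu hz bE.
have h : (P b (- z) - (b - z) <= Zm)%MS by apply: (uc_add hA hZ); right; apply/hZ1; rewrite eqmx_opp.
have [u' [z' [hu' hz' E]]] : exists u z, [/\ (u <= Um)%MS, (z <= Zm)%MS & P b (- (f *m Zm1)) = P u z].
  apply: H; rewrite -/z -[P b _](subrK (b - z)) addmx_sub//.
    by apply: submx_trans h _; exact: addsmxSr.
  by rewrite bE addrK (submx_trans hu)// addsmxSl.
exists u', (P z' z); split => //.
  apply/hZ1; apply: (uc_P hA); last exact/hZ1.
  by apply: (uc_mono hP); apply/hZ.
by rewrite -(plA hP) -E (plKr hP).
Qed.

Hypothesis hB1 : forall b : 'rV[R]_n, (b <= B1)%MS -> exists u z, [/\ (u <= Um)%MS, (z <= Zm1)%MS & b = P u z].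
Hypothesis hB : forall b : 'rV[R]_n, (b <= B)%MS -> exists u z, [/\ (u <= Um)%MS, (z <= Zm)%MS & b = P u z].
Local Notation pi := (cokermx B).

Lemma pi0 v : v *m pi = 0 <-> (v <= B)%MS.
Proof. by rewrite submxE; split => /eqP. Qed.

Lemma pi_eq v z : (v - z <= Zm)%MS -> v *m pi = z *m pi.
Proof.
move=> h; apply/eqP; rewrite -subr_eq0 -mulmxBl; apply/eqP/pi0.
by apply: submx_trans h _; exact: addsmxSr.
Qed.

Lemma piU u : (u <= Um)%MS -> u *m pi = 0.
Proof. by move=> h; apply/pi0; apply: submx_trans h _; exact: addsmxSl. Qed.

(** The linear projection with kernel U + Z_i is a group morphism on the products of U and Z_(i+1):
    central factors add up by [uc_add], and U acts trivially after projection. *)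
Lemma pi_P b c : (b <= B1)%MS -> (c <= B1)%MS -> (P b c <= B1)%MS /\ P b c *m pi = b *m pi + c *m pi.
Proof.
have left z y : (z <= Zm1)%MS -> (y <= B1)%MS -> (P z y <= B1)%MS /\ P z y *m pi = z *m pi + y *m pi.
  move=> hz hy; have h : (P z y - (z + y) <= Zm)%MS by apply: (uc_add hA hZ); left; apply/hZ1.
  split; last by rewrite -mulmxDl; exact: pi_eq.
  rewrite -[P z y](subrK (z + y)); apply: addmx_sub.
    by apply: submx_trans h _; apply: submx_trans Zm_B _; exact: addsmxSr.
  by apply: addmx_sub => //; apply: submx_trans hz _; exact: addsmxSr.
have leftu u y : (u <= Um)%MS -> (y <= B1)%MS -> (P u y <= B1)%MS /\ P u y *m pi = y *m pi.
  move=> hu /hB1[u' [z [hu' hz ->]]]; rewrite -(plA hP); have hp := Um_P hu hu'.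
  split; first exact: B_prod.
  by rewrite (pi_eq (B_prod1 hp hz)) (pi_eq (B_prod1 hu' hz)) !mulmxDl (piU hp) (piU hu').
move=> /hB1[u [z [hu hz ->]]] hc; rewrite (plA hP).
have [h1 h2] := left z c hz hc; have [h3 h4] := leftu u _ hu h1; split => //.
by rewrite h4 h2 (pi_eq (B_prod1 hu hz)) mulmxDl (piU hu) add0r.
Qed.

Lemma cj_pi g z : (z <= Zm1)%MS -> cj g z *m pi = z *m ln g *m pi.
Proof. by move=> /hZ1 hz; apply: pi_eq; exact: (cj_ln hA). Qed.

Lemma ln_Zm1 g z : (z <= Zm1)%MS -> (z *m ln g <= Zm1)%MS.
Proof. by move=> /hZ1 hz; apply/hZ1; exact: (uc_ln hA). Qed.

Lemma cj_Zm1 g z : (z <= Zm1)%MS -> (cj g z <= Zm1)%MS.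
Proof. by move=> /hZ1 hz; apply/hZ1; exact: (uc_cj hA). Qed.

Lemma ln_pi0 g z : D g -> (z <= Zm1)%MS -> z *m pi = 0 -> z *m ln g *m pi = 0.
Proof.
move=> Dg hz /pi0/hB[u [z' [hu hz' E]]]; rewrite -cj_pi// E (cjM hA).
have hcz : (cj g z' <= Zm)%MS by apply/hZ; apply: (uc_cj hA); apply/hZ.
rewrite (pi_eq (B_prod1 (Um_cj Dg hu) (submx_trans hcz Zm_B))) mulmxDl piU ?Um_cj//.
by rewrite add0r; apply/pi0; apply: submx_trans hcz _; exact: addsmxSr.
Qed.

Local Notation Zp := (Zm1 *m pi).
(** The action of linear parts on the quotient of U + Z_(i+1) by U + Z_i: [pinvmx] picks a lift in
    Z_(i+1), and for g in the closure [ln_pi0] shows the result independent of the lift. *)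
Definition wq g : 'M[R]_n := pinvmx Zp *m Zm1 *m ln g *m pi.

Lemma Zp_lift x : (x <= Zp)%MS -> exists2 z, (z <= Zm1)%MS & x = z *m pi.
Proof. by move=> /submxP[e ->]; exists (e *m Zm1); rewrite ?submxMl// mulmxA. Qed.

Lemma wqE g z : D g -> (z <= Zm1)%MS -> z *m pi *m wq g = z *m ln g *m pi.
Proof.
move=> Dg hz; have hx : (z *m pi <= Zp)%MS by exact: submxMr.
pose y := z *m pi *m pinvmx Zp *m Zm1.
have -> : z *m pi *m wq g = y *m ln g *m pi by rewrite /wq /y !mulmxA.
have hy : (y <= Zm1)%MS by exact: submxMl.
have yE : y *m pi = z *m pi by rewrite /y -mulmxA mulmxKpV.
apply/eqP; rewrite -subr_eq0 -!mulmxBl; apply/eqP; apply: ln_pi0 => //.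
  by rewrite addmx_sub// eqmx_opp.
by rewrite mulmxBl yE subrr.
Qed.

(** Modulo U + Z_i the displacement of x is a cocycle in an abelian group on which unipotent
    elements act trivially. An affine fixed point y makes it a coboundary, and replacing x by P y x
    kills it. *)
Lemma base_step x : (forall a, (dis x (rho a) <= B1)%MS) ->
  exists x', forall a, (dis x' (rho a) <= B)%MS.
Proof.
move=> hx; have dp a : exists2 z, (z <= Zm1)%MS & dis x (rho a) *m pi = z *m pi.
  have [u [z [hu hz ->]]] := hB1 (hx a); exists z => //.
  by rewrite (pi_eq (B_prod1 hu hz)) mulmxDl piU// add0r.
have [] := @affine_fixed R G O Gam rho hO rM vp n wq (fun g => dis x g *m pi) Zp.
- have hc m1 m2 (M : 'M[R]_(m1, m2)) : mxin O (fun _ => M) by exact: mxin_cst.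
  by apply: mxin_mul => //; apply: mxin_mul => //; exact: (as_ln hA).
- by apply: mxin_mul => //; [exact: dis_in hA x | exact: mxin_cst].
- move=> a _ /Zp_lift[z hz ->]; rewrite wqE//; last exact: rhoD.
  by apply: submxMr; exact: ln_Zm1.
- by move=> a; have [z hz ->] := dp a; exact: submxMr.
- move=> a c _ /Zp_lift[z hz ->].
  by rewrite !wqE ?rM ?(as_lnM hA) ?mulmxA ?ln_Zm1//; try exact: rhoD; rewrite -rM; exact: rhoD.
- move=> a c; rewrite rM (disM hA).
  have [u [z [hu hz E]]] := hB1 (hx c).
  have hcz := cj_Zm1 (rho a) hz; have hcu := Um_cj (rhoD a) hu.
  have hcj : (cj (rho a) (dis x (rho c)) <= B1)%MS by rewrite E (cjM hA) B_prod.
  rewrite (pi_P hcj (hx a)).2 E (cjM hA) (pi_eq (B_prod1 hcu hcz)) (pi_eq (B_prod1 hu hz)).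
  by rewrite !mulmxDl (piU hcu) (piU hu) ?mul0mx !add0r cj_pi// wqE//; exact: rhoD.
- move=> _ /Zp_lift[z hz ->]; rewrite wqE// ?(ln1 hA) ?mulmx1//.
  by rewrite -rho1; exact: rhoD.
- by rewrite /dis (act1 hA) (plxN hP) mul0mx.
- move=> u uu Du; have E := tau_of hA (TL uu Du).
  have hv : (tr u <= Um)%MS by apply/hU; rewrite -E.
  split; first by rewrite E (dis_tau hA) piU.
  by move=> _ /Zp_lift[z hz ->]; rewrite wqE// (TL uu Du) mulmx1.
move=> _ /Zp_lift[y hy ->] hfix; exists (P y x) => a; apply/pi0.
have -> : dis (P y x) (rho a) = P (cj (rho a) y) (P (dis x (rho a)) (- y)).
  by rewrite /dis (act_P hA) (plNP hP) !(plA hP).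
have hyB : (- y <= B1)%MS by rewrite eqmx_opp (submx_trans hy)// addsmxSr.
have [h1 h2] := pi_P (hx a) hyB.
rewrite (pi_P (submx_trans (cj_Zm1 _ hy) (addsmxSr _ _)) h1).2 h2 cj_pi//.
by rewrite -wqE//; [rewrite mulNmx addrA hfix subrr | exact: rhoD].
Qed.

End Step.

Theorem base_point : exists x, forall g, D g -> D (tau (dis x g)).
Proof.
have sr : subgroup (range rho) by apply: image_subgroup; split.
have [Um hU] := trans_lin hA sr.
have /choice[Z hZ] := uc_mx hA.
have [k hk] := as_nil hA.
have hsplit i : forall b : 'rV[R]_n, (b <= Um + Z i)%MS -> exists u z, [/\ (u <= Um)%MS, (z <= Z i)%MS & b = P u z].
  elim: i => [|i IH]; last exact: (B_split_step (hZ i) (hZ i.+1) IH).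
  move=> b /sub_addsmxP[[e f] /= ->]; exists (e *m Um), (f *m Z 0%N); split; try exact: submxMl.
  have /hZ -> : (f *m Z 0%N <= Z 0%N)%MS by exact: submxMl.
  by rewrite (plx0 hP) addr0.
suff [x hx] : exists x, forall a, (dis x (rho a) <= Um + Z 0%N)%MS.
  (* Lying in the linear space U is a closed condition on the displacement, which is regular in g;
     it extends from the group to its closure. *)
  exists x => g Dg; apply/hU; rewrite submxE; apply/eqP/rowP => j; rewrite [RHS]mxE.
  apply: (Dg (fun g => (dis x g *m cokermx Um) 0 j)).
    by apply: mxin_mul => //; [exact: dis_in hA x | exact: mxin_cst].
  move=> _ [a _ <-]; suff : (dis x (rho a) <= Um)%MS by rewrite submxE => /eqP ->; rewrite mxE.
  have [u [z [hu /hZ -> ->]]] := hsplit _ _ (hx a).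
  by rewrite (plx0 hP).
have : exists x, forall a, (dis x (rho a) <= Um + Z k)%MS.
  exists 0 => a; apply: submx_trans (addsmxSr _ _); apply/hZ; exact: hk.
elim: (k) => // i IH [x hx]; apply: IH.
exact: (base_step hU (hZ i) (hZ i.+1) (hsplit i.+1) (hsplit i) hx).
Qed.

End BasePoint.

Lemma norm_ball_compact (R : realType) n (M : R) : compact [set v : 'rV[R]_n | `|v| <= M].
Proof.
apply: bounded_closed_compact.
  by exists M; split; [exact: num_real | move=> N MN v /= vM; exact: le_trans vM (ltW MN)].
have -> : [set v : 'rV[R]_n | `|v| <= M] = (fun v : 'rV[R]_n => `|v|) @^-1` [set t | t <= M] by [].
by apply: closed_comp; [move=> v _; exact: norm_continuous | exact: closed_le].
Qed.

Lemma poly_bounded (R : realType) n1 n2 m (Q : 'rV[R]_n1 -> 'rV[R]_n2 -> 'rV[R]_m) (M1 M2 : R) :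
  polymap2 Q -> exists M', forall x y, `|x| <= M1 -> `|y| <= M2 -> `|Q x y| <= M'.
Proof.
move=> hQ.
have hc : continuous (fun p : 'rV[R]_n1 * 'rV[R]_n2 => Q p.1 p.2).
  by apply: polymap2_cont => // p; [exact: cvg_fst | exact: cvg_snd].
have := continuous_compact (continuous_subspaceT hc) (compact_setX (@norm_ball_compact R n1 M1) (@norm_ball_compact R n2 M2)).
move=> /compact_bounded[M0 [_ h]]; exists (M0 + 1) => x y hx hy.
by apply: (h (M0 + 1)); [rewrite ltrDl | exists (x, y)].
Qed.

Lemma polymap_mulmx (R : realType) n m (A : 'M[R]_(n, m)) :
  polymap2 (fun (x : 'rV[R]_n) (_ : 'rV[R]_n) => x *m A).
Proof. by move=> X B sB f g hf _; apply: mxin_mul => //; exact: mxin_cst. Qed.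

Section PolyUpoint.
Variables (R : realType) (G : groupType) (O : set (G -> R)).
Hypothesis hO : alg_group O.
Local Notation cx x := (real_complex R x).

(** The unipotent component replaces eigenvalues by 1; the sequence n^k already has eigenvalue 1, so
    n is simply evaluated at 1. *)
Lemma upoint_polyA s u (F : G * R -> R) : (forall f, O f -> cx (f u) = (pol s f).[1]) ->
  polyA O F -> (forall n : nat, F (s ^+ n, n%:R)%g = 0) -> F (u, 1) = 0.
Proof.
move=> hu [m [p [h1 h2 h3]]] F0.
have inj : injective (fun x : R => cx x) by move=> x y [].
have FE g t : F (g, t) = \sum_(k < m) (p g)`_k * t ^+ k by rewrite h3 (horner_coef_wide _ (h2 g)).
apply: inj; rewrite FE rmorph_sum.
pose q : {poly R[i]} := \sum_(k < m) pol s (fun g => (p g)`_k) * 'X^k.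
have : exppoly (fun n => cx (F (s ^+ n, n%:R)%g)) q.
  under eq_fun do rewrite FE rmorph_sum; apply: exppoly_sum => k.
  under eq_fun do rewrite rmorphM rmorphXn rmorph_nat; apply: exppoly_mul; first exact: (polP hO s (h1 k)).
  have := exppoly_poly ('X^k : {poly R[i]}); congr exppoly.
  by apply/funext => n; rewrite hornerXn.
have e0 : exppoly (fun n => cx (F (s ^+ n, n%:R)%g)) 0.
  by under eq_fun do rewrite F0; have := @exppoly_cst R[i] 0; rewrite polyC0.
move=> /exppoly_uniq/(_ e0)/(congr1 (horner^~ 1)); rewrite horner0 horner_sum; apply: etrans.
by apply: eq_bigr => k _; rewrite rmorphM rmorphXn rmorph1; rewrite hornerM hornerXn !expr1n !mulr1; exact: (hu _ (h1 k)).
Qed.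

End PolyUpoint.

Section AffMore.
Variables (R : realType) (n : nat) (P : 'rV[R]_n -> 'rV[R]_n -> 'rV[R]_n) (G : groupType).
Variables (O : set (G -> R)) (tr : G -> 'rV[R]_n) (ln : G -> 'M[R]_n) (tau : 'rV[R]_n -> G).
Hypothesis hA : aff_struct P O tr ln tau.
Implicit Types (x y z v : 'rV[R]_n) (g h : G).
Let hP := as_P hA.
Let hO := as_O hA.
Let hS := ag_sub hO.
Local Notation act := (act P tr ln).
Local Notation cj := (cj P tr ln).
Local Notation dis := (dis P tr ln).

Lemma hom_matrix (f : 'rV[R]_n -> 'rV[R]_n) : (forall x y, f (P x y) = P (f x) (f y)) ->
  (forall c, mxin (@polyfun R) c -> mxin (@polyfun R) (fun t => f (c t))) ->
  exists M, forall v, f v = v *m M.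
Proof.
move=> fP fpol; have hs := polyfun_subalg R.
have f0 : f 0 = 0.
  by apply: (plI hP (x := f 0)); rewrite -fP !(plx0 hP).
have fZ (t : R) v : f (t *: v) = t *: f v.
  apply/rowP => j; apply/eqP; rewrite -subr_eq0; apply/eqP; move: t; apply: polyfun_nat0.
    by apply: sa_sub => //; [apply: fpol; exact: line_fun | exact: line_fun].
  move=> k; apply/eqP; rewrite subr_eq0; apply/eqP; congr (fun_of_matrix _ 0 j).
  elim: k => [|k IH]; first by rewrite !scale0r f0.
  by rewrite -natr1 -!(pl_line hP) fP IH !scale1r.
have hc u : mxin (@polyfun R) (fun _ => u : 'rV[R]_n) by exact: mxin_cst.
have fD u v : f (u + v) = f u + f v.
  have [q [hq q0 hPq]] := P_first hP (hc u) (hc v).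
  have [q' [hq' q'0 hPq']] := P_first hP (hc (f u)) (hc (f v)).
  rewrite -q0 -q'0; apply/rowP => j; apply/eqP; rewrite -subr_eq0; apply/eqP.
  apply: (@polyfun_small0 R (fun s => f (q s) 0 j - q' s 0 j) 1) => //.
    by apply: sa_sub => //; exact: fpol.
  move=> s s0 _; have sn0 : s != 0 by rewrite gt_eqF.
  suff -> : f (q s) = q' s by rewrite subrr.
  by apply: (scalerI sn0); rewrite -fZ -hPq fP !fZ hPq'.
exists (\matrix_j f (delta_mx 0 j)) => v; rewrite {1}(row_sum_delta v) mulmx_sum_row.
rewrite (big_morph f fD f0); apply: eq_bigr => j _; by rewrite fZ rowK.
Qed.

(* [w g] is the linear part of [g] seen from the base point [x]. *)
Lemma recentered_ln x : exists w : G -> 'M[R]_n, [/\ mxin O w,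
  forall g h, w (g * h)%g = w h *m w g, w 1%g = 1%:M, forall g, ln g = 1%:M -> w g = 1%:M &
  forall g v, P (cj g v) (dis x g) = P (dis x g) (v *m w g)].
Proof.
have hs := polyfun_subalg R.
have hC y : exists M, forall v, cj (tau y) v = v *m M.
  apply: hom_matrix; first exact: (cjM hA).
  move=> c hc; have hy z : mxin (@polyfun R) (fun _ => z : 'rV[R]_n) by exact: mxin_cst.
  apply: (pl_poly hP hs); last exact: hy.
  by apply: (pl_poly hP hs); [exact: hy | apply: mxin_mul => //; exact: mxin_cst].
have cjt y v : cj (tau y) v = P (P y v) (- y) by rewrite /cj (as_trt hA) (as_lnt hA) mulmx1.
have [C hC1] := hC x; have [C' hC2] := hC (- x).
have CC' : C *m C' = 1%:M.
  apply/row_matrixP => i; rewrite row_mul -hC2 rowE -hC1 !cjt opprK !(plA hP) (plNx hP) (plx0 hP).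
  by rewrite (plKN hP) row1.
have C'C : C' *m C = 1%:M by exact: mulmx1C.
exists (fun g => C' *m ln g *m C); split.
- have hc (M : 'M[R]_n) : mxin O (fun _ => M) by exact: mxin_cst.
  by apply: mxin_mul => //; apply: mxin_mul => //; exact: (as_ln hA).
- by move=> g h; rewrite (as_lnM hA) !mulmxA -[_ *m C *m C']mulmxA CC' mulmx1.
- by rewrite (ln1 hA) mulmx1.
- by move=> g ->; rewrite mulmx1.
move=> g v; rewrite !mulmxA -hC2 -hC1 !cjt opprK !(as_lnP hA) mulNmx /dis /act /cj.
by rewrite !(plA hP) !(plKN hP, plNK hP).
Qed.

End AffMore.

(** * Cocompactness of the group on the orbit of the base point *)

Section Cocompact.
Variables (R : realType) (n : nat) (P : 'rV[R]_n -> 'rV[R]_n -> 'rV[R]_n) (G : groupType).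
Variables (O : set (G -> R)) (tr : G -> 'rV[R]_n) (ln : G -> 'M[R]_n) (tau : 'rV[R]_n -> G).
Hypothesis hA : aff_struct P O tr ln tau.
Variables (Gam : groupType) (rho : Gam -> G).
Hypothesis rM : forall x y, (rho (x * y) = rho x * rho y)%g.
Implicit Types (y z v : 'rV[R]_n) (g h : G) (s t a b : Gam).
Let hP := as_P hA.
Let hO := as_O hA.
Let hS := ag_sub hO.
Local Notation zcl := (zclosure O).
Local Notation D := (zcl (range rho)).
Local Notation act := (act P tr ln).
Local Notation cj := (cj P tr ln).
Hypothesis TL : forall u : G, unip O u -> D u -> ln u = 1%:M.
Variable x : 'rV[R]_n.
Local Notation dis := (dis P tr ln x).

(* The power trick: modulo the translations of the smaller group, the map
   [g |-> g x] is an anti-morphism, so that it only sees unipotent parts. *)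
Lemma base_normal (A' A : set G) : normal_in A' A -> zcl A `<=` D ->
  (forall g, zcl A g -> zcl A (tau (dis g))) -> forall g, zcl A' g -> zcl A' (tau (dis g)).
Proof.
move=> nA AD hx s Ds; have nD := zcl_normal hO nA; have [sA' sA A'A hn] := nA.
have [sD' sD D'D hnD] := nD; have [Um hU] := trans_lin hA sA'.
pose v := dis s; have Dv : zcl A (tau v) by apply: hx; exact: D'D.
have cj_eq w : zcl A (tau w) -> eqB (zcl A') (tau (cj s w)) (tau w).
  move=> Dw; rewrite /eqB -(cjE hA) !invgM invgK -!mulgA.
  have -> : (s * ((tau w)^-1 * (s^-1 * tau w)))%g = (s * (s^-1 ^ (tau w)))%g by rewrite /conjg.
  by apply: (subgM sD') => //; apply: hnD => //; exact: (subgV sD').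
have pw (m : nat) : eqB (zcl A') (tau (dis (s ^+ m)%g)) (tau v ^+ m)%g.
  elim: m => [|m IH].
    rewrite !expg0 (dis_id hA) (tau0 hA); exact: eqB_refl nD _.
  rewrite expgS (disM hA) (tauM hA) expgSr.
  have Dsm : zcl A (tau (dis (s ^+ m)%g)) by apply: hx; apply: D'D; exact: (subgX m sD' Ds).
  by apply: (eqB_mul nD Dv); [exact: (eqB_trans nD (cj_eq _ Dsm) IH) | exact: eqB_refl nD _].
have [u hu] := upoint hO s.
have Du : zcl A' u by exact: (upoint_zcl hO hu sA').
have uu : unip O u by exact: (upoint_unip hO hu).
have uE := tau_of hA (TL uu (AD _ (D'D _ Du))).
have w_in : (dis u <= Um)%MS by rewrite uE (dis_tau hA); apply/hU; rewrite -uE.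
(* By [pw], the displacement of s^m agrees with m v modulo the smaller group. At the unipotent
   component of s this becomes a relation between dis u and v, and u is itself a translation of the
   smaller group. *)
have key : (P (- dis u) v <= Um)%MS.
  rewrite submxE; apply/eqP/rowP => j; rewrite [RHS]mxE.
  have hpA := polyA_subalg hS.
  have := @upoint_polyA R G O hO s u (fun gt => (P (- dis gt.1) (gt.2 *: v) *m cokermx Um) 0 j) hu.
  rewrite /= scale1r; apply.
    apply: mxin_mul => //; last exact: mxin_cst.
    apply: (pl_poly hP hpA).
      by apply: mxin_opp => // i k; exact: (polyA_fst hS (dis_in hA x i k)).
    by apply: mxin_scale => //; [exact: polyA_snd | exact: mxin_cst].
  move=> m; suff : (P (- dis (s ^+ m)%g) (m%:R *: v) <= Um)%MS.
    by rewrite submxE => /eqP ->; rewrite mxE.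
  by apply/hU; rewrite (tauM hA) (tauN hA) (tauX hA); exact: pw.
have -> : dis s = P (dis u) (P (- dis u) v) by rewrite (plNK hP).
by rewrite (tauM hA); apply: (subgM sD'); [exact/hU | exact/hU].
Qed.

Section CyclicStep.
Variables (H H2 : set Gam) (f : Gam -> int) (t : Gam).
Hypothesis nH : normal_in H H2.
Hypothesis fM : forall a b, H2 a -> H2 b -> f (a * b)%g = f a + f b.
Hypothesis f0 : forall a, H2 a -> (f a = 0 <-> H a).
Hypothesis ht : H2 t.
Hypothesis ft : f t = 1.
Local Notation D1 := (zcl (rho @` H)).
Local Notation D2 := (zcl (rho @` H2)).
Hypothesis hx1 : forall g, D1 g -> D1 (tau (dis g)).
Hypothesis hx2 : forall g, D2 g -> D2 (tau (dis g)).
Variables (U1 U2 : 'M[R]_n).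
Hypothesis hU1 : forall v, D1 (tau v) <-> (v <= U1)%MS.
Hypothesis hU2 : forall v, D2 (tau v) <-> (v <= U2)%MS.
Local Notation eq := (eqB D1).
Local Notation T z := (tau (z%:~R *: dis (rho t))).

Lemma cyc_normal : normal_in D1 D2.
Proof.
apply: (zcl_normal hO); have [sH sH2 HH2 hn] := nH; split.
- exact: image_subgroup.
- exact: image_subgroup.
- by move=> _ [a Ha <-]; exists a => //; exact: HH2.
- move=> _ _ [a Ha <-] [b Hb <-]; exists (b ^ a)%g; first exact: hn.
  by rewrite /conjg !rM (rhoV rM).
Qed.
Let nD := cyc_normal.

Lemma cyc_comm g h : D2 g -> D2 h -> eq (g * h)%g (h * g)%g.
Proof.
move=> Dg Dh; have [sH sH2 HH2 hn] := nH.
have -> : eq (g * h)%g (h * g)%g = D1 [~ h, g]%g.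
  by rewrite /eqB invgM /commg /conjg !mulgA.
apply: (@zcl_commutator R G O hO (rho @` H2) (rho @` H)) => //; first exact: image_subgroup.
have fV b : H2 b -> f b^-1%g = - f b.
  move=> hb; have f1 : f 1%g = 0 by apply/f0; exact: subg1.
  by apply/eqP; rewrite -addr_eq0 -fM ?mulVg ?f1//; exact: subgV.
move=> _ _ [a Ha <-] [b Hb <-]; exists [~ a, b]%g; last by rewrite /commg /conjg !rM !(rhoV rM).
have Ha' := subgV sH2 Ha; have Hb' := subgV sH2 Hb.
have Hab : H2 (a ^ b)%g by rewrite /conjg; apply: (subgM sH2 Hb'); exact: (subgM sH2).
apply/f0; first exact: (subgM sH2).
rewrite /commg fM// /conjg fM//; last exact: (subgM sH2).
by rewrite fM// !fV//; ring.
Qed.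

Lemma cyc_rho a : H2 a -> D2 (rho a). Proof. by move=> Ha; apply: sub_zcl; exists a. Qed.

(** Modulo [D1] the closure [D2] is abelian, so the conjugation in [disM] disappears and
    displacement becomes a morphism. *)
Lemma cyc_dis g h : D2 g -> D2 h ->
  eq (tau (dis (g * h)%g)) (tau (dis g) * tau (dis h))%g.
Proof.
move=> Dg Dh; have [sD1 sD2 D12 hn] := nD.
have rf k : eq k k by exact: eqB_refl nD k.
have Dg' := hx2 Dg; have Dh' := hx2 Dh; have gV := subgV sD2 Dg.
rewrite (disM hA) (tauM hA) -(cjE hA).
have e1 := eqB_mul nD gV (cyc_comm Dg Dh') (rf g^-1%g); rewrite mulgK in e1.
have e2 := eqB_mul nD Dg' e1 (rf (tau (dis g))).
exact: (eqB_trans nD e2 (cyc_comm Dh' Dg')).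
Qed.

Lemma T_add (p q : int) : T (p + q) = (T p * T q)%g.
Proof. by rewrite -(tauM hA) (pl_line hP) intrD. Qed.

Lemma T_in p : D2 (T p).
Proof. by apply/hU2; apply: scalemx_sub; apply/hU2; apply: hx2; exact: cyc_rho. Qed.

(** A morphism killing H is determined by its value at t. By density the quotient of U2 by U1 will
    have dimension at most one, spanned by the displacement of t. *)
Lemma cyc_rhoE a : H2 a -> eq (tau (dis (rho a))) (T (f a)).
Proof.
have [sD1 sD2 D12 hn] := nD; have [sH sH2 HH2 hnH] := nH.
have rf k : eq k k by exact: eqB_refl nD k.
have f1 : f 1%g = 0 by apply/f0; exact: subg1.
have fV b : H2 b -> f b^-1%g = - f b.
  by move=> hb; apply/eqP; rewrite -addr_eq0 -fM ?mulVg ?f1//; exact: subgV.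
have T0 : T 0 = 1%g by rewrite scale0r (tau0 hA).
have hker b : H2 b -> f b = 0 -> eq (tau (dis (rho b))) 1%g.
  move=> Hb /(f0 Hb) hb; rewrite /eqB mulg1; apply: (subgV sD1); apply: hx1.
  by apply: sub_zcl; exists b.
have mul b c p q : H2 b -> H2 c -> eq (tau (dis (rho b))) (T p) -> eq (tau (dis (rho c))) (T q) ->
    eq (tau (dis (rho (b * c)%g))) (T (p + q)).
  move=> Hb Hc e1 e2; rewrite rM T_add; apply: (eqB_trans nD (cyc_dis (cyc_rho Hb) (cyc_rho Hc))).
  by apply: (eqB_mul nD _ e1 e2); apply: hx2; exact: cyc_rho.
have fX (m : nat) : f (t ^+ m)%g = m.
  by elim: m => [|m IH]; rewrite ?expg0// expgS fM ?ft ?IH ?intS//; exact: (subgX m sH2 ht).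
have hX (m : nat) : eq (tau (dis (rho (t ^+ m)%g))) (T m).
  elim: m => [|m IH]; first by rewrite expg0 T0; apply: hker => //; exact: subg1.
  rewrite expgS (intS m); apply: mul => //; first exact: (subgX m sH2 ht).
  by rewrite scale1r; exact: rf.
have pos (m : nat) b : H2 b -> f b = m -> eq (tau (dis (rho b))) (T m).
  move=> Hb fb; have tm := subgX m sH2 ht; have tmV := subgV sH2 tm.
  rewrite -[b](mulVKg (t ^+ m)%g) -[Posz m]addr0; apply: mul => //; first exact: (subgM sH2).
  rewrite T0; apply: hker; first exact: (subgM sH2).
  by rewrite fM// fV// fX fb addNr.
move=> Ha; case E : (f a) => [m|m]; first exact: pos.
have Ha' := subgV sH2 Ha; have e := pos m.+1 _ Ha'.
have fa : f a^-1%g = m.+1 by rewrite fV// E NegzE opprK.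
have {}e := e fa.
have e1 := cyc_dis (cyc_rho Ha) (cyc_rho Ha').
rewrite -rM mulgV (rho1 rM) (dis_id hA) (tau0 hA) in e1.
have e2 := eqB_trans nD e1 (eqB_mul nD (hx2 (cyc_rho Ha')) (rf _) e).
have e3 := eqB_mul nD (T_in (Negz m)) e2 (rf (T (Negz m))).
rewrite -mulgA -T_add NegzE addrN T0 mulg1 mul1g in e3; rewrite NegzE; exact: (eqB_sym nD e3).
Qed.

Lemma cyc_lin y z : (y <= U2)%MS -> (z <= U2)%MS -> eq (tau y) (tau z) ->
  (forall r, (P (- (r *: y)) (r *: z) <= U1)%MS) /\ (z - y <= U1)%MS.
Proof.
move=> hy hz e; have [sD1 sD2 D12 hn] := nD.
have H1 r : (P (- (r *: y)) (r *: z) <= U1)%MS.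
  rewrite submxE; apply/eqP/rowP => j; rewrite [RHS]mxE; move: r; apply: polyfun_nat0.
    have hs := polyfun_subalg R; apply: mxin_mul => //; last exact: mxin_cst.
    by apply: (pl_poly hP hs); [apply: mxin_opp => //|]; exact: line_fun.
  move=> k; suff : (P (- (k%:R *: y)) (k%:R *: z) <= U1)%MS.
    by rewrite submxE => /eqP ->; rewrite mxE.
  apply/hU1; rewrite (tauM hA) (tauN hA) !(tauX hA) -/(eqB D1 _ _).
  elim: k => [|k IH]; first by rewrite !expg0; exact: eqB_refl nD _.
  by rewrite !expgS; apply: (eqB_mul nD _ e IH); apply: (subgX k sD2); exact/hU2.
split=> //; rewrite -[z]addr0; apply: (lin_diff hP) => r.
by rewrite scaler0 (plx0 hP).
Qed.

Lemma cyc_closed (F : 'rV[R]_n -> 'rV[R]_n) :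
  mxin O (fun g => F (dis g)) -> (forall a, H2 a -> (F (dis (rho a)) <= U1)%MS) ->
  forall v, (v <= U2)%MS -> (F v <= U1)%MS.
Proof.
move=> hF h v /hU2 hv; rewrite submxE; apply/eqP/rowP => j; rewrite [RHS]mxE.
rewrite -(dis_tau hA x v); apply: (hv (fun g => (F (dis g) *m cokermx U1) 0 j)).
  by apply: mxin_mul => //; exact: mxin_cst.
move=> _ [a Ha <-]; have := h a Ha.
by rewrite submxE => /eqP ->; rewrite mxE.
Qed.

Lemma cyc_trivial : (dis (rho t) <= U1)%MS -> (U2 <= U1)%MS.
Proof.
have [sD1 sD2 D12 hn] := nD.
move=> h; apply/rV_subP => v; apply: (cyc_closed (F := id)); first exact: (dis_in hA).
move=> a Ha; apply/hU1; have e := cyc_rhoE Ha.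
have hT : D1 (T (f a)) by apply/hU1; exact: scalemx_sub.
have := subgM sD1 hT (subgV sD1 e).
by rewrite invgM invgK mulVKg.
Qed.

Section Main.
Variables (k i : nat) (S : nat -> set Gam).
Hypothesis S0 : S 0%N = [set 1%g].
Hypothesis Sstep : forall i, (i < k)%N -> normal_in (S i) (S i.+1) /\
  (finite_quotient (S i.+1) (S i) \/ infinite_cyclic_quotient (S i.+1) (S i)).
Hypothesis ik : (i <= k)%N.
Hypothesis SH : S i = H.

(** If the displacement of t is in U1, then U2 lies in U1. Otherwise l is the coordinate on U2
    modulo U1: a suitable s1 brings l into [0, 1], and the remainder in U1 is treated by the
    hypothesis for H. *)
Lemma cyc_cocompact M0 :
  (forall z, (z <= U1)%MS -> exists s, H s /\ `|dis (rho s * tau z)%g| <= M0) ->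
  (forall m, exists2 a, H2 a & f a = m) ->
  exists M, forall z, (z <= U2)%MS -> exists s, H2 s /\ `|dis (rho s * tau z)%g| <= M.
Proof.
move=> IH fsurj; have [sD1 sD2 D12 hn] := nD; have [sH sH2 HH2 hnH] := nH.
have rf g : eq g g by exact: eqB_refl nD g.
have [h|h] := boolP (dis (rho t) <= U1)%MS.
  exists M0 => z hz; have [|s [Hs hs]] := IH z; last by exists s; split => //; exact: HH2.
  exact: submx_trans hz (cyc_trivial h).
pose v0 := dis (rho t); have v0U2 : (v0 <= U2)%MS by apply/hU2; apply: hx2; exact: cyc_rho.
have [l [l1 l0]] : exists l : 'cV[R]_n, (v0 *m l) 0 0 = 1 /\ forall v, (v <= U1)%MS -> v *m l = 0.
  have : v0 *m cokermx U1 != 0 by rewrite -submxE.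
  move=> /rV0Pn[j hj]; exists (((v0 *m cokermx U1) 0 j)^-1 *: col j (cokermx U1)); split.
    have key : (v0 *m col j (cokermx U1)) 0 0 = (v0 *m cokermx U1) 0 j by rewrite colE mulmxA -colE mxE.
    by rewrite -scalemxAr mxE key mulVf.
  move=> v; rewrite submxE => /eqP hv; have e : v *m col j (cokermx U1) = 0 by rewrite colE mulmxA hv mul0mx.
  by rewrite -scalemxAr e scaler0.
have Q v : (v <= U2)%MS -> eq (tau v) (tau ((v *m l) 0 0 *: v0)).
  move=> hv; rewrite /eqB -(tauN hA) -(tauM hA); apply/hU1; move: v hv.
  apply: (cyc_closed (F := fun v => P (- v) ((v *m l) 0 0 *: v0))).
    apply: (pl_poly hP hS); first by apply: mxin_opp => //; exact: (dis_in hA).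
    apply: mxin_scale => //; last exact: mxin_cst.
    have : mxin O (fun g => dis g *m l) by apply: mxin_mul => //; [exact: (dis_in hA) | exact: mxin_cst].
    exact.
  move=> a Ha; have e := cyc_rhoE Ha.
  have haU : (dis (rho a) <= U2)%MS by apply/hU2; apply: hx2; exact: cyc_rho.
  have hTU : ((f a)%:~R *: v0 <= U2)%MS by exact: scalemx_sub.
  have [h1 h2] := cyc_lin haU hTU e.
  have -> : (dis (rho a) *m l) 0 0 = (f a)%:~R.
    have := l0 _ h2; rewrite mulmxBl -scalemxAl => /eqP; rewrite subr_eq0 => /eqP <-.
    by rewrite mxE l1 mulr1.
  by have := h1 1; rewrite !scale1r.
have [w [hw wM w1 wln wE]] := recentered_ln hA x.
have wT g v : tau (v *m w g) = ((tau (dis g))^-1 * (g * tau v * g^-1) * tau (dis g))%g.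
  by rewrite (cjE hA) -mulgA -(tauM hA) wE (tauM hA) mulKg.
have wU2 g v : D2 g -> (v <= U2)%MS -> (v *m w g <= U2)%MS.
  move=> Dg /hU2 Dv; apply/hU2; rewrite wT; have Dx := hx2 Dg; have gV := subgV sD2 Dg.
  have xV := subgV sD2 Dx.
  by apply: (subgM sD2) => //; apply: (subgM sD2) => //; apply: (subgM sD2) => //; exact: (subgM sD2).
have D12' a : H a -> D1 (rho a) by move=> Ha; apply: sub_zcl; exists a.
have wl a v : H a -> (v <= U2)%MS -> v *m w (rho a) *m l = v *m l.
  move=> Ha hv; have D1a := D12' a Ha; have D2a := D12 _ D1a.
  have D1x := hx1 D1a; have Dv : D2 (tau v) by apply/hU2.
  have e : eq (tau (v *m w (rho a))) (tau v).
    pose c := ((tau (dis (rho a)))^-1 * rho a)%g.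
    have D1c : D1 c by apply: (subgM sD1) => //; exact: (subgV sD1).
    have -> : tau (v *m w (rho a)) = (c * tau v * c^-1)%g by rewrite wT /c invgM invgK !mulgA.
    have e1 := eqB_mul nD (subgV sD2 (D12 _ D1c)) (cyc_comm (D12 _ D1c) Dv) (rf c^-1%g).
    by rewrite mulgK in e1.
  have [_ h2] := cyc_lin (wU2 _ _ D2a hv) hv e.
  by have := l0 _ h2; rewrite mulmxBl => /eqP; rewrite subr_eq0 => /eqP ->.
(* A direction r transversal to U1 and fixed by H in the representation recentered at x: the bounded
   part th r must survive the later correction by an element of H. *)
have [|||||r [rU2 rl rfix]] := @fixed_vector R G O Gam rho hO rM k S S0 Sstep n w U2 l i ik hw _ _ _ _ _ v0 v0U2 l1.
- by move=> a v; rewrite SH => Ha hv; apply: wU2 => //; apply: D12; exact: D12'.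
- by move=> a b v _ _ _; rewrite rM wM mulmxA.
- by move=> v _; rewrite w1 mulmx1.
- by move=> u uu Du v _; rewrite wln ?mulmx1//; exact: TL.
- by move=> a v; rewrite SH; exact: wl.
have [M hM] := poly_bounded M0 `|r| (pl_poly hP).
exists M => v hv; have Dv : D2 (tau v) by apply/hU2.
pose rr := (v *m l) 0 0; pose m := Num.floor rr.
have [s1 Hs1 fs1] := fsurj (- m).
have Ds1 := cyc_rho Hs1.
pose th := rr - m%:~R.
have th01 : 0 <= th <= 1.
  by rewrite subr_ge0 floor_le/= lerBlDr addrC -intrD1 ltW// lt_succ_floor.
pose g1 := (rho s1 * tau v)%g.
have Dg1 : D2 g1 by exact: (subgM sD2).
have e1 : eq (tau (dis g1)) (tau (th *: r)).
  have h1 := cyc_dis Ds1 Dv; rewrite (dis_tau hA) in h1.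
  have h2 := eqB_mul nD Dv (cyc_rhoE Hs1) (Q v hv).
  have h3 := eqB_trans nD h1 h2; rewrite fs1 -(tauM hA) (pl_line hP) in h3.
  apply: (eqB_trans nD h3); have thr : (th *: r <= U2)%MS by exact: scalemx_sub.
  have := Q _ thr; rewrite -scalemxAl mxE rl mulr1 => h4.
  rewrite (_ : (- m)%:~R + (v *m l) 0 0 = th); first exact: (eqB_sym nD h4).
  by rewrite /th /rr rmorphN addrC.
pose z1 := P (dis g1) (- (th *: r)).
have z1U : (z1 <= U1)%MS.
  apply/hU1; rewrite (tauM hA) (tauN hA).
  have Dth : D2 (tau (th *: r)) by apply/hU2; exact: scalemx_sub.
  have := eqB_mul nD (subgV sD2 Dth) e1 (rf (tau (th *: r))^-1%g).
  by rewrite mulgV /eqB mulg1 => /(subgV sD1); rewrite invgK.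
have [s2 [Hs2 hs2]] := IH z1 z1U.
exists (s2 * s1)%g; split; first by apply: (subgM sH2) => //; exact: HH2.
have -> : (rho (s2 * s1)%g * tau v = rho s2 * g1)%g by rewrite rM /g1 mulgA.
(* Since s2 fixes r, the factor th r can be pulled out on the right, leaving the displacement that
   the induction hypothesis bounds. *)
have -> : dis (rho s2 * g1)%g = P (dis (rho s2 * tau z1)%g) (th *: r).
  rewrite (disM hA x (rho s2) g1) (disM hA x (rho s2) (tau z1)) (dis_tau hA) (plA hP).
  have -> : dis g1 = P z1 (th *: r) by rewrite /z1 (plKr hP).
  by rewrite (cjM hA) (plA hP) wE -scalemxAl rfix// SH.
apply: hM => //; rewrite normrZ; case/andP: th01 => h1 h2; rewrite ger0_norm//.
by rewrite ler_piMl.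
Qed.

End Main.

End CyclicStep.
Section Chain.
Variables (k : nat) (S : nat -> set Gam).
Hypothesis S0 : S 0%N = [set 1%g].
Hypothesis Sk : S k = [set: Gam].
Hypothesis Sstep : forall i, (i < k)%N -> normal_in (S i) (S i.+1) /\
  (finite_quotient (S i.+1) (S i) \/ infinite_cyclic_quotient (S i.+1) (S i)).
Hypothesis hx : forall g, D g -> D (tau (dis g)).
Local Notation D_ i := (zcl (rho @` S i)).

Lemma chain_D i : D_ i `<=` D.
Proof. by apply: zcl_mono => _ [a _ <-]; exists a. Qed.

Lemma chain_normal i : (i < k)%N -> normal_in (rho @` S i) (rho @` S i.+1).
Proof.
move=> ik; have [[sH sH2 HH2 hn] _] := Sstep ik; split.
- exact: image_subgroup.
- exact: image_subgroup.
- by move=> _ [a Ha <-]; exists a => //; exact: HH2.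
- move=> _ _ [a Ha <-] [b Hb <-]; exists (b ^ a)%g; first exact: hn.
  by rewrite /conjg !rM (rhoV rM).
Qed.

Lemma chain_base i : (i <= k)%N -> forall g, D_ i g -> D_ i (tau (dis g)).
Proof.
move=> ik; rewrite -(subKn ik); elim: (k - i)%N => [|j IH] g; first by rewrite subn0 Sk; exact: hx.
have [kj|jk] := leqP k j; first by move: IH; rewrite (_ : (k - j.+1 = k - j)%N); [exact | lia].
have E : (k - j = (k - j.+1).+1)%N by lia.
move: g; apply: (base_normal (A := rho @` S (k - j)%N)) => //; last exact: chain_D.
by rewrite E; apply: chain_normal; lia.
Qed.

(** A finite quotient adds no translations, unipotent elements already lying in the closure of the
    smaller group; an infinite cyclic one is [cyc_cocompact]. *)
Lemma chain_cocompact i : (i <= k)%N ->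
  exists M, forall v, D_ i (tau v) -> exists s, S i s /\ `|dis (rho s * tau v)%g| <= M.
Proof.
elim: i => [|i IH] ik.
  exists 0 => v; have -> : rho @` S 0%N = [set 1%g].
    rewrite S0; apply/seteqP; split => [_ [_ -> <-]|_ ->]; first exact: rho1.
    by exists 1%g => //; exact: rho1.
  move=> /(zcl1 hO) v1; have v0 : v = 0 by apply: (tau_inj hA); rewrite v1 (tau0 hA).
  exists 1%g; rewrite S0 (rho1 rM) mul1g (dis_tau hA) v0 normr0; split => //.
have [M0 hM0] := IH (ltnW ik); have [nS fq] := Sstep ik; have [sS sS2 SS hS'] := nS.
have sD1 := image_subgroup rM sS; have sD2 := image_subgroup rM sS2.
case: fq => [/(findex_quotient sS)[T [f hf]]|[f [fM f0 fsurj]]].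
  exists M0 => v Dv; have [|s [Hs hs]] := hM0 v; last by exists s; split => //; exact: SS.
  pose r (j : T) := xget 1%g [set a | S i.+1 a /\ f a = j].
  have rP a : S i.+1 a -> S i.+1 (r (f a)) /\ f (r (f a)) = f a.
    by move=> Sa; apply: (@xgetPex _ 1%g [set b | S i.+1 b /\ f b = f a]); exists a.
  apply: (@unip_findex R G O hO (rho @` S i) (rho @` S i.+1) T (rho \o r)) => //; last exact: (unip_tau hA).
  move=> _ [a Sa <-]; exists (f a); have [h1 h2] := rP a Sa.
  exists ((r (f a))^-1 * a)%g; last by rewrite rM (rhoV rM).
  exact: hf.
have [t St ft] := fsurj 1.
have [U1 hU1] := trans_lin hA sD1; have [U2 hU2] := trans_lin hA sD2.
have [||M hM] := @cyc_cocompact (S i) (S i.+1) f t nS fM f0 St ft (chain_base (ltnW ik)) (chain_base ik)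
  U1 U2 hU1 hU2 k i S S0 Sstep (ltnW ik) erefl M0.
- by move=> z /hU1; exact: hM0.
- exact: fsurj.
by exists M => v /hU2; exact: hM.
Qed.

End Chain.

Theorem cocompact_unipotent : virtually_polycyclic Gam -> (forall g, D g -> D (tau (dis g))) ->
  exists M, forall v, D (tau v) -> exists s, `|dis (rho s * tau v)%g| <= M.
Proof.
move=> [k [S [S0 Sk Sstep]]] hx.
have [M hM] := chain_cocompact S0 Sk Sstep hx (leqnn k).
by exists M => v; have := hM v; rewrite Sk => h /h[s [_ hs]]; exists s.
Qed.

End Cocompact.

Lemma finite_bound (R : realType) (T : choiceType) (F : set T) (f : T -> R) : finite_set F ->
  exists M, forall a, F a -> f a <= M.
Proof.
move=> /finite_seqP[s ->]; elim: s => [|b s [M hM]]; first by exists 0.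
exists (`|f b| + `|M|) => a; rewrite /= inE => /orP[/eqP ->|h].
  by rewrite (le_trans (ler_norm _))// lerDl.
by rewrite (le_trans (hM a h))// (le_trans (ler_norm _))// lerDr.
Qed.

Lemma line_bounded (R : realType) n (z : 'rV[R]_n) (M : R) : (forall r : R, `|r *: z| <= M) -> z = 0.
Proof.
move=> key; apply: contrapT => /eqP z0; have zp : 0 < `|z| by rewrite normr_gt0.
have := key ((`|M| + 1) / `|z|).
rewrite normrZ ger0_norm ?divr_ge0 ?addr_ge0// divfK ?gt_eqF// => h.
by have := ler_norm M; lra.
Qed.

Section LinMul.
Variables (R : realType) (X : Type) (A : set (X -> R)).
Hypothesis sA : is_subalg A.

Lemma mxin_mxvec m n (F : X -> 'M[R]_(m, n)) : mxin A F -> mxin A (fun x => mxvec (F x)).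
Proof.
move=> h i j; rewrite (ord1 i); case/mxvec_indexP: j => i' j'.
by under eq_fun do rewrite mxvecE; exact: h.
Qed.

Lemma mxin_lin_mulmx m n p (F : X -> 'M[R]_(m, n)) : mxin A F -> mxin A (fun x => lin_mulmx (F x) : 'M[R]_(n * p, m * p)).
Proof.
move=> h i j; have E x : lin_mulmx (F x) i j = (mxvec (F x *m vec_mx (delta_mx 0 i) : 'M[R]_(m, p))) 0 j.
  transitivity (((delta_mx 0 i : 'rV[R]_(n * p)) *m (lin_mulmx (F x) : 'M[R]_(n * p, m * p))) 0 j); first by rewrite -rowE [RHS]mxE.
  by rewrite -{1}(vec_mxK (delta_mx 0 i)) mul_vec_lin.
under eq_fun do rewrite E; apply: mxin_mxvec; apply: mxin_mul => //; exact: mxin_cst.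
Qed.

Lemma mxin_lin_mulmxr m n p (F : X -> 'M[R]_(n, p)) : mxin A F -> mxin A (fun x => lin_mulmxr (F x) : 'M[R]_(m * n, m * p)).
Proof.
move=> h i j; have E x : lin_mulmxr (F x) i j = (mxvec ((vec_mx (delta_mx 0 i) : 'M[R]_(m, n)) *m F x)) 0 j.
  transitivity (((delta_mx 0 i : 'rV[R]_(m * n)) *m (lin_mulmxr (F x) : 'M[R]_(m * n, m * p))) 0 j); first by rewrite -rowE [RHS]mxE.
  by rewrite -{1}(vec_mxK (delta_mx 0 i)) mul_vec_lin.
under eq_fun do rewrite E; apply: mxin_mxvec; apply: mxin_mul => //; exact: mxin_cst.
Qed.

End LinMul.

(** * The closure of a crystallographic group contains all translations *)

Section Surjective.
Variables (R : realType) (n : nat) (P : 'rV[R]_n -> 'rV[R]_n -> 'rV[R]_n) (G : groupType).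
Variables (O : set (G -> R)) (tr : G -> 'rV[R]_n) (ln : G -> 'M[R]_n) (tau : 'rV[R]_n -> G).
Hypothesis hA : aff_struct P O tr ln tau.
Variables (Gam : groupType) (rho : Gam -> G).
Hypothesis rM : forall x y, (rho (x * y) = rho x * rho y)%g.
Hypothesis vp : virtually_polycyclic Gam.
Implicit Types (y z v : 'rV[R]_n) (g h : G) (s t a b : Gam).
Let hP := as_P hA.
Let hO := as_O hA.
Let hS := ag_sub hO.
Local Notation zcl := (zclosure O).
Local Notation D := (zcl (range rho)).
Local Notation act := (act P tr ln).
Local Notation cj := (cj P tr ln).
Hypothesis TL : forall u : G, unip O u -> D u -> ln u = 1%:M.

(* Complete reducibility of [w] along the chain of [Gam]: a projection onto
   [C] commuting with [w] is a fixed vector of the conjugation action. *)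
Lemma invariant_complement (w : G -> 'M[R]_n) (C Z : 'M[R]_n) : mxin O w ->
  (forall g h, w (g * h)%g = w h *m w g) -> w 1%g = 1%:M ->
  (forall u, unip O u -> D u -> w u = 1%:M) ->
  (C <= Z)%MS -> (forall a, (C *m w (rho a) <= C)%MS) -> (forall a, (Z *m w (rho a) <= Z)%MS) ->
  exists W : 'M[R]_n, [/\ (W <= Z)%MS, (W :&: C)%MS = 0, (Z <= W + C)%MS &
    forall a, (W *m w (rho a) <= W)%MS].
Proof.
move=> hw wM w1 wu CZ Cw Zw; have [C0|C0] := eqVneq C 0.
  by exists Z; rewrite C0 capmx0 addsmxSl.
have sD := D_subgroup hA rM.
have wV g : w g^-1%g *m w g = 1%:M by rewrite -wM mulgV w1.
have wVr g : w g *m w g^-1%g = 1%:M by rewrite -wM mulVg w1.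
pose ww g : 'M[R]_(n * n) := lin_mulmx (w g^-1%g) *m lin_mulmxr (w g).
have wwE g (p : 'M[R]_n) : mxvec p *m ww g = mxvec (w g^-1%g *m p *m w g).
  by rewrite /ww mulmxA mul_vec_lin mul_vec_lin.
have [v0 v0C v00] : exists2 v0 : 'rV[R]_n, (v0 <= C)%MS & v0 != 0.
  by have /rowV0Pn[v h1 h2] := C0; exists v.
have [y hy] : exists y : 'cV[R]_n, (v0 *m y) 0 0 = 1.
  have /rV0Pn[j hj] := v00; exists ((v0 0 j)^-1 *: delta_mx j 0).
  by rewrite -scalemxAr -colE mxE mxE mulVf.
(* Maps from Z to C acting on C by some scalar c: allowing any scalar makes the condition linear,
   and the form l below reads off c. Averaging a projection with l = 1 therefore yields an
   equivariant projection. *)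
pose good (r : 'rV[R]_(n * n)) := (Z *m vec_mx r <= C)%MS /\ exists c : R, forall v : 'rV[R]_n, (v <= C)%MS -> v *m vec_mx r = c *: v.
have [W' hW'] : exists W' : 'M[R]_(n * n), forall r : 'rV[R]_(n * n), good r <-> (r <= W')%MS.
  apply: (@lin_set_mx R (n * n) good); rewrite /good.
  - rewrite linear0 mulmx0 sub0mx; split => //; exists 0 => v _; by rewrite mulmx0 scale0r.
  - move=> r r' [h1 [c hc]] [h2 [c' hc']]; rewrite linearD mulmxDr; split; first exact: addmx_sub.
    by exists (c + c') => v hv; rewrite mulmxDr hc// hc'// scalerDl.
  - move=> t r [h1 [c hc]]; rewrite linearZ -scalemxAr; split; first exact: scalemx_sub.
    by exists (t * c) => v hv; rewrite -scalemxAr hc// scalerA.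
pose l : 'cV[R]_(n * n) := \col_j (v0 *m vec_mx (delta_mx 0 j) *m y) 0 0.
have lE (p : 'M[R]_n) : (mxvec p *m l) 0 0 = (v0 *m p *m y) 0 0.
  have pE : p = \sum_j mxvec p 0 j *: vec_mx (delta_mx 0 j).
    by rewrite -{1}(mxvecK p) {1}(row_sum_delta (mxvec p)) linear_sum; apply: eq_bigr => j _; rewrite linearZ.
  rewrite [in RHS]pE mulmx_sumr mulmx_suml summxE mxE; apply: eq_bigr => j _.
  by rewrite -scalemxAr -scalemxAl [in RHS]mxE mxE.
pose r0 : 'rV[R]_(n * n) := mxvec (proj_mx C (C^C)%MS).
have r0W : (r0 <= W')%MS.
  apply/hW'; rewrite /good mxvecK; split; first exact: proj_mx_sub.
  by exists 1 => v hv; rewrite proj_mx_id ?scale1r// capmx_compl.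
have r0l : (r0 *m l) 0 0 = 1 by rewrite lE proj_mx_id// capmx_compl.
have Cwv a v : (v <= C)%MS -> (v *m w (rho a) <= C)%MS.
  by move=> hv; apply: submx_trans (submxMr _ hv) (Cw a).
have wVrho a : w (rho a)^-1%g = w (rho a^-1%g) by rewrite (rhoV rM).
have wwgood a r : good r -> good (r *m ww (rho a)).
  move=> [h1 [c hc]]; rewrite -[r]vec_mxK wwE /good mxvecK wVrho; split.
    rewrite !mulmxA; apply: submx_trans (submxMr _ _) (Cw a).
    exact: submx_trans (submxMr _ (Zw _)) h1.
  exists c => v hv; rewrite !mulmxA hc; last exact: Cwv.
  by rewrite -scalemxAl -mulmxA -wVrho wV mulmx1.
have [k [S [S0 Sk Sstep]]] := vp.
have [||||||r [rW rl rf]] := @fixed_vector R G O Gam rho hO rM k S S0 Sstep (n * n) ww W' l k (leqnn k) _ _ _ _ _ _ r0 r0W r0l.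
- apply: mxin_mul => //; last exact: mxin_lin_mulmxr.
  by apply: mxin_lin_mulmx => // i j; exact: (ag_inv hO (hw i j)).
- by move=> a r _ /hW' hr; apply/hW'; exact: wwgood.
- move=> a b r _ _ _; rewrite -[r]vec_mxK !wwE; congr mxvec.
  by rewrite rM invgM !wM !mulmxA.
- by move=> r _; rewrite -[r]vec_mxK wwE invg1 w1 mul1mx mulmx1.
- move=> u uu Du r _; rewrite -[r]vec_mxK wwE.
  have u1 := wu u uu Du; have := wV u; rewrite u1 mulmx1 => ->.
  by rewrite mul1mx mulmx1.
- move=> a r _ /hW'[_ [c hc]]; apply/matrixP => i j; rewrite !ord1 -[r]vec_mxK wwE !lE.
  rewrite !mulmxA wVrho hc; last exact: Cwv.
  by rewrite -scalemxAl -mulmxA -wVrho wV mulmx1 hc.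
pose p := vec_mx r; have /hW'[pZ [c hc]] := rW.
have c1 : c = 1 by move: rl; rewrite -[r]vec_mxK lE hc// -scalemxAl mxE hy mulr1.
have pC v : (v <= C)%MS -> v *m p = v by move=> hv; rewrite hc// c1 scale1r.
have pw a : p *m w (rho a) = w (rho a) *m p.
  have := rf a; rewrite Sk => /(_ I); rewrite -[r]vec_mxK wwE => /(can_inj mxvecK) E.
  by rewrite -/p in E; rewrite -[in RHS]E !mulmxA wVr mul1mx.
exists (Z :&: kermx p)%MS; split.
- exact: capmxSl.
- apply/eqP; rewrite -submx0; apply/rV_subP => v; rewrite !sub_capmx => /andP[/andP[_ /sub_kermxP h1] h2].
  by rewrite submx0 -(pC v h2) h1.
- apply/rV_subP => v hv; rewrite -[v](subrK (v *m p)).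
  have vpC : (v *m p <= C)%MS by exact: submx_trans (submxMr _ hv) pZ.
  apply: addmx_sub_adds => //; rewrite sub_capmx; apply/andP; split.
    by rewrite addmx_sub// eqmx_opp (submx_trans vpC).
  by apply/sub_kermxP; rewrite mulmxBl (pC _ vpC) subrr.
move=> a; apply/row_subP => i; rewrite row_mul; set v := row i _.
have : (v <= Z :&: kermx p)%MS by exact: row_sub.
rewrite !sub_capmx => /andP[h1 /sub_kermxP h2]; apply/andP; split.
  exact: submx_trans (submxMr _ h1) (Zw a).
by apply/sub_kermxP; rewrite -mulmxA -pw mulmxA h2 mul0mx.
Qed.

Hypothesis proper : forall M : R, finite_set [set a | exists y, `|y| <= M /\ `|act (rho a) y| <= M].
Hypothesis coc : exists M : R, forall y, exists a, `|act (rho a) y| <= M.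

(** Induction along the upper central series: let W be an invariant complement of the translations
    in the next term. For z in W some group element brings r z into a bounded set. Projecting along
    U bounds its W-component and the displacement u, so by properness finitely many group elements
    occur for all real r. Hence the line of z is bounded and z = 0. *)
Theorem translations_surjective v : D (tau v).
Proof.
have sr : subgroup (range rho) by apply: (image_subgroup rM); split.
have [x hx] := base_point hA rM vp TL.
have [U hU] := trans_lin hA sr.
have /choice[Z hZ] := uc_mx hA.
have [k hk] := as_nil hA.
have sD := D_subgroup hA rM.
have [w [hw wM w1 wln wE]] := recentered_ln hA x.
pose dis := dis P tr ln x.
have wcj g v' : v' *m w g = cj (tau (- dis g)) (cj g v').
  apply: (tau_inj hA); apply: (mulgI (tau (dis g))); rewrite -(tauM hA) -wE (tauM hA).
  by rewrite -[in RHS](cjE hA (tau (- dis g))) (tauN hA) invgK !mulgA mulgV mul1g.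
have wU g : D g -> (U *m w g <= U)%MS.
  move=> Dg; apply/row_subP => i; rewrite row_mul wcj.
  have Dd : D (tau (- dis g)) by rewrite (tauN hA); apply: (subgV sD); exact: hx.
  by apply: (Um_cj hA rM hU Dd); apply: (Um_cj hA rM hU Dg); exact: row_sub.
have wZ i g : (Z i *m w g <= Z i)%MS.
  apply/row_subP => j; rewrite row_mul wcj; apply/hZ; apply: (uc_cj hA); apply: (uc_cj hA).
  by apply/hZ; exact: row_sub.
suff H i : (Z i <= U)%MS by apply/hU; apply: submx_trans (H k); apply/hZ; exact: hk.
elim: i => [|i IH].
  by apply/rV_subP => z /hZ ->; exact: sub0mx.
have capw a : ((Z i.+1 :&: U) *m w (rho a) <= Z i.+1 :&: U)%MS.
  rewrite sub_capmx (submx_trans (submxMr _ (capmxSl _ _)) (wZ _ _))/=.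
  by apply: submx_trans (wU (rho a) _); [apply: submxMr; exact: capmxSr | apply: sub_zcl; exists a].
have wu u : unip O u -> D u -> w u = 1%:M by move=> h1 h2; apply: wln; exact: TL.
have [W [WZ WC ZW Ww]] := invariant_complement hw wM w1 wu (capmxSl _ _) capw (fun a => wZ i.+1 (rho a)).
have WU : (W :&: U)%MS = 0.
  apply/eqP; rewrite -submx0 -WC; apply/rV_subP => z; rewrite !sub_capmx => /andP[h1 h2].
  by rewrite h1 h2 (submx_trans h1 WZ).
suff W0 : W = 0 by apply: submx_trans ZW _; rewrite W0 adds0mx capmxSr.
apply/eqP; rewrite -submx0; apply/rV_subP => z hz; rewrite submx0.
have [M hM] := coc.
pose q := proj_mx W U.
have [M1 hM1] := poly_bounded M `|- x| (pl_poly hP).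
have [M2 hM2] := poly_bounded M1 M1 (polymap_mulmx q).
have [M3 hM3] := poly_bounded M1 M2 (pl_poly hP).
have [M4 hM4] := poly_bounded M3 `|x| (pl_poly hP).
have fin := proper (Num.max M4 `|x|).
have /choice[M5 hM5] : forall a, exists M5 : R, forall y : 'rV[R]_n, `|y| <= M2 -> `|y *m w (rho a)^-1%g| <= M5.
  by move=> a; have [M5 h] := poly_bounded M2 M2 (polymap_mulmx (w (rho a)^-1%g)); exists M5 => y hy; exact: (h y y).
have [M6 hM6] := finite_bound M5 fin.
have key (r : R) : `|r *: z| <= M6.
  have [a ha] := hM (P (r *: z) x); pose u := dis (rho a); pose z1 := (r *: z) *m w (rho a).
  have E : act (rho a) (P (r *: z) x) = P (P u z1) x.
    by rewrite (act_P hA) (disE hA x (rho a)) -(plA hP) wE.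
  have uU : (u <= U)%MS by apply/hU; apply: hx; exact: rhoD.
  have z1W : (z1 <= W)%MS by apply: submx_trans (Ww a); apply: submxMr; exact: scalemx_sub.
  have h1 : `|P u z1| <= M1.
    by rewrite -[P u z1](plK hP x); apply: hM1 => //; rewrite -E.
  have h2 : P u z1 *m q = z1.
    have e := uc_add hA (hZ i) (or_intror (iffRL (hZ i.+1 z1) (submx_trans z1W WZ))) (x := u).
    have uz : ((P u z1 - (u + z1) + u)%R <= U)%MS by apply: addmx_sub => //; exact: submx_trans e IH.
    have := proj_mx_0 WU uz; rewrite opprD addrA addrAC subrK mulmxBl => /eqP.
    by rewrite subr_eq0 => /eqP ->; exact: proj_mx_id.
  have h3 : `|z1| <= M2 by rewrite -h2; exact: (hM2 _ (P u z1)).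
  have h4 : `|u| <= M3 by rewrite -[u](plK hP z1); apply: hM3 => //; rewrite normrN.
  have Fa : [set a | exists y, `|y| <= Num.max M4 `|x| /\ `|act (rho a) y| <= Num.max M4 `|x|] a.
    exists x; rewrite !le_max lexx orbT; split => //.
    by rewrite (disE hA x (rho a)) hM4.
  have -> : r *: z = z1 *m w (rho a)^-1%g by rewrite /z1 -mulmxA -wM mulVg w1 mulmx1.
  exact: le_trans (hM5 _ _ h3) (hM6 _ Fa).
apply/eqP; exact: (line_bounded key).
Qed.

End Surjective.

(* Adjoining a point where the functions take the values prescribed by a
   character turns the character into an evaluation. *)
Lemma char_subalg (R : realType) (X : Type) (O : set (X -> R)) (chi : (X -> R) -> R) : is_subalg O ->
  (forall c, chi (fun _ => c) = c) ->
  (forall f f', O f -> O f' -> chi (fun g => f g + f' g) = chi f + chi f') ->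
  (forall f f', O f -> O f' -> chi (fun g => f g * f' g) = chi f * chi f') ->
  is_subalg [set F : option X -> R | O (F \o some) /\ F None = chi (F \o some)].
Proof.
move=> sO chiC chiD chiM; split.
- by move=> a; split; [exact: sa_cst | rewrite /comp chiC].
- by move=> F F' [h1 h2] [h3 h4]; split; [exact: (sa_add sO h1 h3) | rewrite h2 h4 -chiD].
- by move=> F F' [h1 h2] [h3 h4]; split; [exact: (sa_mul sO h1 h3) | rewrite h2 h4 -chiM].
Qed.

(** * Aff(N) as an algebraic group *)

Section AffAlgebraic.
Variables (R : realType) (n : nat) (N : lieGroupType R n).
Hypothesis cscN : connected_sc_nilpotent N.
Implicit Types (g h : Aff N) (f : Aff N -> R) (v x y z : 'rV[R]_n).

Definition nlaw : 'rV[R]_n -> 'rV[R]_n -> 'rV[R]_n := Plaw (lie_lc N).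
Definition Atr g : 'rV[R]_n := lie_log (Aff_trans g).
Definition Aln g : 'M[R]_n := lie_diff (Aff_lin g).
Definition Atau v : Aff N := MkAff (lexp N v) 1%g.
Definition regular : set (Aff N -> R) := [set f | regular_fun f].
Local Notation P := nlaw.

Let hN : hausdorff_space N := lie_hausdorff.
Let nilN : nilpotent_group N. Proof. by case: cscN. Qed.

Lemma lexpM x y : lexp N (P x y) = (lexp N x * lexp N y)%g.
Proof. exact: (ex_Plaw (lie_lc N) hN nilN x y). Qed.

Lemma lie_logM (a b : N) : lie_log (a * b)%g = P (lie_log a) (lie_log b).
Proof. by rewrite -{1}(lie_logK cscN a) -{1}(lie_logK cscN b) -lexpM (lexpK cscN). Qed.

Lemma lexp_injective v v' : lexp N v = lexp N v' -> v = v'.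
Proof. by move=> h; rewrite -(lexpK cscN v) h (lexpK cscN). Qed.

Lemma nlaw_plaw : plaw P.
Proof.
split; [exact: PlawA | exact: PlawX0 | exact: Plaw_line | exact: Plaw_poly].
Qed.

Lemma mx_eq m (A B : 'M[R]_(n, m)) : (forall v : 'rV[R]_n, v *m A = v *m B) -> A = B.
Proof. by move=> h; apply/row_matrixP => i; rewrite !rowE. Qed.

Lemma AlnM g h : Aln (g * h)%g = Aln h *m Aln g.
Proof.
apply: mx_eq => v; apply: lexp_injective; rewrite -lie_diffE mulmxA -!lie_diffE.
by [].
Qed.

Lemma Aln_P g x y : P x y *m Aln g = P (x *m Aln g) (y *m Aln g).
Proof. by apply: lexp_injective; rewrite -lie_diffE !lexpM -!lie_diffE autM. Qed.

Lemma AtrM g h : Atr (g * h)%g = P (Atr g) (Atr h *m Aln g).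
Proof.
rewrite /Atr lie_logM; congr (P _ _); apply: lexp_injective.
by rewrite (lie_logK cscN) -lie_diffE (lie_logK cscN).
Qed.

Lemma Aff_eq g h : Atr g = Atr h -> Aln g = Aln h -> g = h.
Proof.
case: g h => [a s] [b t]; rewrite /Atr /Aln /= => e1 e2.
have -> : a = b by rewrite -(lie_logK cscN a) e1 (lie_logK cscN).
congr MkAff; apply: aut_eq => z; rewrite -(lie_logK cscN z).
by rewrite (lie_diffE s) (lie_diffE t) e2.
Qed.

Lemma Atr_tau v : Atr (Atau v) = v. Proof. exact: lexpK. Qed.

Lemma Aln1 g : Aff_lin g = 1%g -> Aln g = 1%:M.
Proof.
move=> g1; apply: mx_eq => v; apply: lexp_injective; rewrite /Aln g1 mulmx1.
by rewrite -(lie_diffE (1%g : aut N)).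
Qed.

Lemma Aln_unit g : Aln g \in unitmx.
Proof.
have : Aln g^-1%g *m Aln g = 1%:M by rewrite -AlnM mulgV; exact: Aln1.
by move/mulmx1_unit => [].
Qed.

Lemma Adet_neq0 g : \det (Aln g) != 0.
Proof. by have := Aln_unit g; rewrite unitmxE unitfE. Qed.

Definition polyF : set (Aff N -> R) := [set f | exists p, f = Aff_poly p].

Lemma polyF_subalg : is_subalg polyF.
Proof.
split.
- by move=> a; exists (mpoly.mpolyC _ a); apply/funext => g; rewrite /Aff_poly mpoly.mevalC.
- by move=> _ _ [p ->] [q ->]; exists (p + q); apply/funext => g; rewrite /Aff_poly mpoly.mevalD.
- by move=> _ _ [p ->] [q ->]; exists (p * q); apply/funext => g; rewrite /Aff_poly mpoly.mevalM.
Qed.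

Lemma polyF_coord i : polyF (fun g => Aff_coord g 0 i).
Proof.
by exists (mpoly.mpolyX R (mpoly.mnm1 i)); apply/funext => g; rewrite /Aff_poly mpoly.mevalXU.
Qed.

Lemma polyF_tr : mxin polyF Atr.
Proof.
move=> i j; rewrite (ord1 i); have := polyF_coord (lshift (n * n) j).
by under eq_fun do rewrite row_mxEl.
Qed.

Lemma polyF_ln : mxin polyF Aln.
Proof.
move=> i j; have := polyF_coord (rshift n (mxvec_index i j)).
by under eq_fun do rewrite row_mxEr mxvecE.
Qed.

Lemma polyF_regular f : polyF f -> regular f.
Proof. by move=> [p ->]; exists p, 0%N => g; rewrite expr0 divr1. Qed.

Lemma regular_subalg : is_subalg regular.
Proof.
have hp := polyF_subalg; have [D hD] := mxin_det hp polyF_ln.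
have dE g : \det (lie_diff (Aff_lin g)) = Aff_poly D g by rewrite -[LHS]/((fun g => \det (Aln g)) g) hD.
have d0 g : \det (lie_diff (Aff_lin g)) != 0 by exact: Adet_neq0.
split.
- by move=> a; apply: polyF_regular; exact: sa_cst.
- move=> f f' [p [k hf]] [p' [k' hf']]; exists (p * D ^+ k' + p' * D ^+ k), (k + k')%N => g.
  rewrite hf hf' /Aff_poly mpoly.mevalD !mpoly.mevalM !rmorphXn /= -![mpoly.meval _ D]/(Aff_poly D g) -dE.
  have h1 := expf_neq0 k (d0 g); have h2 := expf_neq0 k' (d0 g).
  by rewrite exprD; field; rewrite h1 h2.
- move=> f f' [p [k hf]] [p' [k' hf']]; exists (p * p'), (k + k')%N => g.
  rewrite hf hf' /Aff_poly mpoly.mevalM exprD.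
  have h1 := expf_neq0 k (d0 g); have h2 := expf_neq0 k' (d0 g).
  by field; rewrite h1 h2.
Qed.
Let hR := regular_subalg.

Lemma regular_tr : mxin regular Atr. Proof. by move=> i j; apply: polyF_regular; exact: polyF_tr. Qed.
Lemma regular_ln : mxin regular Aln. Proof. by move=> i j; apply: polyF_regular; exact: polyF_ln. Qed.

Lemma regular_det : regular (fun g => (\det (Aln g))^-1).
Proof.
exists (mpoly.mpolyC _ 1), 1%N => g; rewrite expr1 /Aff_poly.
by rewrite mpoly.mevalC mul1r.
Qed.

(** Reduces every regularity check to the translation part, the linear part and the inverse
    determinant. *)
Lemma regular_comp (X : Type) (A : set (X -> R)) (phi : X -> Aff N) f : is_subalg A -> regular f ->
  mxin A (fun x : X => Atr (phi x)) -> mxin A (fun x : X => Aln (phi x)) ->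
  A (fun x : X => (\det (Aln (phi x)))^-1) -> A (fun x : X => f (phi x)).
Proof.
move=> sA [p [k hf]] h1 h2 h3; under eq_fun do rewrite hf -exprVn.
apply: sa_mul => //; last exact: (sa_exp sA k h3).
under eq_fun do rewrite /Aff_poly mpoly.mevalE.
apply: sa_sum => // m _; apply: sa_mul => //; first exact: sa_cst.
apply: sa_prod => // i _; apply: sa_exp => //.
rewrite -(splitK i); case: (fintype.split i) => j /=.
  by under eq_fun do rewrite row_mxEl; exact: h1.
case/mxvec_indexP: j => j j'.
by under eq_fun do rewrite row_mxEr mxvecE; exact: h2.
Qed.

Lemma Atr_inv g : Atr g^-1%g = - (Atr g *m Aln g^-1%g).
Proof.
have hP := nlaw_plaw; have := AtrM g^-1%g g; rewrite mulVg => E.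
have E0 : Atr 1%g = 0.
  have := Atr_tau 0; have -> // : Atau 0 = 1%g.
  apply: (mulgI (Atau 0)); rewrite mulg1; apply: Aff_eq.
    by rewrite AtrM !Atr_tau mul0mx (plx0 hP).
  by rewrite AlnM [Aln (Atau 0)]Aln1// mulmx1.
by rewrite -[LHS](plK hP (Atr g *m Aln g^-1%g)) -E E0 (pl0x hP).
Qed.

Lemma Aln_inv g : Aln g^-1%g = (\det (Aln g))^-1 *: \adj (Aln g).
Proof.
have h : Aln g^-1%g *m Aln g = 1%:M by rewrite -AlnM mulgV; exact: Aln1.
have := Aln_unit g => u.
have -> : Aln g^-1%g = invmx (Aln g) by rewrite -[LHS]mulmx1 -(mulmxV u) mulmxA h mul1mx.
by rewrite /invmx u.
Qed.

Lemma regular_alg : alg_group regular.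
Proof.
have adj_in X (A : set (X -> R)) (F : X -> 'M[R]_n) : is_subalg A -> mxin A F -> mxin A (fun o : X => \adj (F o)).
  move=> sA hF i j; under eq_fun do rewrite mxE /cofactor; apply: sa_mul => //; first exact: sa_cst.
  apply: mxin_det => // i' j'; under eq_fun do rewrite !mxE; exact: hF.
split.
- exact: hR.
- move=> f hf; have ht := tens_subalg hR hR.
  have t1 k m (F : Aff N -> 'M[R]_(k, m)) : mxin regular F -> mxin (tens regular regular) (fun p : Aff N * Aff N => F p.1).
    by move=> hF i j; exact: (tens_fst hR (hF i j)).
  have t2 k m (F : Aff N -> 'M[R]_(k, m)) : mxin regular F -> mxin (tens regular regular) (fun p : Aff N * Aff N => F p.2).
    by move=> hF i j; exact: (tens_snd hR (hF i j)).
  apply: (regular_comp (phi := fun p : Aff N * Aff N => (p.1 * p.2)%g)) => //.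
  + under eq_fun do rewrite AtrM; apply: (pl_poly nlaw_plaw ht); first exact: (t1 _ _ Atr regular_tr).
    by apply: mxin_mul => //; [exact: (t2 _ _ Atr regular_tr) | exact: (t1 _ _ Aln regular_ln)].
  + under eq_fun do rewrite AlnM; apply: mxin_mul => //; [exact: (t2 _ _ Aln regular_ln) | exact: (t1 _ _ Aln regular_ln)].
  + under eq_fun do rewrite AlnM det_mulmx invfM.
    by apply: sa_mul => //; [exact: (tens_snd hR regular_det) | exact: (tens_fst hR regular_det)].
- move=> f hf; have hln : mxin regular (fun g => Aln g^-1%g).
    under eq_fun do rewrite Aln_inv; apply: mxin_scale => //; first exact: regular_det.
    by apply: adj_in => //; exact: regular_ln.
  apply: (regular_comp (phi := fun g => g^-1%g)) => //.
    under eq_fun do rewrite Atr_inv; apply: mxin_opp => //; apply: mxin_mul => //; exact: regular_tr.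
  have dV g : (\det (Aln g^-1%g))^-1 = \det (Aln g).
    have : \det (Aln g^-1%g *m Aln g) = 1 by rewrite -AlnM mulgV Aln1// det1.
    rewrite det_mulmx => h; apply: (mulfI (Adet_neq0 g^-1%g)); rewrite h divff//.
    exact: Adet_neq0.
  have -> : (fun g => (\det (Aln g^-1%g))^-1) = (fun g => \det (Aln g)) by apply/funext => g; exact: dV.
  exact: (mxin_det hR regular_ln).
- move=> g h H; apply: Aff_eq; first by apply/rowP => j; exact: (H _ (regular_tr 0 j)).
  by apply/matrixP => i j; exact: (H _ (regular_ln i j)).
move=> chi chiC chiD chiM.
pose A := [set F : option (Aff N) -> R | regular (F \o some) /\ F None = chi (F \o some)].
have sA : is_subalg A by exact: char_subalg.
pose ext k m (F : Aff N -> 'M[R]_(k, m)) (o : option (Aff N)) : 'M[R]_(k, m) :=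
  if o is Some g then F g else \matrix_(i, j) chi (fun g => F g i j).
have extA k m (F : Aff N -> 'M[R]_(k, m)) : mxin regular F -> mxin A (ext k m F).
  by move=> hF i j; split; [exact: hF | rewrite /= mxE].
have cA k m (M : 'M[R]_(k, m)) : mxin A (fun _ => M) by exact: mxin_cst.
have hP := nlaw_plaw.
(* The character prescribes a matrix M and a vector v. Identities between regular functions hold at
   the adjoined point too, so M respects the group law; the value at the inverse determinant makes M
   invertible. Hence (v, M) is an element of Aff(N). *)
pose M := ext _ _ Aln None; pose v := ext _ _ Atr None.
have MP x y : P x y *m M = P (x *m M) (y *m M).
  apply/rowP => j.
  have xM z : mxin A (fun o => z *m ext _ _ Aln o) by apply: mxin_mul => //; apply: extA; exact: regular_ln.
  have [_ /= h] := sa_sub sA (xM (P x y) 0 j) (pl_poly hP sA (xM x) (xM y) 0 j).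
  apply/eqP; rewrite -subr_eq0; apply/eqP; rewrite h -[RHS](chiC 0); congr chi.
  by apply/funext => g /=; rewrite Aln_P subrr.
have detA : A (fun o => \det (ext _ _ Aln o)) by apply: mxin_det => //; apply: extA; exact: regular_ln.
have detM : chi (fun g => (\det (Aln g))^-1) * \det M = 1.
  have [_ /= hd] := detA; rewrite /M hd -chiM; [|exact: regular_det|].
    by rewrite -[RHS](chiC 1); congr chi; apply/funext => g /=; rewrite mulVf// Adet_neq0.
  by apply: mxin_det => //; exact: regular_ln.
have uM : M \in unitmx.
  by rewrite unitmxE unitfE; apply: contra_eq_neq detM => ->; rewrite mulr0 eq_sym oner_eq0.
pose a (z : N) : N := lexp N (lie_log z *m M).
pose a' (z : N) : N := lexp N (lie_log z *m invmx M).
have mc (Q : 'M[R]_n) : continuous (fun z : N => lexp N (lie_log z *m Q)).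
  move=> z; apply: (@continuous_comp _ _ _ (fun z : N => lie_log z *m Q) (lexp N)); last exact: lexp_cont.
  have /(_ z) : continuous (fun z : N => lie_log z *m Q); last exact.
  apply: mxin_continuous; apply: mxin_mul; first exact: cont_subalg.
    by apply: continuous_mxin; exact: lie_log_cont.
  by apply: mxin_cst; exact: cont_subalg.
have aP : cont_morphism a.
  by split; [move=> x y; rewrite /a lie_logM MP lexpM | exact: mc].
have aK : cancel a a' by move=> z; rewrite /a /a' (lexpK cscN) mulmxK// (lie_logK cscN).
have a'K : cancel a' a by move=> z; rewrite /a /a' (lexpK cscN) mulmxKV// (lie_logK cscN).
pose g0 : Aff N := MkAff (lexp N v) (MkAut aP (mc (invmx M)) aK a'K).
have tr0 : Atr g0 = v by rewrite /Atr (lexpK cscN).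
have ln0 : Aln g0 = M.
  by apply: mx_eq => z; apply: lexp_injective; rewrite -lie_diffE /= /a (lexpK cscN).
exists g0 => f hf.
pose phi (o : option (Aff N)) := if o is Some g then g else g0.
have phitr : (fun o => Atr (phi o)) = ext _ _ Atr by apply/funext => -[g|] //=; rewrite tr0.
have philn : (fun o => Aln (phi o)) = ext _ _ Aln by apply/funext => -[g|] //=; rewrite ln0.
have [|||_ h] := @regular_comp _ A phi f sA hf.
- by rewrite phitr; apply: extA; exact: regular_tr.
- by rewrite philn; apply: extA; exact: regular_ln.
- split; first exact: regular_det.
  rewrite /= ln0; have d0 : \det M != 0 by rewrite -unitfE -unitmxE.
  by apply: (mulIf d0); rewrite mulVf// detM.
- exact: h.
Qed.

(** The lower central term of index k - j lies in the j-th upper central term, by induction on j. *)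
Lemma uc_nil : exists k, forall v, uc P k v.
Proof.
have [k hk] := nilN; exists k => v.
suff H j : (j <= k)%N -> forall z, @lower_central N (k - j) (lexp N z) -> uc P j z.
  by apply: (H k) => //; rewrite subnn.
have hP := nlaw_plaw.
have lN z : lexp N (- z) = (lexp N z)^-1%g.
  apply: (mulgI (lexp N z)); rewrite -lexpM (plxN hP) mulgV.
  by apply: (mulgI (lexp N 0)); rewrite -lexpM (plx0 hP) mulg1.
elim: j => [|j IH] jk z.
  rewrite subn0 hk => z1; apply: lexp_injective; rewrite z1.
  by apply/esym/(mulgI (lexp N 0)); rewrite -lexpM (plx0 hP) mulg1.
move=> hz y; apply: IH; first exact: ltnW.
have -> : (k - j = (k - j.+1).+1)%N by lia.
have -> : lexp N (P (- P y z) (P z y)) = [~ lexp N z, lexp N y]%g.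
  by rewrite lexpM lN !lexpM /commg /conjg invgM !mulgA.
exact: (commutator_in (a := lexp N z) (b := lexp N y) hz I).
Qed.

Theorem Aff_struct : aff_struct P regular Atr Aln Atau.
Proof.
split.
- exact: nlaw_plaw.
- exact: regular_alg.
- exact: regular_tr.
- exact: regular_ln.
- exact: AtrM.
- exact: AlnM.
- exact: Aln_P.
- exact: Aff_eq.
- exact: Atr_tau.
- by move=> v; exact: Aln1.
- move=> f hf X A sA c hc; apply: (@regular_comp X A (fun o => Atau (c o)) f sA hf).
  + by under eq_fun do rewrite Atr_tau.
  + have -> : (fun o => Aln (Atau (c o))) = (fun _ => 1%:M) by apply/funext => o; exact: Aln1.
    exact: mxin_cst.
  + have -> : (fun o => (\det (Aln (Atau (c o))))^-1) = (fun _ => (\det (1%:M : 'M[R]_n))^-1).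
      by apply/funext => o; rewrite Aln1.
    exact: sa_cst.
- exact: uc_nil.
Qed.

(** A regular function is a polynomial divided by a power of a nowhere vanishing determinant, so it
    has the same zeros as its numerator. *)
Lemma zclosure_closed (A : set (Aff N)) : zariski_closed (zclosure regular A).
Proof.
exists [set p | forall a, A a -> Aff_poly p a = 0]; apply/seteqP; split => [h hh p Pp|h hh f [p [k hf]] fA].
  by apply: hh Pp; apply: polyF_regular; exists p.
rewrite hf hh ?mul0r// => a /fA; rewrite hf => /eqP; rewrite mulf_eq0 invr_eq0.
have d0 : \det (lie_diff (Aff_lin a)) != 0 by exact: Adet_neq0.
by rewrite (negPf (expf_neq0 k d0)) orbF => /eqP.
Qed.

Lemma zclosureE (A : set (Aff N)) : zariski_closure A = zclosure regular A.
Proof.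
apply/seteqP; split => [g hg|g hg B [[Ps ->] AB] p Pp].
  by apply: hg; split; [exact: zclosure_closed | exact: sub_zcl].
apply: (hg (Aff_poly p)); first by apply: polyF_regular; exists p.
by move=> a /AB /(_ p Pp).
Qed.

End AffAlgebraic.

(** * Products of affine structures *)

Section ProductStruct.
Variables (R : realType) (n1 n2 : nat).
Variables (P1 : 'rV[R]_n1 -> 'rV[R]_n1 -> 'rV[R]_n1) (P2 : 'rV[R]_n2 -> 'rV[R]_n2 -> 'rV[R]_n2).
Variables (G1 G2 : groupType) (O1 : set (G1 -> R)) (O2 : set (G2 -> R)).
Variables (tr1 : G1 -> 'rV[R]_n1) (ln1 : G1 -> 'M[R]_n1) (tau1 : 'rV[R]_n1 -> G1).
Variables (tr2 : G2 -> 'rV[R]_n2) (ln2 : G2 -> 'M[R]_n2) (tau2 : 'rV[R]_n2 -> G2).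
Hypothesis h1 : aff_struct P1 O1 tr1 ln1 tau1.
Hypothesis h2 : aff_struct P2 O2 tr2 ln2 tau2.
Let s1 := ag_sub (as_O h1).
Let s2 := ag_sub (as_O h2).

Definition prodP (v w : 'rV[R]_(n1 + n2)) : 'rV[R]_(n1 + n2) :=
  row_mx (P1 (lsubmx v) (lsubmx w)) (P2 (rsubmx v) (rsubmx w)).
Definition prodtr (g : G1 * G2) : 'rV[R]_(n1 + n2) := row_mx (tr1 g.1) (tr2 g.2).
Definition prodln (g : G1 * G2) : 'M[R]_(n1 + n2) := block_mx (ln1 g.1) 0 0 (ln2 g.2).
Definition prodtau (v : 'rV[R]_(n1 + n2)) : G1 * G2 := (tau1 (lsubmx v), tau2 (rsubmx v)).
Local Notation O := (tens O1 O2).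
Local Notation P := prodP.

Lemma prodP_row a b c d : P (row_mx a b) (row_mx c d) = row_mx (P1 a c) (P2 b d).
Proof. by rewrite /P !row_mxKl !row_mxKr. Qed.

Lemma mxin_lsub (X : Type) (A : set (X -> R)) (F : X -> 'rV[R]_(n1 + n2)) : mxin A F -> mxin A (fun x => lsubmx (F x)).
Proof. by move=> h i j; under eq_fun do rewrite mxE; exact: h. Qed.

Lemma mxin_rsub (X : Type) (A : set (X -> R)) (F : X -> 'rV[R]_(n1 + n2)) : mxin A F -> mxin A (fun x => rsubmx (F x)).
Proof. by move=> h i j; under eq_fun do rewrite mxE; exact: h. Qed.

Lemma mxin_row (X : Type) (A : set (X -> R)) (F : X -> 'rV[R]_n1) (F' : X -> 'rV[R]_n2) :
  mxin A F -> mxin A F' -> mxin A (fun x => row_mx (F x) (F' x)).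
Proof.
move=> h h' i j; rewrite -(splitK j); case: (fintype.split j) => j' /=.
  by under eq_fun do rewrite row_mxEl; exact: h.
by under eq_fun do rewrite row_mxEr; exact: h'.
Qed.

Lemma prod_plaw : plaw P.
Proof.
have p1 := as_P h1; have p2 := as_P h2; split.
- by move=> x y z; rewrite /P !row_mxKl !row_mxKr (plA p1) (plA p2).
- by move=> x; rewrite /P !linear0 (plx0 p1) (plx0 p2) hsubmxK.
- move=> x s t; rewrite /P !linearZ /= (pl_line p1) (pl_line p2) -scale_row_mx.
  by rewrite hsubmxK.
- move=> X A sA f g hf hg; apply: mxin_row.
    by apply: (pl_poly p1 sA); exact: mxin_lsub.
  by apply: (pl_poly p2 sA); exact: mxin_rsub.
Qed.

Lemma prod_uc i z : uc P1 i (lsubmx z) -> uc P2 i (rsubmx z) -> uc P i z.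
Proof.
elim: i z => [|i IH] z /=; first by move=> l0 r0; rewrite -[z]hsubmxK l0 r0 row_mx0.
move=> hl hr y; apply: IH; rewrite /P linearN /= ?row_mxKl ?row_mxKr.
  exact: hl.
by rewrite linearN /= row_mxKr; exact: hr.
Qed.

Lemma prod_alg : alg_group O.
Proof.
have t := tens_subalg s1 s2; have tt := tens_subalg t t; split.
- exact: t.
- move=> f [I [a [b [hab E]]]].
  have -> : (fun p : (G1 * G2) * (G1 * G2) => f (p.1 * p.2)%g) =
     fun p => \sum_i a i (p.1.1 * p.2.1)%g * b i (p.1.2 * p.2.2)%g.
    by apply/funext => -[[x y] [z w]]; rewrite E.
  apply: sa_sum => // i _; have [ha hb] := hab i; apply: sa_mul => //.
    have [J [c [d [hcd Ec]]]] := ag_coalg (as_O h1) ha.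
    under eq_fun do rewrite Ec; apply: sa_sum => // j _; have [hc hd] := hcd j; apply: sa_mul => //.
      exact: (tens_fst t (tens_fst s2 hc)).
    exact: (tens_snd t (tens_fst s2 hd)).
  have [J [c [d [hcd Ec]]]] := ag_coalg (as_O h2) hb.
  under eq_fun do rewrite Ec; apply: sa_sum => // j _; have [hc hd] := hcd j; apply: sa_mul => //.
    exact: (tens_fst t (tens_snd s1 hc)).
  exact: (tens_snd t (tens_snd s1 hd)).
- move=> f [I [a [b [hab E]]]].
  have -> : (fun g : G1 * G2 => f g^-1%g) = fun g => \sum_i a i g.1^-1%g * b i g.2^-1%g.
    by apply/funext => -[x y]; rewrite E.
  apply: sa_sum => // i _; have [ha hb] := hab i; apply: sa_mul => //.
    exact: (tens_fst s2 (ag_inv (as_O h1) ha)).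
  exact: (tens_snd s1 (ag_inv (as_O h2) hb)).
- move=> [x y] [z w] H; congr pair.
    by apply: (ag_sep (as_O h1)) => f hf; exact: (H _ (tens_fst s2 hf)).
  by apply: (ag_sep (as_O h2)) => f hf; exact: (H _ (tens_snd s1 hf)).
move=> chi chiC chiD chiM; have sA := char_subalg t chiC chiD chiM.
have [|||g1 hg1] := @ag_pts _ _ _ (as_O h1) (fun f => chi (fun p => f p.1)).
- by move=> c; exact: chiC.
- by move=> f f' hf hf'; exact: chiD (tens_fst s2 hf) (tens_fst s2 hf').
- by move=> f f' hf hf'; exact: chiM (tens_fst s2 hf) (tens_fst s2 hf').
have [|||g2 hg2] := @ag_pts _ _ _ (as_O h2) (fun f => chi (fun p => f p.2)).
- by move=> c; exact: chiC.
- by move=> f f' hf hf'; exact: chiD (tens_snd s1 hf) (tens_snd s1 hf').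
- by move=> f f' hf hf'; exact: chiM (tens_snd s1 hf) (tens_snd s1 hf').
exists (g1, g2) => f [I [a [b [hab E]]]].
pose phi (o : option (G1 * G2)) := if o is Some g then g else (g1, g2).
have : [set F : option (G1 * G2) -> R | O (F \o some) /\ F None = chi (F \o some)]
    (fun o => \sum_i a i (phi o).1 * b i (phi o).2).
  apply: (sa_sum sA) => i _; have [ha hb] := hab i; apply: (sa_mul sA).
    by split; [exact: (tens_fst s2 ha) | rewrite /= (hg1 _ ha)].
  by split; [exact: (tens_snd s1 hb) | rewrite /= (hg2 _ hb)].
move=> [_ /= h]; rewrite E h; congr chi.
by apply/funext => -[x y] /=; rewrite E.
Qed.

Lemma prod_struct : aff_struct P O prodtr prodln prodtau.
Proof.
have t := tens_subalg s1 s2.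
have t1 k m (F : G1 -> 'M[R]_(k, m)) : mxin O1 F -> mxin O (fun p : G1 * G2 => F p.1).
  by move=> hF i j; exact: (tens_fst s2 (hF i j)).
have t2 k m (F : G2 -> 'M[R]_(k, m)) : mxin O2 F -> mxin O (fun p : G1 * G2 => F p.2).
  by move=> hF i j; exact: (tens_snd s1 (hF i j)).
split.
- exact: prod_plaw.
- exact: prod_alg.
- by apply: mxin_row; [exact: (t1 _ _ tr1 (as_tr h1)) | exact: (t2 _ _ tr2 (as_tr h2))].
- apply: mxin_block; [exact: (t1 _ _ ln1 (as_ln h1)) | exact: mxin_cst | exact: mxin_cst |].
  exact: (t2 _ _ ln2 (as_ln h2)).
- move=> [a b] [c d]; rewrite /prodtr /prodln mul_row_block !mulmx0 addr0 add0r prodP_row /=.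
  by rewrite (as_trM h1) (as_trM h2).
- move=> [a b] [c d]; rewrite /prodln mulmx_block !mulmx0 !mul0mx !addr0 !add0r /=.
  by rewrite (as_lnM h1) (as_lnM h2).
- move=> [a b] x y; rewrite -[x]hsubmxK -[y]hsubmxK prodP_row /prodln !mul_row_block.
  by rewrite !mulmx0 !addr0 !add0r prodP_row (as_lnP h1) (as_lnP h2).
- move=> [a b] [c d] /eq_row_mx[e1 e2] /eq_block_mx[e3 _ _ e4].
  by congr pair; [exact: (as_inj h1) | exact: (as_inj h2)].
- by move=> v; rewrite /prodtr /= (as_trt h1) (as_trt h2) hsubmxK.
- by move=> v; rewrite /prodln /= (as_lnt h1) (as_lnt h2) -scalar_mx_block.
- move=> f [I [a [b [hab E]]]] X A sA c hc.
  have -> : (fun x => f (prodtau (c x))) = fun x => \sum_i a i (tau1 (lsubmx (c x))) * b i (tau2 (rsubmx (c x))).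
    by apply/funext => x; rewrite E.
  apply: sa_sum => // i _; have [ha hb] := hab i; apply: sa_mul => //.
    by apply: (as_tau h1 ha sA); exact: mxin_lsub.
  by apply: (as_tau h2 hb sA); exact: mxin_rsub.
have [k1 hk1] := as_nil h1; have [k2 hk2] := as_nil h2.
exists (k1 + k2)%N => v; apply: prod_uc.
  by apply: (uc_le (as_P h1) (leq_addr k2 k1)); exact: hk1.
by apply: (uc_le (as_P h2) (leq_addl k1 k2)); exact: hk2.
Qed.

Lemma prod_unip1 u : unip O u -> unip O1 u.1.
Proof.
move=> h f hf; have [k hk] := h _ (tens_fst s2 hf); exists k.
have E j : iter j (Delta u) (fun p : G1 * G2 => f p.1) = fun p => iter j (Delta u.1) f p.1.
  by elim: j => [//|j IH] /=; rewrite IH.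
by apply/funext => g; have := congr1 (fun F => F (g, 1%g)) (etrans (esym (E k)) hk).
Qed.

Lemma prod_unip2 u : unip O u -> unip O2 u.2.
Proof.
move=> h f hf; have [k hk] := h _ (tens_snd s1 hf); exists k.
have E j : iter j (Delta u) (fun p : G1 * G2 => f p.2) = fun p => iter j (Delta u.2) f p.2.
  by elim: j => [//|j IH] /=; rewrite IH.
by apply/funext => g; have := congr1 (fun F => F (1%g, g)) (etrans (esym (E k)) hk).
Qed.

Lemma prod_zcl1 (A : set (G1 * G2)) u : zclosure O A u -> zclosure O1 (fst @` A) u.1.
Proof.
move=> h f hf fA; apply: (h (fun p => f p.1)); first exact: (tens_fst s2 hf).
by move=> a Aa; apply: fA; exists a.
Qed.

Lemma prod_zcl2 (A : set (G1 * G2)) u : zclosure O A u -> zclosure O2 (snd @` A) u.2.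
Proof.
move=> h f hf fA; apply: (h (fun p => f p.2)); first exact: (tens_snd s1 hf).
by move=> a Aa; apply: fA; exists a.
Qed.

End ProductStruct.

(** * The graph of the action *)

Section Graph.
Variables (R : realType) (n1 n2 : nat).
Variables (P1 : 'rV[R]_n1 -> 'rV[R]_n1 -> 'rV[R]_n1) (P2 : 'rV[R]_n2 -> 'rV[R]_n2 -> 'rV[R]_n2).
Variables (G1 G2 : groupType) (O1 : set (G1 -> R)) (O2 : set (G2 -> R)).
Variables (tr1 : G1 -> 'rV[R]_n1) (ln1 : G1 -> 'M[R]_n1) (tau1 : 'rV[R]_n1 -> G1).
Variables (tr2 : G2 -> 'rV[R]_n2) (ln2 : G2 -> 'M[R]_n2) (tau2 : 'rV[R]_n2 -> G2).
Hypothesis h1 : aff_struct P1 O1 tr1 ln1 tau1.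
Hypothesis h2 : aff_struct P2 O2 tr2 ln2 tau2.
Variables (Gam : groupType) (rho1 : Gam -> G1) (rho2 : Gam -> G2).
Hypothesis rM1 : forall x y, (rho1 (x * y) = rho1 x * rho1 y)%g.
Hypothesis rM2 : forall x y, (rho2 (x * y) = rho2 x * rho2 y)%g.
Hypothesis vp : virtually_polycyclic Gam.
Hypothesis TL1 : forall u, unip O1 u -> zclosure O1 (range rho1) u -> ln1 u = 1%:M.
Hypothesis TL2 : forall u, unip O2 u -> zclosure O2 (range rho2) u -> ln2 u = 1%:M.
Local Notation act1 := (act P1 tr1 ln1).
Local Notation act2 := (act P2 tr2 ln2).
Local Notation cj1 := (cj P1 tr1 ln1).
Local Notation cj2 := (cj P2 tr2 ln2).
Local Notation dis1 := (dis P1 tr1 ln1).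
Local Notation dis2 := (dis P2 tr2 ln2).
Hypothesis proper : forall M : R, finite_set [set a | exists y, `|y| <= M /\ `|act1 (rho1 a) y| <= M].
Hypothesis coc : exists M : R, forall y, exists a, `|act1 (rho1 a) y| <= M.

Let h12 := prod_struct h1 h2.
Let p1 := as_P h1.
Let p2 := as_P h2.
Let s1 := ag_sub (as_O h1).
Let s2 := ag_sub (as_O h2).
Definition rho12 a := (rho1 a, rho2 a).
Definition D12 := zclosure (tens O1 O2) (range rho12).
Definition D2 := zclosure O2 (range rho2).
Local Notation P := (prodP P1 P2).
Local Notation tr := (prodtr tr1 tr2).
Local Notation ln := (prodln ln1 ln2).
Local Notation tau := (prodtau tau1 tau2).

Lemma rho12M a b : (rho12 (a * b) = rho12 a * rho12 b)%g.
Proof. by rewrite /rho12 rM1 rM2. Qed.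

Lemma D12_fst u : D12 u -> zclosure O1 (range rho1) u.1.
Proof. by move=> /(prod_zcl1 h2); apply: zcl_mono => _ [_ [a _ <-] <-]; exists a. Qed.

Lemma D12_snd u : D12 u -> D2 u.2.
Proof. by move=> /(prod_zcl2 h1); apply: zcl_mono => _ [_ [a _ <-] <-]; exists a. Qed.

Lemma D12_translation_like u : unip (tens O1 O2) u -> D12 u -> ln u = 1%:M.
Proof.
move=> uu Du; rewrite /prodln (TL1 (prod_unip1 h2 uu) (D12_fst Du)).
by rewrite (TL2 (prod_unip2 h1 uu) (D12_snd Du)) -scalar_mx_block.
Qed.

Lemma prod_act x g : act P tr ln g x = row_mx (act1 g.1 (lsubmx x)) (act2 g.2 (rsubmx x)).
Proof.
rewrite -{1}[x]hsubmxK /act /prodtr /prodln mul_row_block !mulmx0 addr0 add0r.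
by rewrite /prodP !row_mxKl !row_mxKr.
Qed.

Lemma prod_dis x g : dis P tr ln x g = row_mx (dis1 (lsubmx x) g.1) (dis2 (rsubmx x) g.2).
Proof. by rewrite /dis prod_act /prodP !linearN /= !row_mxKl !row_mxKr. Qed.

Lemma prod_cj v g : cj P tr ln g v = row_mx (cj1 g.1 (lsubmx v)) (cj2 g.2 (rsubmx v)).
Proof.
rewrite /cj /prodtr /prodln -{1}[v]hsubmxK mul_row_block !mulmx0 addr0 add0r.
by rewrite /prodP opp_row_mx !row_mxKl !row_mxKr.
Qed.

Lemma lsub_mul (v : 'rV[R]_(n1 + n2)) : lsubmx v = v *m col_mx 1%:M 0.
Proof. by rewrite -{2}[v]hsubmxK mul_row_col mulmx1 mulmx0 addr0. Qed.

(* Projecting the translations of the closure to the first factor is onto by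
   [translations_surjective]; it is injective because [Gam] acts cocompactly on
   an orbit and properly on the first factor, which bounds the fibres. *)
Theorem graph_linear : exists x1 x2 (M : 'M[R]_(n1, n2)),
  [/\ forall a, dis2 x2 (rho2 a) = dis1 x1 (rho1 a) *m M,
      forall v w, P1 v w *m M = P2 (v *m M) (w *m M),
      forall a v, cj2 (rho2 a) (v *m M) = cj1 (rho1 a) v *m M &
      forall v, D12 (tau1 v, tau2 (v *m M))].
Proof.
have sr12 : subgroup (range rho12) by apply: (image_subgroup rho12M); split.
have [x hx] := base_point h12 rho12M vp D12_translation_like.
have [U hU] := trans_lin h12 sr12.
have sD := D_subgroup h12 rho12M.
pose x1 := lsubmx x; pose x2 := rsubmx x.
have rD a : D12 (rho12 a) by apply: sub_zcl; exists a.
have disU g : D12 g -> (dis P tr ln x g <= U)%MS by move=> Dg; apply/hU; exact: hx.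
have surj (v : 'rV[R]_n1) : exists w, (row_mx v w <= U)%MS.
  pose U1 := U *m col_mx 1%:M 0 : 'M[R]_(n1 + n2, n1).
  suff /submxP[e eE] : (v <= U1)%MS.
    exists (rsubmx (e *m U)); rewrite eE /U1 mulmxA -lsub_mul hsubmxK; exact: submxMl.
  (* The projection of U contains the displacements of all rho1 a, hence by density those of the
     whole first closure; as this contains every translation, the projection is onto. *)
  have Dv := translations_surjective h1 rM1 vp TL1 proper coc v.
  rewrite -[v](dis_tau h1 x1) submxE; apply/eqP/rowP => j; rewrite [RHS]mxE.
  apply: (Dv (fun g => (dis1 x1 g *m cokermx U1) 0 j)).
    by apply: mxin_mul => //; [exact: (dis_in h1) | exact: mxin_cst].
  move=> _ [a _ <-]; have := disU _ (rD a); rewrite prod_dis -/x1 -/x2 /= => h.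
  have : (dis1 x1 (rho1 a) <= U1)%MS.
    have := submxMr (col_mx 1%:M 0 : 'M[R]_(n1 + n2, n1)) h.
    by rewrite mul_row_col mulmx1 mulmx0 addr0.
  by rewrite submxE => /eqP ->; rewrite mxE.
have [M0 hM0] := cocompact_unipotent h12 rho12M D12_translation_like vp hx.
have inj (w : 'rV[R]_n2) : (row_mx 0 w <= U)%MS -> w = 0.
  move=> hw; have [M1 hM1] := poly_bounded M0 M0 (polymap_mulmx (col_mx 1%:M 0 : 'M[R]_(n1 + n2, n1))).
  have [M2 hM2] := poly_bounded M0 M0 (polymap_mulmx (col_mx 0 1%:M : 'M[R]_(n1 + n2, n2))).
  have [M3 hM3] := poly_bounded M1 `|x1| (pl_poly p1).
  have fin := proper (Num.max M3 `|x1|).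
  have /choice[M4 hM4] : forall a, exists M4 : R, forall d : 'rV[R]_n2, `|d| <= M2 ->
      `|cj2 (rho2 a)^-1%g (P2 d (- dis2 x2 (rho2 a)))| <= M4.
    move=> a; have pQ : polymap2 (fun d c : 'rV[R]_n2 => cj2 (rho2 a)^-1%g (P2 d c)).
      move=> X A sA f g hf hg; have hc k m (B : 'M[R]_(k, m)) : mxin A (fun _ => B) by exact: mxin_cst.
      apply: (pl_poly p2 sA); last exact: hc.
      apply: (pl_poly p2 sA); first exact: hc.
      by apply: mxin_mul => //; exact: (pl_poly p2 sA).
    by have [M4 h] := poly_bounded M2 `|- dis2 x2 (rho2 a)| pQ; exists M4 => d hd; exact: h.
  have [M5 hM5] := finite_bound M4 fin.
  apply: (@line_bounded R n2 w M5) => r.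
  (* A multiple of (0, w) is moved into a bounded set by some a. The first component of the result
     is the displacement of x1 under rho1 a alone, so properness leaves finitely many a, and undoing
     them bounds all multiples of w. *)
  have Dr : D12 (tau (row_mx 0 (r *: w))).
    by apply/hU; rewrite -(scaler0 _ r) -scale_row_mx; exact: scalemx_sub.
  have [a ha] := hM0 _ Dr; set d := dis P tr ln x _ in ha.
  have dE : d = row_mx (dis1 x1 (rho1 a)) (P2 (cj2 (rho2 a) (r *: w)) (dis2 x2 (rho2 a))).
    rewrite /d prod_dis -/x1 -/x2 /= row_mxKl row_mxKr (tau0 h1) mulg1.
    by rewrite (disM h2) (dis_tau h2).
  have hd1 : `|dis1 x1 (rho1 a)| <= M1.
    have -> : dis1 x1 (rho1 a) = d *m col_mx 1%:M 0 by rewrite dE mul_row_col mulmx1 mulmx0 addr0.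
    exact: (hM1 d d).
  have hd2 : `|P2 (cj2 (rho2 a) (r *: w)) (dis2 x2 (rho2 a))| <= M2.
    have -> : P2 (cj2 (rho2 a) (r *: w)) (dis2 x2 (rho2 a)) = d *m col_mx 0 1%:M.
      by rewrite dE mul_row_col mulmx1 mulmx0 add0r.
    exact: (hM2 d d).
  have Fa : [set a | exists y, `|y| <= Num.max M3 `|x1| /\ `|act1 (rho1 a) y| <= Num.max M3 `|x1|] a.
    exists x1; rewrite !le_max lexx orbT; split => //.
    by rewrite (disE h1 x1 (rho1 a)) hM3.
  have := hM4 a _ hd2; rewrite (plK p2).
  have -> : cj2 (rho2 a)^-1%g (cj2 (rho2 a) (r *: w)) = r *: w.
    by apply: (tau_inj h2); rewrite -!(cjE h2) invgK !mulgA mulVg mul1g mulgVK.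
  by move=> h; exact: le_trans h (hM5 _ Fa).
have [f hf] := choice surj.
pose M : 'M[R]_(n1, n2) := \matrix_j f (delta_mx 0 j).
have gr (v : 'rV[R]_n1) : (row_mx v (v *m M) <= U)%MS.
  have -> : row_mx v (v *m M) = v *m row_mx 1%:M M by rewrite mul_mx_row mulmx1.
  apply: submx_trans (submxMl _ _) _; apply/row_subP => i.
  by rewrite row_row_mx row1 rowK; exact: hf.
have gr1 (v : 'rV[R]_n1) w : (row_mx v w <= U)%MS -> w = v *m M.
  move=> h; apply/eqP; rewrite -subr_eq0; apply/eqP/inj.
  by rewrite -(subrr v) -add_row_mx -opp_row_mx addmx_sub// eqmx_opp.
exists x1, x2, M; split.
- by move=> a; apply: gr1; have := disU _ (rD a); rewrite prod_dis.
- move=> v w; apply/esym/gr1.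
  by rewrite -prodP_row; apply: (Um_P h12 rho12M hU).
- by move=> a v; apply: gr1; have := Um_cj h12 rho12M hU (rD a) (gr v); rewrite prod_cj row_mxKl row_mxKr.
- by move=> v; have /hU := gr v; rewrite /prodtau row_mxKl row_mxKr.
Qed.

Section Equivariant.
Variables (x1 : 'rV[R]_n1) (x2 : 'rV[R]_n2) (M : 'M[R]_(n1, n2)).
Hypothesis Mdis : forall a, dis2 x2 (rho2 a) = dis1 x1 (rho1 a) *m M.
Hypothesis MP : forall v w, P1 v w *m M = P2 (v *m M) (w *m M).
Hypothesis Mcj : forall a v, cj2 (rho2 a) (v *m M) = cj1 (rho1 a) v *m M.
Hypothesis MD : forall v, D12 (tau1 v, tau2 (v *m M)).
Definition base2 := P2 (- (x1 *m M)) x2.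
Local Notation y0 := base2.

(** The choice of [base2] makes the map y |-> (y M) y0 send z x1 to (z M) x2. Equivariance then says
    that M carries displacements and conjugation of one base point to those of the other. *)
Lemma graph_equivariant a y : act2 (rho2 a) (P2 (y *m M) y0) = P2 (act1 (rho1 a) y *m M) y0.
Proof.
have E z : P2 (P1 z x1 *m M) y0 = P2 (z *m M) x2 by rewrite MP /base2 (plA p2) (plNK p2).
have -> : y = P1 (P1 y (- x1)) x1 by rewrite (plKr p1).
set v := P1 y (- x1); rewrite E (act_P h2) (act_P h1) (disE h1 x1) (disE h2 x2) Mdis Mcj.
by rewrite -(plA p2) -(plA p1) -MP E.
Qed.

Lemma base_dis a : dis2 y0 (rho2 a) = act1 (rho1 a) 0 *m M.
Proof.
have := graph_equivariant a 0; rewrite mul0mx (pl0x p2) /dis => ->.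
by rewrite (plK p2).
Qed.

Lemma D2_tau v : D2 (tau2 (v *m M)). Proof. exact: (D12_snd (MD v)). Qed.

Lemma D2_dis g : D2 g -> D2 (tau2 (dis2 y0 g)).
Proof.
move=> Dg f hf fA; apply: (Dg (fun g => f (tau2 (dis2 y0 g)))).
  by apply: (as_tau h2 hf s2); exact: (dis_in h2).
by move=> _ [a _ <-]; rewrite base_dis; apply: (D2_tau _ hf).
Qed.

(** Equivariance at the single point 0 is a closed condition on pairs, so it extends to the closure
    of the graph. Evaluated at the translations (v, v M) it forces v M' = v M; equality of
    displacements follows on the group and then on its closure. *)
Lemma equivariant_unique (M' : 'M[R]_(n1, n2)) c :
  (forall a, act2 (rho2 a) c = P2 (act1 (rho1 a) 0 *m M') c) ->
  M' = M /\ forall g, D2 g -> dis2 c g = dis2 y0 g.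
Proof.
move=> H; have t := tens_subalg s1 s2.
have HD g : D12 g -> act2 g.2 c = P2 (act1 g.1 0 *m M') c.
  move=> Dg; apply/rowP => j; apply/eqP; rewrite -subr_eq0; apply/eqP.
  apply: (Dg (fun g => act2 g.2 c 0 j - P2 (act1 g.1 0 *m M') c 0 j)).
    apply: sa_sub => //; first exact: (tens_snd s1 (act_in h2 c 0 j)).
    have hc k m (B : 'M[R]_(k, m)) : mxin (tens O1 O2) (fun _ => B) by exact: mxin_cst.
    apply: (pl_poly p2 t); last exact: hc.
    apply: mxin_mul => // i k; exact: (tens_fst s2 (act_in h1 0 i k)).
  by move=> _ [a _ <-] /=; rewrite H subrr.
have MM : M' = M.
  apply/row_matrixP => i; rewrite !rowE; set v := delta_mx 0 i.
  have := HD _ (MD v); rewrite /= (act_tau h2) (act_tau h1) (plx0 p1) => E.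
  by rewrite -(plK p2 c (v *m M')) -E (plK p2).
split=> // g Dg; apply/rowP => j; apply/eqP; rewrite -subr_eq0; apply/eqP.
apply: (Dg (fun g => dis2 c g 0 j - dis2 y0 g 0 j)).
  by apply: sa_sub => //; exact: (dis_in h2).
move=> _ [a _ <-]; suff -> : dis2 c (rho2 a) = dis2 y0 (rho2 a) by rewrite subrr.
by rewrite base_dis {1}/dis H (plK p2) MM.
Qed.

End Equivariant.
End Graph.

(** * Back to Lie groups: coordinates, unipotent radical, Levi subgroup *)

Section Coordinates.
Variables (R : realType) (n : nat) (N : lieGroupType R n).
Hypothesis cscN : connected_sc_nilpotent N.
Implicit Types (g h : Aff N) (y v : 'rV[R]_n).
Let hA := Aff_struct cscN.
Let hO := as_O hA.
Local Notation O := (@regular R n N).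
Local Notation act := (act (nlaw N) (@Atr R n N) (@Aln R n N)).
Local Notation dis := (dis (nlaw N) (@Atr R n N) (@Aln R n N)).

Lemma lexp_act g y : lexp N (act g y) = Aff_act g (lexp N y).
Proof. by rewrite /act (lexpM cscN) /Aff_act -lie_diffE (lie_logK cscN). Qed.

Lemma proper_coord (Gam : groupType) (rho : Gam -> Aff N) : properly_discontinuous rho ->
  forall M : R, finite_set [set a | exists y, `|y| <= M /\ `|act (rho a) y| <= M].
Proof.
move=> H M; have cK : compact (lexp N @` [set v | `|v| <= M]).
  apply: continuous_compact; last exact: norm_ball_compact.
  by apply: continuous_subspaceT => v; exact: lexp_cont.
apply: sub_finite_set (H _ cK) => a [y [y1 y2]] /=.
exists (lexp N (act (rho a) y)); split; last by exists (act (rho a) y).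
by exists (lexp N y); [exists y | rewrite lexp_act].
Qed.

Lemma cocompact_coord (Gam : groupType) (rho : Gam -> Aff N) :
  (forall a b, (rho (a * b) = rho a * rho b)%g) -> cocompact rho ->
  exists M : R, forall y, exists a, `|act (rho a) y| <= M.
Proof.
move=> rM [K cK covK]; have cl : compact (@lie_log R n N @` K).
  apply: continuous_compact => //; apply: continuous_subspaceT => x.
  exact: lie_log_cont.
have [M [_ hM]] := compact_bounded cl; exists (M + 1) => y.
have [a _ [z Kz hz]] : (\bigcup_(g : Gam) (Aff_act (rho g) @` K)) (lexp N y) by rewrite covK.
exists a^-1%g; have -> : act (rho a^-1%g) y = lie_log z.
  have -> : y = act (rho a) (lie_log z).
    by apply: (lexp_injective cscN); rewrite lexp_act (lie_logK cscN).
  by rewrite -(actM hA) -rM mulVg (rho1 rM) (act1 hA).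
by apply: (hM (M + 1)); [rewrite ltrDl | exists z].
Qed.

(** [unip_virtually_solvable] provides one closed normal solvable subgroup containing every
    unipotent element of the closure. *)
Lemma unipotent_radicalE (Gam : groupType) (rho : Gam -> Aff N) :
  (forall a b, (rho (a * b) = rho a * rho b)%g) -> virtually_polycyclic Gam ->
  unipotent_radical (zariski_closure (range rho)) = [set u | zclosure O (range rho) u /\ unip O u].
Proof.
move=> rM vp; rewrite zclosureE//; apply/seteqP; split => [u [[S [_ [_ _ SG _] _] Su] uu]|u [Du uu]].
  by split; [exact: SG | exact: uu].
have [A [nA [l sA] cA hA']] := unip_virtually_solvable hO rM vp.
split; last exact: uu; exists A; last exact: hA'.
split=> //; last by have [sgA _ _ _] := nA; exact: sol_solvable sA.
have -> : A = zclosure O A by apply/seteqP; split; [exact: sub_zcl | exact: cA].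
exact: zclosure_closed.
Qed.

Lemma translation_like_ln (Gam : groupType) (rho : Gam -> Aff N) :
  (forall a b, (rho (a * b) = rho a * rho b)%g) -> virtually_polycyclic Gam -> translation_like rho ->
  forall u, unip O u -> zclosure O (range rho) u -> Aln u = 1%:M.
Proof.
move=> rM vp tl u uu Du; apply: (Aln1 cscN).
have h : unipotent_radical (zariski_closure (range rho)) u -> Aff_lin u = 1%g := @tl u.
by apply: h; rewrite (unipotent_radicalE rM vp).
Qed.

Section Levi.
Variables (Gam : groupType) (rho : Gam -> Aff N).
Hypothesis rM : forall a b, (rho (a * b) = rho a * rho b)%g.
Hypothesis vp : virtually_polycyclic Gam.
Local Notation D := (zclosure O (range rho)).
Hypothesis TL : forall u, unip O u -> D u -> Aln u = 1%:M.
Variable y0 : 'rV[R]_n.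
Hypothesis hy0 : forall g, D g -> D (Atau N (dis y0 g)).
Definition stabilizer := [set g | D g /\ act g y0 = y0].

(** A unipotent element of the closure is a translation, and a translation with a fixed point is
    trivial. *)
Lemma stabilizer_unip g : stabilizer g -> unip O g -> g = 1%g.
Proof.
have hP := as_P hA.
move=> [Dg gy] ug; have gE := tau_of hA (TL ug Dg); rewrite gE (act_tau hA) in gy.
have t0 : Atr g = 0 by rewrite -(plK hP y0 (Atr g)) gy (plxN hP).
by rewrite gE t0 (tau0 hA).
Qed.

(** The base point property splits g as the translation by its displacement, which lies in the
    unipotent radical, times an element fixing y0. The stabilizer has no nontrivial unipotent
    element, so it meets the radical trivially and is reductive. *)
Lemma levi_stabilizer : levi_subgroup (zariski_closure (range rho)) stabilizer.
Proof.
have hS := ag_sub hO; have hP := as_P hA.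
have sD : subgroup D by exact: (D_subgroup hA rM).
have sL : subgroup stabilizer.
  split; first by split; [exact: (subg1 sD) | exact: (act1 hA)].
  move=> g h [Dg gy] [Dh hy]; split; first exact: sD.2.
  by rewrite (actM hA) -{1}hy -(actM hA h^-1%g) mulVg (act1 hA).
have unip1 : unip O 1%g.
  move=> f _; exists 1%N; apply/funext => h /=.
  by rewrite /Delta mulg1 subrr.
have uE := unipotent_radicalE rM vp.
have uT g : (D g /\ unip O g) <-> (D g /\ Aln g = 1%:M).
  split=> -[Dg h]; split => //; first exact: TL.
  by rewrite (tau_of hA h); exact: (unip_tau hA).
split.
- have -> : stabilizer = zclosure O stabilizer; last exact: zclosure_closed.
  apply/seteqP; split; first exact: sub_zcl.
  move=> g hg; split.
    by apply: zcl_idem; apply: zcl_mono hg => h [].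
  apply/rowP => j; apply/eqP; rewrite -subr_eq0; apply/eqP.
  apply: (hg (fun g => act g y0 0 j - y0 0 j)).
    by apply: (sa_sub hS); [exact: (act_in hA y0 0 j) | exact: sa_cst].
  by move=> h [_ ->]; rewrite subrr.
- exact: sL.
- by move=> g [Dg _]; rewrite zclosureE.
- apply/seteqP; split => [g [[S [_ [_ _ SL _] _] Sg] ug]|_ ->].
    by apply: stabilizer_unip; [exact: SL | exact: ug].
  split; last exact: unip1.
  have s1 : subgroup [set (1%g : Aff N)] by split => // x y -> ->; rewrite mulgV.
  exists [set 1%g] => //; split.
  + have -> : [set (1%g : Aff N)] = zclosure O [set 1%g].
      by apply/seteqP; split; [exact: sub_zcl | exact: (zcl1 hO)].
    exact: zclosure_closed.
  + split=> //; first by move=> _ ->; exact: (subg1 sL).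
    by move=> x y _ ->; rewrite conj1g.
  + by apply: (@sol_solvable _ 0%N).
rewrite uE; split; [|split].
- rewrite zclosureE//; split => //.
  + split; first by split; [exact: (subg1 sD) | exact: unip1].
    move=> g h /uT[Dg gl] /uT[Dh hl]; apply/uT; split; first exact: sD.2.
    rewrite (as_lnM hA) gl mulmx1; have := lnV hA h; by rewrite hl mulmx1.
  + by move=> g [].
  + move=> g h Dg /uT[Dh hl]; apply/uT; split.
      by rewrite /conjg; apply: (subgM sD); [exact: (subgV sD) | exact: (subgM sD)].
    by rewrite /conjg !(as_lnM hA) hl mulmx1 (lnVr hA).
- apply/seteqP; split => [g [hL [_ ug]]|_ ->]; first exact: stabilizer_unip.
  by split; [exact: (subg1 sL) | split; [exact: (subg1 sD) | exact: unip1]].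
rewrite zclosureE//; apply/seteqP; split => [_ [g [Dg _]] [h [Dh _] <-]|g Dg].
  exact: (subgM sD).
have Dt := hy0 Dg; pose t := Atau N (dis y0 g).
exists t; first by split => //; exact: (unip_tau hA).
exists (t^-1 * g)%g; last by rewrite mulVKg.
split; first by apply: (subgM sD) => //; exact: (subgV sD).
by rewrite (actM hA) /t -(tauN hA) (act_tau hA) (disE hA y0 g) (plKN hP).
Qed.

End Levi.
End Coordinates.

Lemma lexp_linear_cont (R : realType) n1 n2 (N1 : lieGroupType R n1) (N2 : lieGroupType R n2)
  (M : 'M[R]_(n1, n2)) : connected_sc_nilpotent N1 -> continuous (fun a : N1 => lexp N2 (lie_log a *m M)).
Proof.
move=> c1 z; apply: (@continuous_comp _ _ _ (fun z : N1 => lie_log z *m M) (lexp N2)); last exact: lexp_cont.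
have /(_ z) : continuous (fun z : N1 => lie_log z *m M); last exact.
apply: mxin_continuous; apply: mxin_mul; first exact: cont_subalg.
  by apply: continuous_mxin; exact: lie_log_cont.
by apply: mxin_cst; exact: cont_subalg.
Qed.

Theorem theorem6p6 (R : realType) (n1 n2 : nat)
    (N1 : lieGroupType R n1) (N2 : lieGroupType R n2)
    (Gam1 Gam2 : groupType)
    (phi : {multiplicative Gam1 -> Gam2})
    (rho1 : {multiplicative Gam1 -> Aff N1})
    (rho2 : {multiplicative Gam2 -> Aff N2}) :
  connected_sc_nilpotent N1 -> connected_sc_nilpotent N2 ->
  virtually_polycyclic Gam1 -> virtually_polycyclic Gam2 ->
  crystallographic rho1 -> crystallographic rho2 ->
  translation_like rho1 -> translation_like rho2 ->
  exists L : set (Aff N2),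
    levi_subgroup (zariski_closure (range (rho2 \o phi))) L /\
    exists! delta : N1 -> N2,
      cont_morphism delta /\
      forall al : aff N1 N2,
        (forall g : Gam1,
           Aff_act (rho2 (phi g)) \o aff_map al =
           aff_map al \o Aff_act (rho1 g)) ->
        aff_lin al = delta /\
        forall l, L l -> Aff_act l (aff_trans al) = aff_trans al.
Proof.
move=> c1 c2 vp1 vp2 [pd coc1] _ tl1 tl2.
have rM1 a b : (rho1 (a * b) = rho1 a * rho1 b)%g by exact: gmulfM.
have rM2 a b : ((rho2 \o phi) (a * b) = (rho2 \o phi) a * (rho2 \o phi) b)%g by rewrite /= !gmulfM.
have rM2' a b : (rho2 (a * b) = rho2 a * rho2 b)%g by exact: gmulfM.
have h1 := Aff_struct c1; have h2 := Aff_struct c2.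
have p1 := as_P h1; have p2 := as_P h2.
have TL1 := translation_like_ln c1 rM1 vp1 tl1.
(* Unipotent elements of the smaller closure are unipotent in that of rho2, where all unipotent
   elements belong to the radical; so they are translations. *)
have TL2 u : unip (@regular R n2 N2) u -> zclosure (@regular R n2 N2) (range (rho2 \o phi)) u -> Aln u = 1%:M.
  move=> uu Du; apply: (translation_like_ln c2 rM2' vp2 tl2 uu).
  by apply: zcl_mono Du => _ [a _ <-]; exists (phi a).
have [x1 [x2 [M [Mdis MP Mcj MD]]]] := graph_linear h1 h2 rM1 rM2 vp1 TL1 TL2
  (proper_coord c1 pd) (cocompact_coord c1 rM1 coc1).
pose y0 := base2 (nlaw N2) x1 x2 M.
have equi := graph_equivariant h1 h2 Mdis MP Mcj.
have uniq := equivariant_unique h1 h2 Mdis MP Mcj MD.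
pose delta (a : N1) := lexp N2 (lie_log a *m M).
have deltaP : cont_morphism delta.
  split; last exact: lexp_linear_cont.
  by move=> a b; rewrite /delta (lie_logM c1) MP (lexpM c2).
exists (stabilizer (rho2 \o phi) y0); split.
  apply: levi_stabilizer => //; exact: (D2_dis h1 h2 Mdis MP Mcj MD).
have act0 (g : Aff N1) : lexp N1 (act (nlaw N1) (@Atr R n1 N1) (@Aln R n1 N1) g 0) = Aff_act g 1%g.
  rewrite (lexp_act c1); congr (Aff_act g _).
  by apply: (mulgI (lexp N1 0)); rewrite -(lexpM c1) (plx0 p1) mulg1.
have l10 : lexp N1 0 = 1%g.
  by apply: (mulgI (lexp N1 0)); rewrite -(lexpM c1) (plx0 p1) mulg1.
exists delta; split; [split => //|].
- move=> [t f fP] /= eq; have [M' hM'] := lie_hom_linear fP.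
  have f1 : f 1%g = 1%g by apply: (mulgI (f 1%g)); rewrite -fP.1 !mulg1.
  have H a : act (nlaw N2) (@Atr R n2 N2) (@Aln R n2 N2) ((rho2 \o phi) a) (lie_log t) =
      nlaw N2 (act (nlaw N1) (@Atr R n1 N1) (@Aln R n1 N1) (rho1 a) 0 *m M') (lie_log t).
    apply: (lexp_injective c2); rewrite (lexp_act c2) (lexpM c2) -hM' act0 (lie_logK c2).
    have := congr1 (fun F => F 1%g) (eq a); rewrite /aff_map /= f1 mul1g.
    exact.
  have [MM hdis] := uniq M' (lie_log t) H; split.
    by apply/funext => a; rewrite -{1}(lie_logK c1 a) hM' MM.
  move=> l [Dl ly]; rewrite -{1}(lie_logK c2 t) -(lexp_act c2) -[RHS](lie_logK c2); congr (lexp N2 _).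
  by rewrite (disE h2) hdis// /dis ly (plxN p2) (pl0x p2).
(* An equivariant affine map with linear part [delta] and translation part exp y0 exists by
   [graph_equivariant]; any competing [delta'] must be its linear part, which gives uniqueness. *)
move=> delta' [_ H].
have [] // := H (@MkaffMap N1 N2 (lexp N2 y0) delta deltaP).
move=> a; apply/funext => z /=; rewrite /aff_map /=.
rewrite -(lie_logK c1 z); set v := lie_log z.
rewrite /delta -(lexp_act c1) !(lexpK c1) -!(lexpM c2) -(lexp_act c2); congr (lexp N2 _).
exact: equi.
Qed.
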